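(* Let $\Sigma$ be a noncompact capillary surface immersed, at constant angle $\theta\in(0,\pi)$, in a Riemannian 3-manifold $M$ with smooth boundary, and let $I=\mathrm{Index}_s(\Sigma)$. Assume $I<\infty$. Then there exists a subspace $W$ of $L^2(\Sigma)$ having an orthonormal basis $f_1,\dots,f_I$ consisting of eigenfunctions (in the weak sense) for $Q$ with eigenvalues $\lambda_1,\dots,\lambda_I$, respectively, such that each $\lambda_i<0$. Moreover, for all $\varphi\in C_0^\infty(\Sigma)\cap W^\perp$ we have $$Q(\varphi,\varphi)\ge 0.$$
   Context: Capillary surfaces. $M$ is a smooth Riemannian 3-manifold with smooth boundary, $D$ its Levi-Civita connection, $N$ the outer unit normal of $\partial M$. A capillary surface in $M$ at angle $\theta\in(0,\pi)$ is a smooth surface $\Sigma$ with smooth boundary, with a two-sided isometric immersion into $M$, complete as a metric space (it contains its boundary), whose boundary is mapped into $\partial M$ and whose interior does not touch $\partial M$, which has constant mean curvature (possibly zero) and a unit normal field $\nu$ such that the angle between $N$ and $-\nu$ along $\partial\Sigma$ is constantly $\theta$. $A_\Sigma(X,Y)=\langle D_X\nu,Y\rangle$, $h_{\partial M}(X,Y)=\langle D_XN,Y\rangle$, $\eta$ is the outward unit conormal of $\partial\Sigma$ in $\Sigma$, $T=\cos\theta\,\eta+\sin\theta\,\nu$. Stability operator and strong index. $C_0^\infty(\Sigma)$ denotes smooth functions on $\Sigma$ with compact support (not required to vanish on $\partial\Sigma$). For such $u$, $$Q(u,u)=\int_\Sigma |\nabla u|^2-(\operatorname{Ric}_M(\nu,\nu)+|A_\Sigma|^2)u^2-\int_{\partial\Sigma}q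 u^2,\qquad q=\frac{1}{\sin\theta}h_{\partial M}(T,T)+\cot\theta\,A_\Sigma(\eta,\eta),$$ and $Q(\cdot,\cdot)$ also denotes the associated symmetric bilinear form. For bounded open $\Omega\subset\Sigma$, $\mathrm{Index}_s(\Omega)$ is the maximal dimension of a subspace of the smooth functions compactly supported in $\Omega$ on which $Q$ is negative definite, and $\mathrm{Index}_s(\Sigma)=\lim_n\mathrm{Index}_s(\Omega_n)$ for any exhaustion $\Omega_1\subset\Omega_2\subset\cdots$ of $\Sigma$ by bounded open sets. Weak eigenfunctions. $f$ is an eigenfunction of $Q$ with eigenvalue $\lambda$ in the weak sense if $f\in H^1_{loc}(\Sigma)$ is nonzero and $Q(f,\varphi)=\lambda\int_\Sigma f\varphi$ for all $\varphi\in C_0^\infty(\Sigma)$ (the weak form of $\Delta f+(|A_\Sigma|^2+\operatorname{Ric}_M(\nu,\nu))f+\lambda f=0$ in $\Sigma$, $\partial f/\partial\eta=qf$ on $\partial\Sigma$). $W^\perp$ is the $L^2(\Sigma)$-orthogonal complement of $W$. *)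

(* Defs.v *)
From HB Require Import structures.
From mathcomp Require Import all_boot all_order all_algebra.
From mathcomp Require Import all_classical all_reals all_analysis.

Set Implicit Arguments.
Unset Strict Implicit.
Unset Printing Implicit Defensive.

Import Order.TTheory GRing.Theory Num.Theory.
Import numFieldNormedType.Exports.

Local Open Scope classical_set_scope.
Local Open Scope ring_scope.

(** * Calculus on the closed half-space [x_n >= 0]

    Points of R^(n+1) are row vectors, and vectors act on the left: the Jacobian
    [jac f x] has the partial derivatives of [f] as its rows, so that the
    differential is [v |-> v *m jac f x] and
    [jac (g \o f) x = jac f x *m jac g (f x)]. *)

Definition half_space (R : realType) (n : nat) : set 'rV[R]_n.+1 :=
  [set x | 0 <= x 0 ord_max].

Definition diffquot (R : realType) (n : nat) (f : 'rV[R]_n.+1 -> R)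
    (i : 'I_n.+1) (x : 'rV[R]_n.+1) (h : R) : R :=
  h^-1 * (f (x + h *: delta_mx 0 i) - f x).

Definition diffquot_nbhs (R : realType) (n : nat) (i : 'I_n.+1)
    (x : 'rV[R]_n.+1) : set_system R :=
  within [set h | half_space (x + h *: delta_mx 0 i)] (0 : R)^'.

(** The i-th partial derivative, which is one-sided (from within the half-space)
    at points with last coordinate zero. *)
Definition pderiv (R : realType) (n : nat) (i : 'I_n.+1)
    (f : 'rV[R]_n.+1 -> R) (x : 'rV[R]_n.+1) : R :=
  lim (diffquot f i x @ diffquot_nbhs i x).

(** C^oo on a relatively open subset [V] of the half-space: all iterated partial
    derivatives exist and are continuous on [V], up to the boundary. *)
Definition smooth_on (R : realType) (n : nat) (V : set 'rV[R]_n.+1)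
    (f : 'rV[R]_n.+1 -> R) : Prop :=
  forall (s : seq 'I_n.+1),
    let fs := foldr (@pderiv R n) f s in
    {within V, continuous fs} /\
    forall (i : 'I_n.+1) x, V x -> cvg (diffquot fs i x @ diffquot_nbhs i x).

Definition jac (R : realType) (n m : nat) (f : 'rV[R]_n.+1 -> 'rV[R]_m.+1)
    (x : 'rV[R]_n.+1) : 'M[R]_(n.+1, m.+1) :=
  \matrix_(i, j) pderiv i (fun y => f y 0 j) x.

(** * Riemannian geometry in a coordinate patch

    [G] is the matrix of the metric as a function of the coordinates. *)

Definition ip (R : realType) (n : nat) (G : 'M[R]_n) (u v : 'rV[R]_n) : R :=
  (u *m G *m v^T) 0 0.

(** Gamma^k_ij *)
Definition christoffel (R : realType) (n : nat)
    (G : 'rV[R]_n.+1 -> 'M[R]_n.+1) (x : 'rV[R]_n.+1) (k i j : 'I_n.+1) : R :=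
  2^-1 * \sum_l invmx (G x) k l *
    (pderiv i (fun y => G y j l) x + pderiv j (fun y => G y i l) x
     - pderiv l (fun y => G y i j) x).

(** Signs are such that the round sphere has positive Ricci curvature. *)
Definition ricci (R : realType) (n : nat) (G : 'rV[R]_n.+1 -> 'M[R]_n.+1)
    (x : 'rV[R]_n.+1) : 'M[R]_n.+1 :=
  let Gam := christoffel G in
  \matrix_(i, j)
    (\sum_k pderiv k (fun y => Gam y k i j) x
     - \sum_k pderiv j (fun y => Gam y k i k) x
     + \sum_k \sum_l Gam x k k l * Gam x l i j
     - \sum_k \sum_l Gam x k j l * Gam x l i k).

(** [D_{d/dx_i} V] for a vector field [V] along a map [f] into the patch carrying
    the metric [G]; a vector field on the patch is the case [f = id]. *)
Definition covd (R : realType) (n m : nat) (G : 'rV[R]_m.+1 -> 'M[R]_m.+1)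
    (f V : 'rV[R]_n.+1 -> 'rV[R]_m.+1) (x : 'rV[R]_n.+1) (i : 'I_n.+1) :
    'rV[R]_m.+1 :=
  \row_k (jac V x i k
          + \sum_a \sum_b christoffel G (f x) k a b * jac f x i a * V x 0 b).

(** [- grad x_n / |grad x_n|]: on [x_n = 0] this is the outer unit normal of the
    half-space. *)
Definition outer_normal (R : realType) (n : nat)
    (G : 'rV[R]_n.+1 -> 'M[R]_n.+1) (x : 'rV[R]_n.+1) : 'rV[R]_n.+1 :=
  let Gi := invmx (G x) in
  - (Num.sqrt (Gi ord_max ord_max))^-1 *: row ord_max Gi.

(** [h(u,v) = <D_u N, v>] for the hypersurface [x_n = 0], as a bilinear form on
    all vectors; only its values on vectors tangent to the hypersurface are
    meaningful, and these do not depend on how [N] is extended. *)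
Definition bdry_sff (R : realType) (n : nat) (G : 'rV[R]_n.+1 -> 'M[R]_n.+1)
    (x u v : 'rV[R]_n.+1) : R :=
  \sum_i u 0 i * ip (G x) (covd G id (outer_normal G) x i) v.

(** * Smooth manifolds with boundary *)

Record chart (R : realType) (X : Type) (n : nat) := Chart {
  cdom : set X ;
  cmap : X -> 'rV[R]_n.+1 ;
  cinv : 'rV[R]_n.+1 -> X }.

Definition cimg (R : realType) (X : Type) (n : nat) (c : chart R X n) :
  set 'rV[R]_n.+1 := cmap c @` cdom c.

(** [c] is a homeomorphism from an open set of [X] onto a relatively open subset
    of the half-space, with inverse [cinv c]. *)
Definition chart_axiom (R : realType) (X : topologicalType) (n : nat)
    (c : chart R X n) : Prop :=
  [/\ open (cdom c),
      exists2 O : set 'rV[R]_n.+1, open O & cimg c = O `&` @half_space R n,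
      forall p, cdom c p -> cinv c (cmap c p) = p,
      {within cdom c, continuous (cmap c)} &
      {within cimg c, continuous (cinv c)}].

Definition chart_compat (R : realType) (X : Type) (n : nat)
    (c d : chart R X n) : Prop :=
  forall j, smooth_on (cmap c @` (cdom c `&` cdom d))
                      (fun x => cmap d (cinv c x) 0 j).

(** A smooth manifold of dimension [n.+1] with (possibly empty) boundary.
    [chart_at p] is a preferred chart around [p]: tangent vectors and covectors
    at [p] are represented by their components in that chart. *)
Record manifold (R : realType) (n : nat) := Manifold {
  mcarrier :> ptopologicalType ;
  atlas : set (chart R mcarrier n) ;
  chart_at : mcarrier -> chart R mcarrier n ;
  mf_hausdorff : hausdorff_space mcarrier ;
  mf_second_countable : @second_countable mcarrier ;
  mf_chart : forall c, atlas c -> chart_axiom c ;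
  mf_compat : forall c d, atlas c -> atlas d -> chart_compat c d ;
  mf_chart_at : forall p, atlas (chart_at p) /\ cdom (chart_at p) p }.

Arguments atlas {R n} X : rename.
Arguments chart_at {R n X} p : rename.

Definition bdry (R : realType) (n : nat) (X : manifold R n) : set X :=
  [set p | exists c, [/\ atlas X c, cdom c p & cmap c p 0 ord_max = 0]].

Definition coord (R : realType) (n : nat) (X : manifold R n) (p : X) :
  'rV[R]_n.+1 := cmap (chart_at p) p.

(** Jacobian at [p] of the change of coordinates from [c] to [chart_at p]. *)
Definition to_pref (R : realType) (n : nat) (X : manifold R n)
    (c : chart R X n) (p : X) : 'M[R]_n.+1 :=
  jac (cmap (chart_at p) \o cinv c) (cmap c p).

(** Jacobian at [p] of the change of coordinates from [chart_at p] to [c]. *)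
Definition from_pref (R : realType) (n : nat) (X : manifold R n)
    (c : chart R X n) (p : X) : 'M[R]_n.+1 :=
  jac (cmap c \o cinv (chart_at p)) (coord p).

(** The matrix, in an arbitrary chart, of a bilinear form given pointwise in the
    preferred charts. *)
Definition form_in (R : realType) (n : nat) (X : manifold R n)
    (g : X -> 'M[R]_n.+1) (c : chart R X n) (x : 'rV[R]_n.+1) : 'M[R]_n.+1 :=
  let p := cinv c x in to_pref c p *m g p *m (to_pref c p)^T.

Record riemannian (R : realType) (n : nat) := Riemannian {
  rman :> manifold R n ;
  metric : rman -> 'M[R]_n.+1 ;
  metric_sym : forall p, (metric p)^T = metric p ;
  metric_pos : forall p (v : 'rV[R]_n.+1), v != 0 -> 0 < ip (metric p) v v ;
  metric_smooth : forall c, atlas rman c ->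
        forall i j, smooth_on (cimg c) (fun x => form_in metric c x i j) }.

Arguments metric {R n X} p : rename.

Definition metric_in (R : realType) (n : nat) (X : riemannian R n)
    (c : chart R X n) : 'rV[R]_n.+1 -> 'M[R]_n.+1 :=
  form_in (@metric R n X) c.

Definition metric_at (R : realType) (n : nat) (X : riemannian R n) (p : X) :
    'rV[R]_n.+1 -> 'M[R]_n.+1 :=
  metric_in (chart_at p).

(** ** Functions, vector fields, distance *)

Definition smooth_fun (R : realType) (n : nat) (X : manifold R n)
    (u : X -> R) : Prop :=
  forall c, atlas X c -> smooth_on (cimg c) (u \o cinv c).

Definition smooth_field (R : realType) (n : nat) (X : manifold R n)
    (V : X -> 'rV[R]_n.+1) : Prop :=
  forall c, atlas X c -> forall i, smooth_on (cimg c)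
    (fun x => let p := cinv c x in (V p *m from_pref c p) 0 i).

Definition supported_in (X : topologicalType) (V : zmodType) (Om : set X)
    (u : X -> V) : Prop :=
  exists K, [/\ compact K, K `<=` Om & forall p, ~ K p -> u p = 0].

(** [Cc u setT] is [u \in C_0^oo(X)]. *)
Definition Cc (R : realType) (n : nat) (X : manifold R n) (u : X -> R)
    (Om : set X) : Prop :=
  smooth_fun u /\ supported_in Om u.

(** Components of the differential of [u] at [p]. *)
Definition diff_fun (R : realType) (n : nat) (X : manifold R n) (u : X -> R)
    (p : X) : 'rV[R]_n.+1 :=
  \row_i pderiv i (u \o cinv (chart_at p)) (coord p).

Definition coip (R : realType) (n : nat) (X : riemannian R n) (p : X)
    (xi zeta : 'rV[R]_n.+1) : R :=
  ip (invmx (metric p)) xi zeta.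

Definition divergence (R : realType) (n : nat) (X : riemannian R n)
    (V : X -> 'rV[R]_n.+1) (p : X) : R :=
  let c := chart_at p in
  let vol y := Num.sqrt (\det (metric_at p y)) in
  (vol (coord p))^-1 * \sum_i pderiv i
    (fun y => let q := cinv c y in vol y * (V q *m from_pref c q) 0 i) (coord p).

Definition smooth_curve (R : realType) (n : nat) (X : manifold R n)
    (gam : R -> X) : Prop :=
  continuous gam /\
  forall c, atlas X c -> forall t, cdom c (gam t) -> forall j k,
    derivable (derive1n k (fun s => cmap c (gam s) 0 j)) t 1.

Definition velocity (R : realType) (n : nat) (X : manifold R n)
    (gam : R -> X) (t : R) : 'rV[R]_n.+1 :=
  \row_j derive1 (fun s => cmap (chart_at (gam t)) (gam s) 0 j) t.

Definition curve_length (R : realType) (n : nat) (X : riemannian R n)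
    (gam : R -> X) : \bar R :=
  (\int[@lebesgue_measure R]_(t in `[0%R, 1%R])
    (Num.sqrt (ip (metric (gam t)) (velocity gam t) (velocity gam t)))%:E)%E.

(** Velocities may vanish, so piecewise smooth curves can be reparametrized to
    smooth ones and need not be considered separately. *)
Definition dist (R : realType) (n : nat) (X : riemannian R n) (p q : X) :
    \bar R :=
  ereal_inf [set l | exists gam : R -> X,
    [/\ smooth_curve gam, gam 0 = p, gam 1 = q & l = curve_length gam]].

Definition metrically_complete (R : realType) (n : nat)
    (X : riemannian R n) : Prop :=
  forall u : nat -> X,
    (forall e : R, 0 < e -> exists N, forall i j, (N <= i)%N -> (N <= j)%N ->
       (dist (u i) (u j) < e%:E)%E) ->
    exists p, forall e : R, 0 < e -> exists N, forall i, (N <= i)%N ->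
       (dist (u i) p < e%:E)%E.

Definition metrically_bounded (R : realType) (n : nat) (X : riemannian R n)
    (A : set X) : Prop :=
  exists (p : X) (r : R), forall q, A q -> (dist p q < r%:E)%E.

Definition exhaustion (R : realType) (n : nat) (X : riemannian R n)
    (Om : nat -> set X) : Prop :=
  [/\ forall k, open (Om k), forall k, metrically_bounded (Om k),
      forall k, Om k `<=` Om k.+1 & \bigcup_k Om k = setT].

(** * Area and length measures of a surface *)

Definition borel (X : ptopologicalType) := g_sigma_algebraType (@open X).

Definition plane_pt (R : realType) (z : R * R) : 'rV[R]_2 :=
  \row_i (if i == 0 then z.1 else z.2).

(** The Riemannian area: [sqrt (det g) dx] in every chart.  Exactly one Borel
    measure has this property. *)
Definition is_area (R : realType) (S : riemannian R 1)
    (mu : {measure set (borel S) -> \bar R}) : Prop :=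
  forall c, atlas S c -> forall B : set (borel S), measurable B ->
    B `<=` cdom c ->
    (mu B = \int[(@lebesgue_measure R \x @lebesgue_measure R)%E]_(z in
              [set z | cimg c (plane_pt z) /\ B (cinv c (plane_pt z))])
              (Num.sqrt (\det (metric_in c (plane_pt z))))%:E)%E.

(** Arc length along the boundary, extended by zero to [S]: [sqrt g_11 dx_1] on
    [x_2 = 0] in every chart.  Exactly one Borel measure has this property. *)
Definition is_bdry_length (R : realType) (S : riemannian R 1)
    (sigma : {measure set (borel S) -> \bar R}) : Prop :=
  forall c, atlas S c -> forall B : set (borel S), measurable B ->
    B `<=` cdom c ->
    (sigma B = \int[@lebesgue_measure R]_(t in
              [set t | cimg c (plane_pt (t, 0%R))
                       /\ B (cinv c (plane_pt (t, 0%R)))])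
              (Num.sqrt (metric_in c (plane_pt (t, 0%R)) 0%R 0%R))%:E)%E.

(** * Capillary surfaces

    [F : S -> M] is the immersion and [nu p] is the unit normal at [p], given by
    its components in the preferred chart of [M] at [F p]. *)

Definition local_map (R : realType) (n m : nat) (S : manifold R n)
    (M : manifold R m) (F : S -> M) (c : chart R S n) (d : chart R M m) :
    'rV[R]_n.+1 -> 'rV[R]_m.+1 :=
  cmap d \o F \o cinv c.

Definition local_field (R : realType) (n m : nat) (S : manifold R n)
    (M : manifold R m) (F : S -> M) (nu : S -> 'rV[R]_m.+1)
    (c : chart R S n) (d : chart R M m) (x : 'rV[R]_n.+1) : 'rV[R]_m.+1 :=
  let p := cinv c x in nu p *m from_pref d (F p).

Definition smooth_map (R : realType) (n m : nat) (S : manifold R n)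
    (M : manifold R m) (F : S -> M) : Prop :=
  continuous F /\
  forall c d, atlas S c -> atlas M d -> forall j,
    smooth_on (cmap c @` (cdom c `&` F @^-1` cdom d))
              (fun x => local_map F c d x 0 j).

Definition smooth_field_along (R : realType) (n m : nat) (S : manifold R n)
    (M : manifold R m) (F : S -> M) (nu : S -> 'rV[R]_m.+1) : Prop :=
  forall c d, atlas S c -> atlas M d -> forall j,
    smooth_on (cmap c @` (cdom c `&` F @^-1` cdom d))
              (fun x => local_field F nu c d x 0 j).

Definition dmap (R : realType) (n m : nat) (S : manifold R n)
    (M : manifold R m) (F : S -> M) (p : S) : 'M[R]_(n.+1, m.+1) :=
  jac (local_map F (chart_at p) (chart_at (F p))) (coord p).

(** [A(X,Y) = <D_X nu, Y>] *)
Definition sff (R : realType) (n m : nat) (S : riemannian R n)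
    (M : riemannian R m) (F : S -> M) (nu : S -> 'rV[R]_m.+1) (p : S) :
    'M[R]_n.+1 :=
  let c := chart_at p in let d := chart_at (F p) in
  \matrix_(i, j)
    ip (metric (F p))
       (covd (metric_at (F p)) (local_map F c d) (local_field F nu c d)
             (coord p) i)
       (row j (dmap F p)).

Definition mean_curvature (R : realType) (n m : nat) (S : riemannian R n)
    (M : riemannian R m) (F : S -> M) (nu : S -> 'rV[R]_m.+1) (p : S) : R :=
  \tr (invmx (metric p) *m sff F nu p).

Definition sqnorm_sff (R : realType) (n m : nat) (S : riemannian R n)
    (M : riemannian R m) (F : S -> M) (nu : S -> 'rV[R]_m.+1) (p : S) : R :=
  let Gi := invmx (metric p) in let A := sff F nu p in
  \tr (Gi *m A *m Gi *m A^T).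

Definition ricci_at (R : realType) (m : nat) (M : riemannian R m) (q : M) :
    'M[R]_m.+1 :=
  ricci (metric_at q) (coord q).

(** Outer unit normal of the boundary (for a surface: the outward unit
    conormal); meaningful at boundary points only. *)
Definition normal_at (R : realType) (m : nat) (M : riemannian R m) (q : M) :
    'rV[R]_m.+1 :=
  outer_normal (metric_at q) (coord q).

Record capillary (R : realType) (M : riemannian R 2) (S : riemannian R 1)
    (F : S -> M) (nu : S -> 'rV[R]_3) (theta : R) : Prop := Capillary {
  cap_smooth : smooth_map F ;
  cap_isometric : forall p,
    metric p = dmap F p *m metric (F p) *m (dmap F p)^T ;
  cap_complete : metrically_complete S ;
  cap_bdry : forall p, bdry (F p) <-> bdry p ;
  cap_nu_smooth : smooth_field_along F nu ;
  cap_nu_unit : forall p, ip (metric (F p)) (nu p) (nu p) = 1 ;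
  cap_nu_normal : forall p (v : 'rV[R]_2),
    ip (metric (F p)) (nu p) (v *m dmap F p) = 0 ;
  cap_cmc : exists H : R, forall p, mean_curvature F nu p = H ;
  cap_angle : forall p, bdry p ->
    ip (metric (F p)) (normal_at (F p)) (- nu p) = cos theta }.

(** * The stability form and the strong index *)

Definition potential (R : realType) (M : riemannian R 2) (S : riemannian R 1)
    (F : S -> M) (nu : S -> 'rV[R]_3) (p : S) : R :=
  ip (ricci_at (F p)) (nu p) (nu p) + sqnorm_sff F nu p.

Definition bdry_potential (R : realType) (M : riemannian R 2)
    (S : riemannian R 1) (F : S -> M) (nu : S -> 'rV[R]_3) (theta : R) (p : S) :
    R :=
  let eta := normal_at p in
  let T := cos theta *: (eta *m dmap F p) + sin theta *: nu p in
  (sin theta)^-1 * bdry_sff (metric_at (F p)) (coord (F p)) T T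
  + cos theta / sin theta * ip (sff F nu p) eta eta.

(** [Q(f, phi)], where [f] has differential [xi] and boundary values [tau]. *)
Definition Qgen (R : realType) (M : riemannian R 2) (S : riemannian R 1)
    (F : S -> M) (nu : S -> 'rV[R]_3) (theta : R)
    (mu sigma : {measure set (borel S) -> \bar R})
    (f : S -> R) (xi : S -> 'rV[R]_2) (tau : S -> R) (phi : S -> R) : R :=
  \int[mu]_p (coip p (xi p) (diff_fun phi p) - potential F nu p * f p * phi p)
  - \int[sigma]_(p in @bdry R 1 S)
      (bdry_potential F nu theta p * tau p * phi p).

Definition Q (R : realType) (M : riemannian R 2) (S : riemannian R 1)
    (F : S -> M) (nu : S -> 'rV[R]_3) (theta : R)
    (mu sigma : {measure set (borel S) -> \bar R}) (u phi : S -> R) : R :=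
  Qgen F nu theta mu sigma u (diff_fun u) u phi.

(** The maximal dimension of a subspace of the smooth functions compactly
    supported in [Om] on which [Q] is negative definite.  The condition on [u]
    forces [u 0, ..., u (k-1)] to be linearly independent: they form a basis of
    the subspace. *)
Definition index_on (R : realType) (M : riemannian R 2) (S : riemannian R 1)
    (F : S -> M) (nu : S -> 'rV[R]_3) (theta : R)
    (mu sigma : {measure set (borel S) -> \bar R}) (Om : set S) : \bar R :=
  ereal_sup [set k%:R%:E | k in [set k : nat | exists u : 'I_k -> S -> R,
    (forall i, Cc (u i) Om) /\
    forall a : 'rV[R]_k, a != 0 ->
      let v := fun p => \sum_i a 0 i * u i p in
      Q F nu theta mu sigma v v < 0]].

(** [Index_s(S) = I]; the limit does not depend on the exhaustion. *)
Definition strong_index (R : realType) (M : riemannian R 2)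
    (S : riemannian R 1) (F : S -> M) (nu : S -> 'rV[R]_3) (theta : R)
    (mu sigma : {measure set (borel S) -> \bar R}) (I : \bar R) : Prop :=
  exists2 Om : nat -> set S, exhaustion Om &
    index_on F nu theta mu sigma (Om k) @[k --> \oo] --> I.

(** * Weak eigenfunctions *)

Definition L2loc (R : realType) (S : riemannian R 1)
    (mu : {measure set (borel S) -> \bar R}) (f : S -> R) : Prop :=
  measurable_fun [set: borel S] (f : borel S -> R) /\
  forall K : set S, compact K -> (\int[mu]_(p in K) (f p ^+ 2)%:E < +oo)%E.

Definition L2loc_form (R : realType) (S : riemannian R 1)
    (mu : {measure set (borel S) -> \bar R}) (xi : S -> 'rV[R]_2) : Prop :=
  (forall c, atlas S c -> forall i, measurable_fun (cdom c : set (borel S))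
     (fun p : borel S => (xi p *m (to_pref c p)^T) 0 i)) /\
  forall K : set S, compact K ->
    (\int[mu]_(p in K) (coip p (xi p) (xi p))%:E < +oo)%E.

(** [xi] is the differential of [f] in the sense of distributions on the
    interior of [S]. *)
Definition weak_diff (R : realType) (S : riemannian R 1)
    (mu : {measure set (borel S) -> \bar R}) (f : S -> R) (xi : S -> 'rV[R]_2) :
    Prop :=
  forall V : S -> 'rV[R]_2,
    smooth_field V -> supported_in (~` @bdry R 1 S) V ->
    \int[mu]_p (xi p *m (V p)^T) 0 0 = - \int[mu]_p (f p * divergence V p).

(** [f \in H^1_loc(S)], with weak differential [xi].  Compact subsets of [S] may
    meet the boundary. *)
Definition H1loc (R : realType) (S : riemannian R 1)
    (mu : {measure set (borel S) -> \bar R}) (f : S -> R) (xi : S -> 'rV[R]_2) :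
    Prop :=
  [/\ L2loc mu f, L2loc_form mu xi & weak_diff mu f xi].

(** [tau] is the trace of [f] on the boundary: the L^2_loc limit of the boundary
    values of smooth functions converging to [f] in H^1_loc(S). *)
Definition is_trace (R : realType) (S : riemannian R 1)
    (mu sigma : {measure set (borel S) -> \bar R})
    (f : S -> R) (xi : S -> 'rV[R]_2) (tau : S -> R) : Prop :=
  measurable_fun (@bdry R 1 S : set (borel S)) (tau : borel S -> R) /\
  exists u : nat -> S -> R,
    (forall k, smooth_fun (u k)) /\
    forall K : set S, compact K ->
      [/\ (\int[mu]_(p in K) ((u k p - f p) ^+ 2)%:E)%E @[k --> \oo] --> 0%E,
          (\int[mu]_(p in K)
             (let z := diff_fun (u k) p - xi p in coip p z z)%:E)%E
             @[k --> \oo] --> 0%E &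
          (\int[sigma]_(p in K `&` @bdry R 1 S)
             ((u k p - tau p) ^+ 2)%:E)%E @[k --> \oo] --> 0%E].

Definition weak_eigenfunction (R : realType) (M : riemannian R 2)
    (S : riemannian R 1) (F : S -> M) (nu : S -> 'rV[R]_3) (theta : R)
    (mu sigma : {measure set (borel S) -> \bar R}) (f : S -> R) (lambda : R) :
    Prop :=
  ~ {ae mu, forall p, f p = 0} /\
  exists (xi : S -> 'rV[R]_2) (tau : S -> R),
    [/\ H1loc mu f xi, is_trace mu sigma f xi tau &
        forall phi : S -> R, Cc phi setT ->
          Qgen F nu theta mu sigma f xi tau phi
          = lambda * \int[mu]_p (f p * phi p)].

(** * Subspaces of L^2

    Elements of L^2 are represented by functions, so a subspace is closed under
    almost everywhere equality. *)

Definition L2ip (R : realType) (S : riemannian R 1)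
    (mu : {measure set (borel S) -> \bar R}) (f g : S -> R) : R :=
  \int[mu]_p (f p * g p).

Definition orthonormal_basis (R : realType) (S : riemannian R 1)
    (mu : {measure set (borel S) -> \bar R}) (I : nat) (W : set (borel S -> R))
    (f : 'I_I -> borel S -> R) : Prop :=
  [/\ forall i, f i \in Lfun mu 2%:E,
      forall i j, L2ip mu (f i) (f j) = (i == j)%:R &
      W = [set g | g \in Lfun mu 2%:E /\ exists a : 'rV[R]_I,
             {ae mu, forall p, g p = \sum_i a 0 i * f i p}]].

Definition orthogonal_to (R : realType) (S : riemannian R 1)
    (mu : {measure set (borel S) -> \bar R}) (W : set (borel S -> R))
    (phi : S -> R) : Prop :=
  forall g, W g -> L2ip mu phi g = 0.

(* Main.v *)
(** In a fixed compact set the quadratic form satisfies a Garding inequality: cutting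
    off by a quadratic partition of unity away from the supports of a maximal negative
    definite family, the outer part of [Q] is nonnegative, and the boundary term of the
    inner part is absorbed by the trace inequality.  As [I] is finite, [Q] is also bounded
    below on L^2, and a Rayleigh quotient argument that uses only finite-dimensional
    linear algebra produces a minimizing sequence that is Cauchy in L^2 and in the energy:
    on the [Q]-complement of the maximal negative definite space the form is nonnegative,
    so only finitely many coordinates have to be extracted by compactness.  Adding
    [- lam <f, .>^2] to [Q] lowers the index by one, so that the argument can be
    iterated.  By the Garding inequality the sequences converge in H^1_loc together with
    their boundary values, and their limits are the eigenfunctions. *)

Require Import Defs.
From HB Require Import structures.
From mathcomp Require Import all_boot all_order all_algebra.
From mathcomp Require Import all_classical all_reals all_analysis.
From mathcomp Require Import measurable_realfun ring lra.
Set Implicit Arguments.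
Unset Strict Implicit.
Unset Printing Implicit Defensive.
Import Order.TTheory GRing.Theory Num.Theory.
Import numFieldNormedType.Exports.
Local Open Scope classical_set_scope.
Local Open Scope ring_scope.

(** * Differential calculus on the half-space *)

(** Two obstacles shape the proof. Every geometric quantity is given at a point in the preferred
    chart of that point, and this chart jumps from point to point. Continuity of the potentials
    therefore rests on tensor laws: each quantity is compared with its expression in fixed charts.
    For the boundary potential this works because the constant angle makes [T] tangent to the
    boundary of [M], where only tangential derivatives of the normal enter. Secondly, a noncompact
    surface offers no global compactness, and neither L^2 nor the form domain is completed. The
    spectral argument lives on the vector space of test functions with two symmetric forms, [Q] and
    the L^2 product [B]; an eigenvector is a Cauchy sequence together with a bound on its residual
    in the dual energy norm. Only at the end are such sequences turned into functions. There are
    exactly [I] of them: with fewer, some nonzero vector of a maximal negative definite space would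
    be orthogonal to all of them and yet have [Q >= 0]. *)

Definition hnbhs (R : realType) n (x : 'rV[R]_n.+1) : set_system 'rV[R]_n.+1 :=
  within (@half_space R n) (nbhs x).

Definition hcont (R : realType) n (T : topologicalType) (f : 'rV[R]_n.+1 -> T) x :=
  f y @[y --> hnbhs x] --> f x.

Definition ropen (R : realType) n (V : set 'rV[R]_n.+1) :=
  exists2 O : set 'rV[R]_n.+1, open O & V = O `&` @half_space R n.

(** Differentiability in Caratheodory's form: the increment is a sum with coefficients [phi] tending
    to [g]. Product, chain and quotient rules then become algebra plus limits, also at boundary
    points, where only one side is available. *)
Definition hdiff (R : realType) n (f : 'rV[R]_n.+1 -> R) x (g : 'rV[R]_n.+1) :=
  exists phi : 'rV[R]_n.+1 -> 'rV[R]_n.+1,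
    (\forall y \near hnbhs x, f y = f x + \sum_i (y - x) 0 i * phi y 0 i) /\
    forall i, phi y 0 i @[y --> hnbhs x] --> g 0 i.

Lemma cvg_rsum (R : realType) (T J : Type) (F : set_system T) (r : seq J)
    (P : pred J) (f : J -> T -> R) (l : J -> R) : Filter F ->
  (forall j, P j -> f j x @[x --> F] --> l j) ->
  \sum_(j <- r | P j) f j x @[x --> F] --> \sum_(j <- r | P j) l j.
Proof. by move=> FF h; apply: cvg_big => //; exact: add_continuous. Qed.

Section HalfSpace.
Context (R : realType) (n : nat).
Implicit Types (x y : 'rV[R]_n.+1) (f : 'rV[R]_n.+1 -> R) (V : set 'rV[R]_n.+1).
Local Notation H := (@half_space R n).

Lemma hnbhs_filter x : Filter (hnbhs x).
Proof. exact: within_filter. Qed.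
Existing Instance hnbhs_filter.

Lemma ropen_near V x : ropen V -> V x -> \forall y \near hnbhs x, V y.
Proof.
move=> [W oW ->] [Ox Hx]; rewrite /hnbhs near_withinE.
by near=> y => Hy; split => //; near: y; apply: open_nbhs_nbhs; split.
Unshelve. all: by end_near. Qed.

Lemma ropenH V x : ropen V -> V x -> H x.
Proof. by move=> [W oW ->] []. Qed.

(** Near a point of a relatively open set, [V] and the half-space cut the same traces out of small
    neighbourhoods. *)
Lemma within_contP (T : topologicalType) V (f : 'rV[R]_n.+1 -> T) : ropen V ->
  {within V, continuous f} <-> forall x, V x -> hcont f x.
Proof.
move=> rV; rewrite subspace_continuousP.
suff E x : V x -> within V (nbhs x) = hnbhs x.
  by split => h x Vx; have := h _ Vx; rewrite /hcont E.
move=> Vx; apply/seteqP; split => A; rewrite /hnbhs /within /= => hA.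
- have := ropen_near rV Vx; rewrite /hnbhs near_withinE => hV.
  by near=> y => Hy; (have : V y by near: y; exact: (near hV)) || idtac;
     apply: (near hA y) => //; apply: (near hV y).
- near=> y => Vy; apply: (near hA y) => //.
  exact: ropenH rV Vy.
Unshelve. all: by end_near. Qed.

Lemma hcont_near_eq (T : topologicalType) (f g : 'rV[R]_n.+1 -> T) x :
  H x -> (\forall y \near hnbhs x, f y = g y) -> hcont f x -> hcont g x.
Proof.
move=> Hx fg; rewrite /hcont => fx.
have <- : f x = g x by move: fg; rewrite /hnbhs near_withinE => /nbhs_singleton; apply.
apply: cvg_trans fx; apply: near_eq_cvg.
by near do by rewrite (near fg).
Unshelve. all: by end_near. Qed.

Lemma hcont_dist (f : 'rV[R]_n.+1 -> R) x e : hcont f x -> 0 < e ->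
  \forall y \near hnbhs x, `|f x - f y| < e.
Proof. by move=> fc e0; move/cvgr_dist_lt: (fc : f y @[y --> hnbhs x] --> f x); exact. Qed.

Lemma hcont_coord x i : hcont (fun y => y 0 i) x.
Proof. by apply: cvg_within_filter; exact: coord_continuous. Qed.

Definition shiftc x i (h : R) := x + h *: delta_mx 0 i.

Lemma shiftcE x i h j : shiftc x i h 0 j = x 0 j + h * (j == i)%:R.
Proof. by rewrite !mxE/= eq_sym. Qed.

(** Positive increments never leave the half-space, so the filter of admissible increments is proper
    even at the boundary; this makes the limit in [pderiv] unique. *)
Lemma diffquot_proper i x : H x -> ProperFilter (diffquot_nbhs i x).
Proof.
move=> Hx; split; last exact: within_filter.
rewrite /diffquot_nbhs /within /= => /nbhs_ballP[e /= e0].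
move=> /(_ (e/2)); apply.
- by rewrite /ball/= sub0r normrN gtr0_norm ?divr_gt0// ltr_pdivrMr// mulr_natr mulr2n ltrDl.
- by rewrite gt_eqF// divr_gt0.
- rewrite /half_space /= -/(shiftc _ _ _) shiftcE addr_ge0//.
  by rewrite mulr_ge0// ltW// divr_gt0.
Qed.

Lemma diffquot_to x i : H x -> (fun h => shiftc x i h) @ diffquot_nbhs i x --> hnbhs x.
Proof.
move=> Hx A; rewrite /hnbhs /within /= => /nbhs_ballP[e /= e0 hA].
apply/nbhs_ballP; exists e => //= h; rewrite /ball/= sub0r normrN => he h0 Hh.
apply: hA => //; rewrite -[ball]/(@ball R _) mx_norm_ball /ball_/=.
rewrite /shiftc opprD addrA subrr sub0r normrN normrZ.
apply: le_lt_trans he; rewrite ler_piMr//.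
rewrite [`|_|]mx_normrE; apply/bigmax_leP; split => //= -[a b] _ /=.
by rewrite mxE normr_nat; case: (_ && _); rewrite ?lexx ?ler01.
Qed.

(** Along a coordinate axis all terms of the expansion but the [i]-th vanish, so the difference
    quotient is a component of [phi] itself. *)
Lemma hdiff_pd f x (g : 'rV[R]_n.+1) i : H x -> hdiff f x g ->
  diffquot f i x @ diffquot_nbhs i x --> g 0 i.
Proof.
move=> Hx [phi [fE phic]].
have : (fun h => phi (shiftc x i h) 0 i) @ diffquot_nbhs i x --> g 0 i.
  exact: cvg_comp (diffquot_to i Hx) (phic i).
apply: cvg_trans; apply: near_eq_cvg.
rewrite /diffquot_nbhs; near=> h.
have fEh : f (shiftc x i h) = f x + \sum_i0 (shiftc x i h - x) 0 i0 * phi (shiftc x i h) 0 i0.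
  by near: h; exact: (diffquot_to i Hx fE).
rewrite /diffquot -/(shiftc x i h) fEh addrAC subrr add0r (bigD1 i)//= big1.
  rewrite addr0 /shiftc [_ - x]addrC addKr !mxE/= eqxx mulr1 mulKf//.
  by near: h; rewrite near_withinE; near do move=> _; exact: nbhs_dnbhs_neq.
by move=> j ji; rewrite /shiftc [_ - x]addrC addKr !mxE/= (negbTE ji) mulr0 mul0r.
Unshelve. all: by end_near. Qed.

Lemma hdiff_pderiv f x (g : 'rV[R]_n.+1) i : H x -> hdiff f x g -> pderiv i f x = g 0 i.
Proof.
move=> Hx /(hdiff_pd Hx)-/(_ i) h; apply: cvg_lim => //.
exact: diffquot_proper.
Qed.

Lemma hdiff_cst c x : hdiff (fun=> c) x (0 : 'rV[R]_n.+1).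
Proof.
exists (fun=> 0); split.
  by near=> y; rewrite big1 ?addr0// => i _; rewrite [X in _ * X]mxE mulr0.
by move=> i; exact: cvg_cst.
Unshelve. all: by end_near. Qed.

Lemma hdiff_coord k x : hdiff (fun y => y 0 k) x (delta_mx 0 k).
Proof.
exists (fun=> delta_mx 0 k); split; last by move=> i; exact: cvg_cst.
near=> y; rewrite (bigD1 k)//= big1 => [|i ik].
  by rewrite !mxE !eqxx/=; ring.
by rewrite !mxE eqxx/= (negbTE ik) mulr0.
Unshelve. all: by end_near. Qed.

Lemma hdiff_hcont f x (g : 'rV[R]_n.+1) : hdiff f x g -> hcont f x.
Proof.
move=> [phi [fE phic]].
rewrite /hcont -[X in _ --> X]addr0.
have : f x + \sum_i (y - x) 0 i * phi y 0 i @[y --> hnbhs x] --> f x + 0.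
  apply: cvgD; first exact: cvg_cst.
  rewrite [X in _ --> X](_ : _ = \sum_i 0 * g 0 i :> R); last first.
    by rewrite big1// => i _; rewrite mul0r.
  apply: cvg_rsum => i _; apply: cvgM (phic i).
  under eq_fun do rewrite !mxE.
  rewrite -(subrr (x 0 i)); apply: cvgB; [exact: hcont_coord|exact: cvg_cst].
apply: cvg_trans; apply: near_eq_cvg.
by near=> y; symmetry; near: y.
Unshelve. all: by end_near. Qed.

Lemma hdiff_near_eq f g x (d : 'rV[R]_n.+1) : H x ->
  (\forall y \near hnbhs x, f y = g y) -> hdiff f x d -> hdiff g x d.
Proof.
move=> Hx fg [phi [fE phic]]; exists phi; split => //.
have fgx : f x = g x by move: fg; rewrite /hnbhs near_withinE => /nbhs_singleton; apply.
near=> y; have <- : f y = g y by near: y.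
by rewrite -fgx; near: y.
Unshelve. all: by end_near. Qed.

Lemma hdiffD f g x (d e : 'rV[R]_n.+1) : hdiff f x d -> hdiff g x e ->
  hdiff (fun y => f y + g y) x (d + e).
Proof.
move=> [p [fE pc]] [q [gE qc]]; exists (fun y => p y + q y); split; last first.
  move=> i; rewrite mxE; under eq_fun do rewrite mxE.
  exact: cvgD.
near=> y; have -> : f y = f x + \sum_i (y - x) 0 i * p y 0 i by near: y.
have -> : g y = g x + \sum_i (y - x) 0 i * q y 0 i by near: y.
rewrite addrACA -big_split/=; congr (_ + _).
by apply: eq_bigr => i _; rewrite [(p y + q y) _ _]mxE mulrDr.
Unshelve. all: by end_near. Qed.

Lemma hdiffM f g x (d e : 'rV[R]_n.+1) : hdiff f x d -> hdiff g x e ->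
  hdiff (fun y => f y * g y) x (g x *: d + f x *: e).
Proof.
move=> hf hg; have gc := hdiff_hcont hg.
move: hf hg => [p [fE pc]] [q [gE qc]].
exists (fun y => g y *: p y + f x *: q y); split; last first.
  move=> i; rewrite !mxE; under eq_fun do rewrite !mxE.
  by apply: cvgD; apply: cvgM => //; exact: cvg_cst.
near=> y.
have -> : f y * g y = f x * g x + ((f y - f x) * g y + f x * (g y - g x)) by ring.
have -> : f y - f x = \sum_i (y - x) 0 i * p y 0 i.
  by apply/eqP; rewrite subr_eq addrC; apply/eqP; near: y.
have -> : g y - g x = \sum_i (y - x) 0 i * q y 0 i.
  by apply/eqP; rewrite subr_eq addrC; apply/eqP; near: y.
congr (_ + _); rewrite mulr_suml mulr_sumr -big_split/=.
by apply: eq_bigr => i _; rewrite [X in _ = _ * X]mxE [X in _ = _ * (X + _)]mxE [X in _ = _ * (_ + X)]mxE; ring.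
Unshelve. all: by end_near. Qed.

Lemma hdiffZ c f x (d : 'rV[R]_n.+1) : hdiff f x d ->
  hdiff (fun y => c * f y) x (c *: d).
Proof.
move=> hf; have := hdiffM (hdiff_cst c x) hf.
by rewrite scaler0 add0r.
Qed.

Lemma hdiffN f x (d : 'rV[R]_n.+1) : hdiff f x d -> hdiff (fun y => - f y) x (- d).
Proof.
move=> /(hdiffZ (-1)); rewrite scaleN1r.
by under eq_fun do rewrite mulN1r.
Qed.

Lemma hdiffB f g x (d e : 'rV[R]_n.+1) : hdiff f x d -> hdiff g x e ->
  hdiff (fun y => f y - g y) x (d - e).
Proof. by move=> hf hg; apply: hdiffD => //; exact: hdiffN. Qed.

Lemma hdiff_sum (J : Type) (r : seq J) (P : pred J) (f : J -> 'rV[R]_n.+1 -> R) x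
    (d : J -> 'rV[R]_n.+1) : (forall j, P j -> hdiff (f j) x (d j)) ->
  hdiff (fun y => \sum_(j <- r | P j) f j y) x (\sum_(j <- r | P j) d j).
Proof.
move=> h; elim: r => [|j r ih].
  by under eq_fun do rewrite big_nil; rewrite big_nil; exact: hdiff_cst.
under eq_fun do rewrite big_cons; rewrite big_cons; case: ifP => // Pj.
by apply: hdiffD => //; exact: h.
Qed.

(* Caratheodory's criterion for the outer function. *)
Lemma hdiff_outer (u psi : R -> R) f x (d : 'rV[R]_n.+1) :
  hdiff f x d ->
  (\forall y \near hnbhs x, u (f y) = u (f x) + (f y - f x) * psi (f y)) ->
  psi t @[t --> f x] --> psi (f x) ->
  hdiff (fun y => u (f y)) x (psi (f x) *: d).
Proof.
move=> hf uE psic; have fc := hdiff_hcont hf.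
case: hf => [p [fE pc]]; exists (fun y => psi (f y) *: p y); split; last first.
  move=> i; rewrite !mxE; under eq_fun do rewrite !mxE.
  apply: cvgM => //; exact: cvg_comp fc psic.
near=> y; have -> : u (f y) = u (f x) + (f y - f x) * psi (f y) by near: y.
have -> : f y - f x = \sum_i (y - x) 0 i * p y 0 i.
  by apply/eqP; rewrite subr_eq addrC; apply/eqP; near: y.
by rewrite mulr_suml; congr (_ + _); apply: eq_bigr => i _; rewrite [X in _ = _ * X]mxE; ring.
Unshelve. all: by end_near. Qed.

Lemma hdiff_near_neq0 f x (d : 'rV[R]_n.+1) : hdiff f x d -> f x != 0 ->
  \forall y \near hnbhs x, f y != 0.
Proof.
move=> /hdiff_hcont fc f0; near=> y.
suff : `|f x - f y| < `|f x|.
  by apply: contraTneq => ->; rewrite subr0 ltxx.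
by near: y; apply: (hcont_dist fc); rewrite normr_gt0.
Unshelve. all: by end_near. Qed.

Lemma hdiffV f x (d : 'rV[R]_n.+1) : hdiff f x d -> f x != 0 ->
  hdiff (fun y => (f y)^-1) x (- (f x) ^- 2 *: d).
Proof.
move=> hf f0; have near0 := hdiff_near_neq0 hf f0.
(* The slope of the inverse between [f x] and [t] is [- (t * f x)^-1]. *)
rewrite (_ : - (f x) ^- 2 = (fun t => - (t * f x)^-1) (f x)); last by rewrite expr2.
apply: (@hdiff_outer (fun t => t^-1) (fun t => - (t * f x)^-1)) => //.
  near=> y; have fy0 : f y != 0 by near: y.
  by field; rewrite f0 fy0.
apply: cvgN; apply: cvgV; first by rewrite mulf_neq0.
by apply: cvgM; [exact: cvg_id|exact: cvg_cst].
Unshelve. all: by end_near. Qed.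

Lemma hdiff_sqrt f x (d : 'rV[R]_n.+1) : hdiff f x d -> 0 < f x ->
  hdiff (fun y => Num.sqrt (f y)) x ((Num.sqrt (f x) *+ 2)^-1 *: d).
Proof.
move=> hf f0; have fc := hdiff_hcont hf.
(* The slope of the square root between [f x] and [t], by the conjugate expression. *)
rewrite (_ : (_ *+ 2)^-1 = (fun t => (Num.sqrt t + Num.sqrt (f x))^-1) (f x)); last by rewrite mulr2n.
have s0 : 0 < Num.sqrt (f x) by rewrite sqrtr_gt0.
apply: (@hdiff_outer Num.sqrt (fun t => (Num.sqrt t + Num.sqrt (f x))^-1)) => //.
  near=> y; have fy0 : 0 < f y.
    suff : `|f x - f y| < `|f x|.
      by rewrite (gtr0_norm f0) ltr_norml => /andP[_]; rewrite ltrBlDr ltrDl.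
    by near: y; apply: (hcont_dist fc); rewrite normr_gt0 gt_eqF.
  have sy0 : 0 < Num.sqrt (f y) by rewrite sqrtr_gt0.
  rewrite -{2}(sqr_sqrtr (ltW fy0)) -{2}(sqr_sqrtr (ltW f0)).
  by field; rewrite gt_eqF// addr_gt0.
apply: cvgV; first by rewrite gt_eqF// addr_gt0.
by apply: cvgD; [exact: sqrt_continuous|exact: cvg_cst].
Unshelve. all: by end_near. Qed.

(** Inside the segment small increments of either sign are admissible, so [pderiv] is a genuine
    derivative along the line, and the mean value and fundamental theorems of one variable apply. *)
Lemma line_derive V f x i a b : ropen V ->
  (forall y, V y -> cvg (diffquot f i y @ diffquot_nbhs i y)) ->
  (forall y, V y -> hcont f y) ->
  (forall t, a <= t <= b -> V (shiftc x i t)) ->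
  (forall t, t \in `]a, b[%R ->
     is_derive t 1 (fun s => f (shiftc x i s)) (pderiv i f (shiftc x i t))) /\
  {within `[a, b], continuous (fun s => f (shiftc x i s))}.
Proof.
move=> rV df cf hV; split.
  move=> t; rewrite in_itv/= => /andP[at_ tb].
  have Vt : V (shiftc x i t) by apply: hV; rewrite !ltW.
  suff dl : (fun h => h^-1 *: (f (shiftc x i (h *: 1 + t)) - f (shiftc x i t))) @ 0^' -->
      pderiv i f (shiftc x i t).
    by apply: DeriveDef; [apply/cvg_ex; eexists; exact: dl|exact: cvg_lim dl].
  have := df _ Vt; rewrite -/(pderiv i f (shiftc x i t)) => dfl A /dfl.
  rewrite /diffquot_nbhs /within/= => hA0.
  have hA : \forall h \near (0 : R)^', H (shiftc x i t + h *: delta_mx 0 i) ->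
    A (diffquot f i (shiftc x i t) h) by exact: hA0.
  suff : \forall h \near (0 : R)^', A (h^-1 *: (f (shiftc x i (h *: 1 + t)) - f (shiftc x i t))) by [].
  near=> h.
  have hH : H (shiftc x i t + h *: delta_mx 0 i).
    rewrite /shiftc -addrA -scalerDl; apply: (ropenH rV); apply: hV.
    have h1 : `|h| < t - a by near: h; apply: dnbhs0_lt; rewrite subr_gt0.
    have h2 : `|h| < b - t by near: h; apply: dnbhs0_lt; rewrite subr_gt0.
    by move: h1 h2; rewrite !ltr_norml => /andP[? ?] /andP[? ?]; apply/andP; split; lra.
  have : A (diffquot f i (shiftc x i t) h) by move: hH; near: h.
  by rewrite /diffquot /shiftc [_ *: 1]mulr1 (addrC h) scalerDl addrA.
apply/subspace_continuousP => t; rewrite /= in_itv/= => tab.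
have Vt := hV _ tab.
apply: (@cvg_comp _ _ _ (fun s => shiftc x i s) f _ (hnbhs (shiftc x i t))); last exact: cf.
move=> A; rewrite /hnbhs /within /= => /nbhs_ballP[e /= e0 hA].
apply/nbhs_ballP; exists e => //= s; rewrite /ball/= => tse sab.
apply: hA; last by apply: (ropenH rV); apply: hV; move: sab; rewrite in_itv.
rewrite -[ball]/(@ball R _) mx_norm_ball /ball_/=.
rewrite /shiftc opprD addrACA subrr add0r -scalerBl normrZ.
apply: le_lt_trans tse; rewrite ler_piMr//.
rewrite [`|_|]mx_normrE; apply/bigmax_leP; split => //= -[c d] _ /=.
by rewrite mxE normr_nat; case: (_ && _); rewrite ?lexx ?ler01.
Unshelve. all: by end_near. Qed.

(** A path from [x] to [y] that replaces one coordinate at a time. Each vertex has the last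
    coordinate of [x] or of [y], so it stays in the half-space. *)
Definition mixv x y (k : nat) : 'rV[R]_n.+1 :=
  \row_j (if (j < k)%N then y 0 j else x 0 j).

Lemma mixvS x y (k : 'I_n.+1) :
  mixv x y k.+1 = shiftc (mixv x y k) k (y 0 k - x 0 k).
Proof.
apply/rowP => j; rewrite shiftcE !mxE ltnS leq_eqVlt val_eqE.
have [->|jk] := eqVneq j k; first by rewrite ltnn mulr1 addrC addrNK.
by rewrite mulr0 addr0.
Qed.

Lemma mixvH x y k : H x -> H y -> H (mixv x y k).
Proof. by rewrite /half_space/= => Hx Hy; rewrite mxE; case: ifP. Qed.

Lemma shiftcH x i a b t : H (shiftc x i a) -> H (shiftc x i b) -> a <= t <= b ->
  H (shiftc x i t).
Proof.
rewrite /half_space/= !shiftcE => ha hb /andP[a_t tb].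
case: (_ == _) ha hb => /=; rewrite ?mulr1 ?mulr0//; lra.
Qed.

Lemma mvt_line V f x i s : ropen V ->
  (forall y, V y -> cvg (diffquot f i y @ diffquot_nbhs i y)) ->
  (forall y, V y -> hcont f y) ->
  (forall t, `|t| <= `|s| -> H (shiftc x i t) -> V (shiftc x i t)) ->
  H x -> H (shiftc x i s) ->
  exists t, [/\ `|t| <= `|s|, V (shiftc x i t) &
    f (shiftc x i s) - f x = s * pderiv i f (shiftc x i t)].
Proof.
move=> rV df cf hV Hx Hs.
have x0 : shiftc x i 0 = x by rewrite /shiftc scale0r addr0.
have Hx0 : H (shiftc x i 0) by rewrite x0.
have [s0|s0] := leP 0 s.
- have hV' t : 0 <= t <= s -> V (shiftc x i t).
    move=> /[dup] /(shiftcH Hx0 Hs) Ht /andP[t0 ts]; apply: hV => //.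
    by rewrite !ger0_norm// (le_trans t0).
  have [hd hc] := line_derive rV df cf hV'.
  have [t tab E] := MVT_segment s0 hd hc.
  move: tab; rewrite in_itv/= => tab; exists t; split; last 1 first.
  + by move: E; rewrite x0 subr0 mulrC.
  + by case/andP: tab => t0 ts; rewrite !ger0_norm// (le_trans t0).
  + exact: hV'.
- have hV' t : s <= t <= 0 -> V (shiftc x i t).
    move=> /[dup] /(shiftcH Hs Hx0) Ht /andP[t0 ts]; apply: hV => //.
    by rewrite !ler0_norm ?lerN2// ltW.
  have [hd hc] := line_derive rV df cf hV'.
  have [t tab E] := MVT_segment (ltW s0) hd hc.
  move: tab; rewrite in_itv/= => tab; exists t; split; last 1 first.
  + by move: E; rewrite x0 sub0r => E; rewrite -opprB E mulrN opprK mulrC.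
  + by case/andP: tab => t0 ts; rewrite !ler0_norm ?lerN2// ltW.
  + exact: hV'.
Qed.

(** The increment telescopes along [mixv]. The mean value theorem turns each one-coordinate
    increment into a partial derivative at a point no farther from [x] than [y], and continuity of
    the partials gives the limits. *)
Lemma hdiff_C1 V f x : ropen V -> V x ->
  (forall y, V y -> hcont f y) ->
  (forall i y, V y -> cvg (diffquot f i y @ diffquot_nbhs i y)) ->
  (forall i y, V y -> hcont (pderiv i f) y) ->
  hdiff f x (\row_i pderiv i f x).
Proof.
move=> rV Vx cf df cdf; have Hx := ropenH rV Vx.
(* Where the two coordinates agree the increment is zero, and the coefficient is given the value of
   its expected limit. *)
pose phi y : 'rV[R]_n.+1 := \row_i (if y 0 i == x 0 i then pderiv i f x else
  (f (mixv x y i.+1) - f (mixv x y i)) / (y 0 i - x 0 i)).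
have mix0 y : mixv x y 0 = x by apply/rowP => j; rewrite mxE.
exists phi; split.
  near=> y; rewrite addrC; apply/eqP; rewrite -subr_eq; apply/eqP.
  have -> : f y - f x = \sum_(0 <= i < n.+1) (f (mixv x y i.+1) - f (mixv x y i)).
    rewrite telescope_sumr// mix0; congr (f _ - _).
    by apply/rowP => j; rewrite mxE ltn_ord.
  rewrite big_mkord; apply: eq_bigr => i _.
  rewrite ![in RHS]mxE; case: eqVneq => [e|ne].
    by rewrite mixvS e subrr mul0r /shiftc scale0r addr0 subrr.
  by rewrite mulrC divfK// subr_eq0.
move=> i; apply/cvgrPdist_le => /= e e0.
rewrite !mxE.
have : \forall y \near hnbhs x, V y /\ `|pderiv i f x - pderiv i f y| < e.
  by apply: filterI; [exact: ropen_near|apply: hcont_dist => //; exact: cdf].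
rewrite /hnbhs near_withinE => /nbhs_ballP[d /= d0 hd].
rewrite near_withinE; apply/nbhs_ballP; exists d => //= y.
rewrite -[ball]/(@ball R _) mx_norm_ball /ball_/= => yd Hy.
rewrite mxE; case: eqVneq => [_|ne]; first by rewrite subrr normr0 ltW.
have inball z : H z -> (forall j, `|x 0 j - z 0 j| <= `|x - y|) -> V z /\ `|pderiv i f x - pderiv i f z| < e.
  move=> Hz xz; apply: hd => //; rewrite -[ball]/(@ball R _) mx_norm_ball /ball_/=.
  apply: le_lt_trans yd; rewrite [X in X <= _]mx_normrE; apply/bigmax_leP; split => // -[c k] _ /=.
  by rewrite !mxE ord1.
have xyj j : `|x 0 j - y 0 j| <= `|x - y|.
  rewrite [X in _ <= X]mx_normrE; apply: le_trans (le_bigmax _ _ (0, j)); by rewrite /= !mxE.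
have [] := @mvt_line V f (mixv x y i) i (y 0 i - x 0 i) rV (df i) cf.
- move=> t ts Ht; apply: (proj1 (inball _ Ht _)) => j.
  rewrite shiftcE mxE; case: eqVneq => [->|_].
    rewrite ltnn mulr1 opprD addNKr normrN (le_trans ts)//.
    by rewrite distrC.
  by rewrite mulr0 addr0; case: ifP => // _; rewrite subrr normr0.
- exact: mixvH.
- by rewrite -mixvS; exact: mixvH.
move=> t [ts Vt E]; rewrite mixvS E mulrAC divff ?subr_eq0// mul1r.
apply/ltW; apply: (proj2 (inball _ _ _)); first exact: ropenH rV Vt.
move=> j; rewrite shiftcE mxE; case: eqVneq => [->|_].
  rewrite ltnn mulr1 opprD addNKr normrN (le_trans ts)//.
  by rewrite distrC.
by rewrite mulr0 addr0; case: ifP => // _; rewrite subrr normr0.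
Unshelve. all: by end_near. Qed.

End HalfSpace.

#[local] Existing Instance hnbhs_filter.

(** * Functions of class C^k and their closure properties *)

Definition grad (R : realType) n (f : 'rV[R]_n.+1 -> R) x : 'rV[R]_n.+1 :=
  \row_i pderiv i f x.

(** [smooth_on] quantifies over lists of derivatives. This recursive form allows induction on the
    order, where the derivative of a product or an inverse is again built from functions of lower
    order. *)
Fixpoint Ck (R : realType) n (k : nat) (V : set 'rV[R]_n.+1) (f : 'rV[R]_n.+1 -> R) : Prop :=
  (forall x, V x -> hcont f x) /\
  (if k is k'.+1 then
     (forall i x, V x -> cvg (diffquot f i x @ diffquot_nbhs i x)) /\
     (forall i, Ck k' V (pderiv i f))
   else True).

Section Smooth.
Context (R : realType) (n : nat) (V : set 'rV[R]_n.+1).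
Hypothesis rV : ropen V.
Implicit Types (x y : 'rV[R]_n.+1) (f g : 'rV[R]_n.+1 -> R).
Local Notation H := (@half_space R n).

Lemma smooth_onP f : smooth_on V f <-> forall k, Ck k V f.
Proof using rV.
split.
  move=> sf k; elim: k f sf => [|k ih] f sf.
    by split=> //; apply/within_contP => //; exact: (proj1 (sf [::])).
  split; first by apply/within_contP => //; exact: (proj1 (sf [::])).
  split; first exact: (proj2 (sf [::])).
  (* The derivative taken first is the last entry of the list, hence [rcons]. *)
  by move=> i; apply: ih => s; move: (sf (rcons s i)); rewrite foldr_rcons.
move=> cf s; have {cf} := cf (size s).+1.
elim/last_ind: s f => [|s i ih] f /=.
  by move=> [cf [df _]]; split => //; apply/within_contP.
by rewrite size_rcons foldr_rcons => -[_ [_ /(_ i)]] /ih.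
Qed.

Lemma CkW k f : Ck k.+1 V f -> Ck k V f.
Proof using.
elim: k f => [|k ih] f [cf [df ckf]]; first by split.
by split=> //; split=> // i; apply: ih; exact: ckf.
Qed.

Lemma Ck_hdiff k f x : V x -> Ck k.+1 V f -> hdiff f x (grad f x).
Proof using rV.
move=> Vx [cf [df ckf]]; apply: (@hdiff_C1 _ _ V) => // i.
by have := ckf i; case: (k) => [|?] [].
Qed.

(** Partial derivatives are compared on [V] only, so [Ck] is first shown stable under equality on
    [V]; then the components of a given differential may stand for the partial derivatives. *)
Lemma Ck_step k f (d : 'rV[R]_n.+1 -> 'rV[R]_n.+1) :
  (forall x, V x -> hdiff f x (d x)) -> (forall i, Ck k V (fun x => d x 0 i)) ->
  Ck k.+1 V f.
Proof using rV.
suff E g h : (forall x, V x -> g x = h x) -> Ck k V g -> Ck k V h.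
  move=> hd cd; split; first by move=> x /hd /hdiff_hcont.
  split=> [i x Vx|i].
    by apply/cvg_ex; exists (d x 0 i); apply: hdiff_pd; [exact: ropenH rV Vx|exact: hd].
  apply: E (cd i) => x Vx; symmetry.
  by apply: hdiff_pderiv; [exact: ropenH rV Vx|exact: hd].
elim: k g h => [|k ih] g h gh; (case=> cg rest; split;
  first by move=> x Vx; apply: hcont_near_eq (cg x Vx); [exact: ropenH rV Vx|
    near=> y; apply: gh; near: y; exact: ropen_near]) => //.
case: rest => dg ckg.
have hg x : V x -> hdiff g x (grad g x).
  by move=> Vx; apply: (@hdiff_C1 _ _ V) => // i; have := ckg i; case: (k) => [|?] [].
have hh x : V x -> hdiff h x (grad g x).
  move=> Vx; apply: hdiff_near_eq (hg x Vx); first exact: ropenH rV Vx.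
  by near=> y; apply: gh; near: y; exact: ropen_near.
split=> i; last apply: (ih _ _ _ (ckg i)) => x Vx.
  by move=> x Vx; apply/cvg_ex; eexists; apply: hdiff_pd; [exact: ropenH rV Vx|exact: hh].
by rewrite (hdiff_pderiv _ (ropenH rV Vx) (hh x Vx)) mxE.
Unshelve. all: by end_near. Qed.

Lemma Ck_eq k f g : (forall x, V x -> f x = g x) -> Ck k V f -> Ck k V g.
Proof using rV.
move=> fg; case: k => [[cf _]|k ckf].
  split=> // x Vx; apply: hcont_near_eq (cf x Vx); first exact: ropenH rV Vx.
  by near=> y; apply: fg; near: y; exact: ropen_near.
apply: (@Ck_step k g (grad f)) => [x Vx|i].
  apply: hdiff_near_eq (Ck_hdiff Vx ckf); first exact: ropenH rV Vx.
  by near=> y; apply: fg; near: y; exact: ropen_near.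
case: ckf => _ [_ /(_ i)]; suff -> : (fun x => grad f x 0 i) = pderiv i f by [].
by apply/funext => x; rewrite mxE.
Unshelve. all: by end_near. Qed.

Lemma Ck_grad k f i : Ck k.+1 V f -> Ck k V (fun x => grad f x 0 i).
Proof using.
move=> [_ [_ /(_ i)]]; suff -> : (fun x => grad f x 0 i) = pderiv i f by [].
by apply/funext => x; rewrite mxE.
Qed.

Lemma Ck_cst k c : Ck k V (fun=> c).
Proof using rV.
elim: k c => [|k ih] c; first by split=> // x _; exact: cvg_cst.
apply: (@Ck_step k _ (fun=> 0)); first by move=> x _; exact: hdiff_cst.
by move=> i; apply: Ck_eq (ih 0) => x _; rewrite mxE.
Qed.

Lemma Ck_coord k j : Ck k V (fun x => x 0 j).
Proof using rV.
case: k => [|k]; first by split=> // x _; exact: hcont_coord.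
apply: (@Ck_step k _ (fun=> delta_mx 0 j)); first by move=> x _; exact: hdiff_coord.
by move=> i; exact: Ck_cst.
Qed.

Lemma CkD k f g : Ck k V f -> Ck k V g -> Ck k V (fun x => f x + g x).
Proof using rV.
elim: k f g => [|k ih] f g cf cg.
  by split=> // x Vx; apply: cvgD; [exact: (proj1 cf)|exact: (proj1 cg)].
apply: (@Ck_step k _ (fun x => grad f x + grad g x)).
  by move=> x Vx; apply: hdiffD; [exact: (Ck_hdiff _ cf)|exact: (Ck_hdiff _ cg)].
move=> i; apply: Ck_eq (ih _ _ (Ck_grad i cf) (Ck_grad i cg)) => x _.
by rewrite [RHS]mxE.
Qed.

Lemma CkM k f g : Ck k V f -> Ck k V g -> Ck k V (fun x => f x * g x).
Proof using rV.
elim: k f g => [|k ih] f g cf cg.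
  by split=> // x Vx; apply: cvgM; [exact: (proj1 cf)|exact: (proj1 cg)].
apply: (@Ck_step k _ (fun x => g x *: grad f x + f x *: grad g x)).
  by move=> x Vx; apply: hdiffM; [exact: (Ck_hdiff _ cf)|exact: (Ck_hdiff _ cg)].
move=> i; have := CkD (ih _ _ (CkW cg) (Ck_grad i cf)) (ih _ _ (CkW cf) (Ck_grad i cg)).
by apply: Ck_eq => x _; rewrite !mxE.
Qed.

Lemma CkV k f : (forall x, V x -> f x != 0) -> Ck k V f -> Ck k V (fun x => (f x)^-1).
Proof using rV.
move=> f0; elim: k => [|k ih] cf.
  by split=> // x Vx; apply: cvgV; [exact: f0|exact: (proj1 cf)].
apply: (@Ck_step k _ (fun x => - (f x) ^- 2 *: grad f x)).
  by move=> x Vx; apply: hdiffV; [exact: (Ck_hdiff _ cf)|exact: f0].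
move=> i; have {}ih := ih (CkW cf).
apply: Ck_eq (CkM (CkM (Ck_cst k (-1)) (CkM ih ih)) (Ck_grad i cf)) => x _.
by rewrite [RHS]mxE mulN1r expr2 invfM.
Qed.

Lemma Ck_sqrt k f : (forall x, V x -> 0 < f x) -> Ck k V f ->
  Ck k V (fun x => Num.sqrt (f x)).
Proof using rV.
move=> f0; elim: k => [|k ih] cf.
  split=> // x Vx; apply: (@cvg_comp _ _ _ f Num.sqrt _ (nbhs (f x))).
    exact: (proj1 cf).
  exact: sqrt_continuous.
apply: (@Ck_step k _ (fun x => (Num.sqrt (f x) *+ 2)^-1 *: grad f x)).
  by move=> x Vx; apply: hdiff_sqrt; [exact: (Ck_hdiff _ cf)|exact: f0].
move=> i; have {}ih := ih (CkW cf).
apply: Ck_eq (CkM (CkM (Ck_cst k 2^-1) (@CkV k _ _ ih)) (Ck_grad i cf)).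
  by move=> x _; rewrite [RHS]mxE -[X in _ = X^-1 * _]mulr_natl invfM.
by move=> x Vx; rewrite gt_eqF// sqrtr_gt0 f0.
Qed.

(** [u] lists a function and all its derivatives. Each differentiation replaces [u m] by [u m.+1],
    so the induction treats all [m] at once. *)
Lemma Ck_outer (u : nat -> R -> R) k f :
  (forall m (t : R), is_derive t (1 : R) (u m) (u m.+1 t)) -> Ck k V f ->
  forall m, Ck k V (fun x => u m (f x)).
Proof using rV.
move=> du; elim: k f => [|k ih] f cf m.
  split=> // x Vx; apply: (@cvg_comp _ _ _ f (u m) _ (nbhs (f x))).
    exact: (proj1 cf).
  suff : {for f x, continuous (u m)} by [].
  apply: differentiable_continuous; apply/derivable1_diffP.
  exact: (@ex_derive _ _ _ _ _ _ _ (du m (f x))).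
apply: (@Ck_step k _ (fun x => u m.+1 (f x) *: grad f x)); last first.
  move=> i; apply: Ck_eq (CkM (ih _ (CkW cf) m.+1) (Ck_grad i cf)) => x _.
  by rewrite [RHS]mxE.
move=> x Vx; set s := f x.
(* The slope of [u m] at [s], completed by the derivative: Caratheodory's coefficient for the outer
   function. *)
pose psi t := if t == s then u m.+1 s else (u m t - u m s) / (t - s).
have -> : u m.+1 s = psi s by rewrite /psi eqxx.
apply: hdiff_outer (Ck_hdiff Vx cf) _ _.
  near=> y; rewrite /psi -/s; case: eqVneq => [->|ne]; first by rewrite subrr mul0r addr0.
  by rewrite mulrC divfK ?subr_eq0// addrC addrNK.
rewrite -/s [X in _ --> X]/psi eqxx.
have dd := @ex_derive _ _ _ _ _ _ _ (du m s).
have {}dd : (fun h => h^-1 *: (u m (h *: 1 + s) - u m s)) @ 0^' --> u m.+1 s.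
  by rewrite -(@derive_val _ _ _ _ _ _ _ (du m s)); exact: dd.
apply/cvgrPdist_le => /= e e0.
move/cvgrPdist_le: dd => /(_ e e0); rewrite near_withinE => /nbhs_ballP[d /= d0 hdd].
apply/nbhs_ballP; exists d => //= t; rewrite /ball/= => st.
rewrite /psi; case: eqVneq => [_|ts]; first by rewrite subrr normr0 ltW.
have := hdd (t - s); rewrite /ball/= sub0r normrN distrC => /(_ st).
rewrite subr_eq0 => /(_ ts); rewrite [_ *: 1]mulr1 addrNK.
by rewrite [_ *: _]mulrC.
Unshelve. all: by end_near. Qed.

Section Closure.
Implicit Types (k : nat).

Lemma smooth_eq f g : (forall x, V x -> f x = g x) -> smooth_on V f -> smooth_on V g.
Proof using rV. by move=> e /smooth_onP h; apply/smooth_onP => k; apply: Ck_eq e (h k). Qed.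

Lemma smooth_cst c : smooth_on V (fun=> c).
Proof using rV. by apply/smooth_onP => k; exact: Ck_cst. Qed.

Lemma smooth_coord j : smooth_on V (fun x => x 0 j).
Proof using rV. by apply/smooth_onP => k; exact: Ck_coord. Qed.

Lemma smoothD f g : smooth_on V f -> smooth_on V g -> smooth_on V (fun x => f x + g x).
Proof using rV.
by move=> /smooth_onP hf /smooth_onP hg; apply/smooth_onP => k; exact: CkD. Qed.

Lemma smoothM f g : smooth_on V f -> smooth_on V g -> smooth_on V (fun x => f x * g x).
Proof using rV.
by move=> /smooth_onP hf /smooth_onP hg; apply/smooth_onP => k; exact: CkM. Qed.

Lemma smoothZ c f : smooth_on V f -> smooth_on V (fun x => c * f x).
Proof using rV. by apply: smoothM; exact: smooth_cst. Qed.

Lemma smoothN f : smooth_on V f -> smooth_on V (fun x => - f x).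
Proof using rV.
by move=> /(smoothZ (-1)); apply: smooth_eq => x _; rewrite mulN1r. Qed.

Lemma smoothB f g : smooth_on V f -> smooth_on V g -> smooth_on V (fun x => f x - g x).
Proof using rV. by move=> hf hg; apply: smoothD => //; exact: smoothN. Qed.

Lemma smoothV f : (forall x, V x -> f x != 0) -> smooth_on V f ->
  smooth_on V (fun x => (f x)^-1).
Proof using rV.
by move=> f0 /smooth_onP hf; apply/smooth_onP => k; exact: CkV. Qed.

Lemma smooth_sqrt f : (forall x, V x -> 0 < f x) -> smooth_on V f ->
  smooth_on V (fun x => Num.sqrt (f x)).
Proof using rV.
by move=> f0 /smooth_onP hf; apply/smooth_onP => k; exact: Ck_sqrt. Qed.

Lemma smooth_outer (u : nat -> R -> R) f :
  (forall m (t : R), is_derive t (1 : R) (u m) (u m.+1 t)) -> smooth_on V f ->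
  smooth_on V (fun x => u 0 (f x)).
Proof using rV.
by move=> du /smooth_onP hf; apply/smooth_onP => k; exact: Ck_outer. Qed.

Lemma smooth_sum (J : Type) (r : seq J) (P : pred J) (f : J -> 'rV[R]_n.+1 -> R) :
  (forall j, P j -> smooth_on V (f j)) ->
  smooth_on V (fun x => \sum_(j <- r | P j) f j x).
Proof using rV.
move=> h; elim: r => [|j r ih].
  by apply: smooth_eq (smooth_cst 0) => x _; rewrite big_nil.
case: (boolP (P j)) => Pj.
  by apply: smooth_eq (smoothD (h _ Pj) ih) => x _; rewrite big_cons Pj.
by apply: smooth_eq ih => x _; rewrite big_cons (negbTE Pj).
Qed.

Lemma smooth_prod (J : Type) (r : seq J) (P : pred J) (f : J -> 'rV[R]_n.+1 -> R) :
  (forall j, P j -> smooth_on V (f j)) ->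
  smooth_on V (fun x => \prod_(j <- r | P j) f j x).
Proof using rV.
move=> h; elim: r => [|j r ih].
  by apply: smooth_eq (smooth_cst 1) => x _; rewrite big_nil.
case: (boolP (P j)) => Pj.
  by apply: smooth_eq (smoothM (h _ Pj) ih) => x _; rewrite big_cons Pj.
by apply: smooth_eq ih => x _; rewrite big_cons (negbTE Pj).
Qed.

Lemma smooth_pderiv i f : smooth_on V f -> smooth_on V (pderiv i f).
Proof using rV.
by move=> /smooth_onP h; apply/smooth_onP => k; case: (h k.+1) => _ [_]; apply. Qed.

Lemma smooth_hcont f x : V x -> smooth_on V f -> hcont f x.
Proof using rV. by move=> Vx /smooth_onP/(_ 0) [h _]; exact: h. Qed.

Lemma smooth_hdiff f x : V x -> smooth_on V f -> hdiff f x (grad f x).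
Proof using rV. by move=> Vx /smooth_onP/(_ 1); exact: Ck_hdiff. Qed.

Definition msmooth p q (A : 'rV[R]_n.+1 -> 'M[R]_(p, q)) :=
  forall i j, smooth_on V (fun x => A x i j).

Lemma smooth_det p (A : 'rV[R]_n.+1 -> 'M[R]_p) : msmooth A ->
  smooth_on V (fun x => \det (A x)).
Proof using rV.
move=> sA; apply: smooth_sum => s _; apply: smoothZ.
by apply: smooth_prod => i _; exact: sA.
Qed.

Lemma msmooth_mul p q r (A : 'rV[R]_n.+1 -> 'M[R]_(p, q))
    (B : 'rV[R]_n.+1 -> 'M[R]_(q, r)) :
  msmooth A -> msmooth B -> msmooth (fun x => A x *m B x).
Proof using rV.
move=> sA sB i j.
apply: (@smooth_eq (fun x => \sum_k A x i k * B x k j)) => [x _|]; first by rewrite mxE.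
by apply: smooth_sum => k _; apply: smoothM; [exact: sA|exact: sB].
Qed.

Lemma msmooth_tr p q (A : 'rV[R]_n.+1 -> 'M[R]_(p, q)) :
  msmooth A -> msmooth (fun x => (A x)^T).
Proof using rV. by move=> sA i j; apply: smooth_eq (sA j i) => x _; rewrite mxE. Qed.

(** Cramer's rule: the entries of the inverse are cofactors over the determinant. *)
Lemma msmooth_inv p (A : 'rV[R]_n.+1 -> 'M[R]_p) : msmooth A ->
  (forall x, V x -> A x \in unitmx) -> msmooth (fun x => invmx (A x)).
Proof using rV.
move=> sA uA i j.
apply: (@smooth_eq (fun x => (\det (A x))^-1 * cofactor (A x) j i)).
  by move=> x Vx; rewrite /invmx uA// !mxE.
apply: smoothM.
  apply: smoothV; last exact: smooth_det.
  by move=> x /uA; rewrite unitmxE unitfE.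
apply: smoothZ; apply: smooth_det => a b.
by apply: smooth_eq (sA (lift j a) (lift i b)) => x _; rewrite !mxE.
Qed.

End Closure.

End Smooth.

Section Smooth2.
Context (R : realType) (n : nat).
Implicit Types (V U : set 'rV[R]_n.+1) (x y : 'rV[R]_n.+1) (f g : 'rV[R]_n.+1 -> R).
Local Notation H := (@half_space R n).

Lemma smooth_sub V U f : ropen V -> ropen U -> U `<=` V -> smooth_on V f -> smooth_on U f.
Proof.
move=> rV rU UV /(smooth_onP rV) h; apply/(smooth_onP rU) => k; move: (h k) => {h}.
elim: k f => [|k ih] f [cf rest]; split=> //; try by move=> x /UV; exact: cf.
case: rest => df cdf; split; last by move=> i; apply: ih; exact: cdf.
by move=> i x /UV; exact: df.
Qed.

Lemma smooth_local V f : ropen V ->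
  (forall x, V x -> exists U, [/\ ropen U, U x & smooth_on U f]) -> smooth_on V f.
Proof.
move=> rV loc; apply/(smooth_onP rV) => k.
have {}loc x : V x -> exists U, [/\ ropen U, U x & Ck k U f].
  by move=> /loc[U [rU Ux sf]]; exists U; split=> //; exact: (proj1 (smooth_onP rU f)).
elim: k f loc => [|k ih] f loc; split=> //.
- by move=> x /loc[U [rU Ux [h _]]]; exact: h.
- by move=> x /loc[U [rU Ux [h _]]]; exact: h.
split.
  by move=> i x /loc[U [rU Ux [_ [h _]]]]; exact: h.
by move=> i; apply: ih => x /loc[U [rU Ux [_ [_ h]]]]; exists U; split=> //; exact: h.
Qed.

Lemma pderiv_near f g x i : H x -> (\forall y \near hnbhs x, f y = g y) ->
  pderiv i f x = pderiv i g x.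
Proof.
move=> Hx fg; have fgx : f x = g x.
  by move: fg; rewrite /hnbhs near_withinE => /nbhs_singleton; apply.
have h : {near diffquot_nbhs i x, diffquot f i x =1 diffquot g i x}.
  have := diffquot_to i Hx fg; rewrite /shiftc /diffquot => h.
  by near=> t; rewrite fgx; have -> : f (x + t *: 'e_i) = g (x + t *: 'e_i) by near: t.
have h' : {near diffquot_nbhs i x, diffquot g i x =1 diffquot f i x}.
  by near=> t; symmetry; near: t.
by rewrite /pderiv; congr (lim _); apply/seteqP; split; apply: near_eq_cvg.
Unshelve. all: by end_near. Qed.

Lemma pderiv_eq V f g x i : ropen V -> V x -> (forall y, V y -> f y = g y) ->
  pderiv i f x = pderiv i g x.
Proof.
move=> rV Vx fg; apply: pderiv_near; first exact: ropenH rV Vx.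
by near=> y; apply: fg; near: y; exact: ropen_near.
Unshelve. all: by end_near. Qed.

(** A tangential difference quotient at a boundary point stays in the boundary. This serves for the
    outer normal, whose transformation law is known only there. *)
Lemma pderiv_bdry f g x i : H x -> i != ord_max -> x 0 ord_max = 0 ->
  (\forall y \near hnbhs x, (y : 'rV[R]_n.+1) 0 ord_max = 0 -> f y = g y) -> pderiv i f x = pderiv i g x.
Proof.
move=> Hx im xm fg; have PF := diffquot_proper i Hx.
have Hs h : shiftc x i h 0 ord_max = 0 by rewrite shiftcE eq_sym (negbTE im) mulr0 addr0 xm.
have fgx : f x = g x.
  by move: fg; rewrite /hnbhs near_withinE => /nbhs_singleton; apply.
have h : {near diffquot_nbhs i x, diffquot f i x =1 diffquot g i x}.
  have h := diffquot_to i Hx fg.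
  near=> t; have : shiftc x i t 0 ord_max = 0 -> f (shiftc x i t) = g (shiftc x i t) by near: t.
  by move=> /(_ (Hs t)); rewrite /diffquot -/(shiftc x i t) fgx => ->.
have h' : {near diffquot_nbhs i x, diffquot g i x =1 diffquot f i x}.
  by near=> t; symmetry; near: t.
by rewrite /pderiv; congr (lim _); apply/seteqP; split; apply: near_eq_cvg.
Unshelve. all: by end_near. Qed.

Lemma hdiff_uniq f x (d e : 'rV[R]_n.+1) : H x -> hdiff f x d -> hdiff f x e -> d = e.
Proof.
by move=> Hx hd he; apply/rowP => i; rewrite -(hdiff_pderiv i Hx hd) (hdiff_pderiv i Hx he).
Qed.

Lemma hdiff_grad f x (d : 'rV[R]_n.+1) : H x -> hdiff f x d -> grad f x = d.
Proof. by move=> Hx hd; apply/rowP => i; rewrite mxE (hdiff_pderiv i Hx hd). Qed.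

Lemma hdiff_comp m (T : 'rV[R]_n.+1 -> 'rV[R]_m.+1) (f : 'rV[R]_m.+1 -> R) x
    (d : 'rV[R]_m.+1) (P : 'M[R]_(n.+1, m.+1)) :
  (\forall y \near hnbhs x, half_space (T y)) ->
  (forall j, hdiff (fun y => T y 0 j) x (\row_i P i j)) ->
  hdiff f (T x) d ->
  hdiff (fun y => f (T y)) x (\row_i \sum_j P i j * d 0 j).
Proof.
move=> HT hT [p [fE pc]].
have Tc : T @ hnbhs x --> hnbhs (T x).
  move=> A; rewrite /hnbhs /within /= => /nbhs_ballP[e /= e0 hA].
  have : \forall y \near hnbhs x, half_space (T y) /\ forall j, `|T x 0 j - T y 0 j| < e.
    apply: filterI => //.
    apply: (@filter_forall _ _ (fun j y => `|T x 0 j - T y 0 j| < e) (hnbhs x)) => j.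
    by apply: (hcont_dist (f := fun y => T y 0 j)) => //; exact: hdiff_hcont (hT j).
  apply: filterS => y [Hy yj]; apply: hA => //.
  by split=> // a j; rewrite ord1; exact: yj.
pose q j := projT1 (cid (hT j)).
have qE : \forall y \near hnbhs x, forall j, T y 0 j = T x 0 j + \sum_i (y - x) 0 i * q j y 0 i.
  apply: (@filter_forall _ _ (fun j y => T y 0 j = T x 0 j + \sum_i (y - x) 0 i * q j y 0 i) (hnbhs x)) => j.
  by rewrite /q; case: cid => ? [].
have qc j i : q j y 0 i @[y --> hnbhs x] --> P i j.
  by rewrite /q; case: cid => z /= [_ /(_ i)]; rewrite mxE.
exists (fun y => \row_i \sum_j q j y 0 i * p (T y) 0 j); split; last first.
  move=> i; rewrite mxE; under eq_fun do rewrite mxE.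
  apply: cvg_rsum => j _; apply: cvgM; first exact: qc.
  exact: cvg_comp Tc (pc j).
near=> y.
have -> : f (T y) = f (T x) + \sum_i (T y - T x) 0 i * p (T y) 0 i.
  by near: y; exact: (Tc _ fE).
congr (_ + _); under [RHS]eq_bigr do rewrite [X in _ * X]mxE mulr_sumr.
rewrite exchange_big/=; apply: eq_bigr => j _.
have -> : (T y - T x) 0 j = \sum_i (y - x) 0 i * q j y 0 i.
  rewrite [LHS]mxE [X in _ + X]mxE; apply/eqP; rewrite subr_eq addrC; apply/eqP.
  by move: j; near: y.
by rewrite mulr_suml; apply: eq_bigr => i _; rewrite mulrA.
Unshelve. all: by end_near. Qed.

End Smooth2.

(* Otherwise unification unfolds iterated derivatives down to limits of filters. *)
#[local] Opaque pderiv smooth_on.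

(** * Symmetry of mixed partial derivatives, up to the boundary *)

Section Schwarz.
Context (R : realType) (n : nat).
Implicit Types (V U : set 'rV[R]_n.+1) (x y : 'rV[R]_n.+1) (f g : 'rV[R]_n.+1 -> R).
Local Notation H := (@half_space R n).

Lemma ball_rVE x e y : 0 < e -> ball x e y <-> forall j, `|x 0 j - y 0 j| < e.
Proof.
move=> e0; split; first by move=> [_ h] j; exact: h.
by move=> h; split=> // a j; rewrite ord1; exact: h.
Qed.

Lemma ropen_ball x e : ropen (ball x e `&` H).
Proof. by exists (ball x e) => //; exact: ball_open. Qed.

Lemma shiftcP x i h : H x -> 0 <= h -> H (shiftc x i h).
Proof. by rewrite /half_space /= shiftcE => Hx h0; rewrite addr_ge0// mulr_ge0. Qed.

Lemma shiftc_dist x y i h a b : (forall j, `|x 0 j - y 0 j| <= a) -> `|h| <= b ->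
  forall j, `|x 0 j - shiftc y i h 0 j| <= a + b.
Proof.
move=> xy hb j; rewrite shiftcE opprD addrA (le_trans (ler_normB _ _))// lerD//.
by rewrite normrM (le_trans _ hb)// ler_piMr//; case: (_ == _); rewrite ?normr1 ?normr0.
Qed.

Lemma hdiff_shiftc f x i h (d : 'rV[R]_n.+1) : H x -> 0 <= h -> hdiff f (shiftc x i h) d ->
  hdiff (fun y => f (shiftc y i h)) x d.
Proof.
move=> Hx h0 hf.
have := @hdiff_comp R n n (fun y => shiftc y i h) f x d 1%:M _ _ hf.
have -> : \row_i0 \sum_j (1%:M : 'M[R]_n.+1) i0 j * d 0 j = d.
  apply/rowP => k; rewrite mxE (bigD1 k)//= big1 => [|j jk]; rewrite mxE ?eqxx ?mul1r ?addr0//.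
  by rewrite eq_sym (negbTE jk) mul0r.
apply.
  by rewrite /hnbhs near_withinE; near=> y => Hy; exact: shiftcP.
move=> j; rewrite (_ : \row_i0 _ = delta_mx 0 j + 0); last first.
  by apply/rowP => k; rewrite !mxE eqxx addr0.
rewrite (_ : (fun _ => _) = (fun y => y 0 j + h * (j == i)%:R)); last by apply/funext=> y; rewrite shiftcE.
by apply: hdiffD; [exact: hdiff_coord|exact: hdiff_cst].
Unshelve. all: by end_near. Qed.

(** The mean value theorem is applied to the increment of [f] in direction [j], then to
    [pderiv i f]. Positive steps keep the square in the half-space, and [h * 3 < d] keeps it, with
    the intermediate points, in the ball. *)
Lemma mixed_difference V f x i j h d : ropen V -> smooth_on V f -> H x ->
  ball x d `&` H `<=` V -> 0 < h -> h * 3 < d ->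
  exists y, [/\ H y, ball x d y &
   f (shiftc (shiftc x i h) j h) - f (shiftc x i h) - f (shiftc x j h) + f x
    = h ^+ 2 * pderiv j (pderiv i f) y].
Proof.
move=> rV sf Hx bV h0 hd; have d0 : 0 < d by rewrite (le_lt_trans _ hd)// mulr_ge0// ltW.
pose g y := f (shiftc y j h) - f y.
pose U := ball x (h * 2) `&` H; have rU : ropen U by exact: ropen_ball.
have h20 : 0 < h * 2 by rewrite mulr_gt0.
have inV y a : H y -> a <= h * 2 + h -> (forall k, `|x 0 k - y 0 k| <= a) -> V y.
  move=> Hy ah xy; apply: bV; split=> //; apply/(ball_rVE _ _ d0) => k.
  by apply: le_lt_trans (xy k) _; lra.
have hg y : U y -> hdiff g y (grad f (shiftc y j h) - grad f y).
  move=> [/(ball_rVE _ _ h20) yx Hy]; apply: hdiffB.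
    apply: hdiff_shiftc => //; first exact: ltW.
    apply: (smooth_hdiff rV) => //; apply: (inV _ (h * 2 + h)) => //.
      by apply: shiftcP => //; exact: ltW.
    by apply: shiftc_dist => [k|]; [exact: ltW|rewrite gtr0_norm].
  apply: (smooth_hdiff rV) => //; apply: (inV _ (h * 2)) => //; first by lra.
  by move=> k; exact: ltW.
have xx k : `|x 0 k - x 0 k| <= 0 by rewrite subrr normr0.
have [] := @mvt_line R n U g x i h rU _ _ _ Hx.
- by move=> y Uy; apply/cvg_ex; eexists; apply: hdiff_pd (hg y Uy); exact: ropenH rU Uy.
- by move=> y Uy; apply: hdiff_hcont (hg y Uy).
- move=> t th Ht; split=> //; apply/(ball_rVE _ _ h20) => k.
  apply: (@le_lt_trans _ _ (0 + h)); last by lra.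
  by apply: shiftc_dist => //; rewrite (gtr0_norm h0) in th.
- by apply: shiftcP => //; exact: ltW.
move=> s [sh Us]; rewrite (hdiff_pderiv i (ropenH rU Us) (hg _ Us)).
rewrite (gtr0_norm h0) in sh.
rewrite 2!mxE; set x' := shiftc x i s.
have xx' k : `|x 0 k - x' 0 k| <= h by rewrite -[h]add0r; exact: shiftc_dist.
have Hx' : H x' := ropenH rU Us.
have sfi := smooth_pderiv rV i sf.
have [] := @mvt_line R n V (pderiv i f) x' j h rV _ _ _ Hx'.
- by move=> y Vy; apply/cvg_ex; eexists; apply: hdiff_pd (smooth_hdiff rV Vy sfi); exact: ropenH rV Vy.
- by move=> y Vy; apply: (smooth_hcont rV).
- move=> t th Ht; apply: (inV _ (h + h)) => //; first by lra.
  by apply: shiftc_dist => //; rewrite (gtr0_norm h0) in th.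
- by apply: shiftcP => //; exact: ltW.
rewrite (gtr0_norm h0) => t [th Vt E1] E2.
exists (shiftc x' j t); split; first exact: ropenH rV Vt.
  apply/(ball_rVE _ _ d0) => k; apply: (@le_lt_trans _ _ (h + h)); last by lra.
  exact: shiftc_dist.
move: E2; rewrite /g /= [in RHS]mxE [grad f x' 0 i]mxE E1 => E2.
transitivity (h * (h * pderiv j (pderiv i f) (shiftc x' j t))); last by ring.
by rewrite -E2; ring.
Qed.

(** The second difference is symmetric in the two directions, so near [x] there are points [y], [z]
    at which the two mixed derivatives take equal values; continuity carries this to [x]. *)
Lemma schwarz V f x i j : ropen V -> smooth_on V f -> V x ->
  pderiv i (pderiv j f) x = pderiv j (pderiv i f) x.
Proof.
move=> rV sf Vx; have Hx := ropenH rV Vx.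
apply/eqP; rewrite -subr_eq0 -normr_le0; apply/ler_addgt0Pl => e e0; rewrite addr0.
have c1 := smooth_hcont rV Vx (smooth_pderiv rV i (smooth_pderiv rV j sf)).
have c2 := smooth_hcont rV Vx (smooth_pderiv rV j (smooth_pderiv rV i sf)).
have e2 : 0 < e / 2 by rewrite divr_gt0.
have : \forall y \near hnbhs x, [/\ V y,
    `|pderiv i (pderiv j f) x - pderiv i (pderiv j f) y| < e / 2 &
    `|pderiv j (pderiv i f) x - pderiv j (pderiv i f) y| < e / 2].
  by apply: filterS3 (ropen_near rV Vx) (hcont_dist c1 e2) (hcont_dist c2 e2) => y.
rewrite /hnbhs near_withinE => /nbhs_ballP[d /= d0 hd].
have bV : ball x d `&` H `<=` V by move=> y [yd Hy]; case: (hd y yd Hy).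
have h0 : 0 < d / 4 by rewrite divr_gt0.
have hd3 : d / 4 * 3 < d by lra.
have [y [Hy yd E1]] := mixed_difference i j rV sf Hx bV h0 hd3.
have [z [Hz zd E2]] := mixed_difference j i rV sf Hx bV h0 hd3.
have [_ hz _] := hd z zd Hz.
have [_ _ hy] := hd y yd Hy.
have E : pderiv j (pderiv i f) y = pderiv i (pderiv j f) z.
  apply: (mulfI (lt0r_neq0 (exprn_gt0 2 h0))).
  have e3 : shiftc (shiftc x j (d / 4)) i (d / 4) = shiftc (shiftc x i (d / 4)) j (d / 4).
    by rewrite /shiftc addrAC.
  apply: etrans (esym E1) (etrans _ E2); rewrite e3.
  by rewrite [X in X + _ = _]addrAC.
set A := pderiv i (pderiv j f) x in hz *; set B := pderiv j (pderiv i f) x in hy *.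
rewrite E in hy; set C := pderiv i (pderiv j f) z in hz hy *.
rewrite (_ : A - B = (A - C) - (B - C)); last by ring.
by rewrite [e]splitr; exact: le_trans (ler_normB _ _) (lerD (ltW hz) (ltW hy)).
Unshelve. all: by end_near. Qed.

End Schwarz.

(** * Charts and Borel measures *)

Section BorelSets.
Context (R : realType) (X : ptopologicalType).

Lemma borel_open (U : set X) : open U -> measurable (U : set (borel X)).
Proof. by move=> oU; exact: sub_sigma_algebra. Qed.

Lemma borel_closed (U : set X) : closed U -> measurable (U : set (borel X)).
Proof. by move=> cU; rewrite -(setCK U); apply: measurableC; apply: borel_open; exact: closed_openC. Qed.

Lemma within_continuous_measurable (D : set (borel X)) (f : borel X -> R) :
  measurable D -> {within (D : set X), continuous (f : X -> R)} -> measurable_fun D f.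
Proof.
move=> mD /continuousP cf; apply: (measurability _ (RGenOpens.measurableE R)).
move=> _ [_ [a [b ->] <-]].
have oI : open (`]a, b[%classic : set R) by exact: interval_open.
have /open_subspaceP[U oU UE] := cf _ oI.
rewrite setIC -UE setIC; apply: measurableI => //; exact: borel_open.
Qed.

End BorelSets.

(** * Measurability on the coordinate plane *)

Section PlaneMeas.
Context (R : realType).
Notation plane := (R * R)%type.

Lemma plane_pt_continuous : continuous (@plane_pt R).
Proof.
move=> z A /nbhs_ballP[e /= e0 hA]; apply/nbhs_ballP; exists e => //= y zy.
apply: hA; split=> // i j; rewrite !mxE; case: ifP => _; by case: zy.
Qed.

(** The product sigma-algebra contains an open set because it is a countable union of rectangles
    with rational corners. *)
Lemma plane_open_measurable (U : set plane) : open U -> measurable U.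
Proof.
move=> oU.
pose I (q : rat * rat * (rat * rat)) : set plane :=
  `]ratr q.1.1, ratr q.1.2[%classic `*` `]ratr q.2.1, ratr q.2.2[%classic.
have -> : U = \bigcup_(q in [set q | I q `<=` U]) I q.
  apply/seteqP; split=> [z Uz|z [q qU] /qU//].
  have /nbhs_ballP[e /= e0 hU] := open_nbhs_nbhs (conj oU Uz).
  have rin (x : R) : exists q : rat * rat, [/\ ratr q.1 < x, x < ratr q.2, x - e < ratr q.1 & ratr q.2 < x + e].
    have h1 : x - e < x by rewrite ltrBlDr ltrDl.
    have h2 : x < x + e by rewrite ltrDl.
    have [a /[!in_itv]/= /andP[a1 a2]] := rat_in_itvoo h1.
    have [b /[!in_itv]/= /andP[b1 b2]] := rat_in_itvoo h2.
    by exists (a, b).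
  have [q1 [a1 a2 a3 a4]] := rin z.1; have [q2 [b1 b2 b3 b4]] := rin z.2.
  exists (q1, q2); last by split; rewrite /= in_itv/= ?a1 ?a2 ?b1 ?b2.
  move=> y [] /=; rewrite !in_itv/= => /andP[y1 y2] /andP[y3 y4]; apply: hU.
  split; rewrite /ball/= distrC ltr_distl; apply/andP; split.
  - exact: lt_trans a3 y1.
  - exact: lt_trans y2 a4.
  - exact: lt_trans b3 y3.
  - exact: lt_trans y4 b4.
rewrite bigcup_mkcond; apply: countable_bigcupT_measurable => [|q]; first exact: countableP.
case: ifP => _ //.
by apply: measurableX; exact: measurable_itv.
Qed.

Lemma plane_preimage_measurable (V : set 'rV[R]_2) : ropen V ->
  measurable [set z : plane | V (plane_pt z)].
Proof.
move=> [W oW ->].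
have -> : [set z : plane | (W `&` @half_space R 1) (plane_pt z)] =
   (@plane_pt R) @^-1` W `&` (setT `*` `[0, +oo[%classic).
  apply/seteqP; split=> z [Wz]; rewrite /half_space/= ?mxE/= ?in_itv/= ?andbT.
    by move=> h; split=> //; split=> //=; rewrite in_itv/= andbT.
  by case=> _ /= h; split.
apply: measurableI; last by apply: measurableX => //; exact: measurable_itv.
apply: plane_open_measurable; apply: open_comp => // z _; exact: plane_pt_continuous.
Qed.

Lemma plane_hcont_measurable (X : topologicalType) (V : set 'rV[R]_2) (f : 'rV[R]_2 -> X) (O : set X) :
  ropen V -> (forall x, V x -> hcont f x) -> open O ->
  measurable [set z : plane | V (plane_pt z) /\ O (f (plane_pt z))].
Proof.
move=> rV cf oO.
apply: (@plane_preimage_measurable [set x | V x /\ O (f x)]).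
have /within_contP := rV; move=> /(_ _ f)[_ /(_ cf)/continuousP/(_ O oO)/open_subspaceP[U oU UE]].
have [W oW VE] := rV.
exists (U `&` W); first exact: openI.
rewrite -setIA -VE UE; apply/seteqP; split=> x [].
  by move=> Vx Ox; split.
by move=> Ox Vx; split.
Qed.

Lemma plane_hcont_measurable_fun (V : set 'rV[R]_2) (f : 'rV[R]_2 -> R) :
  ropen V -> (forall x, V x -> hcont f x) ->
  measurable_fun [set z : plane | V (plane_pt z)] (f \o @plane_pt R).
Proof.
move=> rV cf; apply: (measurability _ (RGenOpens.measurableE R)).
move=> _ [_ [a [b ->] <-]].
have oI : open (`]a, b[%classic : set R) by exact: interval_open.
exact: (plane_hcont_measurable rV cf oI).
Qed.

End PlaneMeas.

(** * Transfer of integrals along a parametrization with a density *)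

Section Transfer.
Local Open Scope ereal_scope.
Context d1 d2 (T1 : measurableType d1) (T2 : measurableType d2) (R : realType).
Context (m1 : {measure set T1 -> \bar R}) (m2 : {measure set T2 -> \bar R}).
Context (D1 : set T1) (D2 : set T2) (h : T2 -> T1) (w : T2 -> R).
Hypotheses (mD1 : measurable D1) (mD2 : measurable D2).
Hypotheses (mh : measurable_fun D2 h) (hD : forall z, D2 z -> D1 (h z)).
Hypotheses (mw : measurable_fun D2 w) (w0 : forall z, D2 z -> (0 <= w z)%R).
Hypothesis m12 : forall B, measurable B -> B `<=` D1 ->
  m1 B = \int[m2]_(z in D2 `&` h @^-1` B) (w z)%:E.

Import HBNNSimple.

Lemma transfer_nnsfun (g : {nnsfun T1 >-> R}) :
  \int[m1]_(x in D1) (g x)%:E = \int[m2]_(z in D2) ((g (h z))%:E * (w z)%:E).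
Proof using mD1 mD2 mh hD mw w0 m12.
under eq_integral do rewrite fimfunE -fsumEFin//.
rewrite ge0_integral_fsum//; last 2 first.
- by move=> y; apply/measurable_EFinP; exact: measurable_funM.
- by move=> y x _; exact: nnfun_muleindic_ge0.
have mgh (y : R) : measurable_fun D2 (fun z => \1_(g @^-1` [set y]) (h z) : R).
  apply: (@measurable_comp _ _ _ _ _ _ setT) => //.
transitivity (\int[m2]_(z in D2) \sum_(y \in range g) ((y * \1_(g @^-1` [set y]) (h z))%:E * (w z)%:E)).
  rewrite ge0_integral_fsum//; last 2 first.
  - move=> y; apply: emeasurable_funM; apply/measurable_EFinP => //.
    exact: measurable_funM.
  - move=> y z Dz; rewrite mule_ge0 ?lee_fin ?w0//; exact: nnfun_muleindic_ge0.
  apply: eq_fsbigr => y /[!inE] -[x _ gx].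
  have y0 : (0 <= y)%R by rewrite -gx.
  under eq_integral do rewrite EFinM.
  rewrite ge0_integralZl//; last first.
    by apply/measurable_EFinP; exact: measurable_indic.
  under [RHS]eq_integral do rewrite EFinM -muleA.
  rewrite ge0_integralZl//; last first.
  - by move=> z Dz; rewrite mule_ge0// lee_fin w0.
  - by apply: emeasurable_funM; apply/measurable_EFinP.
  congr (_ * _).
  have mA : measurable (g @^-1` [set y]) by [].
  rewrite integral_indic// setIC m12; [|exact: measurableI|by move=> ? []].
  have -> : D2 `&` h @^-1` (D1 `&` g @^-1` [set y]) = D2 `&` h @^-1` (g @^-1` [set y]).
    apply/seteqP; split=> z [Dz]; first by case.
    by move=> gz; split=> //; split=> //; exact: hD.
  rewrite integral_mkcondr; apply: eq_integral => z _.
  rewrite /patch /= !indicE; case: (boolP (z \in _)) => zA.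
    have -> : h z \in g @^-1` [set y] by move: zA; rewrite !inE.
    by rewrite mul1e.
  have -> : h z \in g @^-1` [set y] = false.
    by apply/negbTE; apply: contra zA; rewrite !inE.
  by rewrite mul0e.
apply: eq_integral => z _; rewrite [in RHS]fimfunE -fsumEFin// ge0_mule_fsuml//.
by move=> y; exact: nnfun_muleindic_ge0.
Qed.

(** Hypothesis [m12] is the case of indicator functions; linearity gives simple functions, and
    monotone convergence the rest. *)
Lemma ge0_transfer (g : T1 -> \bar R) : measurable_fun D1 g ->
  (forall x, D1 x -> 0 <= g x) ->
  \int[m1]_(x in D1) g x = \int[m2]_(z in D2) (g (h z) * (w z)%:E).
Proof using mD1 mD2 mh hD mw w0 m12.
move=> mg g0.
have [f [ndf cf]] := approximation mD1 mg g0.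
transitivity (limn (fun n => \int[m1]_(x in D1) (f n x)%:E)).
  rewrite -monotone_convergence//.
  - apply: eq_integral => x /[!inE] Dx; apply/esym/cvg_lim => //; exact: cf.
  - by move=> n; apply/measurable_EFinP; exact: measurable_funTS.
  - by move=> n x _; rewrite lee_fin.
  - by move=> x _ a b ab; rewrite lee_fin; move/ndf: ab => /lefP.
under eq_fun do rewrite transfer_nnsfun.
rewrite -monotone_convergence//.
- apply: eq_integral => z /[!inE] Dz; apply/cvg_lim => //.
  apply: cvgeZr => //; exact: cf (hD Dz).
- move=> n; apply: emeasurable_funM; apply/measurable_EFinP => //.
  exact: (@measurable_comp _ _ _ _ _ _ setT).
- by move=> n z Dz; rewrite mule_ge0 ?lee_fin ?w0.
- move=> z Dz a b ab; rewrite lee_wpmul2r ?lee_fin ?w0//.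
  by move/ndf: ab => /lefP; apply.
Qed.

End Transfer.

(** The sign [s] picks a direction that can be followed inside the half-space. With both signs the
    derivative vanishes; at a boundary point and for the last coordinate only the inward sign is
    available. This is what tells boundary points from interior ones. *)
Lemma hdiff_min (R : realType) n (f : 'rV[R]_n.+1 -> R) x (g : 'rV[R]_n.+1) i s :
  half_space x -> hdiff f x g -> (\forall y \near hnbhs x, f x <= f y) ->
  `|s| = 1 -> (exists2 e, 0 < e & forall h, 0 < h < e -> half_space (shiftc x i (s * h))) ->
  0 <= s * g 0 i.
Proof.
move=> Hx hf fmin s1 [e e0 he]; rewrite leNgt; apply/negP => sg.
have g0 : 0 < `|g 0 i| by rewrite normr_gt0; apply: contraTneq sg => ->; rewrite mulr0 ltxx.
have h1 := diffquot_to i Hx fmin.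
have /cvgrPdist_lt/(_ _ g0) h2 := hdiff_pd (i := i) Hx hf.
have : \forall h \near diffquot_nbhs i x, f x <= f (shiftc x i h) /\ `|g 0 i - diffquot f i x h| < `|g 0 i|.
  exact: filterI.
rewrite /diffquot_nbhs /within/= => /nbhs_ballP[d /= d0 hd].
pose t := Num.min e d / 2.
have m0 : 0 < Num.min e d by rewrite lt_min e0.
have t0 : 0 < t by rewrite divr_gt0.
have tm : t < Num.min e d by rewrite ltr_pdivrMr// mulr_natr mulr2n ltrDl.
have [te td] : t < e /\ t < d by move: tm; rewrite lt_min => /andP.
have s0 : s != 0 by rewrite -normr_eq0 s1 oner_eq0.
have := hd (s * t); rewrite /ball/= sub0r normrN normrM s1 mul1r gtr0_norm// => /(_ td).
have st0 : s * t != 0 by rewrite mulf_neq0// gt_eqF.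
move=> /(_ st0).
have /he Hst : 0 < t < e by rewrite t0.
move=> /(_ Hst) [fle]; rewrite /diffquot -/(shiftc x i (s * t)).
set D := f _ - f _ => h.
have D0 : 0 <= D by rewrite subr_ge0.
have ss : s * s = 1.
  by rewrite -expr2 -real_normK ?num_real// s1 expr1n.
have sV : (s * t)^-1 = s * t^-1.
  by apply: (mulfI st0); rewrite divff// mulrACA ss divff ?(lt0r_neq0 t0)// mulr1.
move: h; rewrite sV -[`|g 0 i|]mul1r -s1 -normrM -[`|g 0 i - _|]mul1r -{1}s1 -normrM.
rewrite (ltr0_norm sg) mulrBr mulrA mulrA ss mul1r ltr_norml opprK => /andP[+ _].
have : 0 <= t^-1 * D by rewrite mulr_ge0// invr_ge0 ltW.
by move: (t^-1 * D) (s * g 0 i) sg => a b; lra.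
Qed.

(** * Charts, changes of coordinates and boundary points *)

Section Charts.
Context (R : realType) (n : nat) (X : manifold R n).
Local Notation H := (@half_space R n).
Implicit Types (c d : chart R X n) (p : X).

Lemma cdom_open c : atlas X c -> open (cdom c).
Proof. by move=> /mf_chart[]. Qed.

Lemma cimg_ropen c : atlas X c -> ropen (cimg c).
Proof. by move=> /mf_chart[]. Qed.

Lemma cinvK c p : atlas X c -> cdom c p -> cinv c (cmap c p) = p.
Proof. by move=> /mf_chart[_ _ + _ _]; apply. Qed.

Lemma cinv_dom c x : atlas X c -> cimg c x -> cdom c (cinv c x).
Proof. by move=> ac [p cp <-]; rewrite cinvK. Qed.

Lemma cmapK c x : atlas X c -> cimg c x -> cmap c (cinv c x) = x.
Proof. by move=> ac [p cp <-]; rewrite cinvK. Qed.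

Lemma cmap_img c p : cdom c p -> cimg c (cmap c p).
Proof. by move=> cp; exists p. Qed.

Lemma cmap_half c p : atlas X c -> cdom c p -> H (cmap c p).
Proof. by move=> ac cp; apply: (ropenH (cimg_ropen ac)); exists p. Qed.

Lemma cinv_hcont c x : atlas X c -> cimg c x -> hcont (cinv c) x.
Proof.
move=> ac; have [_ _ _ _ cc] := mf_chart ac.
by move: cc => /(within_contP _ (cimg_ropen ac)); apply.
Qed.

Lemma cmap_cont c p : atlas X c -> cdom c p -> cmap c q @[q --> p] --> cmap c p.
Proof.
move=> ac cp; have [oc _ _ cc _] := mf_chart ac.
move: cc; rewrite continuous_open_subspace// => /(_ p); apply.
by rewrite inE.
Qed.

Lemma cmap_hcvg c p : atlas X c -> cdom c p -> cmap c q @[q --> p] --> hnbhs (cmap c p).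
Proof.
move=> ac cp A; rewrite /hnbhs /within /= => hA.
have h1 := cmap_cont ac cp hA.
have h2 : \forall q \near p, cdom c q by apply: open_nbhs_nbhs; split=> //; exact: cdom_open.
have : \forall q \near p, A (cmap c q).
  near=> q; have : H (cmap c q) by apply: cmap_half => //; near: q.
  by near: q.
by [].
Unshelve. all: by end_near. Qed.

Lemma preimage_open c (W : set 'rV[R]_n.+1) : atlas X c -> open W ->
  open [set p | cdom c p /\ W (cmap c p)].
Proof.
move=> ac oW; rewrite openE => p [cp Wp].
have h1 : \forall q \near p, W (cmap c q) by apply: (cmap_cont ac cp); exact: open_nbhs_nbhs.
have h2 : \forall q \near p, cdom c q by apply: open_nbhs_nbhs; split=> //; exact: cdom_open.
rewrite /interior; near=> q; split; near: q => //.
Unshelve. all: by end_near. Qed.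

Lemma image_ropen c (U : set X) : atlas X c -> open U ->
  ropen (cmap c @` (cdom c `&` U)).
Proof.
move=> ac oU; have [_ [W oW WE] _ _ /continuousP/(_ U oU)/open_subspaceP[Z oZ ZE]] := mf_chart ac.
exists (Z `&` W); first exact: openI.
rewrite -setIA -WE ZE; apply/seteqP; split=> [_ [p [cp Up] <-]|x [Ux [p cp px]]].
  by split; [rewrite /from_subspace /preimage/= cinvK|exists p].
by exists p => //; split=> //; move: Ux; rewrite /from_subspace /preimage/= -px cinvK.
Qed.

Definition trans c d x := cmap d (cinv c x).
Definition tdom c d := cmap c @` (cdom c `&` cdom d).

Lemma tdom_ropen c d : atlas X c -> atlas X d -> ropen (tdom c d).
Proof. by move=> ac ad; apply: image_ropen => //; exact: cdom_open. Qed.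

Lemma tdomP c d p : cdom c p -> cdom d p -> tdom c d (cmap c p).
Proof. by move=> cp dp; exists p. Qed.

Lemma trans_cmap c d p : atlas X c -> cdom c p -> trans c d (cmap c p) = cmap d p.
Proof. by move=> ac cp; rewrite /trans cinvK. Qed.

Lemma trans_smooth c d j : atlas X c -> atlas X d -> smooth_on (tdom c d) (fun x => trans c d x 0 j).
Proof. by move=> ac ad; exact: (mf_compat ac ad). Qed.

Lemma trans_tdom c d x : atlas X c -> tdom c d x -> tdom d c (trans c d x).
Proof. by move=> ac [p [cp dp] <-]; rewrite trans_cmap//; exists p. Qed.

Definition tjac c d p := jac (trans c d) (cmap c p).

Lemma to_prefE c p : to_pref c p = tjac c (chart_at p) p.
Proof. by []. Qed.

Lemma from_prefE c p : from_pref c p = tjac (chart_at p) c p.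
Proof. by []. Qed.

Lemma trans_half_near c d p : atlas X c -> atlas X d -> cdom c p -> cdom d p ->
  \forall x \near hnbhs (cmap c p), H (trans c d x).
Proof.
move=> ac ad cp dp; have : \forall x \near hnbhs (cmap c p), tdom c d x.
  by apply: ropen_near; [exact: tdom_ropen|exact: tdomP].
by apply: filterS => x [q [cq dq] <-]; rewrite trans_cmap//; exact: cmap_half.
Qed.

Lemma trans_hdiff c d p j : atlas X c -> atlas X d -> cdom c p -> cdom d p ->
  hdiff (fun x => trans c d x 0 j) (cmap c p) (\row_i tjac c d p i j).
Proof.
move=> ac ad cp dp.
rewrite (_ : \row_i _ = grad (fun x => trans c d x 0 j) (cmap c p)); last first.
  by apply/rowP => i; rewrite !mxE.
by apply: (smooth_hdiff (tdom_ropen ac ad)); [exact: tdomP|exact: trans_smooth].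
Qed.

Lemma hdiff_trans c d p (f : 'rV[R]_n.+1 -> R) (g : 'rV[R]_n.+1) :
  atlas X c -> atlas X d -> cdom c p -> cdom d p ->
  hdiff f (cmap d p) g ->
  hdiff (f \o trans c d) (cmap c p) (g *m (tjac c d p)^T).
Proof.
move=> ac ad cp dp hf.
have -> : g *m (tjac c d p)^T = \row_i \sum_j tjac c d p i j * g 0 j.
  by apply/rowP => i; rewrite !mxE; apply: eq_bigr => j _; rewrite mxE mulrC.
apply: hdiff_comp; [exact: trans_half_near|by move=> j; exact: trans_hdiff|].
by rewrite trans_cmap.
Qed.

Lemma tjac_comp c d e p : atlas X c -> atlas X d -> atlas X e ->
  cdom c p -> cdom d p -> cdom e p -> tjac c e p = tjac c d p *m tjac d e p.
Proof.
move=> ac ad ae cp dp ep; apply/matrixP => i j.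
have h1 := hdiff_trans ac ad cp dp (trans_hdiff j ad ae dp ep).
have h2 := trans_hdiff j ac ae cp ep.
have : hdiff (fun x => trans c e x 0 j) (cmap c p) (\row_i tjac d e p i j *m (tjac c d p)^T).
  apply: hdiff_near_eq h1; first exact: cmap_half.
  have : \forall x \near hnbhs (cmap c p), tdom c d x.
    by apply: ropen_near; [exact: tdom_ropen|exact: tdomP].
  apply: filterS => x [q [cq dq] <-] /=; by rewrite trans_cmap// /trans !cinvK.
move=> /(hdiff_uniq (cmap_half ac cp) h2)/rowP/(_ i); rewrite !mxE => ->.
by apply: eq_bigr => k _; rewrite !mxE mulrC.
Qed.

Lemma tjac_id c p : atlas X c -> cdom c p -> tjac c c p = 1%:M.
Proof.
move=> ac cp; apply/matrixP => i j.
have h : hdiff (fun x => trans c c x 0 j) (cmap c p) (delta_mx 0 j).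
  apply: hdiff_near_eq (hdiff_coord j _); first exact: cmap_half.
  have : \forall x \near hnbhs (cmap c p), tdom c c x.
    by apply: ropen_near; [exact: tdom_ropen|exact: tdomP].
  by apply: filterS => x [q [cq dq] <-]; rewrite trans_cmap.
have := hdiff_uniq (cmap_half ac cp) (trans_hdiff j ac ac cp cp) h.
by move=> /rowP/(_ i); rewrite !mxE eqxx /= eq_sym => ->; rewrite eq_sym.
Qed.

Lemma tjacV c d p : atlas X c -> atlas X d -> cdom c p -> cdom d p ->
  tjac c d p *m tjac d c p = 1%:M.
Proof. by move=> ac ad cp dp; rewrite -tjac_comp// tjac_id. Qed.

Lemma tjac_unit c d p : atlas X c -> atlas X d -> cdom c p -> cdom d p ->
  tjac c d p \in unitmx.
Proof. by move=> ac ad cp dp; case: (mulmx1_unit (tjacV ac ad cp dp)). Qed.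

Lemma chart_atlas p : atlas X (chart_at p).
Proof. by case: (mf_chart_at p). Qed.

Lemma chart_dom p : cdom (chart_at p) p.
Proof. by case: (mf_chart_at p). Qed.

(* At a boundary point the last coordinate of an inner point of another chart
   would have an interior minimum, so its differential would vanish. *)
Lemma bdryP c p : atlas X c -> cdom c p -> bdry p <-> cmap c p 0 ord_max = 0.
Proof.
move=> ac cp; split=> [[d [ad dp p0]]|p0]; last by exists c.
apply/eqP; apply: contrapT => /negP c0.
have cpos : 0 < cmap c p 0 ord_max by rewrite lt_def c0; exact: (cmap_half ac cp).
have hT := trans_hdiff ord_max ac ad cp dp.
have ge0 : \forall x \near hnbhs (cmap c p), trans c d (cmap c p) 0 ord_max <= trans c d x 0 ord_max.
  by rewrite trans_cmap// p0; exact: trans_half_near.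
have inner i s : `|s| = 1 -> exists2 e, 0 < e & forall h, 0 < h < e -> H (shiftc (cmap c p) i (s * h)).
  move=> s1; exists (cmap c p 0 ord_max) => // h /andP[h0 hc].
  rewrite /half_space/= shiftcE; have : `|s * h| < cmap c p 0 ord_max by rewrite normrM s1 mul1r gtr0_norm.
  by rewrite ltr_norml => /andP[h1 h2]; case: (_ == _); rewrite ?mulr0 ?mulr1/=; lra.
have g0 i : tjac c d p i ord_max = 0.
  have := hdiff_min (i := i) (cmap_half ac cp) hT ge0 _ (inner i 1 (normr1 _)).
  have := hdiff_min (i := i) (cmap_half ac cp) hT ge0 _ (inner i (-1) (normrN1 _)).
  by rewrite mxE normr1 normrN1 mul1r mulN1r => /(_ erefl) h1 /(_ erefl) h2; apply/eqP; rewrite eq_le h2 -oppr_ge0 h1.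
have : (tjac d c p *m tjac c d p) ord_max ord_max = 0.
  by rewrite mxE big1// => k _; rewrite g0 mulr0.
by rewrite tjacV// mxE eqxx => /eqP; rewrite oner_eq0.
Qed.

Lemma bdry_closed : closed (@bdry R n X).
Proof.
rewrite -openC openE => p pb.
have := cmap_half (chart_atlas p) (chart_dom p); rewrite /half_space/= le_eqVlt => /orP[/eqP p0|p0].
  by exfalso; apply: pb; apply/(bdryP (chart_atlas p) (chart_dom p)).
have : \forall q \near p, 0 < cmap (chart_at p) q 0 ord_max.
  apply: cvgr_gt p0; have := cmap_cont (chart_atlas p) (chart_dom p).
  by move=> h; apply: (@cvg_comp _ _ _ (cmap (chart_at p)) (fun y : 'rV[R]_n.+1 => y 0 ord_max) _ _ _ h); exact: coord_continuous.
have h2 : \forall q \near p, cdom (chart_at p) q.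
  by apply: open_nbhs_nbhs; split; [exact: cdom_open (chart_atlas p)|exact: chart_dom].
move=> h1; rewrite /interior; near=> q.
have cq : cdom (chart_at p) q by near: q.
have q0 : 0 < cmap (chart_at p) q 0 ord_max by near: q.
by move/(bdryP (chart_atlas p) cq) => q00; move: q0; rewrite q00 ltxx.
Unshelve. all: by end_near. Qed.

End Charts.

(** * Smooth functions on manifolds *)

(* e^(-1/t) times a polynomial in 1/t, extended by zero: a class closed under
   derivation, so the flat function is smooth. *)
Section Flat.
Context (R : realType).
Implicit Types (p : {poly R}) (t : R).

Definition flatp p t : R := if 0 < t then p.[t^-1] * expR (- t^-1) else 0.

(** With [s = 1/t] the derivative in [t] of [p(s) exp(-s)] is [s^2 (p(s) - p'(s)) exp(-s)]. *)
Definition flat_step p := ('X^2 * (p - p^`()))%R.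

Definition flat (k : nat) : R -> R := flatp (iter k flat_step 1).

(** The exponent [k] is carried along because removing the constant term of [p] and dividing by the
    variable trades a degree of [p] for a power of [s]. Powers are bounded by the Taylor terms of
    the exponential. *)
Lemma horner_expR_bound p k : exists C, 0 <= C /\ forall s, 0 <= s -> `|p.[s]| * s ^+ k <= C * expR s.
Proof.
have mono m : exists C, 0 <= C /\ forall s : R, 0 <= s -> s ^+ m <= C * expR s.
  case: m => [|m].
    by exists 1; split=> // s s0; rewrite expr0 mul1r -expR0 ler_expR.
  exists (m.+1`!%:R); split=> // s s0.
  have f0 : 0 < m.+1`!%:R :> R by rewrite ltr0n fact_gt0.
  rewrite mulrC -ler_pdivrMr//; apply: le_trans (expR_ge1Dxn m s0).
  by rewrite lerDr.
elim/poly_ind: p k => [|p c ih] k.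
  by exists 0; split=> // s _; rewrite horner0 normr0 !mul0r.
have [C [C0 hC]] := ih k.+1; have [D [D0 hD]] := mono k.
exists (C + `|c| * D); split=> [|s s0]; first by rewrite addr_ge0// mulr_ge0.
rewrite hornerD hornerMX hornerC.
apply: le_trans (_ : _ <= (`|p.[s]| * s + `|c|) * s ^+ k) _.
  rewrite ler_wpM2r ?exprn_ge0// (le_trans (ler_normD _ _))// normrM (ger0_norm s0)//.
rewrite mulrDl -mulrA -exprS mulrDl lerD ?hC// -mulrA ler_wpM2l//.
exact: hD.
Qed.

Lemma flatp_derive0 p : is_derive (0 : R) (1 : R) (flatp p) 0.
Proof.
have [C [C0 hC]] := horner_expR_bound p 2.
suff dl : (fun h : R => h^-1 *: (flatp p (h *: 1 + 0) - flatp p 0)) @ 0^' --> (0 : R).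
  by apply: DeriveDef; [apply/cvg_ex; eexists; exact: dl|exact: cvg_lim dl].
apply/cvgr0Pnorm_lt => e e0.
have d0 : 0 < e / (C + 1) by rewrite divr_gt0// ltr_wpDl.
near=> h; have hd : `|h| < e / (C + 1) by near: h; exact: dnbhs0_lt.
rewrite [_ *: 1]mulr1 addr0 /flatp ltxx subr0; case: ifPn => [h0|_]; last by rewrite scaler0 normr0.
rewrite gtr0_norm// in hd; rewrite [_ *: _]mulrA normrM (ger0_norm (expR_ge0 _)) expRN.
rewrite ltr_pdivrMr ?expR_gt0// normrM (gtr0_norm (_ : 0 < h^-1)) ?invr_gt0//.
have := hC h^-1; rewrite invr_ge0 => /(_ (ltW h0)) h1.
(* Of the two powers provided by the bound, one pays for the difference quotient and the other
   leaves the factor [h]. *)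
have -> : h^-1 * `|p.[h^-1]| = h * (`|p.[h^-1]| * h^-1 ^+ 2) by field; rewrite gt_eqF.
apply: le_lt_trans (_ : _ <= h * (C * expR h^-1)) _; first by rewrite ler_wpM2l// ltW.
rewrite mulrA ltr_pM2r ?expR_gt0//.
move: hd; rewrite ltr_pdivlMr ?ltr_wpDl// mulrDr mulr1 => hd.
by apply: le_lt_trans hd; rewrite lerDl ltW.
Unshelve. all: by end_near. Qed.

Lemma flatp_derive p t : is_derive t (1 : R) (flatp p) (flatp (flat_step p) t).
Proof.
have [t0|t0|->] := ltgtP t 0; last 1 first.
- by rewrite /flatp ltxx; exact: flatp_derive0.
- rewrite {2}/flatp ltNge (ltW t0) /=.
  apply: (near_eq_is_derive (f := fun=> 0)) => //.
  by near=> s; rewrite /flatp ltNge; have -> : s <= 0 by (apply: ltW; near: s; exact: lt_nbhsl).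
rewrite {2}/flatp t0.
suff : is_derive t (1 : R) (fun s : R => p.[s^-1] * expR (- s^-1)) ((flat_step p).[t^-1] * expR (- t^-1)).
  apply: near_eq_is_derive.
  by near=> s; rewrite /flatp; have -> : 0 < s by near: s; exact: lt_nbhsr.
have tn : t != 0 by rewrite gt_eqF.
have hi : is_derive t (1 : R) (fun s : R => s^-1) (- t ^- 2 *: 1) by apply: is_deriveV.
have hp : is_derive t (1 : R) (horner p \o (fun s : R => s^-1)) (p^`().[t^-1] * (- t ^- 2 *: 1)).
  exact: is_derive1_comp.
have he : is_derive t (1 : R) (expR \o (fun s : R => - s^-1)) (expR (- t^-1) * - (- t ^- 2 *: 1)).
  by apply: is_derive1_comp; exact: is_deriveN.
have := is_deriveM hp he.
congr is_derive; rewrite /flat_step !hornerE /= [_ *: 1]mulr1 -![_ *: _]/(_ * _).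
by field.
Unshelve. all: by end_near. Qed.

Lemma flat_derive k t : is_derive t (1 : R) (flat k) (flat k.+1 t).
Proof. exact: flatp_derive. Qed.

Lemma flat_gt0 t : 0 < t -> 0 < flat 0 t.
Proof. by move=> t0; rewrite /flat /flatp /= t0 hornerC mul1r expR_gt0. Qed.

Lemma flat_eq0 t : t <= 0 -> flat 0 t = 0.
Proof. by move=> t0; rewrite /flat /flatp ltNge t0. Qed.

Lemma flat_ge0 t : 0 <= flat 0 t.
Proof. by have [/flat_eq0->//|/flat_gt0/ltW] := leP t 0. Qed.

End Flat.

Section SmoothFun.
Context (R : realType) (n : nat) (X : manifold R n).
Implicit Types (u v : X -> R) (c d : chart R X n) (p : X) (K : set X).

Lemma smooth_fun_cst a : smooth_fun (fun _ : X => a).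
Proof. by move=> c ac; apply: smooth_cst; exact: cimg_ropen. Qed.

Lemma smooth_funD u v : smooth_fun u -> smooth_fun v -> smooth_fun (fun p => u p + v p).
Proof. by move=> su sv c ac; apply: smoothD; [exact: cimg_ropen|exact: su|exact: sv]. Qed.

Lemma smooth_funM u v : smooth_fun u -> smooth_fun v -> smooth_fun (fun p => u p * v p).
Proof. by move=> su sv c ac; apply: smoothM; [exact: cimg_ropen|exact: su|exact: sv]. Qed.

Lemma smooth_funZ a u : smooth_fun u -> smooth_fun (fun p => a * u p).
Proof. by move=> su; apply: smooth_funM => //; exact: smooth_fun_cst. Qed.

Lemma smooth_funB u v : smooth_fun u -> smooth_fun v -> smooth_fun (fun p => u p - v p).
Proof. by move=> su sv c ac; apply: smoothB; [exact: cimg_ropen|exact: su|exact: sv]. Qed.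

Lemma smooth_funV u : (forall p, u p != 0) -> smooth_fun u -> smooth_fun (fun p => (u p)^-1).
Proof. by move=> u0 su c ac; apply: smoothV; [exact: cimg_ropen|move=> x _; exact: u0|exact: su]. Qed.

Lemma smooth_fun_sqrt u : (forall p, 0 < u p) -> smooth_fun u -> smooth_fun (fun p => Num.sqrt (u p)).
Proof. by move=> u0 su c ac; apply: smooth_sqrt; [exact: cimg_ropen|move=> x _; exact: u0|exact: su]. Qed.

Lemma smooth_fun_flat u : smooth_fun u -> smooth_fun (fun p => flat 0 (u p)).
Proof.
move=> su c ac; apply: (@smooth_outer _ _ _ (cimg_ropen ac) (@flat R)); last exact: su.
exact: flat_derive.
Qed.

Lemma smooth_fun_sum (J : Type) (r : seq J) (f : J -> X -> R) :
  (forall j, smooth_fun (f j)) -> smooth_fun (fun p => \sum_(j <- r) f j p).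
Proof.
move=> sf c ac; apply: smooth_sum; first exact: cimg_ropen.
by move=> j _; exact: sf.
Qed.

Lemma smooth_fun_continuous u : smooth_fun u -> continuous u.
Proof.
move=> su p; have ac := chart_atlas p; have cp := chart_dom p.
have h : u \o cinv (chart_at p) @ hnbhs (Defs.coord p) --> (u \o cinv (chart_at p)) (Defs.coord p).
  by apply: (smooth_hcont (cimg_ropen ac)); [exists p|exact: su].
have := cvg_comp (cmap (chart_at p)) (u \o cinv (chart_at p)) (cmap_hcvg ac cp) h.
rewrite /Defs.coord /= cinvK//; apply: cvg_trans; apply: near_eq_cvg.
have : \forall q \near p, cdom (chart_at p) q by apply: open_nbhs_nbhs; split=> //; exact: cdom_open.
by apply: filterS => q cq /=; rewrite cinvK.
Qed.

Lemma supported_inS (V : zmodType) (A B : set X) (u : X -> V) : A `<=` B ->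
  supported_in A u -> supported_in B u.
Proof. by move=> AB [K [cK KA h]]; exists K; split=> // p /KA/AB. Qed.

Lemma CcS (A B : set X) u : A `<=` B -> Cc u A -> Cc u B.
Proof. by move=> AB [su h]; split=> //; exact: supported_inS h. Qed.

Lemma CcM (A : set X) u v : Cc u A -> smooth_fun v -> Cc (fun p => v p * u p) A.
Proof.
move=> [su [K [cK KA h]]] sv; split; first exact: smooth_funM.
by exists K; split=> // p /h ->; rewrite mulr0.
Qed.

Lemma CcD (A : set X) u v : Cc u A -> Cc v A -> Cc (fun p => u p + v p) A.
Proof.
move=> [su [K [cK KA h]]] [sv [L [cL LA g]]]; split; first exact: smooth_funD.
exists (K `|` L); split.
- exact: compactU.
- by move=> p [/KA|/LA].
- by move=> p KLp; rewrite h ?g ?addr0// => ?; apply: KLp; [right|left].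
Qed.

Lemma Cc0 (A : set X) : Cc (fun _ : X => 0 : R) A.
Proof. by split; [exact: smooth_fun_cst|exists set0; split=> //; exact: compact0]. Qed.

Lemma CcZ (A : set X) a u : Cc u A -> Cc (fun p => a * u p) A.
Proof. by move=> hu; apply: CcM => //; exact: smooth_fun_cst. Qed.

Lemma Cc_sum (A : set X) (J : Type) (r : seq J) (f : J -> X -> R) :
  (forall j, Cc (f j) A) -> Cc (fun p => \sum_(j <- r) f j p) A.
Proof.
move=> cf; elim: r => [|j r ih].
  by have := Cc0 A; congr Cc; apply/funext => p; rewrite big_nil.
by have := CcD (cf j) ih; congr Cc; apply/funext => p; rewrite big_cons.
Qed.

Lemma box_compact (x0 : 'rV[R]_n.+1) e :
  compact ([set x : 'rV[R]_n.+1 | forall i, x0 0 i - e <= x 0 i <= x0 0 i + e] `&` @half_space R n).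
Proof.
have c1 := @rV_compact R n.+1 (fun i => `[x0 0 i - e, x0 0 i + e]%classic) (fun i => @segment_compact _ _ _).
have -> : [set x : 'rV[R]_n.+1 | forall i, x0 0 i - e <= x 0 i <= x0 0 i + e] =
  [set v : 'rV[R]_n.+1 | forall i, `[x0 0 i - e, x0 0 i + e]%classic (v ord0 i)].
  by apply/seteqP; split=> x h i; have := h i; rewrite /= in_itv.
apply: compact_closedI => //.
rewrite /half_space; apply: (@closed_comp _ _ (fun x : 'rV[R]_n.+1 => x 0 ord_max) [set t : R | 0 <= t]).
  by move=> x _; exact: coord_continuous.
exact: closed_ge.
Qed.

(** The flat function of [(e/2)^2 - |x - x0|^2] lives on a compact box of the chart. As [X] is
    Hausdorff, the image of the box is closed, so every point has a neighbourhood inside the chart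
    domain or one where the extension by zero vanishes. *)
Lemma bump_exists p0 : exists chi : X -> R,
  [/\ Cc chi (cdom (chart_at p0)), forall p, 0 <= chi p & 0 < chi p0].
Proof.
set c := chart_at p0; have ac : atlas X c := chart_atlas p0.
have cp : cdom c p0 := chart_dom p0.
set x0 := cmap c p0; have [W oW WE] := cimg_ropen ac.
have [W0 Hx0] : (W `&` @half_space R n) x0 by rewrite -WE; exists p0.
have /nbhs_ballP[e /= e0 hW] := open_nbhs_nbhs (conj oW W0).
have e2 : 0 < e / 2 by rewrite divr_gt0.
pose box := [set x : 'rV[R]_n.+1 | forall i, x0 0 i - e / 2 <= x 0 i <= x0 0 i + e / 2] `&` @half_space R n.
have cbox : compact box := @box_compact x0 (e / 2).
have boxW : box `<=` cimg c.
  move=> x [bx Hx]; rewrite WE; split=> //; apply: hW; apply/(ball_rVE _ _ e0) => i.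
  by have := bx i; rewrite ltr_norml => /andP[? ?]; apply/andP; split; lra.
pose f (x : 'rV[R]_n.+1) : R := (e / 2) ^+ 2 - \sum_i (x 0 i - x0 0 i) ^+ 2.
have fbox x : @half_space R n x -> ~ box x -> f x <= 0.
  move=> Hx bx; rewrite leNgt; apply/negP => f0; apply: bx; split=> // i.
  have : (x 0 i - x0 0 i) ^+ 2 < (e / 2) ^+ 2.
    move: f0; rewrite subr_gt0; apply: le_lt_trans.
    by rewrite (bigD1 i)//= lerDl sumr_ge0// => j _; exact: sqr_ge0.
  rewrite -[X in X < _]real_normK ?num_real// ltr_pXn2r ?nnegrE ?normr_ge0 ?(ltW e2)// ltr_norml.
  by move=> /andP[? ?]; apply/andP; split; lra.
pose chi p := if `[< cdom c p >] then flat 0 (f (cmap c p)) else 0.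
have chi0 p : 0 <= chi p by rewrite /chi; case: ifP => // _; exact: flat_ge0.
have bK : compact (cinv c @` box).
  apply: continuous_compact => //; have [_ _ _ _] := mf_chart ac.
  exact: continuous_subspaceW.
have Kcl : closed (cinv c @` box) by apply: compact_closed => //; exact: mf_hausdorff.
have chiK p : ~ (cinv c @` box) p -> chi p = 0.
  move=> Kp; rewrite /chi; case: asboolP => // cpp.
  apply: flat_eq0; apply: fbox; first exact: cmap_half.
  by move=> bx; apply: Kp; exists (cmap c p) => //; rewrite cinvK.
exists chi; split=> //; last first.
  rewrite /chi asboolT// flat_gt0// /f big1 ?subr0 ?exprn_gt0// => i _.
  by rewrite subrr expr0n.
split; last first.
  exists (cinv c @` box); split=> // _ [x bx <-]; apply: cinv_dom => //; exact: boxW.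
move=> d ad; apply: smooth_local; first exact: cimg_ropen.
move=> _ [p dp <-]; have [cpp|cpp] := pselect (cdom c p).
  have rU := tdom_ropen ad ac.
  exists (tdom d c); split=> //; first exact: tdomP.
  apply: (@smooth_eq _ _ _ rU (fun x => flat 0 (f (trans d c x)))).
    by move=> _ [q [dq cq] <-]; rewrite trans_cmap// /chi /= cinvK// asboolT.
  apply: (@smooth_outer _ _ _ rU (@flat R)); first exact: flat_derive.
  apply: (smoothB rU); first exact: smooth_cst.
  apply: (smooth_sum rU) => i _; apply: (smoothM rU); apply: (smoothB rU); try exact: smooth_cst;
    exact: trans_smooth.
have Kp : (~` (cinv c @` box)) p by move=> [x bx xp]; apply: cpp; rewrite -xp; apply: cinv_dom => //; exact: boxW.
have rU := image_ropen ad (closed_openC Kcl).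
exists (cmap d @` (cdom d `&` ~` (cinv c @` box))); split=> //; first by exists p.
apply: (@smooth_eq _ _ _ rU (fun=> 0)); last exact: smooth_cst.
by move=> _ [q [dq Kq] <-] /=; rewrite cinvK// chiK.
Qed.

Lemma partition_of_unity K : compact K -> exists (s : seq X) (rho : X -> X -> R) (U : set X),
  [/\ forall i, Cc (rho i) (cdom (chart_at i)), forall i p, 0 <= rho i p,
      forall p, \sum_(i <- s) rho i p <= 1, open U /\ K `<=` U &
      forall p, U p -> \sum_(i <- s) rho i p = 1].
Proof.
move=> cK; pose chi p := projT1 (cid (bump_exists p)).
have chiC p : Cc (chi p) (cdom (chart_at p)) by rewrite /chi; case: cid => f [].
have chi0 p q : 0 <= chi p q by rewrite /chi; case: cid => f [].
have chip p : 0 < chi p p by rewrite /chi; case: cid => f [].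
(* The factor makes [psi p p = 2], so that [p] lies in the open set [V p]. *)
pose psi p q := 2 / chi p p * chi p q.
have psiC p : Cc (psi p) (cdom (chart_at p)) by exact: CcZ.
have psi0 p q : 0 <= psi p q by rewrite mulr_ge0// divr_ge0// ltW.
pose V p := [set q | 1 < psi p q].
have psic p : continuous (psi p) by apply: smooth_fun_continuous; case: (psiC p).
have oV p : open (V p).
  by apply: (@open_comp _ _ (psi p) [set t | 1 < t]) => [q _|]; [exact: psic|exact: open_gt].
move: cK; rewrite compact_cover => /(_ _ setT V (fun p _ => oV p)) [|D _ KD].
  by move=> p _; exists p => //; rewrite /V/= /psi divfK ?gt_eqF// ltr1n.
pose s : seq X := finmap.enum_fset D.
pose W p := \sum_(i <- s) psi i p.
have sW : smooth_fun W by apply: smooth_fun_sum => j; case: (psiC j).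
have W0 p : 0 <= W p by apply: sumr_ge0.
(* A denominator positive everywhere and equal to [W] where [W >= 1]: the quotients sum to [1] near
   [K] and never to more than [1]. *)
pose G p := W p + flat 0 (1 - W p).
have sG : smooth_fun G.
  apply: smooth_funD => //; apply: smooth_fun_flat; apply: smooth_funB => //; exact: smooth_fun_cst.
have WG p : W p <= G p by rewrite lerDl flat_ge0.
have G0 p : 0 < G p.
  have [W1|W1] := ltP (W p) 1; last by apply: lt_le_trans (WG p); exact: lt_le_trans W1.
  by rewrite ltr_wpDl// flat_gt0// subr_gt0.
have sV : smooth_fun (fun p => (G p)^-1) by apply: smooth_funV => // p; rewrite gt_eqF.
exists s, (fun i p => (G p)^-1 * psi i p), [set p | 1 < W p]; split.
- by move=> i; apply: CcM.
- by move=> i p; rewrite mulr_ge0// invr_ge0 ltW.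
- by move=> p; rewrite -mulr_sumr mulrC ler_pdivrMr// mul1r; exact: WG.
- split.
    apply: (@open_comp _ _ W [set t | 1 < t]) => [q _|]; [exact: smooth_fun_continuous|exact: open_gt].
  move=> p /KD[i iD Vp]; apply: lt_le_trans Vp _.
  rewrite /W (bigD1_seq i)//=; last exact: finmap.fset_uniq.
  by rewrite lerDl sumr_ge0.
- move=> p /= W1; rewrite -mulr_sumr -/(W p) /G flat_eq0 ?subr_le0 ?(ltW W1)//.
  by rewrite addr0 mulVf// gt_eqF// (lt_trans _ W1).
Qed.

End SmoothFun.

(** * Area and length in charts *)

Section TransferSigned.
Local Open Scope ereal_scope.
Context d1 d2 (T1 : measurableType d1) (T2 : measurableType d2) (R : realType).
Context (m1 : {measure set T1 -> \bar R}) (m2 : {measure set T2 -> \bar R}).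
Context (D1 : set T1) (D2 : set T2) (h : T2 -> T1) (w : T2 -> R).
Hypotheses (mD1 : measurable D1) (mD2 : measurable D2).
Hypotheses (mh : measurable_fun D2 h) (hD : forall z, D2 z -> D1 (h z)).
Hypotheses (mw : measurable_fun D2 w) (w0 : forall z, D2 z -> (0 <= w z)%R).
Hypothesis m12 : forall B, measurable B -> B `<=` D1 ->
  m1 B = \int[m2]_(z in D2 `&` h @^-1` B) (w z)%:E.

Lemma transfer (g : T1 -> \bar R) : measurable_fun D1 g ->
  \int[m1]_(x in D1) g x = \int[m2]_(z in D2) (g (h z) * (w z)%:E).
Proof using mD1 mD2 mh hD mw w0 m12.
move=> mg; rewrite integralE [in RHS]integralE; congr (_ - _).
- rewrite (ge0_transfer mD1 mD2 mh hD mw w0 m12)//; last exact: measurable_funepos.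
  apply: eq_integral => z /[!inE] /w0 wz; rewrite !funeposE.
  by rewrite maxe_pMl ?lee_fin// ?mul0e.
- rewrite (ge0_transfer mD1 mD2 mh hD mw w0 m12)//; last exact: measurable_funeneg.
  apply: eq_integral => z /[!inE] /w0 wz; rewrite !funenegE.
  by rewrite maxe_pMl ?lee_fin// ?mul0e mulNe.
Qed.

End TransferSigned.

(** * Locally bounded measurable functions *)

Section LBM.
Context (R : realType) (X : ptopologicalType).
Hypothesis hX : hausdorff_space X.
Implicit Types (D : set (borel X)) (K : set X) (h k : borel X -> R).

Lemma compact_measurable_borel K : compact K -> measurable (K : set (borel X)).
Proof using hX. by move=> cK; apply: borel_closed; exact: compact_closed. Qed.

(** The class is taken relative to a set [D] because the boundary potential is meaningful on the
    boundary only. It is stable under products, and members with compact support are integrable for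
    a measure finite on compact sets. *)
Definition lbm D h := measurable_fun D h /\
  forall K, compact K -> exists M, forall p, D p -> K p -> `|h p| <= M.

Lemma lbmM D h k : lbm D h -> lbm D k -> lbm D (fun p => h p * k p).
Proof using.
move=> [mh bh] [mk bk]; split; first exact: measurable_funM.
move=> K cK; have [M hM] := bh K cK; have [N hN] := bk K cK; exists (M * N) => p Dp Kp.
by rewrite normrM ler_pM ?hM ?hN.
Qed.

Lemma lbmS D D' h : measurable D' -> measurable D -> D' `<=` D -> lbm D h -> lbm D' h.
Proof using.
move=> mD' mD DD [mh bh]; split; first exact: measurable_funS mh.
by move=> K /bh[M hM]; exists M => p /DD; exact: hM.
Qed.

Lemma lbm_within_continuous D h : measurable D -> closed (D : set X) ->
  {within (D : set X), continuous (h : X -> R)} -> lbm D h.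
Proof using.
move=> mD cD ch; split; first exact: within_continuous_measurable.
move=> K cK.
have cKD : compact (K `&` (D : set X)) by exact: compact_closedI.
have : compact ((h : X -> R) @` (K `&` (D : set X))).
  apply: continuous_compact => //; apply: continuous_subspaceW ch; exact: subIsetr.
move=> /compact_bounded[M [_ hM]]; exists (M + 1) => p Dp Kp.
by apply: (hM (M + 1)); [rewrite ltrDl|exists p].
Qed.

Lemma lbm_continuous h : continuous (h : X -> R) -> lbm setT h.
Proof using.
move=> ch; apply: lbm_within_continuous; [exact: measurableT|exact: (@closedT X)|].
exact: continuous_subspaceT.
Qed.

Context (m : {measure set (borel X) -> \bar R}).
Hypothesis mfin : forall K, compact K -> (m K < +oo)%E.

Lemma lbm_integrable D h K : measurable D -> lbm D h -> compact K ->
  (forall p, D p -> ~ K p -> h p = 0) -> m.-integrable D (EFin \o h).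
Proof using hX mfin.
move=> mD [mh bh] cK h0; have [M hM] := bh K cK.
have mK := compact_measurable_borel cK.
apply/integrableP; split; first exact/measurable_EFinP.
apply: le_lt_trans (_ : (\int[m]_(x in D) ((`|M|%:E) * (\1_K x)%:E) < +oo)%E).
  apply: ge0_le_integral => //.
  - by apply/measurableT_comp => //; exact/measurable_EFinP.
  - by apply: measurable_funeM; exact/measurable_EFinP.
  move=> p Dp /=; rewrite -EFinM lee_fin indicE; case: (boolP (p \in K)); rewrite ?inE ?notin_setE => Kp.
    by rewrite mulr1 (le_trans (hM _ Dp Kp))// ler_norm.
  by rewrite h0// normr0 mulr0.
rewrite ge0_integralZl//; last by apply/measurable_EFinP.
rewrite integral_indic// lte_mul_pinfty//.
apply: le_lt_trans (mfin cK); apply: le_measure; rewrite ?inE//.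
by apply: measurableI.
Qed.

End LBM.

(** * Area and length densities *)

Section VolumeForm.
Context (R : realType) (S : riemannian R 1).
Implicit Types (c d : chart R S 1) (p : S).

Lemma det2 (G : 'M[R]_2) : \det G = G 0 0 * G 1 1 - G 0 1 * G 1 0.
Proof.
rewrite (expand_det_row _ ord0) !big_ord_recl big_ord0 addr0 /cofactor /= !det_mx11 !mxE.
rewrite /= expr0 expr1 mul1r mulN1r mulrN.
by congr (G _ _ * G _ _ - G _ _ * G _ _); apply/val_inj.
Qed.

Lemma ip2 (G : 'M[R]_2) (u v : 'rV[R]_2) : ip G u v =
  u 0 0 * G 0 0 * v 0 0 + u 0 0 * G 0 1 * v 0 1 + u 0 1 * G 1 0 * v 0 0 + u 0 1 * G 1 1 * v 0 1.
Proof.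
rewrite /ip !mxE !big_ord_recl big_ord0 addr0 !mxE !big_ord_recl !big_ord0 !addr0.
have -> : lift ord0 ord0 = 1 :> 'I_2 by apply/val_inj.
have -> : ord0 = 0 :> 'I_2 by apply/val_inj.
ring.
Qed.

Lemma spd_det2 (G : 'M[R]_2) : G^T = G -> (forall v : 'rV[R]_2, v != 0 -> 0 < ip G v v) ->
  0 < G 0 0 /\ 0 < \det G.
Proof.
move=> Gs Gp; have Gs01 : G 1 0 = G 0 1 by rewrite -[in RHS]Gs mxE.
have a0 : 0 < G 0 0.
  have := Gp (delta_mx 0 0); rewrite ip2 !mxE /= !mul1r !mulr1 !mul0r !mulr0 !addr0; apply.
  by apply/eqP => /rowP/(_ 0); rewrite !mxE /= => /eqP; rewrite oner_eq0.
split=> //.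
(* On this vector the form takes the value [G 0 0 * \det G]. *)
have := Gp (\row_j (if j == 0 then G 0 1 else - G 0 0) : 'rV[R]_2); rewrite ip2 !mxE /= Gs01.
have -> : (\row_j (if j == 0 then G 0 1 else - G 0 0) : 'rV[R]_2) != 0.
  apply/eqP => /rowP/(_ 1); rewrite !mxE /= => /eqP.
  by rewrite oppr_eq0 gt_eqF.
move=> /(_ isT); rewrite det2 Gs01 => h.
rewrite -(pmulr_rgt0 _ a0).
by move: h; congr (_ < _); ring.
Qed.

Lemma ip_form n (P G : 'M[R]_n) (u v : 'rV[R]_n) :
  ip (P *m G *m P^T) u v = ip G (u *m P) (v *m P).
Proof. by rewrite /ip trmx_mul !mulmxA. Qed.

Lemma metric_inE n (X : riemannian R n) (c : chart R X n) (p : X) : atlas X c -> cdom c p ->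
  metric_in c (cmap c p) = to_pref c p *m metric p *m (to_pref c p)^T.
Proof. by move=> ac cp; rewrite /metric_in /form_in cinvK. Qed.

Lemma metric_in_sym n (X : riemannian R n) (c : chart R X n) x : (metric_in c x)^T = metric_in c x.
Proof. by rewrite /metric_in /form_in !trmx_mul trmxK Defs.metric_sym mulmxA. Qed.

Lemma metric_in_pos n (X : riemannian R n) (c : chart R X n) x (v : 'rV[R]_n.+1) :
  atlas X c -> cimg c x -> v != 0 -> 0 < ip (metric_in c x) v v.
Proof.
move=> ac [p cp <-] v0; rewrite metric_inE// ip_form; apply: metric_pos.
have uP : to_pref c p \in unitmx.
  by rewrite to_prefE; apply: tjac_unit => //; [exact: chart_atlas|exact: chart_dom].
by apply: contraNneq v0 => /(congr1 (mulmx^~ (invmx (to_pref c p)))); rewrite mulmxK// mul0mx => ->.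
Qed.

Lemma metric_in_smooth n (X : riemannian R n) (c : chart R X n) : atlas X c ->
  msmooth (cimg c) (metric_in c).
Proof. by move=> ac i j; exact: metric_smooth. Qed.

Lemma spd_unit n (G : 'M[R]_n) : (forall v : 'rV[R]_n, v != 0 -> 0 < ip G v v) -> G \in unitmx.
Proof.
move=> Gp; rewrite -row_free_unit -kermx_eq0; apply/eqP/row_matrixP => i.
rewrite row0; apply/eqP; apply: contraT => /Gp.
have -> : ip G (row i (kermx G)) (row i (kermx G)) = 0.
  by rewrite /ip -row_mul mulmx_ker row0 mul0mx mxE.
by rewrite ltxx.
Qed.

Lemma metric_in_unit n (X : riemannian R n) (c : chart R X n) x : atlas X c -> cimg c x ->
  metric_in c x \in unitmx.
Proof. by move=> ac cx; apply: spd_unit => v; exact: metric_in_pos. Qed.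

Definition vol c x := Num.sqrt (\det (metric_in c x)).

Lemma metric_in_det_gt0 c x : atlas S c -> cimg c x -> 0 < \det (metric_in c x).
Proof.
move=> ac cx; apply: (proj2 (spd_det2 (metric_in_sym _ _) _)) => v.
exact: metric_in_pos.
Qed.

Lemma metric_in00_gt0 c x : atlas S c -> cimg c x -> 0 < metric_in c x 0 0.
Proof.
move=> ac cx; apply: (proj1 (spd_det2 (metric_in_sym _ _) _)) => v.
exact: metric_in_pos.
Qed.

Lemma vol_gt0 c x : atlas S c -> cimg c x -> 0 < vol c x.
Proof. by move=> ac cx; rewrite sqrtr_gt0 metric_in_det_gt0. Qed.

Lemma vol_smooth c : atlas S c -> smooth_on (cimg c) (vol c).
Proof.
move=> ac; have rV := cimg_ropen ac; apply: (smooth_sqrt rV).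
  by move=> x cx; exact: metric_in_det_gt0.
by apply: (smooth_det rV); exact: metric_in_smooth.
Qed.

Definition len c x := Num.sqrt (metric_in c x 0 0).

Lemma len_smooth c : atlas S c -> smooth_on (cimg c) (len c).
Proof.
move=> ac; have rV := cimg_ropen ac; apply: (smooth_sqrt rV).
  by move=> x cx; exact: metric_in00_gt0.
exact: metric_in_smooth.
Qed.

End VolumeForm.

Section ChangeOfVariables.
Context (R : realType) (S : riemannian R 1).
Context (mu sigma : {measure set (borel S) -> \bar R}).
Hypotheses (mu_area : is_area mu) (sigma_length : is_bdry_length sigma).
Implicit Types (c d : chart R S 1) (p : S).
Notation leb := (@lebesgue_measure R).
Notation leb2 := (@lebesgue_measure R \x @lebesgue_measure R)%E.

Definition plane_dom c : set (R * R) := [set z | cimg c (plane_pt z)].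
Definition line_dom c : set R := [set t | cimg c (plane_pt (t, 0))].

Lemma plane_dom_measurable c : atlas S c -> measurable (plane_dom c).
Proof. by move=> ac; apply: plane_preimage_measurable; exact: cimg_ropen. Qed.

Lemma line_pt_measurable : measurable_fun [set: R] (fun t : R => (t, 0 : R)).
Proof. by apply: measurable_fun_pair => //; exact: measurable_cst. Qed.

Lemma line_dom_measurable c : atlas S c -> measurable (line_dom c).
Proof.
move=> ac; rewrite -[line_dom c]setTI.
exact: line_pt_measurable (plane_dom_measurable ac).
Qed.

Lemma cinv_plane_measurable c : atlas S c ->
  measurable_fun (plane_dom c) (fun z => cinv c (plane_pt z) : borel S).
Proof.
move=> ac; apply: (@measurability _ _ _ (borel S) (plane_dom c) _ (@open S)) => // _ [U oU <-].
apply: (plane_hcont_measurable (cimg_ropen ac) _ oU) => x cx; exact: cinv_hcont.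
Qed.

Lemma cinv_line_measurable c : atlas S c ->
  measurable_fun (line_dom c) (fun t => cinv c (plane_pt (t, 0)) : borel S).
Proof.
move=> ac; apply: (measurable_comp (F := plane_dom c) (f := fun z => cinv c (plane_pt z) : borel S) (g := fun t : R => (t, 0 : R))).
- exact: plane_dom_measurable.
- by move=> _ [t ct <-].
- exact: cinv_plane_measurable.
- exact: measurable_funTS line_pt_measurable.
Qed.

Lemma plane_smooth_measurable c f : atlas S c -> smooth_on (cimg c) f ->
  measurable_fun (plane_dom c) (f \o @plane_pt R).
Proof.
move=> ac sf; apply: plane_hcont_measurable_fun; first exact: cimg_ropen.
by move=> x cx; exact: (smooth_hcont (cimg_ropen ac)).
Qed.

Lemma line_smooth_measurable c f : atlas S c -> smooth_on (cimg c) f ->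
  measurable_fun (line_dom c) (fun t => f (plane_pt (t, 0))).
Proof.
move=> ac sf; apply: (measurable_comp (F := plane_dom c) (f := f \o @plane_pt R) (g := fun t : R => (t, 0 : R))).
- exact: plane_dom_measurable.
- by move=> _ [t ct <-].
- exact: plane_smooth_measurable.
- exact: measurable_funTS line_pt_measurable.
Qed.

Lemma integral_area c (g : borel S -> \bar R) : atlas S c ->
  measurable_fun (cdom c : set (borel S)) g ->
  (\int[mu]_(p in cdom c) g p =
   \int[leb2]_(z in plane_dom c) (g (cinv c (plane_pt z)) * (vol c (plane_pt z))%:E))%E.
Proof using mu_area.
move=> ac mg.
apply: (@transfer _ _ _ _ _ mu leb2 (cdom c) (plane_dom c) (fun z => cinv c (plane_pt z)) (vol c \o @plane_pt R)) => //.
- by apply: borel_open; exact: cdom_open.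
- exact: plane_dom_measurable.
- exact: cinv_plane_measurable.
- by move=> z cz; exact: cinv_dom.
- by apply: plane_smooth_measurable => //; exact: vol_smooth.
- by move=> z cz; exact: sqrtr_ge0.
- by move=> B mB Bc; rewrite (mu_area ac mB Bc).
Qed.

Lemma integral_length c (g : borel S -> \bar R) : atlas S c ->
  measurable_fun (cdom c : set (borel S)) g ->
  (\int[sigma]_(p in cdom c) g p =
   \int[leb]_(t in line_dom c) (g (cinv c (plane_pt (t, 0%R))) * (len c (plane_pt (t, 0%R)))%:E))%E.
Proof using sigma_length.
move=> ac mg.
apply: (@transfer _ _ _ _ _ sigma leb (cdom c) (line_dom c) (fun t => cinv c (plane_pt (t, 0))) (fun t => len c (plane_pt (t, 0)))) => //.
- by apply: borel_open; exact: cdom_open.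
- exact: line_dom_measurable.
- exact: cinv_line_measurable.
- by move=> z cz; exact: cinv_dom.
- by apply: line_smooth_measurable => //; exact: len_smooth.
- by move=> z cz; exact: sqrtr_ge0.
- by move=> B mB Bc; rewrite (sigma_length ac mB Bc).
Qed.

End ChangeOfVariables.

Lemma box_measure_finite (R : realType) x y (a b c d : R) :
  ((@lebesgue_measure R \x @lebesgue_measure R)
    ([set` Interval (BSide x a) (BSide y b)] `*` [set` Interval (BSide x c) (BSide y d)]) < +oo)%E.
Proof.
rewrite product_measure1E; [|exact: measurable_itv..].
have fin u v : (@lebesgue_measure R [set` Interval (BSide x u) (BSide y v)] < +oo)%E.
  by rewrite lebesgue_measure_itv /=; case: ifP => // _; rewrite -EFinB ltry.
by apply: lte_mul_pinfty; rewrite ?ge0_fin_numE ?fin.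
Qed.

Section LocallyFinite.
Context (R : realType) (X : ptopologicalType).
Hypothesis hX : hausdorff_space X.
Context (m : {measure set (borel X) -> \bar R}).
Hypothesis lf : forall p : X, exists U : set X, [/\ open U, U p & (m U < +oo)%E].

Lemma locally_finite_compact (K : set X) : compact K -> (m K < +oo)%E.
Proof.
move=> cK; pose V p := projT1 (cid (lf p)).
have oV p : open (V p) by rewrite /V; case: cid => U [].
have Vp p : V p p by rewrite /V; case: cid => U [].
have mV p : (m (V p) < +oo)%E by rewrite /V; case: cid => U [].
move: (cK); rewrite compact_cover => /(_ _ setT V (fun p _ => oV p)) [p _|D _ KD]; first by exists p.
pose cov (s : seq X) : set X := [set q | exists2 i, i \in s & V i q].
have covo s : open (cov s).
  have -> : cov s = \bigcup_(i in [set` s]) V i by apply/seteqP; split=> q [i si Vi]; exists i.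
  by apply: bigcup_open => i _.
have mcov s : (m (cov s) < +oo)%E.
  elim: s => [|i s ih].
    have -> : cov [::] = set0 by apply/seteqP; split=> // q [].
    by rewrite measure0.
  have -> : cov (i :: s) = V i `|` cov s.
    apply/seteqP; split=> q.
      by case=> j; rewrite inE => /orP[/eqP->|js] Vj; [left|right; exists j].
    by case=> [Vi|[j js Vj]]; [exists i; rewrite ?mem_head|exists j; rewrite // inE js orbT].
  apply: (@le_lt_trans _ _ (m (V i) + m (cov s))%E); last exact: lte_add_pinfty.
  by apply: measureU2; apply: borel_open.
apply: le_lt_trans (mcov (finmap.enum_fset D)); apply: le_measure; rewrite ?inE.
- exact: compact_measurable_borel.
- exact: borel_open.
- by move=> q /KD[i iD Vi]; exists i.
Qed.

End LocallyFinite.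

Section FiniteMeasures.
Context (R : realType) (S : riemannian R 1).
Context (mu sigma : {measure set (borel S) -> \bar R}).
Hypotheses (mu_area : is_area mu) (sigma_length : is_bdry_length sigma).
Notation leb := (@lebesgue_measure R).
Notation leb2 := (@lebesgue_measure R \x @lebesgue_measure R)%E.

(** Such a neighbourhood has finite area or length: the density [w] is bounded on it, and its
    coordinates stay in a bounded box. *)
Lemma chart_ball (p : S) (w : 'rV[R]_2 -> R) : smooth_on (cimg (chart_at p)) w ->
  exists (e : R) (M : R) (U : set S), [/\ 0 < e, open U /\ U p, U `<=` cdom (chart_at p) &
    forall x, cimg (chart_at p) x -> U (cinv (chart_at p) x) ->
      w x <= M /\ forall i, Defs.coord p 0 i - e < x 0 i < Defs.coord p 0 i + e].
Proof.
set c := chart_at p; have ac : atlas S c := chart_atlas p.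
have cp : cdom c p := chart_dom p; set x0 := Defs.coord p => sw.
have cx : cimg c x0 by exists p.
have := hcont_dist (smooth_hcont (cimg_ropen ac) cx sw) ltr01.
rewrite /hnbhs near_withinE => /nbhs_ballP[e /= e0 he].
exists e, (w x0 + 1), [set q | cdom c q /\ ball x0 e (cmap c q)]; split=> //.
- split; last by split=> //; exact: ballxx.
  by apply: preimage_open => //; exact: ball_open.
- by move=> q [].
move=> x cix [_]; rewrite cmapK// => bx; split.
  have := he x bx (ropenH (cimg_ropen ac) cix).
  by rewrite ltr_distl => /andP[h1 h2]; lra.
move=> i; have /(ball_rVE _ _ e0)/(_ i) := bx.
by rewrite ltr_distl => /andP[h1 h2]; apply/andP; split; lra.
Qed.

Lemma area_compact_finite (K : set S) : compact K -> (mu K < +oo)%E.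
Proof using mu_area.
apply: locally_finite_compact => [|p]; first exact: mf_hausdorff.
have ac := chart_atlas p.
have [e [M [U [e0 [oU Up] Uc hU]]]] := chart_ball (vol_smooth ac).
exists U; split=> //; rewrite (mu_area ac (borel_open oU) Uc).
set A := [set z | _].
have mA : measurable A.
  by apply: (plane_hcont_measurable (cimg_ropen ac) _ oU) => x cx; exact: cinv_hcont.
pose box : set (R * R) := `](Defs.coord p 0 0 - e), (Defs.coord p 0 0 + e)[%classic `*`
  `](Defs.coord p 0 1 - e), (Defs.coord p 0 1 + e)[%classic.
have Abox : A `<=` box.
  move=> z [cz Uz]; have [_ hz] := hU _ cz Uz.
  by have := hz 0; have := hz 1; rewrite !mxE /= => h1 h0; split; rewrite /= in_itv.
apply: (@le_lt_trans _ _ (\int[leb2]_(z in A) (cst `|M|%:E z))%E).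
  apply: ge0_le_integral => //.
  - apply/measurable_EFinP; apply: (@measurable_funS _ _ _ _ (plane_dom (chart_at p))).
    + exact: plane_dom_measurable.
    + by move=> z [].
    + by have := plane_smooth_measurable ac (vol_smooth ac).
  - move=> z [cz Uz]; have [hv _] := hU _ cz Uz.
    by rewrite lee_fin (le_trans hv)// ler_norm.
rewrite integral_cst// lte_mul_pinfty//.
apply: le_lt_trans (_ : leb2 box < +oo)%E.
  by apply: le_measure => //; rewrite inE//; apply: measurableX; exact: measurable_itv.
exact: box_measure_finite.
Qed.

Lemma length_compact_finite (K : set S) : compact K -> (sigma K < +oo)%E.
Proof using sigma_length.
apply: locally_finite_compact => [|p]; first exact: mf_hausdorff.
have ac := chart_atlas p.
have [e [M [U [e0 [oU Up] Uc hU]]]] := chart_ball (len_smooth ac).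
exists U; split=> //; rewrite (sigma_length ac (borel_open oU) Uc).
set A := [set z | _].
have mA : measurable A.
  have -> : A = line_dom (chart_at p) `&` (fun t => cinv (chart_at p) (plane_pt (t, 0))) @^-1` U by [].
  by apply: (cinv_line_measurable ac) => //; [exact: line_dom_measurable|exact: borel_open].
pose box : set R := `](Defs.coord p 0 0 - e), (Defs.coord p 0 0 + e)[%classic.
have Abox : A `<=` box.
  move=> z [cz Uz]; have [_ hz] := hU _ cz Uz.
  by have := hz 0; rewrite !mxE /= => h0; rewrite /box /= in_itv.
apply: (@le_lt_trans _ _ (\int[leb]_(z in A) (cst `|M|%:E z))%E).
  apply: ge0_le_integral => //.
  - apply/measurable_EFinP; apply: (@measurable_funS _ _ _ _ (line_dom (chart_at p))).
    + exact: line_dom_measurable.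
    + by move=> z [].
    + by have := line_smooth_measurable ac (len_smooth ac).
  - move=> z [cz Uz]; have [hv _] := hU _ cz Uz.
    by rewrite lee_fin (le_trans hv)// ler_norm.
rewrite integral_cst// lte_mul_pinfty//.
apply: le_lt_trans (_ : leb box < +oo)%E.
  by apply: le_measure => //; rewrite inE//; exact: measurable_itv.
by rewrite !lebesgue_measure_itv /=; case: ifP => // _; rewrite -EFinB ltry.
Qed.

End FiniteMeasures.

(** * Divergence theorem in the half-plane *)

Section HalfPlaneDivergence.
Context (R : realType).
Notation leb := (@lebesgue_measure R).
Notation leb2 := (@lebesgue_measure R \x @lebesgue_measure R)%E.
Implicit Types (f : 'rV[R]_2 -> R).
Local Notation H := (@half_space R 1).

Lemma ropen_half n : ropen (@half_space R n).
Proof. by exists setT; rewrite ?setTI//; exact: openT. Qed.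

Lemma FTC_line n (V : set 'rV[R]_n.+1) (f : 'rV[R]_n.+1 -> R) x i a b : ropen V ->
  smooth_on V f -> a < b -> (forall t, a <= t <= b -> V (shiftc x i t)) ->
  (\int[leb]_(t in `[a, b]) (pderiv i f (shiftc x i t))%:E =
   (f (shiftc x i b))%:E - (f (shiftc x i a))%:E)%E.
Proof.
move=> rV sf ab hV.
have sfi := smooth_pderiv rV i sf.
have cvgd g y : smooth_on V g -> V y -> cvg (diffquot g i y @ diffquot_nbhs i y).
  move=> sg Vy; apply/cvg_ex; eexists; apply: hdiff_pd (smooth_hdiff rV Vy sg).
  exact: ropenH rV Vy.
have [d1 c1] := line_derive (x := x) (i := i) rV (fun y => cvgd f y sf) (fun y Vy => smooth_hcont rV Vy sf) hV.
have [_ c2] := line_derive (x := x) (i := i) rV (fun y => cvgd _ y sfi) (fun y Vy => smooth_hcont rV Vy sfi) hV.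
apply: (@continuous_FTC2 _ (fun t => pderiv i f (shiftc x i t)) (fun t => f (shiftc x i t)) a b ab c2).
- have /(continuous_within_itvP _ ab)[_ ca cb] := c1; split=> //.
  by move=> t tab; exact: (@ex_derive _ _ _ _ _ _ _ (d1 t tab)).
- by move=> t tab; rewrite derive1E; exact: (@derive_val _ _ _ _ _ _ _ (d1 t tab)).
Qed.

Section Support.
Context (f : 'rV[R]_2 -> R) (M : R).
Hypotheses (sf : smooth_on H f) (M0 : 0 < M).
Hypothesis f0 : forall x i, H x -> M < `|x 0 i| -> f x = 0.

Lemma pderiv_support j (x : 'rV[R]_2) i : H x -> M < `|x 0 i| -> pderiv j f x = 0.
Proof using f0.
move=> Hx xi.
have -> : pderiv j f x = pderiv j (fun=> 0) x.
  apply: pderiv_near => //.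
  have h : \forall y \near hnbhs x, M < `|(y : 'rV[R]_2) 0 i|.
    have c : (fun y : 'rV[R]_2 => `|y 0 i|) @ hnbhs x --> `|x 0 i|.
      by apply: cvg_norm; exact: hcont_coord.
    exact: cvgr_gt c _ xi.
  have h2 : \forall y \near hnbhs x, H y by rewrite /hnbhs near_withinE; near=> y.
  by near=> y; apply: (f0 (i := i)); near: y.
by have := hdiff_pderiv j Hx (hdiff_cst 0 x); rewrite mxE.
Unshelve. all: by end_near. Qed.

(** The derivative, not the function, is extended by zero below the axis. Integrals can then be
    taken over the whole plane by Fubini, and the boundary term is the value at the lower end of
    each vertical half-line. *)
Definition Dext j (z : R * R) : R := if 0 <= z.2 then pderiv j f (plane_pt z) else 0.

Lemma plane_half z : H (@plane_pt R z) = (0 <= z.2).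
Proof using. by rewrite /half_space/= mxE. Qed.

Lemma Dext_measurable j : measurable_fun setT (Dext j).
Proof using sf.
have rH := ropen_half 1.
have mH : measurable [set z : R * R | H (plane_pt z)] by exact: plane_preimage_measurable.
have -> : Dext j = patch (fun=> 0) [set z : R * R | H (plane_pt z)] (pderiv j f \o @plane_pt R).
  apply/funext => z; rewrite /Dext /patch; case: ifPn => hz.
    by rewrite mem_set//= plane_half.
  by rewrite memNset//= plane_half; exact/negP.
apply/(measurable_restrictT _ mH).
apply: plane_hcont_measurable_fun => // x Hx.
exact: (smooth_hcont rH Hx (smooth_pderiv rH j sf)).
Qed.

Lemma Dext_bounded j : exists C, forall z, `|Dext j z| <= C /\ (M < `|z.1| \/ M < `|z.2| -> Dext j z = 0).
Proof using sf f0.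
have rH := ropen_half 1.
have cb := @box_compact R 1 0 M.
have : compact (pderiv j f @` ([set x : 'rV[R]_2 | forall i, (0 : 'rV[R]_2) 0 i - M <= x 0 i <= (0 : 'rV[R]_2) 0 i + M] `&` H)).
  apply: continuous_compact => //; apply: continuous_subspaceW (@subIsetr _ _ _) _.
  apply/(within_contP _ rH) => x Hx; exact: (smooth_hcont rH Hx (smooth_pderiv rH j sf)).
move=> /compact_bounded[C [_ hC]]; exists (`|C| + 1) => z.
have z0 : M < `|z.1| \/ M < `|z.2| -> Dext j z = 0.
  rewrite /Dext; case: ifP => // hz [h|h].
    by apply: (@pderiv_support j _ 0); rewrite ?plane_half// mxE.
  by apply: (@pderiv_support j _ 1); rewrite ?plane_half// mxE.
split=> //.
have [[h1 h2]|h] := pselect (`|z.1| <= M /\ `|z.2| <= M); last first.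
  rewrite z0 ?normr0 ?addr_ge0//; have [h1|] := leP `|z.1| M; last by left.
  by have [h2|] := leP `|z.2| M; [exfalso; apply: h|right].
rewrite /Dext; case: ifPn => hz; last by rewrite normr0 addr_ge0.
apply: (hC (`|C| + 1)); first by rewrite (le_lt_trans (ler_norm _))// ltrDl.
exists (plane_pt z) => //; split; last by rewrite plane_half.
by move=> i; rewrite !mxE sub0r add0r; case: ifP => _; rewrite -ler_norml.
Qed.

Lemma Dext_integrable j : leb2.-integrable setT (EFin \o Dext j).
Proof using sf f0 M0.
have [C hC] := Dext_bounded j.
pose box : set (R * R) := `[(- M), M]%classic `*` `[(- M), M]%classic.
have mbox : measurable box by apply: measurableX; exact: measurable_itv.
apply/integrableP; split; first by apply/measurable_EFinP; exact: Dext_measurable.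
apply: le_lt_trans (_ : (\int[leb2]_z ((`|C|%:E) * (\1_box z)%:E) < +oo)%E).
  apply: ge0_le_integral => //.
  - by apply/measurableT_comp => //; apply/measurable_EFinP; exact: Dext_measurable.
  - by apply: measurable_funeM; exact/measurable_EFinP.
  move=> z _ /=; rewrite -EFinM lee_fin indicE; have [h1 h2] := hC z.
  case: (boolP (z \in box)); rewrite ?inE ?notin_setE => zb.
    by rewrite mulr1 (le_trans h1)// ler_norm.
  rewrite h2 ?normr0 ?mulr0//; have [b1|] := leP `|z.1| M; last by left.
  have [b2|] := leP `|z.2| M; last by right.
  by exfalso; apply: zb; split; rewrite /= in_itv/= -ler_norml.
rewrite ge0_integralZl//; last by apply/measurable_EFinP.
rewrite integral_indic// setIT lte_mul_pinfty//.
exact: box_measure_finite.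
Qed.

Lemma shiftc_plane0 t y : shiftc (@plane_pt R (0, y)) 0 t = plane_pt (t, y).
Proof using. by apply/rowP => i; rewrite shiftcE !mxE; case: i => [[|[|]]]//= ?; rewrite ?mulr1 ?mulr0 ?add0r ?addr0. Qed.

Lemma shiftc_plane1 t y : shiftc (@plane_pt R (t, 0)) 1 y = plane_pt (t, y).
Proof using. by apply/rowP => i; rewrite shiftcE !mxE; case: i => [[|[|]]]//= ?; rewrite ?mulr1 ?mulr0 ?add0r ?addr0. Qed.

Lemma divergence0 : (\int[leb2]_z (Dext 0 z)%:E = 0)%E.
Proof using sf f0 M0.
have [C hC] := Dext_bounded 0.
rewrite -(integral21_prod_meas1 (Dext_integrable 0)) /fubini_G.
apply: integral0_eq => y _ /=.
have [y0|y0] := leP 0 y; last first.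
  by apply: integral0_eq => x _; rewrite /Dext /= leNgt y0.
(* [f] is known to vanish only beyond [M], hence the margin [1]. *)
transitivity (\int[leb]_(x in `[(- (M + 1))%R, (M + 1)%R]) (pderiv 0%R f (shiftc (plane_pt (0%R, y)) 0%R x))%:E)%E.
  rewrite [RHS]integral_mkcond; apply: eq_integral => x _; rewrite /patch shiftc_plane0.
  case: ifPn; rewrite ?inE ?notin_setE /= in_itv /= => xM; first by rewrite /Dext /= y0.
  rewrite (proj2 (hC (x, y)))//; left => /=; rewrite ltNge; apply/negP => h; apply: xM.
  by rewrite -ler_norml (le_trans h)// lerDl.
rewrite (@FTC_line _ _ _ _ _ _ _ (ropen_half 1) sf); [|by move: M0; lra|by move=> t _; rewrite shiftc_plane0 plane_half].
have M1 : M < M + 1 by rewrite ltrDl.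
rewrite !shiftc_plane0 !(f0 (i := 0)) ?subee// ?plane_half// mxE/= ?normrN;
  by rewrite (lt_le_trans M1)// ler_norm.
Qed.

Lemma divergence1 : (\int[leb2]_z (Dext 1 z)%:E = \int[leb]_t (- f (plane_pt (t, 0%R)))%:E)%E.
Proof using sf f0 M0.
have [C hC] := Dext_bounded 1.
rewrite -(integral12_prod_meas1 (Dext_integrable 1)) /fubini_F.
apply: eq_integral => x _ /=.
transitivity (\int[leb]_(y in `[0%R, (M + 1)%R]) (pderiv 1%R f (shiftc (plane_pt (x, 0%R)) 1%R y))%:E)%E.
  rewrite [RHS]integral_mkcond; apply: eq_integral => y _; rewrite /patch shiftc_plane1.
  case: ifPn; rewrite ?inE ?notin_setE /= in_itv /=; first by move=> /andP[y0 _]; rewrite /Dext /= y0.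
  move=> yM; have [y0|y0] := leP 0 y; last by rewrite /Dext /= leNgt y0.
  rewrite (proj2 (hC (x, y)))//; right => /=; rewrite ltNge; apply/negP => h; apply: yM.
  by rewrite y0 /= -(ger0_norm y0) (le_trans h)// lerDl.
rewrite (@FTC_line _ _ _ _ _ _ _ (ropen_half 1) sf); [|by move: M0; lra|by move=> t /andP[t0 _]; rewrite shiftc_plane1 plane_half].
have M1 : M < M + 1 by rewrite ltrDl.
rewrite !shiftc_plane1 [in X in (X - _)%E](f0 (i := 1)) ?sub0e// ?plane_half/=; last 2 first.
- by rewrite addr_ge0// ltW.
- by rewrite mxE/= (lt_le_trans M1)// ler_norm.
Qed.

End Support.
End HalfPlaneDivergence.

(** * Levi-Civita connection and curvature under changes of charts *)

(* Locked: rewriting with [mxE] under [pderiv] otherwise does not terminate. *)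
HB.lock Definition mpd (R : realType) n p q (A : 'rV[R]_n.+1 -> 'M[R]_(p, q)) x (i : 'I_n.+1) :
  'M[R]_(p, q) := \matrix_(a, b) pderiv i (fun y => A y a b) x.

(** * Calculus of matrix-valued functions *)

Section MatrixCalculus.
Context (R : realType) (n : nat).
Implicit Types (x y : 'rV[R]_n.+1) (V : set 'rV[R]_n.+1).

Definition mdiff p q (A : 'rV[R]_n.+1 -> 'M[R]_(p, q)) x (D : 'I_n.+1 -> 'M[R]_(p, q)) :=
  forall a b, hdiff (fun y => A y a b) x (\row_i D i a b).

Lemma mpdE p q (A : 'rV[R]_n.+1 -> 'M[R]_(p, q)) x i a b :
  mpd A x i a b = pderiv i (fun y => A y a b) x.
Proof. by rewrite mpd.unlock mxE. Qed.

Lemma jacE m (f : 'rV[R]_n.+1 -> 'rV[R]_m.+1) x i j : jac f x i j = pderiv i (fun y => f y 0 j) x.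
Proof. by rewrite mxE. Qed.

Lemma msmooth_mdiff V p q (A : 'rV[R]_n.+1 -> 'M[R]_(p, q)) x : ropen V ->
  msmooth V A -> V x -> mdiff A x (mpd A x).
Proof.
move=> rV sA Vx a b; have := smooth_hdiff rV Vx (sA a b).
by congr (hdiff _ _ _); apply/rowP => i; rewrite [LHS]mxE [RHS]mxE mpdE.
Qed.

Lemma mdiff_mpd p q (A : 'rV[R]_n.+1 -> 'M[R]_(p, q)) x D i : half_space x ->
  mdiff A x D -> mpd A x i = D i.
Proof. by move=> Hx h; apply/matrixP => a b; rewrite mpdE (hdiff_pderiv i Hx (h a b)) mxE. Qed.

Lemma mdiff_near p q (A B : 'rV[R]_n.+1 -> 'M[R]_(p, q)) x D : half_space x ->
  (\forall y \near hnbhs x, A y = B y) -> mdiff A x D -> mdiff B x D.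
Proof.
move=> Hx AB h a b; apply: hdiff_near_eq (h a b) => //.
by apply: filterS AB => y ->.
Qed.

Lemma mdiffD p q (A B : 'rV[R]_n.+1 -> 'M[R]_(p, q)) x DA DB :
  mdiff A x DA -> mdiff B x DB -> mdiff (fun y => A y + B y) x (fun i => DA i + DB i).
Proof.
move=> hA hB a b; have := hdiffD (hA a b) (hB a b).
rewrite (_ : (fun y => (A y + B y) a b) = fun y => A y a b + B y a b); last by apply/funext => y; rewrite mxE.
by congr (hdiff _ _ _); apply/rowP => i; rewrite !mxE.
Qed.

Lemma mdiffM p q r (A : 'rV[R]_n.+1 -> 'M[R]_(p, q)) (B : 'rV[R]_n.+1 -> 'M[R]_(q, r)) x DA DB :
  mdiff A x DA -> mdiff B x DB ->
  mdiff (fun y => A y *m B y) x (fun i => DA i *m B x + A x *m DB i).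
Proof.
move=> hA hB a b.
rewrite (_ : (fun y => (A y *m B y) a b) = fun y => \sum_k A y a k * B y k b); last by apply/funext => y; rewrite mxE.
have := hdiff_sum (J := 'I_q) (P := xpredT) (index_enum 'I_q) (fun k _ => hdiffM (hA a k) (hB k b)).
congr (hdiff _ _ _); apply/rowP => i; rewrite summxE !mxE -big_split /=.
by apply: eq_bigr => k _; rewrite !mxE mulrC.
Qed.

Lemma mdiff_tr p q (A : 'rV[R]_n.+1 -> 'M[R]_(p, q)) x D :
  mdiff A x D -> mdiff (fun y => (A y)^T) x (fun i => (D i)^T).
Proof.
move=> h a b; have := h b a.
rewrite (_ : (fun y => (A y)^T a b) = fun y => A y b a); last by apply/funext => y; rewrite mxE.
by congr (hdiff _ _ _); apply/rowP => i; rewrite !mxE.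
Qed.

Lemma mdiff_scale p q (u : 'rV[R]_n.+1 -> R) (A : 'rV[R]_n.+1 -> 'M[R]_(p, q)) x d D :
  hdiff u x d -> mdiff A x D -> mdiff (fun y => u y *: A y) x (fun i => d 0 i *: A x + u x *: D i).
Proof.
move=> hu h a b; have := hdiffM hu (h a b).
rewrite (_ : (fun y => (u y *: A y) a b) = fun y => u y * A y a b); last by apply/funext => y; rewrite mxE.
by congr (hdiff _ _ _); apply/rowP => i; rewrite !mxE mulrC.
Qed.

Lemma mdiff_sum p q (J : finType) (A : J -> 'rV[R]_n.+1 -> 'M[R]_(p, q)) x D :
  (forall j, mdiff (A j) x (D j)) -> mdiff (fun y => \sum_j A j y) x (fun i => \sum_j D j i).
Proof.
move=> h a b.
rewrite (_ : (fun y => _) = fun y => \sum_k A k y a b); last by apply/funext => y; rewrite summxE.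
have := hdiff_sum (P := xpredT) (index_enum J) (fun k _ => h k a b).
by congr (hdiff _ _ _); apply/rowP => i; rewrite !mxE !summxE; apply: eq_bigr => k _; rewrite mxE.
Qed.

Lemma mdiff_comp m p q (T : 'rV[R]_n.+1 -> 'rV[R]_m.+1) (A : 'rV[R]_m.+1 -> 'M[R]_(p, q)) x
    (J : 'M[R]_(n.+1, m.+1)) (D : 'I_m.+1 -> 'M[R]_(p, q)) :
  (\forall y \near hnbhs x, half_space (T y)) -> mdiff T x (fun i => row i J) ->
  (forall a b, hdiff (fun z => A z a b) (T x) (\row_i D i a b)) ->
  mdiff (fun y => A (T y)) x (fun i => \sum_a J i a *: D a).
Proof.
move=> HT hT hA a b.
have hT' j : hdiff (fun y => T y 0 j) x (\row_i J i j).
  by have := hT 0 j; congr (hdiff _ _ _); apply/rowP => i; rewrite !mxE.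
have := hdiff_comp HT hT' (hA a b).
congr (hdiff _ _ _); apply/rowP => i; rewrite !mxE summxE.
by apply: eq_bigr => j _; rewrite !mxE.
Qed.

Lemma jac_row m (f : 'rV[R]_n.+1 -> 'rV[R]_m.+1) x i : row i (jac f x) = mpd f x i.
Proof. by apply/matrixP => a b; rewrite mxE mpdE jacE ord1. Qed.

Lemma jac_smooth V m (f : 'rV[R]_n.+1 -> 'rV[R]_m.+1) : ropen V -> msmooth V f -> msmooth V (jac f).
Proof.
move=> rV sf i j; apply: smooth_eq (smooth_pderiv rV i (sf 0 j)) => // x _.
by rewrite jacE.
Qed.

Lemma msmooth_mpd V p q (A : 'rV[R]_n.+1 -> 'M[R]_(p, q)) i : ropen V -> msmooth V A -> msmooth V (mpd A ^~ i).
Proof.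
move=> rV sf a b; apply: smooth_eq (smooth_pderiv rV i (sf a b)) => // x _.
by rewrite mpdE.
Qed.

Lemma jac_sym V m (f : 'rV[R]_n.+1 -> 'rV[R]_m.+1) x i j : ropen V -> msmooth V f -> V x ->
  row j (mpd (jac f) x i) = row i (mpd (jac f) x j).
Proof.
move=> rV sf Vx; apply/rowP => k; rewrite [LHS]mxE [RHS]mxE !mpdE.
have E i' j' : pderiv i' (fun y => jac f y j' k) x = pderiv i' (pderiv j' (fun y => f y 0 k)) x.
  by apply: pderiv_eq rV Vx _ => y _; rewrite (jacE, mpdE).
by rewrite !E (schwarz _ _ rV).
Qed.

Lemma mpd_sym V p q (A : 'rV[R]_n.+1 -> 'M[R]_(p, q)) x i j : ropen V -> msmooth V A -> V x ->
  mpd (mpd A ^~ i) x j = mpd (mpd A ^~ j) x i.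
Proof.
move=> rV sA Vx; apply/matrixP => a b; rewrite !mpdE.
have E i' j' : pderiv i' (fun y => mpd A y j' a b) x = pderiv i' (pderiv j' (fun y => A y a b)) x.
  by apply: pderiv_eq rV Vx _ => y _; rewrite (jacE, mpdE).
by rewrite !E (schwarz _ _ rV).
Qed.

End MatrixCalculus.

(* The connection matrices: [D_i V] is [mpd V x i + V x *m Gam G x i]. *)
HB.lock Definition Gam (R : realType) n (G : 'rV[R]_n.+1 -> 'M[R]_n.+1) x (i : 'I_n.+1) :
  'M[R]_n.+1 := \matrix_(j, k) christoffel G x k i j.

(** * Connection and curvature matrices *)

Section LeviCivita.
Context (R : realType) (n : nat).
Implicit Types (G : 'rV[R]_n.+1 -> 'M[R]_n.+1) (x : 'rV[R]_n.+1).

Lemma GamE G x i j k : Gam G x i j k = christoffel G x k i j.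
Proof. by rewrite Gam.unlock mxE. Qed.

(** Applying the two symmetries alternately, three times each, returns to the same entry with the
    opposite sign. This is the algebra behind the uniqueness of the Levi-Civita connection. *)
Lemma sym_antisym0 (D : 'I_n.+1 -> 'M[R]_n.+1) :
  (forall i j k, D i j k = D j i k) -> (forall i, (D i)^T = - D i) -> forall i, D i = 0.
Proof.
move=> h1 h2 i; apply/matrixP => j k; rewrite mxE.
have s a b c : D a b c = - D a c b by have /matrixP/(_ c b) := h2 a; rewrite !mxE.
have : D i j k = - D i j k.
  by rewrite {1}h1 s h1 s opprK h1 s h1.
by move=> h; lra.
Qed.

Section Metric.
Context (V : set 'rV[R]_n.+1) (G : 'rV[R]_n.+1 -> 'M[R]_n.+1).
Hypotheses (rV : ropen V) (sG : msmooth V G).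
Hypotheses (symG : forall x, V x -> (G x)^T = G x) (uG : forall x, V x -> G x \in unitmx).

Lemma mpd_metric_sym x i : V x -> (mpd G x i)^T = mpd G x i.
Proof using rV symG.
move=> Vx; apply/matrixP => a b; rewrite mxE !mpdE; apply: pderiv_eq rV Vx _ => y Vy.
by rewrite -[in LHS](symG Vy) mxE.
Qed.

(** The Koszul formula: with the upper index lowered, no inverse of the metric is left. *)
Lemma Gam_lower x i : V x -> Gam G x i *m G x =
  \matrix_(j, l) (2^-1 * (mpd G x i j l + mpd G x j i l - mpd G x l i j)).
Proof using rV symG uG.
move=> Vx; set E := \matrix_(j, l) _.
rewrite (_ : Gam G x i = E *m invmx (G x)) ?mulmxKV ?uG//.
apply/matrixP => j k; rewrite GamE [RHS]mxE /christoffel mulr_sumr; apply: eq_bigr => l _.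
have -> : invmx (G x) k l = invmx (G x) l k by rewrite -[in LHS](symG Vx) -trmx_inv mxE.
by rewrite mxE !mpdE mulrCA mulrC.
Qed.

Lemma Gam_sym x i j k : V x -> Gam G x i j k = Gam G x j i k.
Proof using rV symG.
move=> Vx; rewrite !GamE /christoffel; congr (_ * _); apply: eq_bigr => l _; congr (_ * _).
have /matrixP/(_ i j) := mpd_metric_sym l Vx; rewrite mxE !mpdE => ->.
by rewrite (addrC (pderiv i _ _)).
Qed.

(** Metric compatibility, one of the two properties that characterize the connection; [Gam_sym] is
    the other. *)
Lemma Gam_metric x i : V x -> mpd G x i = Gam G x i *m G x + G x *m (Gam G x i)^T.
Proof using rV symG uG.
move=> Vx; have -> : G x *m (Gam G x i)^T = (Gam G x i *m G x)^T by rewrite trmx_mul symG.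
rewrite Gam_lower//; apply/matrixP => j l; rewrite [RHS]mxE [X in _ + X]mxE ![X in X + _]mxE ![X in _ + X]mxE.
have s a b c : mpd G x a b c = mpd G x a c b by rewrite -[in LHS]mpd_metric_sym// mxE.
rewrite (s i l j) (s l i j) (s j i l) (s l j i).
move: (mpd G x i j l) (mpd G x j l i) (mpd G x l j i) => u v w; lra.
Qed.

Lemma Gam_smooth i : msmooth V (fun x => Gam G x i).
Proof using rV sG uG.
move=> j k; apply: smooth_eq (_ : smooth_on V (fun x => christoffel G x k i j)) => // [x _|]; first by rewrite GamE.
apply: smoothZ => //; apply: smooth_sum => // l _; apply: smoothM => //; first exact: msmooth_inv.
by apply: smoothB => //; [apply: smoothD => //|]; apply: smooth_pderiv.
Qed.

End Metric.

(** The commutator of covariant derivatives: for a row vector field [V], the product of [V] with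
    this matrix is [[D_i, D_j] V]. Vectors act on the left, which fixes the order of the products of
    [Ga]. *)
Definition curv (Ga : 'rV[R]_n.+1 -> 'I_n.+1 -> 'M[R]_n.+1) x i j : 'M[R]_n.+1 :=
  mpd (fun y => Ga y j) x i - mpd (fun y => Ga y i) x j + Ga x j *m Ga x i - Ga x i *m Ga x j.

Lemma ricci_curv V G x : ropen V -> msmooth V G -> (forall x, V x -> (G x)^T = G x) -> V x ->
  ricci G x = \matrix_(i, j) \sum_k curv (Gam G) x k j i k.
Proof.
move=> rV sG symG Vx; apply/matrixP => i j; rewrite [LHS]mxE [RHS]mxE.
rewrite -sumrB -big_split /= -sumrB; apply: eq_bigr => k _.
have s := Gam_sym rV symG.
have E (A B C D : 'M[R]_n.+1) : (A - B + C - D) i k = A i k - B i k + C i k - D i k by rewrite !mxE.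
rewrite /curv E !mpdE; congr (_ - _ + _ - _).
- by apply: pderiv_eq rV Vx _ => y Vy; rewrite -s// GamE.
- by apply: pderiv_eq rV Vx _ => y Vy; rewrite -s// GamE.
- by rewrite mxE; apply: eq_bigr => l _; rewrite mulrC -(s _ i j l)// !GamE.
- by rewrite mxE; apply: eq_bigr => l _; rewrite mulrC -(s _ i k l)// !GamE.
Qed.

End LeviCivita.

#[local] Opaque jac.

Section CovariantDerivative.
Context (R : realType).

Lemma covdE n m (G : 'rV[R]_m.+1 -> 'M[R]_m.+1) (f W : 'rV[R]_n.+1 -> 'rV[R]_m.+1) x i :
  covd G f W x i = mpd W x i + W x *m \sum_a jac f x i a *: Gam G (f x) a.
Proof.
apply/rowP => k; rewrite mxE [RHS]mxE jacE mpdE; congr (_ + _).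
rewrite mxE exchange_big; apply: eq_bigr => b _; rewrite summxE mulr_sumr.
by apply: eq_bigr => a _; rewrite [in RHS]mxE GamE; ring.
Qed.

Lemma covd_near n m (G : 'rV[R]_m.+1 -> 'M[R]_m.+1) (f g W Z : 'rV[R]_n.+1 -> 'rV[R]_m.+1) x i :
  half_space x -> (\forall y \near hnbhs x, f y = g y) -> (\forall y \near hnbhs x, W y = Z y) ->
  f x = g x -> W x = Z x -> covd G f W x i = covd G g Z x i.
Proof.
move=> Hx fg WZ fgx WZx; rewrite !covdE fgx WZx.
have -> : mpd W x i = mpd Z x i.
  apply/rowP => k; rewrite !mpdE; apply: pderiv_near => //.
  by apply: filterS WZ => y ->.
congr (_ + mulmx _ _); apply: eq_bigr => a _; congr (_ *: _); rewrite !jacE; apply: pderiv_near => //.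
by apply: filterS fg => y ->.
Qed.

Lemma msmooth_row n m V (f : 'rV[R]_n.+1 -> 'rV[R]_m.+1) x : ropen V -> msmooth V f -> V x ->
  mdiff f x (fun i => row i (jac f x)).
Proof.
move=> rV sf Vx; have -> : (fun i => row i (jac f x)) = mpd f x by apply/funext => i; rewrite jac_row.
exact: msmooth_mdiff rV sf Vx.
Qed.

Lemma chain_rule k n p q U U' (S : 'rV[R]_k.+1 -> 'rV[R]_n.+1) (A : 'rV[R]_n.+1 -> 'M[R]_(p, q)) x :
  ropen U -> ropen U' -> msmooth U S -> (forall y, U y -> U' (S y)) -> msmooth U' A -> U x ->
  mdiff (fun y => A (S y)) x (fun i => \sum_j jac S x i j *: mpd A (S x) j).
Proof.
move=> rU rU' sS SU sA Ux; apply: mdiff_comp; last exact: msmooth_mdiff rU' sA (SU _ Ux).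
  by apply: filterS (ropen_near rU Ux) => y /SU; exact: ropenH.
exact: msmooth_row rU sS Ux.
Qed.

Lemma jac_comp k n m U U' (S : 'rV[R]_k.+1 -> 'rV[R]_n.+1) (f : 'rV[R]_n.+1 -> 'rV[R]_m.+1) x :
  ropen U -> ropen U' -> msmooth U S -> (forall y, U y -> U' (S y)) -> msmooth U' f -> U x ->
  jac (fun y => f (S y)) x = jac S x *m jac f (S x).
Proof.
move=> rU rU' sS SU sf Ux; apply/row_matrixP => i.
rewrite jac_row (mdiff_mpd i (ropenH rU Ux) (chain_rule rU rU' sS SU sf Ux)).
rewrite row_mul; apply/rowP => j; rewrite summxE mxE; apply: eq_bigr => a _.
by rewrite [LHS]mxE [X in _ = X * _]mxE mpdE (jacE f).
Qed.

Lemma covd_source k n m (G : 'rV[R]_m.+1 -> 'M[R]_m.+1) U U' (S : 'rV[R]_k.+1 -> 'rV[R]_n.+1)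
    (f W : 'rV[R]_n.+1 -> 'rV[R]_m.+1) x i :
  ropen U -> ropen U' -> msmooth U S -> (forall y, U y -> U' (S y)) ->
  msmooth U' f -> msmooth U' W -> U x ->
  covd G (fun y => f (S y)) (fun y => W (S y)) x i = \sum_j jac S x i j *: covd G f W (S x) j.
Proof.
move=> rU rU' sS SU sf sW Ux; rewrite covdE.
rewrite (mdiff_mpd i (ropenH rU Ux) (chain_rule rU rU' sS SU sW Ux)).
under [RHS]eq_bigr do rewrite covdE scalerDr.
rewrite big_split; congr (_ + _) => /=; under [RHS]eq_bigr do rewrite scalemxAr.
rewrite -mulmx_sumr; congr (_ *m _); rewrite (jac_comp rU rU' sS SU sf Ux).
under eq_bigr do rewrite mxE scaler_suml; rewrite exchange_big; apply: eq_bigr => j _ /=.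
by rewrite scaler_sumr; apply: eq_bigr => a _; rewrite scalerA.
Qed.

Lemma hdiff_min_bdry n (f : 'rV[R]_n.+1 -> R) (x g : 'rV[R]_n.+1) :
  x 0 ord_max = 0 -> f x = 0 -> (\forall y \near hnbhs x, 0 <= f y) -> hdiff f x g ->
  (forall i, i != ord_max -> g 0 i = 0) /\ 0 <= g 0 ord_max.
Proof.
move=> xm fx f0 hf; have Hx : half_space x by rewrite /half_space /= xm.
have fm : \forall y \near hnbhs x, f x <= f y by rewrite fx.
split=> [i im|].
  have Hs h : half_space (shiftc x i h) by rewrite /half_space /= shiftcE eq_sym (negbTE im) mulr0 addr0 xm.
  have h1 : 0 <= 1 * g 0 i by apply: hdiff_min hf fm _ _ => //; [rewrite normr1|exists 1].
  have h2 : 0 <= -1 * g 0 i by apply: hdiff_min hf fm _ _ => //; [rewrite normrN1|exists 1].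
  by apply/eqP; rewrite eq_le; apply/andP; split; move: h1 h2; rewrite mul1r mulN1r oppr_ge0.
have : 0 <= 1 * g 0 ord_max; last by rewrite mul1r.
apply: hdiff_min hf fm _ _ => //; first by rewrite normr1.
exists 1 => // h /andP[h0 _]; apply: shiftcP => //; by rewrite mul1r ltW.
Qed.

End CovariantDerivative.

(** * Transformation laws under a change of patch *)

Section ChangeOfPatch.
Context (R : realType) (n : nat).
Context (V V' : set 'rV[R]_n.+1) (G G' : 'rV[R]_n.+1 -> 'M[R]_n.+1) (T : 'rV[R]_n.+1 -> 'rV[R]_n.+1).
Hypotheses (rV : ropen V) (rV' : ropen V') (sG : msmooth V G) (sG' : msmooth V' G').
Hypotheses (symG : forall x, V x -> (G x)^T = G x) (uG : forall x, V x -> G x \in unitmx).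
Hypotheses (symG' : forall x, V' x -> (G' x)^T = G' x) (uG' : forall x, V' x -> G' x \in unitmx).
Hypotheses (sT : msmooth V T) (TV : forall x, V x -> V' (T x)).
Local Notation J := (jac T).
Hypotheses (uJ : forall x, V x -> J x \in unitmx).
Hypothesis GE : forall x, V x -> G x = J x *m G' (T x) *m (J x)^T.

Lemma patch_mdiff x : V x -> mdiff T x (fun i => row i (J x)).
Proof using rV sT.
move=> Vx; have -> : (fun i => row i (J x)) = mpd T x by apply/funext => i; rewrite jac_row.
exact: msmooth_mdiff rV sT Vx.
Qed.

Lemma patch_half x : V x -> \forall y \near hnbhs x, half_space (T y).
Proof using rV rV' TV.
move=> Vx; apply: filterS (ropen_near rV Vx) => y /TV; exact: ropenH.
Qed.

Lemma patch_comp p q (A : 'rV[R]_n.+1 -> 'M[R]_(p, q)) x : msmooth V' A -> V x ->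
  mdiff (fun y => A (T y)) x (fun i => \sum_a J x i a *: mpd A (T x) a).
Proof using rV rV' sT TV.
move=> sA Vx; apply: mdiff_comp; [exact: patch_half|exact: patch_mdiff|].
exact: msmooth_mdiff rV' sA (TV Vx).
Qed.

(** The connection form of [G'] pulled back along [T]. *)
Definition conn_pull x i : 'M[R]_n.+1 := \sum_a J x i a *: Gam G' (T x) a.

(* The right-hand side, times [invmx (J x)], satisfies the two properties characterizing
   the Levi-Civita connection of [G]: it is symmetric and compatible with [G]. *)
Lemma Gam_trans x i : V x -> Gam G x i *m J x = mpd J x i + J x *m conn_pull x i.
Proof using rV rV' sG sG' symG uG symG' uG' sT TV uJ GE.
move=> Vx; have sJ := jac_smooth rV sT.
pose L i := (mpd J x i + J x *m conn_pull x i) *m invmx (J x).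
have LJ j : L j *m J x = mpd J x j + J x *m conn_pull x j by rewrite /L mulmxKV// uJ.
suff : (Gam G x i - L i) *m G x = 0.
  move/(congr1 (mulmx^~ (invmx (G x)))); rewrite mul0mx mulmxK ?uG// => /eqP.
  by rewrite subr_eq0 => /eqP ->; exact: LJ.
have sL j k : row k (L j) = row j (L k).
  rewrite /L !row_mul; congr (_ *m _); rewrite !linearD /= (jac_sym _ _ rV sT Vx); congr (_ + _).
  apply/rowP => l; rewrite [LHS]mxE [RHS]mxE ![LHS]mxE ![RHS]mxE.
  under eq_bigr do rewrite /conn_pull summxE mulr_sumr.
  under [RHS]eq_bigr do rewrite /conn_pull summxE mulr_sumr.
  rewrite exchange_big; apply: eq_bigr => a _; apply: eq_bigr => b _.
  by rewrite [X in _ * X]mxE [X in _ = _ * X]mxE (Gam_sym rV' symG' _ _ _ (TV Vx)) mulrCA.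
have LG j : L j *m G x = (mpd J x j + J x *m conn_pull x j) *m (G' (T x) *m (J x)^T).
  by rewrite GE// -mulmxA mulmxA LJ.
have mL j : mpd G x j = L j *m G x + (L j *m G x)^T.
  have h := mdiffM (mdiffM (msmooth_mdiff rV sJ Vx) (patch_comp sG' Vx)) (mdiff_tr (msmooth_mdiff rV sJ Vx)).
  have -> := mdiff_mpd j (ropenH rV Vx) (mdiff_near (ropenH rV Vx) _ h); last first.
    by apply: filterS (ropen_near rV Vx) => y Vy; rewrite GE.
  rewrite /= LG !trmx_mul trmxK linearD /= !trmx_mul symG'; last exact: TV.
  have -> : \sum_a J x j a *: mpd G' (T x) a =
      conn_pull x j *m G' (T x) + G' (T x) *m (conn_pull x j)^T.
    rewrite /conn_pull mulmx_suml linear_sum mulmx_sumr -big_split /=; apply: eq_bigr => a _.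
    rewrite (Gam_metric rV' symG' uG' _ (TV Vx)) scalerDr linearZ /=.
    by rewrite -scalemxAl -scalemxAr.
  rewrite !(mulmxDl, mulmxDr) !mulmxA -!addrA; congr (_ + _); congr (_ + _).
  by rewrite addrC.
suff h0 : forall k, (Gam G x k - L k) *m G x = 0 by exact: h0.
apply: sym_antisym0 => [j k l|j].
  have e : row k ((Gam G x j - L j) *m G x) = row j ((Gam G x k - L k) *m G x).
    rewrite !row_mul !linearB /= sL; congr ((_ - _) *m _).
    by apply/rowP => a; rewrite mxE [RHS]mxE (Gam_sym rV symG).
  by have /rowP/(_ l) := e; rewrite [LHS]mxE [RHS]mxE.
rewrite mulmxBl linearB /=; have := Gam_metric rV symG uG j Vx.
have -> : G x *m (Gam G x j)^T = (Gam G x j *m G x)^T by rewrite trmx_mul symG.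
rewrite mL => /eqP; rewrite addrC -subr_eq opprB => /eqP h.
rewrite -[in RHS]h; move: (Gam G x j *m G x)^T (L j *m G x) => X Y.
by apply/matrixP => a b; rewrite !mxE; lra.
Qed.

(** Differentiate the law of [Gam_trans] and antisymmetrize. The second derivatives of the Jacobian
    cancel by symmetry, its first derivatives cancel against the quadratic terms, and the curvature
    of the pulled-back connection remains. *)
Lemma curv_trans x i j : V x -> curv (Gam G) x i j *m J x =
  J x *m \sum_a \sum_b (J x i a * J x j b) *: curv (Gam G') (T x) a b.
Proof using rV rV' sG sG' symG uG symG' uG' sT TV uJ GE.
move=> Vx; have sJ := jac_smooth rV sT; have Hx := ropenH rV Vx.
have dJ := msmooth_mdiff rV sJ Vx.
have sGa k := Gam_smooth rV sG uG k; have sGa' k := Gam_smooth rV' sG' uG' k.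
pose dA k l : 'M[R]_n.+1 := \sum_a (mpd J x k l a *: Gam G' (T x) a +
    J x l a *: \sum_b J x k b *: mpd (fun y => Gam G' y a) (T x) b).
have hA l : mdiff (conn_pull ^~ l) x (fun k => dA k l).
  apply: mdiff_sum => a; have := dJ l a => hl.
  have := mdiff_scale hl (patch_comp (sGa' a) Vx).
  by congr (mdiff _ _ _); apply/funext => k; rewrite !mxE.
have key k l : mpd (fun y => Gam G y l) x k *m J x =
    mpd (fun y => mpd J y l) x k + mpd J x k *m conn_pull x l + J x *m dA k l - Gam G x l *m mpd J x k.
  have h1 := mdiffM (msmooth_mdiff rV (sGa l) Vx) dJ.
  have h2 := mdiffD (msmooth_mdiff rV (msmooth_mpd l rV sJ) Vx) (mdiffM dJ (hA l)).
  have nE : \forall y \near hnbhs x, mpd J y l + J y *m conn_pull y l = Gam G y l *m J y.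
    by apply: filterS (ropen_near rV Vx) => y Vy; rewrite Gam_trans.
  have := mdiff_mpd k Hx (mdiff_near Hx nE h2); rewrite (mdiff_mpd k Hx h1) /= addrA => e.
  by apply/eqP; rewrite eq_sym subr_eq; apply/eqP.
have key2 k l : Gam G x k *m Gam G x l *m J x = Gam G x k *m mpd J x l +
    (mpd J x k *m conn_pull x l + J x *m (conn_pull x k *m conn_pull x l)).
  by rewrite -mulmxA Gam_trans// mulmxDr mulmxA Gam_trans// mulmxDl mulmxA.
have -> : curv (Gam G) x i j *m J x =
    J x *m (dA i j - dA j i + conn_pull x j *m conn_pull x i - conn_pull x i *m conn_pull x j).
  rewrite /curv !(mulmxBl, mulmxDl) !key !key2 (mpd_sym _ _ rV sJ Vx) !(mulmxBr, mulmxDr).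
  apply/matrixP => a b; rewrite !mxE.
  lra.
congr (_ *m _).
(* The derivative of the Jacobian is symmetric in its two directions, so the terms that do not
   differentiate the connection drop out. *)
have sdA : dA i j - dA j i = \sum_a \sum_b (J x i a * J x j b) *:
   (mpd (fun y => Gam G' y b) (T x) a - mpd (fun y => Gam G' y a) (T x) b).
  rewrite /dA !big_split /=.
  have -> : \sum_a mpd J x j i a *: Gam G' (T x) a = \sum_a mpd J x i j a *: Gam G' (T x) a.
    apply: eq_bigr => a _; congr (_ *: _).
    by have /rowP/(_ a) := jac_sym i j rV sT Vx; rewrite [LHS]mxE [RHS]mxE.
  rewrite opprD addrACA subrr add0r.
  under [X in X - _]eq_bigr do rewrite scaler_sumr.
  under [X in _ - X]eq_bigr do rewrite scaler_sumr.
  rewrite [X in X - _]exchange_big -sumrB; apply: eq_bigr => a _; rewrite -sumrB; apply: eq_bigr => b _.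
  by rewrite !scalerA scalerBr mulrC.
have sAA k l : conn_pull x k *m conn_pull x l =
    \sum_a \sum_b (J x k a * J x l b) *: (Gam G' (T x) a *m Gam G' (T x) b).
  rewrite /conn_pull mulmx_suml; apply: eq_bigr => a _; rewrite mulmx_sumr; apply: eq_bigr => b _.
  by rewrite -scalemxAl -scalemxAr scalerA.
rewrite sdA !sAA [X in _ + X - _]exchange_big -sumrN -!big_split /=; apply: eq_bigr => a _.
rewrite -sumrN -!big_split /=; apply: eq_bigr => b _.
by rewrite /curv -addrA !scalerDr !scalerN (mulrC (J x j _)) addrA.
Qed.

(** In the trace the inverse Jacobian of the curvature law meets the Jacobian of the contracted
    index. *)
Lemma ricci_trans x : V x -> ricci G x = J x *m ricci G' (T x) *m (J x)^T.
Proof using rV rV' sG sG' symG uG symG' uG' sT TV uJ GE.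
move=> Vx; rewrite (ricci_curv rV sG symG Vx) (ricci_curv rV' sG' symG' (TV Vx)).
apply/matrixP => i j; rewrite mxE.
pose N a : 'M[R]_n.+1 := \sum_b J x j b *: curv (Gam G') (T x) a b.
have cE k : curv (Gam G) x k j = \sum_a J x k a *: (J x *m N a *m invmx (J x)).
  rewrite -[LHS](mulmxK (uJ Vx)) curv_trans// mulmx_sumr mulmx_suml; apply: eq_bigr => a _.
  rewrite scalemxAl scalemxAr scaler_sumr; congr (_ *m _ *m _); apply: eq_bigr => b _.
  by rewrite scalerA.
transitivity (\sum_a (J x *m N a) i a).
  under eq_bigr do rewrite cE summxE; rewrite exchange_big; apply: eq_bigr => a _.
  rewrite -[in RHS](mulmxKV (uJ Vx) (J x *m N a)) [RHS]mxE; apply: eq_bigr => k _.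
  by rewrite mxE mulrC.
under eq_bigr do rewrite mxE; rewrite exchange_big [RHS]mxE.
under [RHS]eq_bigr do rewrite mxE mulr_suml.
rewrite [RHS]exchange_big; apply: eq_bigr => m _ /=.
under [RHS]eq_bigr do rewrite [X in _ * X * _]mxE [X in _ * X]mxE -mulrA mulr_suml mulr_sumr.
rewrite [RHS]exchange_big; apply: eq_bigr => a _ /=; rewrite summxE mulr_sumr.
by apply: eq_bigr => b _; rewrite [X in _ * X]mxE (mulrC (J x j b)).
Qed.

(** The derivative that falls on the Jacobian of [T] is the inhomogeneous term in the law of
    [Gam]. *)
Lemma covd_target m U (f W : 'rV[R]_m.+1 -> 'rV[R]_n.+1) x i : ropen U -> msmooth U f -> msmooth U W ->
  (forall y, U y -> V (f y)) -> U x ->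
  covd G' (fun y => T (f y)) (fun y => W y *m J (f y)) x i = covd G f W x i *m J (f x).
Proof using rV rV' sG sG' symG uG symG' uG' sT TV uJ GE.
move=> rU sf sW fU Ux; have sJ := jac_smooth rV sT; have Hx := ropenH rU Ux.
rewrite !covdE.
have h := mdiffM (msmooth_mdiff rU sW Ux) (chain_rule rU rV sf fU sJ Ux).
rewrite (mdiff_mpd i Hx h) mulmxDl /= -addrA; congr (_ + _).
rewrite -!mulmxA -mulmxDr mulmx_suml; congr (_ *m _).
rewrite (jac_comp rU rV sf fU sT Ux).
transitivity (\sum_a jac f x i a *: (mpd J (f x) a + J (f x) *m conn_pull (f x) a)); last first.
  by apply: eq_bigr => a _; rewrite -scalemxAl Gam_trans//; exact: fU.
under [RHS]eq_bigr do rewrite scalerDr.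
rewrite big_split /=; congr (_ + _).
under [RHS]eq_bigr do rewrite scalemxAr; rewrite -mulmx_sumr; congr (_ *m _).
under eq_bigr do rewrite mxE scaler_suml; rewrite exchange_big; apply: eq_bigr => a _ /=.
by rewrite /conn_pull scaler_sumr; apply: eq_bigr => b _; rewrite scalerA.
Qed.

Hypothesis posG : forall x, V x -> 0 < invmx (G x) ord_max ord_max.
Hypothesis posG' : forall x, V' x -> 0 < invmx (G' x) ord_max ord_max.
Hypothesis bT : forall x, V x -> x 0 ord_max = 0 ->
  (forall i, i != ord_max -> J x i ord_max = 0) /\ 0 < J x ord_max ord_max.

Lemma outer_normal_smooth : msmooth V (outer_normal G).
Proof using rV sG uG posG.
have sGi := msmooth_inv rV sG uG => i j.
apply: smooth_eq (_ : smooth_on V (fun x => - ((Num.sqrt (invmx (G x) ord_max ord_max))^-1 * invmx (G x) ord_max j))) => //.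
  by move=> x _; rewrite /outer_normal !mxE mulNr.
apply: smoothN => //; apply: smoothM => //; apply: smoothV => //; last by apply: smooth_sqrt.
by move=> x Vx; rewrite sqrtr_eq0 -ltNge; exact: posG.
Qed.

(** At the boundary the last column of the Jacobian is a positive multiple of the last basis vector.
    The gradient of the last coordinate therefore changes only by a positive factor, which the
    normalization removes. *)
Lemma outer_normal_trans x : V x -> x 0 ord_max = 0 -> outer_normal G' (T x) = outer_normal G x *m J x.
Proof using uJ GE bT uG uG' TV.
move=> Vx xm; have [J0 Jm] := bT Vx xm; set m := ord_max in J0 Jm *.
have Gi : invmx (G' (T x)) = (J x)^T *m invmx (G x) *m J x.
  have e : invmx (G x) *m J x *m G' (T x) *m (J x)^T = 1%:M.
    by rewrite -!mulmxA (mulmxA (J x)) -GE// mulVmx// uG.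
  by rewrite -[LHS]mul1mx -(mulmx1C e) !mulmxA mulmxK//; apply: uG'; exact: TV.
have rE : row m (J x)^T = J x m m *: delta_mx 0 m.
  apply/rowP => k; rewrite [LHS]mxE [LHS]mxE [RHS]mxE [X in _ = _ * X]mxE /=; case: (eqVneq k m) => [->|km]; first by rewrite mulr1.
  by rewrite J0// mulr0.
have e1 : row m (invmx (G' (T x))) = J x m m *: (row m (invmx (G x)) *m J x).
  by rewrite Gi !row_mul rE -scalemxAl -rowE -scalemxAl.
have e2 : invmx (G' (T x)) m m = J x m m ^+ 2 * invmx (G x) m m.
  have /rowP/(_ m) := e1; rewrite [LHS]mxE [RHS]mxE => ->.
  rewrite [X in _ * X]mxE (bigD1 m)//= big1 ?addr0 => [|k km]; last by rewrite J0// mulr0.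
  by rewrite [X in _ * (X * _)]mxE; ring.
rewrite /outer_normal -/m e1 e2 sqrtrM ?sqr_ge0// sqrtr_sqr ger0_norm ?ltW// -scalemxAl scalerA.
by congr (_ *: _); rewrite invfM mulNr mulrAC mulVf ?gt_eqF// mul1r.
Qed.

(** The law of the normal holds on the boundary only, so only its tangential derivatives can be
    compared; [u 0 ord_max = 0] keeps the transversal one out. *)
Lemma bdry_sff_trans (x u v : 'rV[R]_n.+1) : V x -> x 0 ord_max = 0 -> u 0 ord_max = 0 ->
  bdry_sff G x u v = bdry_sff G' (T x) (u *m J x) (v *m J x).
Proof using rV rV' sG sG' symG uG symG' uG' sT TV uJ GE bT posG posG'.
move=> Vx xm um; have Hx := ropenH rV Vx.
have sid W : ropen W -> msmooth W (@idfun 'rV[R]_n.+1) by move=> rW i j; rewrite ord1; exact: smooth_coord.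
have sN := outer_normal_smooth.
have sN' : msmooth V' (outer_normal G').
  have sGi := msmooth_inv rV' sG' uG' => i j.
  apply: smooth_eq (_ : smooth_on V' (fun x => - ((Num.sqrt (invmx (G' x) ord_max ord_max))^-1 * invmx (G' x) ord_max j))) => //.
    by move=> y _; rewrite /outer_normal !mxE mulNr.
  apply: smoothN => //; apply: smoothM => //; apply: smoothV => //; last by apply: smooth_sqrt.
  by move=> y Vy; rewrite sqrtr_eq0 -ltNge; exact: posG'.
have key i : i != ord_max ->
    covd G id (outer_normal G) x i *m J x = \sum_j J x i j *: covd G' id (outer_normal G') (T x) j.
  move=> im.
  rewrite -(covd_target (f := id) i rV (sid _ rV) sN _ Vx)//.
  rewrite -(covd_source G' (f := id) i rV rV' sT TV (sid _ rV') sN' Vx) !covdE /=.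
  rewrite outer_normal_trans//; congr (_ + _); apply/rowP => k; rewrite !mpdE.
  apply: pderiv_bdry => //; apply: filterS (ropen_near rV Vx) => y Vy ym.
  by rewrite outer_normal_trans.
rewrite /bdry_sff.
transitivity (\sum_i \sum_j u 0 i * J x i j * ip (G' (T x)) (covd G' id (outer_normal G') (T x) j) (v *m J x)); last first.
  by rewrite exchange_big; apply: eq_bigr => j _; rewrite -mulr_suml [X in _ = X * _]mxE.
apply: eq_bigr => i _; have [->|im] := eqVneq i ord_max.
  by rewrite um mul0r big1// => j _; rewrite !mul0r.
rewrite GE// ip_form key// /ip !mulmx_suml summxE mulr_sumr; apply: eq_bigr => j _.
by rewrite -!scalemxAl [in LHS]mxE mulrA.
Qed.

End ChangeOfPatch.

Section ContinuousMatrices.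
Context (R : realType) (n : nat).
Implicit Types (x : 'rV[R]_n.+1) (V : set 'rV[R]_n.+1).

Definition mhcont p q (A : 'rV[R]_n.+1 -> 'M[R]_(p, q)) x := forall a b, hcont (fun y => A y a b) x.

Lemma mhcont_smooth V p q (A : 'rV[R]_n.+1 -> 'M[R]_(p, q)) x : ropen V -> V x -> msmooth V A -> mhcont A x.
Proof. by move=> rV Vx sA a b; exact: (smooth_hcont rV Vx (sA a b)). Qed.

Lemma mhcontD p q (A B : 'rV[R]_n.+1 -> 'M[R]_(p, q)) x : mhcont A x -> mhcont B x ->
  mhcont (fun y => A y + B y) x.
Proof.
move=> hA hB a b; rewrite /hcont mxE.
rewrite (_ : (fun y => _) = fun y => A y a b + B y a b); last by apply/funext => y; rewrite mxE.
by apply: cvgD; [exact: hA|exact: hB].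
Qed.

Lemma mhcont_scale p q (u : 'rV[R]_n.+1 -> R) (A : 'rV[R]_n.+1 -> 'M[R]_(p, q)) x : hcont u x -> mhcont A x ->
  mhcont (fun y => u y *: A y) x.
Proof.
move=> hu hA a b; rewrite /hcont mxE.
rewrite (_ : (fun y => _) = fun y => u y * A y a b); last by apply/funext => y; rewrite mxE.
by apply: cvgM; [exact: hu|exact: hA].
Qed.

Lemma mhcont_sum p q (J : finType) (A : J -> 'rV[R]_n.+1 -> 'M[R]_(p, q)) x :
  (forall j, mhcont (A j) x) -> mhcont (fun y => \sum_j A j y) x.
Proof.
move=> hA a b; rewrite /hcont summxE.
rewrite (_ : (fun y => _) = fun y => \sum_j A j y a b); last by apply/funext => y; rewrite summxE.
by apply: cvg_rsum => j _; exact: hA.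
Qed.

Lemma mhcontM p q r (A : 'rV[R]_n.+1 -> 'M[R]_(p, q)) (B : 'rV[R]_n.+1 -> 'M[R]_(q, r)) x :
  mhcont A x -> mhcont B x -> mhcont (fun y => A y *m B y) x.
Proof.
move=> hA hB a b; rewrite /hcont mxE.
rewrite (_ : (fun y => _) = fun y => \sum_k A y a k * B y k b); last by apply/funext => y; rewrite mxE.
by apply: cvg_rsum => j _; apply: cvgM; [exact: hA|exact: hB].
Qed.

Lemma mhcont_tr p q (A : 'rV[R]_n.+1 -> 'M[R]_(p, q)) x : mhcont A x -> mhcont (fun y => (A y)^T) x.
Proof.
move=> hA a b; rewrite /hcont mxE.
rewrite (_ : (fun y => _) = fun y => A y b a); last by apply/funext => y; rewrite mxE.
exact: hA.
Qed.

Lemma mhcont_comp m p q (V : set 'rV[R]_m.+1) (f : 'rV[R]_n.+1 -> 'rV[R]_m.+1) (A : 'rV[R]_m.+1 -> 'M[R]_(p, q)) x :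
  mhcont f x -> (\forall y \near hnbhs x, half_space (f y)) ->
  ropen V -> V (f x) -> msmooth V A -> mhcont (fun y => A (f y)) x.
Proof.
move=> hf Hf rV Vx sA a b; have h := smooth_hcont rV Vx (sA a b).
apply: (cvg_comp _ _ _ h) => B; rewrite /hnbhs /within /= => /nbhs_ballP[e /= e0 hB].
have : \forall y \near hnbhs x, half_space (f y) /\ forall j, `|f x 0 j - f y 0 j| < e.
  apply: filterI => //.
  apply: (@filter_forall _ _ (fun j y => `|f x 0 j - f y 0 j| < e) (hnbhs x)) => j.
  by apply: (hcont_dist (f := fun y => f y 0 j)) => //; exact: hf.
by apply: filterS => y [Hy yj]; apply: hB => //; split=> // i j; rewrite ord1; exact: yj.
Qed.

End ContinuousMatrices.

(** * Geometric quantities of a Riemannian manifold in two charts *)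

Section MetricCharts.
Context (R : realType) (n : nat) (X : riemannian R n).
Implicit Types (c d : chart R X n) (p : X).

Lemma metric_in_trans c d p : atlas X c -> atlas X d -> cdom c p -> cdom d p ->
  metric_in c (cmap c p) = tjac c d p *m metric_in d (cmap d p) *m (tjac c d p)^T.
Proof.
move=> ac ad cp dp; rewrite !metric_inE// !to_prefE.
rewrite (tjac_comp ac ad (chart_atlas p) cp dp (chart_dom p)) trmx_mul.
by rewrite !mulmxA.
Qed.

Lemma metric_at_coord p : metric_at p (Defs.coord p) = metric p.
Proof.
rewrite /metric_at metric_inE; [|exact: chart_atlas|exact: chart_dom].
rewrite to_prefE tjac_id ?trmx1 ?mulmx1 ?mul1mx//; [exact: chart_atlas|exact: chart_dom].
Qed.

Lemma spd_inv_diag m (G : 'M[R]_m) i : G^T = G -> (forall v : 'rV[R]_m, v != 0 -> 0 < ip G v v) ->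
  0 < invmx G i i.
Proof.
move=> Gs Gp; have uG := spd_unit Gp.
have -> : invmx G i i = ip G (row i (invmx G)) (row i (invmx G)).
  rewrite /ip -row_mul mulVmx// mxE (bigD1 i)//= big1 ?addr0 => [|k ki].
    by rewrite !mxE eqxx mul1r.
  by rewrite !mxE eq_sym (negbTE ki) mul0r.
apply: Gp; apply/eqP => /(congr1 (mulmx^~ G)); rewrite -row_mul mulVmx// mul0mx => /rowP/(_ i).
by rewrite !mxE eqxx => /eqP; rewrite oner_eq0.
Qed.

Lemma metric_in_inv_diag c x i : atlas X c -> cimg c x -> 0 < invmx (metric_in c x) i i.
Proof. by move=> ac cx; apply: spd_inv_diag; [exact: metric_in_sym|move=> v; exact: metric_in_pos]. Qed.

Lemma tdom_cimg c d x : tdom c d x -> cimg c x.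
Proof. by move=> [p [cp _] <-]; exact: cmap_img. Qed.

Lemma trans_msmooth c d : atlas X c -> atlas X d -> msmooth (tdom c d) (trans c d).
Proof. by move=> ac ad i j; rewrite ord1; exact: trans_smooth. Qed.

Lemma metric_in_tdom_smooth c d : atlas X c -> atlas X d -> msmooth (tdom c d) (metric_in c).
Proof.
move=> ac ad i j; apply: smooth_sub (metric_in_smooth ac i j); [exact: cimg_ropen|exact: tdom_ropen|exact: tdom_cimg].
Qed.

(** In the chart [c] the last coordinate of [d] has a minimum on the boundary. Its tangential
    derivatives vanish there, and the inward one is nonzero because the Jacobian is invertible. *)
Lemma tjac_bdry c d p : atlas X c -> atlas X d -> cdom c p -> cdom d p -> bdry p ->
  (forall i, i != ord_max -> tjac c d p i ord_max = 0) /\ 0 < tjac c d p ord_max ord_max.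
Proof.
move=> ac ad cp dp bp.
have xm : cmap c p 0 ord_max = 0 by apply/(bdryP ac cp).
have ym : trans c d (cmap c p) 0 ord_max = 0 by rewrite trans_cmap//; apply/(bdryP ad dp).
have [] := hdiff_min_bdry xm ym (trans_half_near ac ad cp dp) (trans_hdiff _ ac ad cp dp).
rewrite mxE => J0 Jm; have {}J0 i : i != ord_max -> tjac c d p i ord_max = 0 by move=> /J0; rewrite mxE.
split=> //; rewrite lt_neqAle Jm andbT eq_sym; apply/eqP => J1.
have := tjacV ad ac dp cp => /matrixP/(_ ord_max ord_max); rewrite !mxE eqxx big1 => [/eqP|k _].
  by rewrite eq_sym oner_eq0.
by have [->|km] := eqVneq k ord_max; rewrite ?J1 ?J0// mulr0.
Qed.

Section TwoCharts.
Context (c d : chart R X n) (ac : atlas X c) (ad : atlas X d).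
Let rV := tdom_ropen ac ad.
Let rV' := tdom_ropen ad ac.
Let sG := metric_in_tdom_smooth ac ad.
Let sG' := metric_in_tdom_smooth ad ac.
Let symG x (_ : tdom c d x) := metric_in_sym c x.
Let symG' x (_ : tdom d c x) := metric_in_sym d x.
Let uG x (h : tdom c d x) := metric_in_unit ac (tdom_cimg h).
Let uG' x (h : tdom d c x) := metric_in_unit ad (tdom_cimg h).
Let sT := trans_msmooth ac ad.
Let TV x (h : tdom c d x) := trans_tdom ac h.
Let posG x (h : tdom c d x) := metric_in_inv_diag ord_max ac (tdom_cimg h).
Let posG' x (h : tdom d c x) := metric_in_inv_diag ord_max ad (tdom_cimg h).

Let uJ x : tdom c d x -> jac (trans c d) x \in unitmx.
Proof. by move=> [p [cp dp] <-]; exact: tjac_unit. Qed.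

Let GE x : tdom c d x -> metric_in c x =
  jac (trans c d) x *m metric_in d (trans c d x) *m (jac (trans c d) x)^T.
Proof. by move=> [p [cp dp] <-]; rewrite trans_cmap//; exact: metric_in_trans. Qed.

Let bT x : tdom c d x -> x 0 ord_max = 0 ->
  (forall i, i != ord_max -> jac (trans c d) x i ord_max = 0) /\ 0 < jac (trans c d) x ord_max ord_max.
Proof. by move=> [p [cp dp] <-] xm; apply: tjac_bdry => //; apply/(bdryP ac cp). Qed.

Lemma ricci_chart p : cdom c p -> cdom d p -> ricci (metric_in c) (cmap c p) =
  tjac c d p *m ricci (metric_in d) (cmap d p) *m (tjac c d p)^T.
Proof.
move=> cp dp; rewrite (ricci_trans rV rV' sG sG' symG uG symG' uG' sT TV uJ GE (tdomP cp dp)).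
by rewrite trans_cmap.
Qed.

Lemma normal_chart p : cdom c p -> cdom d p -> bdry p ->
  outer_normal (metric_in d) (cmap d p) = outer_normal (metric_in c) (cmap c p) *m tjac c d p.
Proof.
move=> cp dp bp; have xm : cmap c p 0 ord_max = 0 by apply/(bdryP ac cp).
by rewrite -(outer_normal_trans uG uG' TV uJ GE bT (tdomP cp dp) xm) trans_cmap.
Qed.

Lemma bdry_sff_chart p (u v : 'rV[R]_n.+1) : cdom c p -> cdom d p -> bdry p -> u 0 ord_max = 0 ->
  bdry_sff (metric_in c) (cmap c p) u v =
  bdry_sff (metric_in d) (cmap d p) (u *m tjac c d p) (v *m tjac c d p).
Proof.
move=> cp dp bp um; have xm : cmap c p 0 ord_max = 0 by apply/(bdryP ac cp).
rewrite (bdry_sff_trans rV rV' sG sG' symG uG symG' uG' sT TV uJ GE posG posG' bT v (tdomP cp dp) xm um).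
by rewrite trans_cmap.
Qed.

Lemma covd_chart m U (f W : 'rV[R]_m.+1 -> 'rV[R]_n.+1) x i : ropen U -> msmooth U f -> msmooth U W ->
  (forall y, U y -> tdom c d (f y)) -> U x ->
  covd (metric_in d) (fun y => trans c d (f y)) (fun y => W y *m jac (trans c d) (f y)) x i
  = covd (metric_in c) f W x i *m jac (trans c d) (f x).
Proof. by apply: (covd_target rV rV' sG sG' symG uG symG' uG' sT TV uJ GE). Qed.

End TwoCharts.

Lemma ricci_smooth c : atlas X c -> msmooth (cimg c) (ricci (metric_in c)).
Proof.
move=> ac i j; have rV := cimg_ropen ac; have sG := metric_in_smooth ac.
have uG x (h : cimg c x) := metric_in_unit ac h.
have sGa k a b : smooth_on (cimg c) (fun x => christoffel (metric_in c) x b k a).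
  by apply: smooth_eq (Gam_smooth rV sG uG k a b) => // x _; rewrite GamE.
apply: smooth_eq (_ : smooth_on (cimg c) (fun x => let Gam := christoffel (metric_in c) in
    \sum_k pderiv k (fun y => Gam y k i j) x
     - \sum_k pderiv j (fun y => Gam y k i k) x
     + \sum_k \sum_l Gam x k k l * Gam x l i j
     - \sum_k \sum_l Gam x k j l * Gam x l i k)) => // [x _|]; first by rewrite [RHS]mxE.
cbv zeta; apply: smoothB => //; [apply: smoothD => //; [apply: smoothB => //|]|].
- by apply: smooth_sum => // k _; apply: smooth_pderiv.
- by apply: smooth_sum => // k _; apply: smooth_pderiv.
- by apply: smooth_sum => // k _; apply: smooth_sum => // l _; apply: smoothM.
- by apply: smooth_sum => // k _; apply: smooth_sum => // l _; apply: smoothM.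
Qed.

End MetricCharts.

(** * Continuity of the potentials *)

Section SurfaceCharts.
Context (R : realType) (n m : nat) (S : riemannian R n) (M : riemannian R m).
Context (F : S -> M) (nu : S -> 'rV[R]_m.+1).
Hypotheses (smF : smooth_map F) (smnu : smooth_field_along F nu).
Implicit Types (c : chart R S n) (d : chart R M m) (p : S).

Definition ldom c d := cmap c @` (cdom c `&` F @^-1` cdom d).

Lemma ldom_open d : atlas M d -> open (F @^-1` cdom d).
Proof. by move=> ad; apply: open_comp; [move=> p _; exact: (proj1 smF)|exact: cdom_open]. Qed.

Lemma ldom_ropen c d : atlas S c -> atlas M d -> ropen (ldom c d).
Proof. by move=> ac ad; apply: image_ropen => //; exact: ldom_open. Qed.

Lemma ldomP c d p : cdom c p -> cdom d (F p) -> ldom c d (cmap c p).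
Proof. by move=> cp dp; exists p. Qed.

Lemma lmap_smooth c d : atlas S c -> atlas M d -> msmooth (ldom c d) (local_map F c d).
Proof. by move=> ac ad i j; rewrite ord1; exact: (proj2 smF). Qed.

Lemma lfield_smooth c d : atlas S c -> atlas M d -> msmooth (ldom c d) (local_field F nu c d).
Proof. by move=> ac ad i j; rewrite ord1; exact: smnu. Qed.

Lemma lmap_cmap c d p : atlas S c -> cdom c p -> local_map F c d (cmap c p) = cmap d (F p).
Proof. by move=> ac cp; rewrite /local_map /= cinvK. Qed.

Lemma lfield_cmap c d p : atlas S c -> cdom c p ->
  local_field F nu c d (cmap c p) = nu p *m tjac (chart_at (F p)) d (F p).
Proof. by move=> ac cp; rewrite /local_field cinvK. Qed.

Definition cov_normal c d x : 'M[R]_(n.+1, m.+1) :=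
  \matrix_i covd (metric_in d) (local_map F c d) (local_field F nu c d) x i.

(** [sff] uses charts that vary with the point, so its regularity is read off from this expression
    in two fixed charts. *)
Definition sff_in c d x : 'M[R]_n.+1 :=
  cov_normal c d x *m metric_in d (local_map F c d x) *m (jac (local_map F c d) x)^T.

Lemma sff_pref p : sff F nu p = sff_in (chart_at p) (chart_at (F p)) (Defs.coord p).
Proof.
apply/matrixP => i j; rewrite mxE /sff_in lmap_cmap; [|exact: chart_atlas|exact: chart_dom].
rewrite -(metric_at_coord (F p)) -/(metric_at (F p)) -/(Defs.coord (F p)) -/(dmap F p).
rewrite [RHS]mxE /ip mxE; apply: eq_bigr => k _.
have -> : covd (metric_at (F p)) (local_map F (chart_at p) (chart_at (F p)))
   (local_field F nu (chart_at p) (chart_at (F p))) (Defs.coord p) i =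
   row i (cov_normal (chart_at p) (chart_at (F p)) (Defs.coord p)) by rewrite rowK.
by rewrite -row_mul [in X in X * _]mxE; congr (_ * _); rewrite !mxE.
Qed.

Section FourCharts.
Context (c c' : chart R S n) (d d' : chart R M m).
Hypotheses (ac : atlas S c) (ac' : atlas S c') (ad : atlas M d) (ad' : atlas M d').
Context (p : S).
Hypotheses (cp : cdom c p) (cp' : cdom c' p) (dp : cdom d (F p)) (dp' : cdom d' (F p)).
Let U := cmap c @` (cdom c `&` ((cdom c' `&` F @^-1` cdom d) `&` F @^-1` cdom d')).
Let x := cmap c p.

Let rU : ropen U.
Proof.
apply: image_ropen => //; apply: openI; [apply: openI|]; by [exact: cdom_open|exact: ldom_open].
Qed.
Let Ux : U x. Proof. by exists p. Qed.

Let Ul : U `<=` ldom c d.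
Proof. by move=> _ [q [cq [[_ dq] _]] <-]; exists q. Qed.

Let Ut : U `<=` tdom c c'.
Proof. by move=> _ [q [cq [[cq' _] _]] <-]; exists q. Qed.

Let sl : msmooth U (local_map F c d).
Proof.
by move=> i j; apply: smooth_sub (lmap_smooth ac ad i j) => //; exact: ldom_ropen.
Qed.

Let sf : msmooth U (local_field F nu c d).
Proof.
by move=> i j; apply: smooth_sub (lfield_smooth ac ad i j) => //; exact: ldom_ropen.
Qed.

Let st : msmooth U (trans c c').
Proof.
by move=> i j; apply: smooth_sub (trans_msmooth ac ac' i j) => //; exact: tdom_ropen.
Qed.

Let lU y : U y -> tdom d d' (local_map F c d y).
Proof. by move=> [q [cq [[cq' dq] dq']] <-]; rewrite lmap_cmap//; exists (F q). Qed.

Let tU y : U y -> ldom c' d' (trans c c' y).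
Proof. by move=> [q [cq [[cq' dq] dq']] <-]; rewrite trans_cmap//; exists q. Qed.

Let mapE y : U y -> trans d d' (local_map F c d y) = local_map F c' d' (trans c c' y).
Proof.
by move=> [q [cq [[cq' dq] dq']] <-]; rewrite lmap_cmap// trans_cmap// trans_cmap// lmap_cmap.
Qed.

Let fieldE y : U y -> local_field F nu c d y *m jac (trans d d') (local_map F c d y) =
  local_field F nu c' d' (trans c c' y).
Proof.
move=> [q [cq [[cq' dq] dq']] <-]; rewrite lmap_cmap// trans_cmap// !lfield_cmap// -mulmxA.
by rewrite -tjac_comp//; [exact: chart_atlas|exact: chart_dom].
Qed.

Lemma jac_lmap_trans : jac (local_map F c d) x *m tjac d d' (F p) =
  tjac c c' p *m jac (local_map F c' d') (cmap c' p).
Proof.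
have -> : tjac d d' (F p) = jac (trans d d') (local_map F c d x) by rewrite lmap_cmap.
have -> : cmap c' p = trans c c' x by rewrite trans_cmap.
rewrite -(jac_comp rU (tdom_ropen ad ad') sl lU (trans_msmooth ad ad') Ux).
rewrite -(jac_comp rU (ldom_ropen ac' ad') st tU (lmap_smooth ac' ad') Ux).
apply/matrixP => i j; rewrite !jacE; apply: pderiv_eq rU Ux _ => y Uy; by rewrite mapE.
Qed.

(** The target patch is changed first, with the source fixed, and then the source by the chain
    rule. *)
Lemma cov_normal_trans : cov_normal c d x *m tjac d d' (F p) =
  tjac c c' p *m cov_normal c' d' (cmap c' p).
Proof.
have -> : tjac d d' (F p) = jac (trans d d') (local_map F c d x) by rewrite lmap_cmap.
have -> : cmap c' p = trans c c' x by rewrite trans_cmap.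
apply/row_matrixP => i; rewrite !row_mul rowK -(covd_chart ad ad' i rU sl sf lU Ux).
transitivity (covd (metric_in d') (fun y => local_map F c' d' (trans c c' y))
  (fun y => local_field F nu c' d' (trans c c' y)) x i).
  apply: covd_near => //; [exact: ropenH rU Ux| | |exact: mapE|exact: fieldE].
  - by apply: filterS (ropen_near rU Ux) => y; exact: mapE.
  - by apply: filterS (ropen_near rU Ux) => y; exact: fieldE.
rewrite (covd_source _ _ rU (ldom_ropen ac' ad') st tU (lmap_smooth ac' ad') (lfield_smooth ac' ad') Ux).
apply/rowP => k; rewrite summxE [RHS]mxE; apply: eq_bigr => j _.
by rewrite [LHS]mxE [X in _ = X * _]mxE [X in _ = _ * X]mxE.
Qed.

Lemma sff_in_trans : sff_in c d x = tjac c c' p *m sff_in c' d' (cmap c' p) *m (tjac c c' p)^T.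
Proof.
rewrite /sff_in !lmap_cmap// (metric_in_trans ad ad' dp dp') !mulmxA cov_normal_trans.
by rewrite -(mulmxA _ _ (jac _ _)^T) -trmx_mul jac_lmap_trans trmx_mul !mulmxA.
Qed.

End FourCharts.

Lemma lmap_half_near c d p : atlas S c -> atlas M d -> cdom c p -> cdom d (F p) ->
  \forall y \near hnbhs (cmap c p), half_space (local_map F c d y).
Proof.
move=> ac ad cp dp; apply: filterS (ropen_near (ldom_ropen ac ad) (ldomP cp dp)) => _ [q [cq dq] <-].
by rewrite lmap_cmap//; exact: cmap_half.
Qed.

Section Continuity.
Context (c : chart R S n) (d : chart R M m) (p : S).
Hypotheses (ac : atlas S c) (ad : atlas M d) (cp : cdom c p) (dp : cdom d (F p)).
Let x := cmap c p.
Let rl := ldom_ropen ac ad.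
Let lx := ldomP cp dp.

Lemma lmap_mhcont : mhcont (local_map F c d) x.
Proof. exact: mhcont_smooth rl lx (lmap_smooth ac ad). Qed.

Lemma lfield_mhcont : mhcont (local_field F nu c d) x.
Proof. exact: mhcont_smooth rl lx (lfield_smooth ac ad). Qed.

Lemma jac_lmap_mhcont : mhcont (jac (local_map F c d)) x.
Proof.
exact: mhcont_smooth rl lx (jac_smooth rl (lmap_smooth ac ad)).
Qed.

Lemma comp_mhcont k q (A : 'rV[R]_m.+1 -> 'M[R]_(k, q)) : msmooth (cimg d) A ->
  mhcont (fun y => A (local_map F c d y)) x.
Proof.
move=> sA; apply: mhcont_comp sA; [exact: lmap_mhcont|exact: lmap_half_near|exact: cimg_ropen|].
by rewrite lmap_cmap//; exact: cmap_img.
Qed.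

Lemma sff_in_mhcont : mhcont (sff_in c d) x.
Proof.
apply: mhcontM; [apply: mhcontM|by apply: mhcont_tr; exact: jac_lmap_mhcont].
  move=> i j.
  rewrite (_ : (fun y => _) = fun y => (mpd (local_field F nu c d) y i + local_field F nu c d y *m
     \sum_a jac (local_map F c d) y i a *: Gam (metric_in d) (local_map F c d y) a) 0 j); last first.
    by apply/funext => y; rewrite mxE covdE.
  apply: mhcontD; first exact: mhcont_smooth rl lx (msmooth_mpd _ rl (lfield_smooth ac ad)).
  apply: mhcontM; first exact: lfield_mhcont.
  apply: mhcont_sum => a; apply: mhcont_scale; first exact: jac_lmap_mhcont.
  apply: (comp_mhcont (A := fun y => Gam (metric_in d) y a)); apply: Gam_smooth; [exact: cimg_ropen|exact: metric_in_smooth|].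
  by move=> y; exact: metric_in_unit.
by apply: comp_mhcont; exact: metric_in_smooth.
Qed.

End Continuity.
End SurfaceCharts.

Section Potentials.
Context (R : realType) (S : riemannian R 1) (M : riemannian R 2).
Context (F : S -> M) (nu : S -> 'rV[R]_3) (theta : R).
Hypothesis capF : capillary F nu theta.
Implicit Types (c : chart R S 1) (d : chart R M 2) (p : S).
Let smF := cap_smooth capF.
Let smnu := cap_nu_smooth capF.

Definition potential_in c d x : R :=
  (local_field F nu c d x *m ricci (metric_in d) (local_map F c d x) *m (local_field F nu c d x)^T) 0 0 +
  \tr (invmx (metric_in c x) *m sff_in F nu c d x *m invmx (metric_in c x) *m (sff_in F nu c d x)^T).

Lemma potentialE c d p : atlas S c -> atlas M d -> cdom c p -> cdom d (F p) ->
  potential F nu p = potential_in c d (cmap c p).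
Proof.
move=> ac ad cp dp; have ac' := chart_atlas p; have ad' := chart_atlas (F p).
have cp' := chart_dom p; have dp' := chart_dom (F p).
rewrite /potential /potential_in; congr (_ + _).
  rewrite lmap_cmap// lfield_cmap// (ricci_chart ad ad' dp dp').
  have tt := tjacV ad' ad dp' dp.
  rewrite trmx_mul !mulmxA -(mulmxA (nu p)) tt mulmx1.
  by rewrite -!mulmxA (mulmxA (tjac d _ _)^T) -trmx_mul tt trmx1 mul1mx !mulmxA.
have -> := sff_in_trans smF smnu ac ac' ad ad' cp cp' dp dp'.
rewrite /sqnorm_sff sff_pref -/(Defs.coord p).
set A := sff_in _ _ _ _ _; set s := tjac c _ p.
have us : s \in unitmx by exact: tjac_unit.
have -> : invmx (metric_in c (cmap c p)) = invmx s^T *m invmx (metric p) *m invmx s.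
  have -> : metric_in c (cmap c p) = s *m metric p *m s^T.
    by rewrite metric_inE.
  have um : metric p \in unitmx by apply: spd_unit => v; exact: metric_pos.
  have ust : s^T \in unitmx by rewrite unitmx_tr.
  have e : (invmx s^T *m invmx (metric p) *m invmx s) *m (s *m metric p *m s^T) = 1%:M.
    by rewrite !mulmxA mulmxKV// mulmxKV// mulVmx.
  have ug : s *m metric p *m s^T \in unitmx by rewrite !unitmx_mul us um ust.
  by rewrite -[RHS](mulmxK ug) e mul1mx.
rewrite (trmx_mul _ s^T) (trmx_mul s A) trmxK; move: A (metric p) s us => A g s us.
have ust : s^T \in unitmx by rewrite unitmx_tr.
rewrite !mulmxA mulmxKV// mulmxK// mulmxKV//.
have tr (X : 'M[R]_2) : \tr (invmx s^T *m (X *m s^T)) = \tr X by rewrite mxtrace_mulC mulmxK.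
by rewrite -[LHS]tr !mulmxA.
Qed.

Lemma near_chart c d p : atlas S c -> atlas M d -> cdom c p -> cdom d (F p) ->
  \forall q \near p, cdom c q /\ cdom d (F q).
Proof.
move=> ac ad cp dp; apply: (open_nbhs_nbhs (A := cdom c `&` F @^-1` cdom d)); split=> //.
by apply: openI; [exact: cdom_open|exact: ldom_open].
Qed.

(** By invariance the charts of [p] and [F p] serve all neighbouring points as well; in these fixed
    charts every ingredient is continuous. *)
Lemma potential_continuous : continuous (potential F nu).
Proof.
move=> p; have ac := chart_atlas p; have ad := chart_atlas (F p).
have cp := chart_dom p; have dp := chart_dom (F p).
set c := chart_at p in ac cp; set d := chart_at (F p) in ad dp.
have hE : \forall q \near p, potential_in c d (cmap c q) = potential F nu q.
  by apply: filterS (near_chart ac ad cp dp) => q [cq dq]; rewrite -potentialE.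
have h : hcont (potential_in c d) (cmap c p).
  have hn := lfield_mhcont smF smnu ac ad cp dp.
  have hs := sff_in_mhcont smF smnu ac ad cp dp.
  have hg : mhcont (fun x => invmx (metric_in c x)) (cmap c p).
    apply: (mhcont_smooth (cimg_ropen ac) (cmap_img cp)).
    by apply: (msmooth_inv (cimg_ropen ac) (metric_in_smooth ac)) => x; exact: metric_in_unit.
  apply: cvgD.
    apply: (mhcontM (mhcontM hn _) (mhcont_tr hn)).
    by apply: (comp_mhcont smF ac ad cp dp); exact: ricci_smooth.
  by apply: cvg_rsum => i _; exact: (mhcontM (mhcontM (mhcontM hg hs) hg) (mhcont_tr hs)).
rewrite /continuous_at (potentialE ac ad cp dp).
apply: cvg_trans (cvg_comp _ _ (cmap_hcvg ac cp) h).
exact: near_eq_cvg hE.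
Qed.

Section Boundary.
Context (p : S).
Hypothesis bp : bdry p.
Local Notation G := (metric (F p)).
Local Notation D := (dmap F p).
Local Notation m := (ord_max : 'I_3).

(** The tangent frame and [nu] form a basis in which the metric of [M] is block diagonal, with
    blocks [metric p] and [1]. Inverting gives this completeness relation. *)
Lemma inv_metric_frame : invmx G = D^T *m invmx (metric p) *m D + (nu p)^T *m nu p.
Proof.
pose B : 'M[R]_(2 + 1) := block_mx (invmx (metric p)) 0 0 1%:M.
pose E : 'M[R]_(2 + 1, 3) := col_mx D (nu p).
have um : metric p \in unitmx by apply: spd_unit => v; exact: metric_pos.
have uG : G \in unitmx by apply: spd_unit => v; exact: metric_pos.
have nD : nu p *m G *m D^T = 0.
  apply/rowP => i; rewrite [RHS]mxE -[RHS](cap_nu_normal capF p (delta_mx 0 i)).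
  by rewrite /ip trmx_mul !mulmxA trmx_delta -colE [RHS]mxE.
have Dn : D *m G *m (nu p)^T = 0.
  by apply: trmx_inj; rewrite !trmx_mul trmxK Defs.metric_sym mulmxA nD trmx0.
have nn : nu p *m G *m (nu p)^T = 1%:M.
  by apply/rowP => i; rewrite !ord1 [RHS]mxE; exact: (cap_nu_unit capF p).
have e : E *m (G *m E^T *m B) = 1%:M.
  rewrite !mulmxA /E mul_col_mx tr_col_mx mul_col_row nD Dn nn -(cap_isometric capF p).
  by rewrite /B mulmx_block !mul0mx !mulmx0 !addr0 !add0r mulmxV// mulmx1 scalar_mx_block.
have e2 : G *m (E^T *m B *m E) = 1%:M.
  by move: (mulmx1C (e : (E : 'M[R]_3) *m ((G *m E^T *m B) : 'M[R]_3) = 1%:M)); rewrite !mulmxA.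
have -> : invmx G = E^T *m B *m E by apply: (can_inj (mulKmx uG)); rewrite mulmxV//; exact: esym e2.
rewrite /E /B tr_col_mx mul_row_block !mulmx0 addr0 add0r mulmx1 mul_row_col//.
Qed.

(** The last coordinate of [F] vanishes at [p] and is nonnegative nearby, so at this boundary
    minimum its tangential derivative is zero and its inward derivative nonnegative. *)
Lemma dmap_bdry : D 0 m = 0 /\ 0 <= D 1 m.
Proof.
have ac := chart_atlas p; have ad := chart_atlas (F p).
have cp := chart_dom p; have dp := chart_dom (F p).
have xm : Defs.coord p 0 ord_max = 0 by apply/(bdryP ac cp).
have ym : local_map F (chart_at p) (chart_at (F p)) (Defs.coord p) 0 ord_max = 0.
  by rewrite lmap_cmap//; apply/(bdryP ad dp); apply/(cap_bdry capF).
have h := smooth_hdiff (ldom_ropen smF ac ad) (ldomP cp dp) (lmap_smooth smF ac ad 0 ord_max).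
have [] := hdiff_min_bdry xm ym (lmap_half_near smF ac ad cp dp) h.
have gE i : grad (fun x => local_map F (chart_at p) (chart_at (F p)) x 0 ord_max) (cmap (chart_at p) p) 0 i = D i m.
  by rewrite [LHS]mxE [RHS]jacE.
by move=> /(_ 0 isT); rewrite !gE (_ : (ord_max : 'I_2) = 1)//; exact/val_inj.
Qed.

(** The angle condition gives the last component of [nu] as [cos theta] times the length of the
    gradient of the last coordinate. The completeness relation then gives that of the conormal as
    [- sin theta] times the same length, the sign being fixed by [0 <= D 1 m], and the two
    contributions cancel. Tangency of [T] is what makes the boundary form independent of charts. *)
Lemma conormal_tangent (st := sin theta) : 0 < st ->
  (cos theta *: (normal_at p *m D) + st *: nu p) 0 m = 0.
Proof.
move=> s0; set Gi := invmx G; set gi := invmx (metric p).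
have uG : G \in unitmx by apply: spd_unit => v; exact: metric_pos.
have [D0 D1] := dmap_bdry.
have Gm : 0 < Gi m m by apply: spd_inv_diag => [|v]; [exact: Defs.metric_sym|exact: metric_pos].
have g1 : 0 < gi 1 1 by apply: spd_inv_diag => [|v]; [exact: Defs.metric_sym|exact: metric_pos].
have colD : col m D = D 1 m *: delta_mx 1 0.
  apply/colP => i; rewrite [LHS]mxE [RHS]mxE [X in _ = _ * X]mxE eqxx andbT.
  by case: i => [[|[|]]]//= ?; rewrite ?mulr0 ?mulr1 -?D0; congr (D _ _); apply/val_inj.
have key : Gi m m = gi 1 1 * D 1 m ^+ 2 + nu p 0 m ^+ 2.
  rewrite /Gi inv_metric_frame mxE; congr (_ + _); last by rewrite mxE big_ord1 mxE.
  have -> : (D^T *m gi *m D) m m = ((col m D)^T *m gi *m col m D) 0 0.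
    have q (A : 'M[R]_(2, 3)) (B : 'M[R]_2) k : (A^T *m B *m A) k k = ((col k A)^T *m B *m col k A) 0 0.
      rewrite !mxE; apply: eq_bigr => i _; rewrite !mxE; congr (_ * _).
      by apply: eq_bigr => l _; rewrite !mxE.
    exact: q.
  have q (a : R) (B : 'M[R]_2) (v := a *: (delta_mx 1 0 : 'cV[R]_2)) : (v^T *m B *m v) 0 0 = B 1 1 * a ^+ 2.
    rewrite /v !mxE !big_ord_recl !big_ord0 !mxE !big_ord_recl !big_ord0 !mxE /=.
    by rewrite (_ : lift ord0 ord0 = 1 :> 'I_2); [ring|exact/val_inj].
  by rewrite colD q.
have nE : nu p 0 m = Num.sqrt (Gi m m) * cos theta.
  have bF : bdry (F p) by apply/(cap_bdry capF).
  rewrite -(cap_angle capF bp) /normal_at /outer_normal metric_at_coord -/Gi /ip linearN /= mulmxN mxE.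
  rewrite -!scalemxAl -row_mul mulVmx// mxE row1 -rowE !mxE.
  by rewrite mulNr opprK mulrA divff ?mul1r// sqrtr_eq0 -ltNge.
have sE : Num.sqrt (gi 1 1) * D 1 m = Num.sqrt (Gi m m) * st.
  apply/eqP; rewrite -(@eqrXn2 _ 2)//; [|by rewrite mulr_ge0// sqrtr_ge0|by rewrite mulr_ge0// ?sqrtr_ge0// ltW].
  rewrite !exprMn !sqr_sqrtr ?ltW// -/st.
  have := cos2Dsin2 theta; rewrite -/st => cs.
  have := key; rewrite nE exprMn sqr_sqrtr ?ltW// => k2.
  apply/eqP; move: k2 cs; move: (Gi m m) (gi 1 1 * _) (cos theta ^+ 2) (st ^+ 2) => a b e f k2 cs.
  have -> : f = 1 - e by lra.
  by rewrite mulrBr mulr1; move: (a * e) k2 => z k2; lra.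
have etaE : (normal_at p *m D) 0 m = - (Num.sqrt (gi 1 1) * D 1 m).
  have q (v : 'rV[R]_2) (A : 'M[R]_(2, 3)) : A 0 m = 0 -> (v *m A) 0 m = v 0 1 * A 1 m.
    move=> A0; rewrite mxE !big_ord_recl big_ord0 addr0 (_ : lift ord0 ord0 = 1); last exact/val_inj.
    by rewrite (_ : ord0 = 0) ?A0 ?mulr0 ?add0r//; exact/val_inj.
  rewrite q// -mulNr; congr (_ * _); rewrite /normal_at /outer_normal metric_at_coord -/gi.
  rewrite (_ : (ord_max : 'I_2) = 1); last exact/val_inj.
  rewrite [LHS]mxE [X in _ * X]mxE -{2}[gi 1 1]sqr_sqrtr ?ltW// expr2 mulNr mulrA mulVf ?mul1r//.
  by rewrite sqrtr_eq0 -ltNge.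
by rewrite [LHS]mxE [X in X + _]mxE [X in _ + X]mxE etaE sE nE; ring.
Qed.

End Boundary.

Definition conormal_in c d x : 'rV[R]_3 :=
  cos theta *: (outer_normal (metric_in c) x *m jac (local_map F c d) x) + sin theta *: local_field F nu c d x.

Definition bdry_cov d y : 'M[R]_3 :=
  \matrix_i covd (metric_in d) id (outer_normal (metric_in d)) y i.

Definition bdry_potential_in c d x : R :=
  (sin theta)^-1 * (conormal_in c d x *m bdry_cov d (local_map F c d x) *m
    metric_in d (local_map F c d x) *m (conormal_in c d x)^T) 0 0 +
  cos theta / sin theta * (outer_normal (metric_in c) x *m sff_in F nu c d x *m (outer_normal (metric_in c) x)^T) 0 0.

Lemma bdry_sff_cov d y u v : bdry_sff (metric_in d) y u v = (u *m bdry_cov d y *m metric_in d y *m v^T) 0 0.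
Proof.
have q (B g : 'M[R]_3) : \sum_i u 0 i * ip g (row i B) v = (u *m B *m g *m v^T) 0 0.
  rewrite -!mulmxA [RHS]mxE; apply: eq_bigr => i _; congr (_ * _).
  by rewrite /ip -!row_mul mxE !mulmxA.
by rewrite -q; apply: eq_bigr => i _; rewrite rowK.
Qed.

Hypothesis sin_gt0 : 0 < sin theta.

Lemma bdry_potentialE c d p : atlas S c -> atlas M d -> cdom c p -> cdom d (F p) -> bdry p ->
  bdry_potential F nu theta p = bdry_potential_in c d (cmap c p).
Proof.
move=> ac ad cp dp bp; have ac' := chart_atlas p; have ad' := chart_atlas (F p).
have cp' := chart_dom p; have dp' := chart_dom (F p).
have bF : bdry (F p) by apply/(cap_bdry capF).
have etaE : normal_at p = outer_normal (metric_in c) (cmap c p) *m tjac c (chart_at p) p.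
  exact: (normal_chart ac ac' cp cp' bp).
rewrite /bdry_potential /bdry_potential_in.
set T := (_ + _ : 'rV[R]_3).
have Tm : T 0 ord_max = 0 by exact: conormal_tangent.
have TE : T *m tjac (chart_at (F p)) d (F p) = conormal_in c d (cmap c p).
  have h := jac_lmap_trans smF ac' ac ad' ad cp' cp dp' dp.
  rewrite /T mulmxDl -(scalemxAl (cos theta)) -(scalemxAl (sin theta)) /conormal_in lfield_cmap//.
  congr (_ *: _ + _); rewrite -[dmap F p]/(jac _ (cmap (chart_at p) p)) etaE.
  move: (outer_normal _ _) h (tjacV ac ac' cp cp') => e h tt.
  by rewrite -mulmxA h mulmxA -(mulmxA e) tt mulmx1.
have -> : bdry_sff (metric_at (F p)) (Defs.coord (F p)) T T =
    (conormal_in c d (cmap c p) *m bdry_cov d (local_map F c d (cmap c p)) *m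
    metric_in d (local_map F c d (cmap c p)) *m (conormal_in c d (cmap c p))^T) 0 0.
  by rewrite (bdry_sff_chart ad' ad T dp' dp bF Tm) TE bdry_sff_cov lmap_cmap.
have -> // : ip (sff F nu p) (normal_at p) (normal_at p) =
  (outer_normal (metric_in c) (cmap c p) *m sff_in F nu c d (cmap c p) *m (outer_normal (metric_in c) (cmap c p))^T) 0 0.
rewrite (sff_in_trans smF smnu ac ac' ad ad' cp cp' dp dp') sff_pref /ip etaE trmx_mul.
by rewrite !mulmxA.
Qed.

(** Continuity holds along the boundary: off it [normal_at] has no meaning and depends on the chart.
    Since the boundary is closed, local boundedness follows. *)
Lemma bdry_potential_lbm : lbm (@bdry R 1 S) (bdry_potential F nu theta).
Proof.
apply: lbm_within_continuous; [by apply: borel_closed; exact: bdry_closed|exact: bdry_closed|].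
apply/subspace_continuousP => p bp; have ac := chart_atlas p; have ad := chart_atlas (F p).
have cp := chart_dom p; have dp := chart_dom (F p).
set c := chart_at p in ac cp; set d := chart_at (F p) in ad dp.
have hE : \forall q \near within (@bdry R 1 S) (nbhs p), bdry_potential_in c d (cmap c q) = bdry_potential F nu theta q.
  by rewrite near_withinE; apply: filterS (near_chart ac ad cp dp) => q [cq dq] bq; rewrite -bdry_potentialE.
have h : hcont (bdry_potential_in c d) (cmap c p).
  have hs := sff_in_mhcont smF smnu ac ad cp dp.
  have sN k (X : riemannian R k) (e : chart R X k) : atlas X e -> msmooth (cimg e) (outer_normal (metric_in e)).
    move=> ae; apply: outer_normal_smooth; [exact: cimg_ropen|exact: metric_in_smooth| |].
      by move=> x; exact: metric_in_unit.
    by move=> x; exact: metric_in_inv_diag.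
  have hN : mhcont (outer_normal (metric_in c)) (cmap c p).
    by apply: (mhcont_smooth (cimg_ropen ac) (cmap_img cp)); exact: sN.
  have hT : mhcont (conormal_in c d) (cmap c p).
    apply: mhcontD; apply: mhcont_scale; try exact: cvg_cst.
      by apply: mhcontM => //; exact: jac_lmap_mhcont.
    exact: lfield_mhcont.
  apply: cvgD; apply: cvgMr; last exact: (mhcontM (mhcontM hN hs) (mhcont_tr hN)).
  apply: (mhcontM (mhcontM (mhcontM hT _) _) (mhcont_tr hT)); last first.
    by apply: (comp_mhcont smF ac ad cp dp); exact: metric_in_smooth.
  apply: (comp_mhcont smF ac ad cp dp) => i j.
  have rd := cimg_ropen ad.
  have sid : msmooth (cimg d) (@idfun 'rV[R]_3) by move=> a b; rewrite ord1; exact: smooth_coord.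
  apply: smooth_eq (_ : smooth_on (cimg d) (fun y => mpd (outer_normal (metric_in d)) y i 0 j +
     (outer_normal (metric_in d) y *m \sum_a jac idfun y i a *: Gam (metric_in d) y a) 0 j)) => // [y _|].
    by rewrite [RHS]mxE covdE [RHS]mxE.
  apply: smoothD => //; first exact: msmooth_mpd rd (sN _ _ _ ad) 0 j.
  apply: (msmooth_mul rd (sN _ _ _ ad)) => a b.
  apply: smooth_eq (_ : smooth_on (cimg d) (fun y => \sum_k jac idfun y i k * Gam (metric_in d) y k a b)) => // [y _|].
    by rewrite summxE; apply: eq_bigr => k _; rewrite [RHS]mxE.
  apply: smooth_sum => // k _; apply: smoothM => //; first exact: jac_smooth.
  apply: Gam_smooth; [exact: cimg_ropen|exact: metric_in_smooth|].
  by move=> y; exact: metric_in_unit.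
suff : bdry_potential F nu theta q @[q --> within (@bdry R 1 S) (nbhs p)] --> bdry_potential F nu theta p by [].
rewrite (bdry_potentialE ac ad cp dp bp).
apply: cvg_trans (cvg_comp _ _ (cvg_trans (cvg_app _ (@cvg_within _ _ _ _)) (cmap_hcvg ac cp)) h).
exact: near_eq_cvg hE.
Qed.

End Potentials.

(** * Divergence theorem and trace inequality *)

Section Differentials.
Context (R : realType) (n : nat) (X : manifold R n).
Implicit Types (u v : X -> R) (c d : chart R X n) (p : X).

Lemma smooth_fun_hdiff u c p : smooth_fun u -> atlas X c -> cdom c p ->
  hdiff (u \o cinv c) (cmap c p) (grad (u \o cinv c) (cmap c p)).
Proof.
move=> su ac cp; have h := smooth_hdiff (cimg_ropen ac) (cmap_img cp) (su c ac).
exact: h.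
Qed.

Lemma diff_fun_grad u p : diff_fun u p = grad (u \o cinv (chart_at p)) (Defs.coord p).
Proof. by []. Qed.

Lemma hdiff_diff_fun u p (g : 'rV[R]_n.+1) : hdiff (u \o cinv (chart_at p)) (Defs.coord p) g -> diff_fun u p = g.
Proof. by move=> h; rewrite diff_fun_grad (hdiff_grad _ h)//; apply: cmap_half; [exact: chart_atlas|exact: chart_dom]. Qed.

Lemma diff_funP u p : smooth_fun u -> hdiff (u \o cinv (chart_at p)) (Defs.coord p) (diff_fun u p).
Proof. by move=> su; apply: smooth_fun_hdiff => //; [exact: chart_atlas|exact: chart_dom]. Qed.

Lemma diff_funD u v p : smooth_fun u -> smooth_fun v ->
  diff_fun (fun q => u q + v q) p = diff_fun u p + diff_fun v p.
Proof. by move=> su sv; apply: hdiff_diff_fun; apply: hdiffD; exact: diff_funP. Qed.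

Lemma diff_funB u v p : smooth_fun u -> smooth_fun v ->
  diff_fun (fun q => u q - v q) p = diff_fun u p - diff_fun v p.
Proof. by move=> su sv; apply: hdiff_diff_fun; apply: hdiffB; exact: diff_funP. Qed.

Lemma diff_funZ a u p : smooth_fun u -> diff_fun (fun q => a * u q) p = a *: diff_fun u p.
Proof. by move=> su; apply: hdiff_diff_fun; apply: hdiffZ; exact: diff_funP. Qed.

Lemma diff_funM u v p : smooth_fun u -> smooth_fun v ->
  diff_fun (fun q => u q * v q) p = v p *: diff_fun u p + u p *: diff_fun v p.
Proof.
move=> su sv; apply: hdiff_diff_fun; have := hdiffM (diff_funP p su) (diff_funP p sv).
by rewrite /= cinvK//; [exact: chart_atlas|exact: chart_dom].
Qed.

Lemma cinv_near c p (P : set X) : atlas X c -> cdom c p -> (\forall q \near p, P q) ->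
  \forall y \near hnbhs (cmap c p), P (cinv c y).
Proof. by move=> ac cp nP; apply: (cinv_hcont ac (cmap_img cp)); rewrite cinvK. Qed.

Lemma diff_fun_near u v p : (\forall q \near p, u q = v q) -> diff_fun u p = diff_fun v p.
Proof.
move=> uv; have ac := chart_atlas p; have cp := chart_dom p.
apply/rowP => i; rewrite [LHS]mxE [RHS]mxE; apply: pderiv_near; first exact: cmap_half.
exact: (cinv_near ac cp uv).
Qed.

Lemma diff_fun_sum (J : Type) (r : seq J) (f : J -> X -> R) p : (forall j, smooth_fun (f j)) ->
  diff_fun (fun q => \sum_(j <- r) f j q) p = \sum_(j <- r) diff_fun (f j) p.
Proof. by move=> sf; apply: hdiff_diff_fun; apply: hdiff_sum => j _; exact: diff_funP. Qed.

Lemma diff_fun_cst a p : diff_fun (fun=> a) p = 0.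
Proof. by apply: hdiff_diff_fun; exact: hdiff_cst. Qed.

Lemma grad_chart u c p : smooth_fun u -> atlas X c -> cdom c p ->
  grad (u \o cinv c) (cmap c p) = diff_fun u p *m (to_pref c p)^T.
Proof.
move=> su ac cp; have ad := chart_atlas p; have dp := chart_dom p.
apply: hdiff_grad; first exact: cmap_half.
apply: hdiff_near_eq (hdiff_trans ac ad cp dp (diff_funP p su)); first exact: cmap_half.
by apply: filterS (ropen_near (tdom_ropen ac ad) (tdomP cp dp)) => _ [q [cq dq] <-] /=; rewrite trans_cmap// !cinvK.
Qed.

Definition fld (V : X -> 'rV[R]_n.+1) c y : 'rV[R]_n.+1 := V (cinv c y) *m from_pref c (cinv c y).

Lemma fld_cmap V c p : atlas X c -> cdom c p -> fld V c (cmap c p) = V p *m from_pref c p.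
Proof. by move=> ac cp; rewrite /fld cinvK. Qed.

Lemma fld_smooth V c : smooth_field V -> atlas X c -> msmooth (cimg c) (fld V c).
Proof. by move=> sV ac i j; rewrite ord1; exact: sV. Qed.

Lemma fld_trans V c d p : atlas X c -> atlas X d -> cdom c p -> cdom d p ->
  fld V d (cmap d p) = fld V c (cmap c p) *m tjac c d p.
Proof.
move=> ac ad cp dp; rewrite !fld_cmap// !from_prefE -mulmxA.
by rewrite -tjac_comp//; [exact: chart_atlas|exact: chart_dom].
Qed.

Lemma pref_unit c p : atlas X c -> cdom c p -> to_pref c p \in unitmx.
Proof. by move=> ac cp; rewrite to_prefE; apply: tjac_unit => //; [exact: chart_atlas|exact: chart_dom]. Qed.

Lemma from_to c p : atlas X c -> cdom c p -> from_pref c p *m to_pref c p = 1%:M.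
Proof. by move=> ac cp; rewrite to_prefE from_prefE tjacV//; [exact: chart_atlas|exact: chart_dom]. Qed.

Lemma pairing_chart (xi V : 'rV[R]_n.+1) c p : atlas X c -> cdom c p ->
  (xi *m V^T) 0 0 = ((xi *m (to_pref c p)^T) *m (V *m from_pref c p)^T) 0 0.
Proof.
by move=> ac cp; rewrite trmx_mul mulmxA -(mulmxA xi) -trmx_mul from_to// trmx1 mulmx1.
Qed.

Lemma pairing_smooth u V : smooth_fun u -> smooth_field V -> smooth_fun (fun p => (diff_fun u p *m (V p)^T) 0 0).
Proof.
move=> su sV c ac; have rc := cimg_ropen ac.
apply: smooth_eq (_ : smooth_on (cimg c) (fun x => \sum_i pderiv i (u \o cinv c) x * fld V c x 0 i)) => // [x [p cp <-]|].
  rewrite /= cinvK// (pairing_chart _ _ ac cp) -grad_chart// -fld_cmap// mxE.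
  by apply: eq_bigr => i _; rewrite [X in _ = X * _]mxE [X in _ = _ * X]mxE.
apply: smooth_sum => // i _; apply: smoothM => //; last exact: fld_smooth.
by apply: smooth_pderiv => //; exact: su.
Qed.

Lemma smooth_field_scale u V : smooth_fun u -> smooth_field V -> smooth_field (fun p => u p *: V p).
Proof.
move=> su sV c ac i; have rc := cimg_ropen ac.
apply: smooth_eq (_ : smooth_on (cimg c) (fun x => u (cinv c x) * fld V c x 0 i)) => // [x _|].
  by rewrite /= -scalemxAl [RHS]mxE.
by apply: smoothM => //; [exact: su|exact: fld_smooth].
Qed.

End Differentials.

Lemma ip_CS (R : realType) n (A : 'M[R]_n) (u w : 'rV[R]_n) : A^T = A ->
  (forall v : 'rV[R]_n, 0 <= ip A v v) -> ip A u w ^+ 2 <= ip A u u * ip A w w.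
Proof.
move=> As Ap; have sym (x y : 'rV[R]_n) : ip A x y = ip A y x.
  rewrite /ip; transitivity ((x *m A *m y^T)^T 0 0); first by rewrite [RHS]mxE.
  by rewrite !trmx_mul trmxK As mulmxA.
have h t : 0 <= ip A u u + t * ip A u w *+ 2 + t ^+ 2 * ip A w w.
  have := Ap (u + t *: w).
  have -> : ip A (u + t *: w) (u + t *: w) = ip A u u + t * ip A u w + (t * ip A w u + t * (t * ip A w w)).
    rewrite /ip linearD linearZ /= !mulmxDl !mulmxDr -!scalemxAl -!scalemxAr !mxE; ring.
  by rewrite (sym w u) => h; apply: le_trans h _; rewrite le_eqVlt; apply/orP; left; apply/eqP; ring.
have := Ap u; have := Ap w.
move: (ip A u u) (ip A u w) (ip A w w) h => a b e h e0 a0.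
have [e1|e1] := eqVneq e 0.
  rewrite e1 in h *; have [->|b0] := eqVneq b 0; first by rewrite expr0n mulr0.
  (* If [ip A w w] is zero the expression is affine in [t]; a nonzero slope would make it negative
     at this point. *)
  have := h (- (a + 1) / b); rewrite mulr0 addr0 mulfVK// mulr2n => k; exfalso; move: k a0; clear; lra.
have := h (- b / e); have ep : 0 < e by rewrite lt_neqAle eq_sym e1.
have -> : a + - b / e * b *+ 2 + (- b / e) ^+ 2 * e = (a * e - b ^+ 2) / e by field.
by rewrite pmulr_lge0 ?invr_gt0// subr_ge0.
Qed.

Section CometricCharts.
Context (R : realType) (n : nat) (X : riemannian R n).
Implicit Types (u v : X -> R) (c : chart R X n) (p : X).

Lemma invmx_form m (s g : 'M[R]_m) : s \in unitmx -> g \in unitmx ->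
  s^T *m invmx (s *m g *m s^T) *m s = invmx g.
Proof.
move=> us ug; have ust : s^T \in unitmx by rewrite unitmx_tr.
have uu : s *m g *m s^T \in unitmx by rewrite !unitmx_mul us ug ust.
have e : s *m (g *m s^T *m invmx (s *m g *m s^T)) = 1%:M by rewrite !mulmxA mulmxV.
apply: (can_inj (mulKmx ug)); rewrite mulmxV// !mulmxA; exact: (mulmx1C e).
Qed.

Lemma coip_chart c p xi zeta : atlas X c -> cdom c p ->
  coip p xi zeta = ip (invmx (metric_in c (cmap c p))) (xi *m (to_pref c p)^T) (zeta *m (to_pref c p)^T).
Proof.
move=> ac cp; rewrite /coip metric_inE// -ip_form trmxK invmx_form//; first exact: pref_unit.
by apply: spd_unit => v; exact: metric_pos.
Qed.

Lemma coip_smooth u v : smooth_fun u -> smooth_fun v -> smooth_fun (fun p => coip p (diff_fun u p) (diff_fun v p)).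
Proof.
move=> su sv c ac; have rc := cimg_ropen ac.
have sg : msmooth (cimg c) (fun x => invmx (metric_in c x)).
  by apply: (msmooth_inv rc (metric_in_smooth ac)) => x; exact: metric_in_unit.
apply: smooth_eq (_ : smooth_on (cimg c) (fun x => (grad (u \o cinv c) x *m invmx (metric_in c x) *m (grad (v \o cinv c) x)^T) 0 0)) => // [x [p cp <-]|].
  transitivity (coip p (diff_fun u p) (diff_fun v p)); last by rewrite /= cinvK.
  by rewrite (coip_chart _ _ ac cp) /ip (grad_chart su ac cp) (grad_chart sv ac cp).
have sgr w : smooth_fun w -> msmooth (cimg c) (grad (w \o cinv c)).
  move=> sw i j; apply: smooth_eq (smooth_pderiv rc j (sw c ac)) => // x _; by rewrite mxE.
by apply: (msmooth_mul rc (msmooth_mul rc (sgr _ su) sg) (msmooth_tr rc (sgr _ sv))).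
Qed.

Lemma coip_ge0 p xi : 0 <= coip p xi xi.
Proof.
have um : metric p \in unitmx by apply: spd_unit => v; exact: metric_pos.
have -> : coip p xi xi = ip (metric p) (xi *m invmx (metric p)) (xi *m invmx (metric p)).
  rewrite -ip_form /coip; congr (ip _ _ _).
  by rewrite mulVmx// mul1mx trmx_inv Defs.metric_sym.
have [->|x0] := eqVneq (xi *m invmx (metric p)) 0; first by rewrite /ip !mul0mx mxE.
by apply: ltW; exact: metric_pos.
Qed.

Lemma coip_sym p xi zeta : coip p xi zeta = coip p zeta xi.
Proof.
rewrite /coip /ip; transitivity ((xi *m invmx (metric p) *m zeta^T)^T 0 0); first by rewrite [RHS]mxE.
by rewrite !trmx_mul trmxK trmx_inv Defs.metric_sym mulmxA.
Qed.

Lemma coipDl p xi xi' zeta : coip p (xi + xi') zeta = coip p xi zeta + coip p xi' zeta.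
Proof. by rewrite /coip /ip !mulmxDl mxE. Qed.

Lemma coipZl p a xi zeta : coip p (a *: xi) zeta = a * coip p xi zeta.
Proof. by rewrite /coip /ip -!scalemxAl mxE. Qed.

Lemma coipDr p xi xi' zeta : coip p zeta (xi + xi') = coip p zeta xi + coip p zeta xi'.
Proof. by rewrite coip_sym coipDl !(coip_sym _ zeta). Qed.

Lemma coipZr p a xi zeta : coip p zeta (a *: xi) = a * coip p zeta xi.
Proof. by rewrite coip_sym coipZl coip_sym. Qed.

Lemma coip0l p zeta : coip p 0 zeta = 0.
Proof. by rewrite /coip /ip !mul0mx mxE. Qed.

Lemma coip_CS p xi zeta : coip p xi zeta ^+ 2 <= coip p xi xi * coip p zeta zeta.
Proof. by apply: ip_CS => [|v]; [rewrite trmx_inv Defs.metric_sym|exact: coip_ge0]. Qed.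

End CometricCharts.

Section Divergence.
Context (R : realType) (S : riemannian R 1).
Implicit Types (V : S -> 'rV[R]_2) (c d : chart R S 1) (p : S).

Definition divc V c x : R := (vol c x)^-1 * \sum_i pderiv i (fun y => vol c y * fld V c y 0 i) x.

Lemma divergence_pref V p : divergence V p = divc V (chart_at p) (Defs.coord p).
Proof. by []. Qed.

Lemma sum2 (W : zmodType) (f : 'I_2 -> W) : \sum_i f i = f 0 + f 1.
Proof.
rewrite !big_ord_recl big_ord0 addr0; congr (f _ + f _); exact/val_inj.
Qed.

Lemma divc2 V c x : divc V c x = (vol c x)^-1 *
  (pderiv 0 (fun y => vol c y * fld V c y 0 0) x + pderiv 1 (fun y => vol c y * fld V c y 0 1) x).
Proof. by rewrite /divc sum2. Qed.

Lemma vol_trans c d p : atlas S c -> atlas S d -> cdom c p -> cdom d p ->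
  vol c (cmap c p) = `|\det (tjac c d p)| * vol d (cmap d p).
Proof.
move=> ac ad cp dp; rewrite /vol (metric_in_trans ac ad cp dp); move: (metric_in d _) => g.
have -> : \det (tjac c d p *m g *m (tjac c d p)^T) = \det (tjac c d p) ^+ 2 * \det g.
  by rewrite !det_mulmx det_tr; ring.
by rewrite sqrtrM ?sqr_ge0// sqrtr_sqr.
Qed.

Lemma pderiv_trans2 c d p (f : 'rV[R]_2 -> R) k : atlas S c -> atlas S d -> cdom c p -> cdom d p ->
  smooth_on (cimg d) f -> pderiv k (fun x => f (trans c d x)) (cmap c p) =
  tjac c d p k 0 * pderiv 0 f (cmap d p) + tjac c d p k 1 * pderiv 1 f (cmap d p).
Proof.
move=> ac ad cp dp sf.
have h := hdiff_trans ac ad cp dp (smooth_hdiff (cimg_ropen ad) (cmap_img dp) sf).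
rewrite (hdiff_pderiv k (cmap_half ac cp) h) mxE sum2.
by congr (_ + _); rewrite mulrC; congr (_ * _); rewrite mxE.
Qed.

Lemma pderiv_minor (s : R) (u1 u2 u3 u4 : 'rV[R]_2 -> R) x k : half_space x ->
  hdiff u1 x (grad u1 x) -> hdiff u2 x (grad u2 x) -> hdiff u3 x (grad u3 x) -> hdiff u4 x (grad u4 x) ->
  pderiv k (fun y => s * (u1 y * u2 y - u3 y * u4 y)) x =
  s * ((pderiv k u1 x * u2 x + u1 x * pderiv k u2 x) - (pderiv k u3 x * u4 x + u3 x * pderiv k u4 x)).
Proof.
move=> Hx h1 h2 h3 h4; have h := hdiffZ s (hdiffB (hdiffM h1 h2) (hdiffM h3 h4)).
rewrite (hdiff_pderiv k Hx h).
have gE f : grad f x 0 k = pderiv k f x by rewrite mxE.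
rewrite -!gE; move: (grad u1 x) (grad u2 x) (grad u3 x) (grad u4 x) => *; rewrite !mxE; ring.
Qed.

(* [vol V] is a vector density: in dimension two it transforms under the adjugate of the
   Jacobian, whose divergence vanishes because mixed partial derivatives commute. *)
Lemma divc_trans V c d p : smooth_field V -> atlas S c -> atlas S d -> cdom c p -> cdom d p ->
  divc V c (cmap c p) = divc V d (cmap d p).
Proof.
move=> sV ac ad cp dp; have rc := cimg_ropen ac; have rt := tdom_ropen ac ad.
pose T j x := trans c d x 0 j; have sT j : smooth_on (tdom c d) (T j) by exact: trans_smooth.
pose w j y := vol d y * fld V d y 0 j.
have sw j : smooth_on (cimg d) (w j).
  by apply: smoothM => //; [exact: cimg_ropen|exact: vol_smooth|exact: fld_smooth].
pose J i j := pderiv i (T j).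
pose x0 := cmap c p; have tx : tdom c d x0 by exact: tdomP.
have Hx : half_space x0 by exact: ropenH rt tx.
have JE q i j : tjac c d q i j = J i j (cmap c q) by rewrite /tjac jacE.
have sJ i j : smooth_on (tdom c d) (J i j) by exact: smooth_pderiv.
pose dJ x := J 0 0 x * J 1 1 x - J 0 1 x * J 1 0 x.
have vT (v : 'rV[R]_2) q j : (v *m tjac c d q) 0 j = v 0 0 * J 0 j (cmap c q) + v 0 1 * J 1 j (cmap c q).
  by rewrite mxE sum2 !JE.
have dJE q : \det (tjac c d q) = dJ (cmap c q) by rewrite det2 !JE.
have dJ0 : dJ x0 != 0 by rewrite -dJE -unitfE -unitmxE; exact: tjac_unit.
(* The sign of the Jacobian determinant is constant near [x0], so its absolute value can be
   differentiated. *)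
pose s := Num.sg (dJ x0).
have sdJ : smooth_on (tdom c d) dJ by apply: smoothB => //; apply: smoothM.
have near_s : \forall x \near hnbhs x0, `|dJ x| = s * dJ x.
  have cdJ := smooth_hcont rt tx sdJ.
  have : 0 < `|dJ x0| by rewrite normr_gt0.
  move=> /(hcont_dist cdJ); apply: filterS => x.
  rewrite /s; case: (ltrgtP (dJ x0) 0) dJ0 => // h _.
    by rewrite ltr0_sg// mulN1r (ltr0_norm h) => hx; rewrite ltr0_norm//; move: hx; rewrite ltr_norml => /andP[]; lra.
  by rewrite gtr0_sg// mul1r (gtr0_norm h) => hx; rewrite gtr0_norm//; move: hx; rewrite ltr_norml => /andP[]; lra.
have VE x : tdom c d x -> `|dJ x| = s * dJ x ->
    vol c x * fld V c x 0 0 = s * (w 0 (trans c d x) * J 1 1 x - w 1 (trans c d x) * J 1 0 x) /\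
    vol c x * fld V c x 0 1 = s * (w 1 (trans c d x) * J 0 0 x - w 0 (trans c d x) * J 0 1 x).
  move=> [q [cq dq] <-] hs; rewrite trans_cmap// /w (vol_trans ac ad cq dq) (fld_trans _ ac ad cq dq) dJE hs.
  move: (fld V c (cmap c q)) => z; rewrite (vT z q 0) (vT z q 1) /dJ.
  move: (J 0 0 _) (J 0 1 _) (J 1 0 _) (J 1 1 _) (z 0 0) (z 0 1) (vol d _) => a b e f z0 z1 v.
  by split; ring.
have Tw k j : pderiv k (fun x => w j (trans c d x)) x0 = J k 0 x0 * pderiv 0 (w j) (cmap d p) + J k 1 x0 * pderiv 1 (w j) (cmap d p).
  by rewrite -!JE; exact: pderiv_trans2.
have hw j : hdiff (fun x => w j (trans c d x)) x0 (grad (fun x => w j (trans c d x)) x0).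
  have h := hdiff_trans ac ad cp dp (smooth_hdiff (cimg_ropen ad) (cmap_img dp) (sw j)).
  by rewrite (hdiff_grad Hx h).
have hJ i j : hdiff (J i j) x0 (grad (J i j) x0) by exact: (smooth_hdiff rt tx (sJ i j)).
have nt := ropen_near rt tx.
have d0 : pderiv 0 (fun y => vol c y * fld V c y 0 0) x0 =
    s * ((J 0 0 x0 * pderiv 0 (w 0) (cmap d p) + J 0 1 x0 * pderiv 1 (w 0) (cmap d p)) * J 1 1 x0 + w 0 (cmap d p) * pderiv 0 (J 1 1) x0
       - ((J 0 0 x0 * pderiv 0 (w 1) (cmap d p) + J 0 1 x0 * pderiv 1 (w 1) (cmap d p)) * J 1 0 x0 + w 1 (cmap d p) * pderiv 0 (J 1 0) x0)).
  rewrite (pderiv_near (g := fun x => s * (w 0 (trans c d x) * J 1 1 x - w 1 (trans c d x) * J 1 0 x)) 0 Hx); last first.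
    by apply: filterS2 nt near_s => x tx' hs; have [] := VE x tx' hs.
  rewrite (pderiv_minor s 0 Hx (hw 0) (hJ 1 1) (hw 1) (hJ 1 0)) (Tw 0 0) (Tw 0 1) (trans_cmap d ac cp).
  reflexivity.
have d1 : pderiv 1 (fun y => vol c y * fld V c y 0 1) x0 =
    s * ((J 1 0 x0 * pderiv 0 (w 1) (cmap d p) + J 1 1 x0 * pderiv 1 (w 1) (cmap d p)) * J 0 0 x0 + w 1 (cmap d p) * pderiv 1 (J 0 0) x0
       - ((J 1 0 x0 * pderiv 0 (w 0) (cmap d p) + J 1 1 x0 * pderiv 1 (w 0) (cmap d p)) * J 0 1 x0 + w 0 (cmap d p) * pderiv 1 (J 0 1) x0)).
  rewrite (pderiv_near (g := fun x => s * (w 1 (trans c d x) * J 0 0 x - w 0 (trans c d x) * J 0 1 x)) 1 Hx); last first.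
    by apply: filterS2 nt near_s => x tx' hs; have [] := VE x tx' hs.
  rewrite (pderiv_minor s 1 Hx (hw 1) (hJ 0 0) (hw 0) (hJ 0 1)) (Tw 1 0) (Tw 1 1) (trans_cmap d ac cp).
  reflexivity.
rewrite !divc2 -/x0 d0 d1.
have -> : pderiv 0 (J 1 1) x0 = pderiv 1 (J 0 1) x0 by exact: schwarz rt (sT 1) tx.
have -> : pderiv 0 (J 1 0) x0 = pderiv 1 (J 0 0) x0 by exact: schwarz rt (sT 0) tx.
have -> : vol c x0 = s * dJ x0 * vol d (cmap d p).
  rewrite (vol_trans ac ad cp dp) dJE; congr (_ * _).
  exact: normrEsg.
have s0 : s != 0 by rewrite sgr_eq0.
have v0 : vol d (cmap d p) != 0 by rewrite gt_eqF//; apply: vol_gt0 => //; exact: cmap_img.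
rewrite -/(w 0) -/(w 1).
move: (pderiv 0 (w 0) _) (pderiv 1 (w 0) _) (pderiv 0 (w 1) _) (pderiv 1 (w 1) _) => D00 D10 D01 D11.
move: dJ0; rewrite /dJ; move: (J 0 0 x0) (J 0 1 x0) (J 1 0 x0) (J 1 1 x0) => a b e f dJ0.
move: (w 0 _) (w 1 _) (pderiv 1 (J 0 1) x0) (pderiv 1 (J 0 0) x0) => w0 w1 k l.
by field; rewrite dJ0 s0 v0.
Qed.

End Divergence.

(** * Extension by zero of functions supported in a chart *)

Section ExtensionByZero.
Context (R : realType) (n : nat) (X : manifold R n).
Context (c : chart R X n) (L : set X).
Hypotheses (ac : atlas X c) (cL : compact L) (Lc : L `<=` cdom c).

Lemma cmap_compact : compact (cmap c @` L).
Proof.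
apply: continuous_compact => //; have [_ _ _ h _] := mf_chart ac.
exact: continuous_subspaceW h.
Qed.

Lemma chart_bound (f : 'rV[R]_n.+1 -> R) : smooth_on (cimg c) f ->
  exists2 M, 0 < M & forall p, L p -> `|f (cmap c p)| <= M.
Proof.
move=> sf; have rc := cimg_ropen ac.
have : compact (f @` (cmap c @` L)).
  apply: continuous_compact cmap_compact; apply: (@continuous_subspaceW _ _ _ (cimg c)).
    by move=> _ [p Lp <-]; apply: cmap_img; exact: Lc.
  by apply/(within_contP _ rc) => x cx; exact: smooth_hcont sf.
move=> /compact_bounded[M [_ hM]]; exists (`|M| + 1) => [|p Lp]; first by rewrite ltr_wpDl.
apply: (hM (`|M| + 1)); first by rewrite (le_lt_trans (ler_norm _))// ltrDl.
by exists (cmap c p) => //; exists p.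
Qed.

Context (g : 'rV[R]_n.+1 -> R).
Hypotheses (sg : smooth_on (cimg c) g) (g0 : forall p, cdom c p -> ~ L p -> g (cmap c p) = 0).

Definition ext0 x := if `[< cimg c x >] then g x else 0.

Lemma ext0_out x : ~ (cmap c @` L) x -> ext0 x = 0.
Proof.
rewrite /ext0; case: asboolP => // -[p cp <-] Lp; apply: g0 => // Lp'; apply: Lp; by exists p.
Qed.

Lemma ropen_out : ropen (@half_space R n `&` ~` (cmap c @` L)).
Proof.
exists (~` (cmap c @` L)); last by rewrite setIC.
by apply: closed_openC; apply: compact_closed cmap_compact; exact: norm_hausdorff.
Qed.

Lemma ext0_smooth : smooth_on (@half_space R n) ext0.
Proof.
apply: smooth_local; first exact: ropen_half.
move=> x Hx; have [cx|cx] := pselect (cimg c x).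
  exists (cimg c); split=> //; first exact: cimg_ropen.
  by apply: (smooth_eq (cimg_ropen ac)) sg => y cy; rewrite /ext0 asboolT.
exists (@half_space R n `&` ~` (cmap c @` L)); split; first exact: ropen_out.
  by split=> // -[p Lp px]; apply: cx; rewrite -px; apply: cmap_img; exact: Lc.
apply: (smooth_eq ropen_out (f := fun=> 0)); last exact: (smooth_cst ropen_out).
by move=> y [_ /ext0_out].
Qed.

Lemma ext0_support : exists2 M, 0 < M & forall x (i : 'I_n.+1), half_space x -> M < `|x 0 i| -> ext0 x = 0.
Proof.
have /compact_bounded[M [_ hM]] := cmap_compact.
exists (`|M| + 1) => [|x i _ xi]; first by rewrite ltr_wpDl.
apply: ext0_out => Lx.
have := hM (`|M| + 1); rewrite (le_lt_trans (ler_norm _)) ?ltrDl// => /(_ isT _ Lx) /=.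
rewrite leNgt => /negP; apply; apply: lt_le_trans xi _.
rewrite [leRHS]/Num.norm /= mx_normrE.
by apply: le_trans (le_bigmax _ _ (0, i)).
Qed.

Lemma ext0_pderiv x i : cimg c x -> pderiv i ext0 x = pderiv i g x.
Proof. by move=> cx; apply: (pderiv_eq _ (cimg_ropen ac) cx) => y cy; rewrite /ext0 asboolT. Qed.

Lemma ext0_pderiv_out x i : half_space x -> ~ (cmap c @` L) x -> pderiv i ext0 x = 0.
Proof.
move=> Hx xL; have -> : pderiv i ext0 x = pderiv i (fun=> 0) x.
  by apply: (pderiv_eq _ ropen_out) => // y [_ /ext0_out].
by rewrite (hdiff_pderiv i Hx (hdiff_cst 0 x)) mxE.
Qed.

End ExtensionByZero.

(** * Integration by parts and traces on the surface *)

Section IntegralFormulas.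
Context (R : realType) (S : riemannian R 1).
Context (mu sigma : {measure set (borel S) -> \bar R}).
Hypotheses (mu_area : is_area mu) (sigma_length : is_bdry_length sigma).
Implicit Types (V : S -> 'rV[R]_2) (c : chart R S 1) (p : S) (u : S -> R).
Notation leb := (@lebesgue_measure R).
Notation leb2 := (@lebesgue_measure R \x @lebesgue_measure R)%E.

Lemma divergenceE V c p : smooth_field V -> atlas S c -> cdom c p ->
  divergence V p = divc V c (cmap c p).
Proof. by move=> sV ac cp; rewrite divergence_pref (divc_trans sV (chart_atlas p) ac (chart_dom p) cp). Qed.

Lemma volfld_smooth V c i : smooth_field V -> atlas S c -> smooth_on (cimg c) (fun y => vol c y * fld V c y 0 i).
Proof.
move=> sV ac; apply: smoothM; [exact: cimg_ropen|exact: vol_smooth|exact: fld_smooth].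
Qed.

Lemma divergence_smooth V : smooth_field V -> smooth_fun (divergence V).
Proof.
move=> sV c ac; have rc := cimg_ropen ac.
apply: (smooth_eq rc (f := divc V c)) => [_ [p cp <-]|].
  by rewrite -(divergenceE sV ac cp) /= cinvK.
apply: (smoothM rc); first by apply: (smoothV rc); [move=> x cx; rewrite gt_eqF// vol_gt0|exact: vol_smooth].
by apply: (smooth_sum rc) => i _; apply: (smooth_pderiv rc); exact: volfld_smooth.
Qed.

Lemma divergence_scale u V p : smooth_fun u -> smooth_field V ->
  divergence (fun q => u q *: V q) p = u p * divergence V p + (diff_fun u p *m (V p)^T) 0 0.
Proof.
move=> su sV; have ac := chart_atlas p; have cp := chart_dom p; rewrite !divergence_pref /divc.
have Hx := cmap_half ac cp; set c := chart_at p in ac cp *; rewrite -/(Defs.coord p) in Hx.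
have v0 : vol c (Defs.coord p) != 0 by rewrite gt_eqF//; apply: vol_gt0 => //; exact: cmap_img.
have du := diff_funP p su.
have dV i := smooth_hdiff (cimg_ropen ac) (cmap_img cp) (volfld_smooth i sV ac).
have E i : pderiv i (fun y => vol c y * fld (fun q => u q *: V q) c y 0 i) (Defs.coord p) =
    u p * pderiv i (fun y => vol c y * fld V c y 0 i) (Defs.coord p) + vol c (Defs.coord p) * (diff_fun u p 0 i * V p 0 i).
  rewrite (_ : (fun y => _) = fun y => (u \o cinv c) y * (vol c y * fld V c y 0 i)); last first.
    apply/funext => y; have -> : fld (fun q => u q *: V q) c y = u (cinv c y) *: fld V c y by rewrite /fld -scalemxAl.
    by move: (fld V c y) => z; rewrite mxE mulrCA.
  rewrite (hdiff_pderiv i Hx (hdiffM du (dV i))).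
  have -> : fld V c (cmap c p) = V p by rewrite fld_cmap// from_prefE tjac_id// mulmx1.
  rewrite /= cinvK// [LHS]mxE [X in X + _]mxE [X in _ + X]mxE addrC; congr (_ * _ + _); last by rewrite mulrA mulrAC mulrC mulrA mulrAC.
  by rewrite mxE.
under eq_bigr do rewrite E.
rewrite big_split /= -!mulr_sumr mulrDr mulrCA mulKf//; congr (_ + _).
by rewrite [RHS]mxE; apply: eq_bigr => i _; congr (_ * _); rewrite [RHS]mxE.
Qed.

Lemma Cc_integrable u : Cc u setT -> mu.-integrable setT (EFin \o (u : borel S -> R)).
Proof.
move=> [su [K [cK _ uK]]]; apply: (lbm_integrable (@mf_hausdorff _ _ S) (area_compact_finite mu_area) measurableT _ cK).
  by apply: lbm_continuous; exact: smooth_fun_continuous.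
by move=> p _; exact: uK.
Qed.

Lemma divergence_out V L p : compact L -> (forall q, ~ L q -> V q = 0) -> ~ L p -> divergence V p = 0.
Proof.
move=> cL V0 Lp; rewrite divergence_pref /divc big1 ?mulr0// => i _.
have cL' : closed L by apply: compact_closed => //; exact: mf_hausdorff.
have nL : \forall q \near p, ~ L q by apply: open_nbhs_nbhs; split=> //; exact: closed_openC.
have Hx := cmap_half (chart_atlas p) (chart_dom p).
rewrite (pderiv_near (g := fun=> 0) i Hx).
  by rewrite (hdiff_pderiv i Hx (hdiff_cst 0 _)) mxE.
apply: filterS (cinv_near (chart_atlas p) (chart_dom p) nL) => y Ly.
by rewrite /fld V0// mul0mx mxE mulr0.
Qed.

Section ChartDivergence.
Context (c : chart R S 1) (V : S -> 'rV[R]_2) (L : set S).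
Hypotheses (ac : atlas S c) (sV : smooth_field V) (cL : compact L) (Lc : L `<=` cdom c).
Hypotheses (V0 : forall p, ~ L p -> V p = 0) (Lb : forall p, L p -> ~ bdry p).

(** In coordinates the density times the divergence is a sum of partial derivatives of compactly
    supported functions; the boundary term vanishes since the support avoids the boundary. *)
Lemma divergence_chart0 : (\int[mu]_p (divergence V p)%:E = 0)%E.
Proof.
pose g i x := vol c x * fld V c x 0 i.
have sg i : smooth_on (cimg c) (g i) by exact: volfld_smooth.
have g0 i p : cdom c p -> ~ L p -> g i (cmap c p) = 0.
  by move=> cp Lp; rewrite /g fld_cmap// V0// mul0mx mxE mulr0.
have se i := ext0_smooth ac cL Lc (sg i) (g0 i).
have [M0 M00 e0] := ext0_support ac cL Lc (g0 0).
have [M1 M10 e1] := ext0_support ac cL Lc (g0 1).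
transitivity (\int[mu]_(p in cdom c) (divergence V p)%:E)%E.
  rewrite [RHS]integral_mkcond; apply: eq_integral => p _; rewrite /patch; case: ifPn => //.
  by rewrite notin_setE => cp; rewrite (divergence_out cL V0)// => /Lc.
rewrite (integral_area mu_area ac); last first.
  apply/measurable_EFinP; apply: measurable_funS (_ : measurable_fun setT (divergence V : borel S -> R)) => //.
  by have [] := lbm_continuous (smooth_fun_continuous (divergence_smooth sV)).
transitivity (\int[leb2]_z ((Dext (ext0 c (g 0)) 0 z)%:E + (Dext (ext0 c (g 1)) 1 z)%:E))%E.
  rewrite [LHS]integral_mkcond; apply: eq_integral => z _; rewrite /patch -EFinD; case: ifPn.
    rewrite inE => cz; have hz : 0 <= z.2 by rewrite -plane_half; exact: ropenH (cimg_ropen ac) cz.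
    rewrite /Dext hz !(ext0_pderiv ac)// -EFinM; congr (_%:E).
    have [p cp pz] := cz; rewrite -pz cinvK// (divergenceE sV ac cp) pz divc2 mulrC mulVKf//.
    by rewrite gt_eqF// vol_gt0.
  rewrite notin_setE => cz; rewrite /Dext; case: ifP => hz; last by rewrite addr0.
  have zL : ~ (cmap c @` L) (plane_pt z) by move=> [p Lp pz]; apply: cz; rewrite /plane_dom /= -pz; apply: cmap_img; exact: Lc.
  by rewrite !(ext0_pderiv_out ac cL Lc (g0 _)) ?addr0// plane_half.
rewrite integralD//; [|exact: (Dext_integrable (se _) M00 e0)|exact: (Dext_integrable (se _) M10 e1)].
rewrite (divergence0 (se 0) M00 e0) (divergence1 (se 1) M10 e1) add0e.
apply: integral0_eq => t _; congr (_%:E); apply/eqP; rewrite oppr_eq0; apply/eqP.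
apply: (ext0_out (g0 1)) => -[p Lp pt]; apply: (Lb Lp); apply/(bdryP ac (Lc Lp)).
by rewrite pt mxE.
Qed.

End ChartDivergence.

(** The product rule for [rho i * u * V] and the chart case give the identity, summed over a
    partition of unity; the differentials of the [rho i] add up to zero near the support of [V]. *)
Lemma weak_diff_smooth u : smooth_fun u -> weak_diff mu u (diff_fun u).
Proof.
move=> su V sV [K [cK Kb V0]].
have [s [rho [U [cr _ _ [oU KU] r1]]]] := partition_of_unity cK.
have srho i : smooth_fun (rho i) by have [] := cr i.
have Vout p : ~ K p -> (forall v : 'rV[R]_2, (v *m (V p)^T) 0 0 = 0) by move=> Kp v; rewrite V0// trmx0 mulmx0 mxE.
have h1 : Cc (fun p => (diff_fun u p *m (V p)^T) 0 0) setT.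
  split; first exact: pairing_smooth.
  by exists K; split=> // p Kp; exact: Vout.
have divV0 p : ~ K p -> divergence V p = 0 by exact: divergence_out cK V0.
have h2 : Cc (fun p => u p * divergence V p) setT.
  split; first by apply: smooth_funM => //; exact: divergence_smooth.
  by exists K; split=> // p Kp; rewrite divV0// mulr0.
have sW := smooth_field_scale su sV.
pose d i p := divergence (fun q => rho i q *: (u q *: V q)) p.
have d0 i : (\int[mu]_p (d i p)%:E = 0)%E.
  have [_ [Li [cLi Lic r0]]] := cr i.
  apply: (divergence_chart0 (chart_atlas i) (smooth_field_scale (srho i) sW) (L := Li `&` K)).
  - by apply: compact_closedI => //; apply: compact_closed => //; exact: mf_hausdorff.
  - by move=> p [/Lic].
  - move=> p LK; have [Lp|Lp] := pselect (Li p); last by rewrite r0// scale0r.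
    by rewrite V0 ?scaler0// => Kp; apply: LK.
  - by move=> p [_ /Kb].
have di i : mu.-integrable setT (EFin \o (d i : borel S -> R)).
  apply: Cc_integrable; split; first by apply: divergence_smooth; exact: smooth_field_scale.
  exists K; split=> // p Kp; apply: (divergence_out cK) Kp => q Kq.
  by rewrite V0// !scaler0.
have E p : \sum_(i <- s) d i p = (diff_fun u p *m (V p)^T) 0 0 + u p * divergence V p.
  under eq_bigr do rewrite /d (divergence_scale _ (srho _) sW) divergence_scale//.
  rewrite big_split /= -mulr_suml.
  have [Kp|Kp] := pselect (K p); last first.
    rewrite divV0// !mulr0 !(Vout _ Kp) addr0 mulr0 add0r big1// => i _.
    by rewrite V0// scaler0 trmx0 mulmx0 mxE.
  rewrite r1 ?mul1r; last exact: KU.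
  have -> : \sum_(i <- s) (diff_fun (rho i) p *m (u p *: V p)^T) 0 0 = 0.
    rewrite -summxE -mulmx_suml -diff_fun_sum//.
    rewrite (diff_fun_near (v := fun=> 1)) ?diff_fun_cst ?mul0mx ?mxE//.
    by apply: filterS (open_nbhs_nbhs (conj oU (KU _ Kp))) => q Uq; exact: r1.
  by rewrite addr0 addrC.
have : (\int[mu]_p (\sum_(i <- s) (d i p)%:E) = 0)%E.
  by rewrite integral_sum// big1.
under eq_integral do rewrite sumEFin E EFinD.
have i1 := Cc_integrable h1; have i2 := Cc_integrable h2.
rewrite integralD// => e0; rewrite /Rintegral.
have f1 := integral_fune_fin_num measurableT i1; have f2 := integral_fune_fin_num measurableT i2.
by move/(congr1 fine): e0; rewrite fineD//= => /eqP; rewrite addr_eq0 => /eqP.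
Qed.

Section ChartTrace.
Context (c : chart R S 1) (rho : S -> R).
Hypotheses (ac : atlas S c) (crho : Cc rho (cdom c)).

(* Completing the square in [- 2 b u X] with [X] the normal derivative of [u]. *)
Lemma trace_pointwise (eps : R) : 0 < eps -> exists2 C : R, 0 <= C & forall u, smooth_fun u ->
  forall p, cdom c p -> - pderiv 1 (fun x => len c x * (rho (cinv c x) * u (cinv c x) ^+ 2)) (cmap c p) <=
    vol c (cmap c p) * (eps * coip p (diff_fun u p) (diff_fun u p) + C * u p ^+ 2).
Proof.
move=> eps0; have [srho [L [cL Lc r0]]] := crho; have rc := cimg_ropen ac.
pose m x := len c x * rho (cinv c x).
have sm : smooth_on (cimg c) m by apply: (smoothM rc); [exact: len_smooth|exact: srho].
have sV : smooth_on (cimg c) (fun x => (vol c x)^-1).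
  by apply: (smoothV rc); [move=> x cx; rewrite gt_eqF// vol_gt0|exact: vol_smooth].
have [A A0 hA] := chart_bound ac cL Lc (smoothM rc sV (smooth_pderiv rc 1 sm)).
have [B B0 hB] := chart_bound ac cL Lc (smoothM rc sV sm).
have [G G0 hG] := chart_bound ac cL Lc (metric_in_smooth ac 1 1).
(* [A] covers the derivative of the density [m]; the cross term costs [B ^+ 2 * G / eps] once the
   squared transversal derivative is bounded by [G] times the energy density. *)
exists (A + B ^+ 2 * G / eps) => [|u su p cp]; first by rewrite addr_ge0 ?ltW// divr_gt0// mulr_gt0// exprn_gt0.
have Hx := cmap_half ac cp; have cx := cmap_img cp.
have v0 : 0 < vol c (cmap c p) by exact: vol_gt0.
set X := pderiv 1 (u \o cinv c) (cmap c p).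
have dE : pderiv 1 (fun x => len c x * (rho (cinv c x) * u (cinv c x) ^+ 2)) (cmap c p) =
    pderiv 1 m (cmap c p) * u p ^+ 2 + m (cmap c p) * (2 * u p * X).
  have hu := smooth_hdiff rc cx (su c ac); have hm := smooth_hdiff rc cx sm.
  rewrite (_ : (fun x => _) = fun x => m x * ((u \o cinv c) x * (u \o cinv c) x)); last first.
    by apply/funext => x; rewrite /m /=; ring.
  rewrite (hdiff_pderiv 1 Hx (hdiffM hm (hdiffM hu hu))) /= cinvK//.
  have gE f : grad f (cmap c p) 0 1 = pderiv 1 f (cmap c p) by rewrite mxE.
  have q (a b k : R) (d e : 'rV[R]_2) : (a *: d + k *: (b *: e + b *: e)) 0 1 = a * d 0 1 + k * (b * e 0 1 + b * e 0 1).
    by rewrite !mxE.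
  rewrite q !gE -/X; ring.
have k0 := coip_ge0 p (diff_fun u p).
have Xk : X ^+ 2 <= metric_in c (cmap c p) 1 1 * coip p (diff_fun u p) (diff_fun u p).
  have uG := metric_in_unit ac cx.
  have gs := metric_in_sym c (cmap c p).
  (* [X] is the cometric product of the differential with a covector whose squared length is the
     entry [1 1] of the metric; Cauchy-Schwarz then bounds it. *)
  have XE : X = ip (invmx (metric_in c (cmap c p))) (diff_fun u p *m (to_pref c p)^T) (delta_mx 0 1 *m metric_in c (cmap c p)).
    rewrite /ip trmx_mul gs mulmxA mulmxKV// trmx_delta -colE -(grad_chart su ac cp) mxE mxE//.
  rewrite XE (coip_chart _ _ ac cp) mulrC; apply: le_trans (ip_CS _ _ _ _) _.
  - by rewrite trmx_inv gs.
  - move=> v; have -> : v = (v *m invmx (to_pref c p)^T) *m (to_pref c p)^T.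
      by rewrite mulmxKV// unitmx_tr; exact: pref_unit.
    by rewrite -coip_chart//; exact: coip_ge0.
  rewrite le_eqVlt; apply/orP; left; apply/eqP; congr (_ * _).
  rewrite /ip trmx_mul gs mulmxA mulmxK// trmx_delta -colE mxE -rowE mxE//.
rewrite dE; have [Lp|Lp] := pselect (L p); last first.
  have m0 : \forall y \near hnbhs (cmap c p), m y = 0.
    have cL' : closed L by apply: compact_closed => //; exact: mf_hausdorff.
    have nL : \forall q \near p, ~ L q by apply: open_nbhs_nbhs; split=> //; exact: closed_openC.
    by apply: filterS (cinv_near ac cp nL) => y Ly; rewrite /m r0// mulr0.
  rewrite (pderiv_near (g := fun=> 0) 1 Hx m0) (hdiff_pderiv 1 Hx (hdiff_cst 0 _)) mxE.
  rewrite {1}/m cinvK// r0// mulr0 !mul0r addr0 oppr0 mulr_ge0 ?(ltW v0)// addr_ge0// mulr_ge0 ?sqr_ge0 ?(ltW eps0)//.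
  by rewrite addr_ge0 ?ltW// divr_gt0// mulr_gt0// exprn_gt0.
have := hA _ Lp; have := hB _ Lp; have := hG _ Lp; move: k0 Xk v0.
move: (vol c _) (metric_in c _ 1 1) (pderiv 1 m _) (m _) (u p) (coip _ _ _) => v g m' k w q q0 Xq v0 hg hb ha.
pose a := v^-1 * m'; pose b := v^-1 * k.
have -> : - (m' * w ^+ 2 + k * (2 * w * X)) = v * (- a * w ^+ 2 - 2 * b * w * X).
  by rewrite /a /b; field; rewrite gt_eqF.
rewrite ler_pM2l//.
have h1 : - a * w ^+ 2 <= A * w ^+ 2.
  by apply: ler_wpM2r; [exact: sqr_ge0|apply: le_trans ha; rewrite -normrN; exact: ler_norm].
have Xq2 : X ^+ 2 <= G * q.
  by apply: le_trans Xq _; apply: ler_wpM2r => //; apply: le_trans hg; exact: ler_norm.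
have h2 : - (2 * b * w * X) <= eps * q + B ^+ 2 * G / eps * w ^+ 2.
  have eG : 0 < eps / G by rewrite divr_gt0.
  have s0 : 0 <= eps / G * (X + b * w * (G / eps)) ^+ 2 by rewrite mulr_ge0 ?sqr_ge0// ltW.
  have s1 : eps / G * (X + b * w * (G / eps)) ^+ 2 = eps / G * X ^+ 2 + 2 * b * w * X + b ^+ 2 * (G / eps * w ^+ 2).
    by field; rewrite !gt_eqF.
  have s2 : eps / G * X ^+ 2 <= eps * q.
    have -> : eps * q = eps / G * (G * q) by field; rewrite gt_eqF.
    by rewrite ler_pM2l.
  have s3 : b ^+ 2 * (G / eps * w ^+ 2) <= B ^+ 2 * G / eps * w ^+ 2.
    have -> : B ^+ 2 * G / eps * w ^+ 2 = B ^+ 2 * (G / eps * w ^+ 2) by rewrite !mulrA.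
    apply: ler_wpM2r; first by rewrite mulr_ge0 ?sqr_ge0// ltW// divr_gt0.
    rewrite -(real_normK (num_real b)); apply: lerXn2r; rewrite ?nnegrE ?normr_ge0 ?(ltW B0)//.
  move: s0; rewrite s1; move: (eps / G * X ^+ 2) (b ^+ 2 * _) (2 * b * w * X) (B ^+ 2 * G / eps * w ^+ 2) (eps * q) s2 s3 => *; lra.
rewrite [leRHS](_ : _ = A * w ^+ 2 + (eps * q + B ^+ 2 * G / eps * w ^+ 2)); last by ring.
exact: lerD.
Qed.

(** The boundary integral is the integral over the half-plane of minus the transversal derivative of
    the extended density. Only the positive part of that integrand is kept and compared with the
    energy. *)
Lemma trace_chart (eps : R) : 0 < eps -> exists2 C : R, 0 <= C & forall u, smooth_fun u ->
  (\int[sigma]_(p in @bdry R 1 S) (rho p * u p ^+ 2)%:E <=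
   \int[mu]_p (eps * coip p (diff_fun u p) (diff_fun u p) + C * u p ^+ 2)%:E)%E.
Proof.
move=> eps0; have [C C0 hC] := trace_pointwise eps0; exists C => // u su.
have [srho [L [cL Lc r0]]] := crho; have rc := cimg_ropen ac.
have meas (f : S -> R) (D : set (borel S)) : smooth_fun f -> measurable D -> measurable_fun D (EFin \o (f : borel S -> R)).
  move=> sf mD; apply/measurable_EFinP; apply: measurable_funS (_ : measurable_fun setT (f : borel S -> R)) => //.
  by have [] := lbm_continuous (smooth_fun_continuous sf).
have mb : measurable (@bdry R 1 S : set (borel S)) by apply: borel_closed; exact: bdry_closed.
have mc : measurable (cdom c : set (borel S)) by apply: borel_open; exact: cdom_open.
pose r p := rho p * u p ^+ 2.
have sr : smooth_fun r.
  by apply: smooth_funM => //; rewrite (_ : (fun p => u p ^+ 2) = fun p => u p * u p)//; exact: smooth_funM.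
pose h p := eps * coip p (diff_fun u p) (diff_fun u p) + C * u p ^+ 2.
have sh : smooth_fun h.
  apply: smooth_funD; first by apply: smooth_funZ; exact: coip_smooth.
  by apply: smooth_funZ; rewrite (_ : (fun p => u p ^+ 2) = fun p => u p * u p)//; exact: smooth_funM.
have h0 p : 0 <= h p by rewrite addr_ge0// mulr_ge0// ?sqr_ge0 ?coip_ge0// ltW.
pose g x := - (len c x * r (cinv c x)).
have sg : smooth_on (cimg c) g by apply: (smoothN rc); apply: (smoothM rc); [exact: len_smooth|exact: sr].
have g0 p : cdom c p -> ~ L p -> g (cmap c p) = 0.
  by move=> cp Lp; rewrite /g cinvK// /r r0// mul0r mulr0 oppr0.
have se := ext0_smooth ac cL Lc sg g0.
have [M M0 e0] := ext0_support ac cL Lc g0.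
have -> : (\int[sigma]_(p in @bdry R 1 S) (rho p * u p ^+ 2)%:E = \int[leb2]_z (Dext (ext0 c g) 1 z)%:E)%E.
  rewrite (divergence1 se M0 e0).
  transitivity (\int[sigma]_(p in cdom c) (((EFin \o r) \_ (@bdry R 1 S)) p))%E.
    rewrite [LHS]integral_mkcond [RHS]integral_mkcond; apply: eq_integral => p _.
    rewrite [in RHS]/patch; case: ifPn => // ; rewrite notin_setE => cp.
    by rewrite /patch; case: ifPn => // _; rewrite r0 ?mul0r// => /Lc.
  rewrite (integral_length sigma_length ac); last first.
    apply/(measurable_restrict _ mb mc); apply: meas => //; exact: measurableI.
  rewrite [LHS]integral_mkcond; apply: eq_integral => t _; rewrite /ext0 [LHS]/patch.
  case: ifPn; rewrite ?inE ?notin_setE /line_dom /= => ct; last by rewrite asboolF// oppr0.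
  rewrite asboolT// /g opprK mulrC EFinM /patch mem_set//.
  have [q cq qt] := ct; rewrite -qt cinvK//; apply/(bdryP ac cq); by rewrite qt mxE.
pose D1 z := (Dext (ext0 c g) 1 z)%:E.
have D1p : (\int[leb2]_z D1 z <= \int[leb2]_z D1^\+ z)%E.
  rewrite integralE -[leRHS]adde0; apply: leeD2l; rewrite oppe_le0; exact: integral_ge0.
apply: (le_trans D1p); apply: (@le_trans _ _ (\int[mu]_(p in cdom c) (h p)%:E)%E); last first.
  by apply: ge0_subset_integral => //; [exact: meas|move=> p _; rewrite lee_fin].
rewrite (integral_area mu_area ac); last exact: meas.
rewrite [leRHS]integral_mkcond; apply: ge0_le_integral => //.
- apply: measurable_funepos; apply/measurable_EFinP; exact: (Dext_measurable se).
- apply/(measurable_restrictT _ (plane_dom_measurable ac)); apply: emeasurable_funM; apply/measurable_EFinP.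
    exact: (plane_smooth_measurable ac (sh c ac)).
  exact: (plane_smooth_measurable ac (vol_smooth ac)).
move=> z _; rewrite /patch; case: ifPn; rewrite ?inE ?notin_setE /plane_dom /= => cz.
  have hz : 0 <= z.2 by rewrite -plane_half; exact: ropenH rc cz.
  rewrite funeposE ge_max; apply/andP; split; last by rewrite -EFinM lee_fin mulr_ge0// sqrtr_ge0.
  rewrite lee_fin /Dext hz (ext0_pderiv ac)//; have [q cq qz] := cz; rewrite -qz cinvK// mulrC.
  apply: le_trans (hC _ su _ cq); rewrite le_eqVlt; apply/orP; left; apply/eqP.
  have sl : smooth_on (cimg c) (fun x => len c x * r (cinv c x)) by apply: (smoothM rc); [exact: len_smooth|exact: sr].
  have hl := smooth_hdiff rc (cmap_img cq) sl; have Hq := cmap_half ac cq.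
  by rewrite (hdiff_pderiv 1 Hq (hdiffN hl)) (hdiff_pderiv 1 Hq hl) mxE.
rewrite funeposE ge_max lexx andbT lee_fin /Dext; case: ifP => // hz.
by rewrite (ext0_pderiv_out ac cL Lc g0) ?plane_half// => -[p Lp pz]; apply: cz; rewrite -pz; apply: cmap_img; exact: Lc.
Qed.

End ChartTrace.

Lemma bdry_measurable : measurable (@bdry R 1 S : set (borel S)).
Proof. by apply: borel_closed; exact: bdry_closed. Qed.

Lemma smooth_fun_sqr u : smooth_fun u -> smooth_fun (fun p => u p ^+ 2).
Proof. by move=> su; rewrite (_ : (fun p => u p ^+ 2) = fun p => u p * u p)//; exact: smooth_funM. Qed.

(** Each chart of the list uses half of the remaining [eps]. *)
Lemma trace_sum (s : seq S) (rho : S -> S -> R) (eps : R) :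
  (forall i, Cc (rho i) (cdom (chart_at i))) -> (forall i p, 0 <= rho i p) -> 0 < eps ->
  exists2 C : R, 0 <= C & forall u, smooth_fun u ->
  (\int[sigma]_(p in @bdry R 1 S) ((\sum_(i <- s) rho i p) * u p ^+ 2)%:E <=
   \int[mu]_p (eps * coip p (diff_fun u p) (diff_fun u p) + C * u p ^+ 2)%:E)%E.
Proof.
move=> cr r0; have meas (D : set (borel S)) (f : S -> R) : measurable D -> smooth_fun f -> measurable_fun D (EFin \o (f : borel S -> R)).
  move=> mD sf; apply/measurable_EFinP; apply: measurable_funS (_ : measurable_fun setT (f : borel S -> R)) => //.
  by have [] := lbm_continuous (smooth_fun_continuous sf).
have sh u e C : smooth_fun u -> smooth_fun (fun p => e * coip p (diff_fun u p) (diff_fun u p) + C * u p ^+ 2).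
  move=> su; apply: smooth_funD; apply: smooth_funZ; first exact: coip_smooth.
  exact: smooth_fun_sqr.
have h0 u e C p : 0 <= e -> 0 <= C -> (0 <= (e * coip p (diff_fun u p) (diff_fun u p) + C * u p ^+ 2)%:E)%E.
  by move=> e0 C0; rewrite lee_fin addr_ge0// mulr_ge0// ?coip_ge0 ?sqr_ge0.
elim: s eps => [|i s ih] eps eps0.
  exists 0 => // u su; rewrite integral0_eq => [|p _]; last by rewrite big_nil mul0r.
  by apply: integral_ge0 => p _; apply: h0 => //; exact: ltW.
have e2 : 0 < eps / 2 by rewrite divr_gt0.
have [C1 C10 h1] := ih _ e2; have [C2 C20 h2] := trace_chart (chart_atlas i) (cr i) e2.
exists (C2 + C1) => [|u su]; first by rewrite addr_ge0.
under eq_integral do rewrite big_cons mulrDl EFinD.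
have srho j : smooth_fun (rho j) by have [] := cr j.
rewrite ge0_integralD//; first last.
- by apply: (meas _ (fun p => (\sum_(i <- s) rho i p) * u p ^+ 2)) bdry_measurable _; apply: smooth_funM; [exact: smooth_fun_sum|exact: smooth_fun_sqr].
- by move=> p _; rewrite lee_fin mulr_ge0 ?sqr_ge0// sumr_ge0.
- by apply: (meas _ (fun p => rho i p * u p ^+ 2)) bdry_measurable _; apply: smooth_funM => //; exact: smooth_fun_sqr.
- by move=> p _; rewrite lee_fin mulr_ge0 ?sqr_ge0.
- exact: bdry_measurable.
apply: le_trans (leeD (h2 _ su) (h1 _ su)) _.
rewrite -ge0_integralD//; first last.
- by apply: (meas _ (fun p => _)) => //; exact: sh.
- by move=> p _; apply: h0 => //; exact: ltW.
- by apply: (meas _ (fun p => _)) => //; exact: sh.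
- by move=> p _; apply: h0 => //; exact: ltW.
rewrite le_eqVlt; apply/orP; left; apply/eqP; apply: eq_integral => p _; rewrite -EFinD; congr (_%:E).
by move: (coip _ _ _) (u p) => k w; field.
Qed.

Lemma trace_inequality (K : set S) (eps : R) : compact K -> 0 < eps ->
  exists2 C : R, 0 <= C & forall u, smooth_fun u -> (forall p, ~ K p -> u p = 0) ->
  \int[sigma]_(p in @bdry R 1 S) (u p ^+ 2) <=
   eps * \int[mu]_p coip p (diff_fun u p) (diff_fun u p) + C * \int[mu]_p (u p ^+ 2).
Proof.
move=> cK eps0; have [s [rho [U [cr r0 _ [oU KU] r1]]]] := partition_of_unity cK.
have [C C0 hC] := trace_sum s cr r0 eps0; exists C => // u su u0.
have cu : Cc u setT by split=> //; exists K; split.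
have cL : closed K by apply: compact_closed => //; exact: mf_hausdorff.
have c1 : Cc (fun p => coip p (diff_fun u p) (diff_fun u p)) setT.
  split; first exact: coip_smooth.
  exists K; split=> // p Kp; rewrite (diff_fun_near (v := fun=> 0)) ?diff_fun_cst ?coip0l//.
  by apply: filterS (open_nbhs_nbhs (conj (closed_openC cL) Kp)) => q; exact: u0.
have c2 : Cc (fun p => u p ^+ 2) setT.
  by split; [exact: smooth_fun_sqr|exists K; split=> // p Kp; rewrite u0// expr0n].
have := hC u su.
have -> : (\int[sigma]_(p in @bdry R 1 S) ((\sum_(i <- s) rho i p) * u p ^+ 2)%:E =
    \int[sigma]_(p in @bdry R 1 S) (u p ^+ 2)%:E)%E.
  apply: eq_integral => p _; have [/KU Up|/u0 ->] := pselect (K p); first by rewrite r1// mul1r.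
  by rewrite expr0n mulr0.
have i1 := Cc_integrable c1; have i2 := Cc_integrable c2.
under [leRHS]eq_integral do rewrite EFinD !EFinM.
rewrite integralD//; [|exact: integrableZl|exact: integrableZl].
rewrite !integralZl// => h.
have f1 := integral_fune_fin_num measurableT i1; have f2 := integral_fune_fin_num measurableT i2.
rewrite /Rintegral -(fineK f1) -(fineK f2) -!EFinM -EFinD in h *.
rewrite !fineK// -lee_fin fineK//.
rewrite ge0_fin_numE; last by apply: integral_ge0 => p _; rewrite lee_fin sqr_ge0.
by apply: le_lt_trans h _; rewrite ltry.
Qed.

End IntegralFormulas.

(** * Spectral theory of forms of finite index *)

Section Forms.
Context (R : realType) (E : lmodType R).
Implicit Types (x y z : E) (P Q : E -> E -> R).

Definition symbil Q := (forall x y, Q x y = Q y x) /\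
  (forall a x y z, Q (a *: x + y) z = a * Q x z + Q y z).

Definition lincomb k (a : 'rV[R]_k) (u : 'I_k -> E) := \sum_i a 0 i *: u i.

Definition negdef Q k (u : 'I_k -> E) :=
  forall a : 'rV[R]_k, a != 0 -> Q (lincomb a u) (lincomb a u) < 0.

Lemma sum_CS k (a b : 'I_k -> R) :
  (\sum_i a i * b i) ^+ 2 <= (\sum_i a i ^+ 2) * (\sum_i b i ^+ 2).
Proof.
rewrite expr2 !big_distrlr/=.
rewrite -(ler_pM2r (_ : 0 < 2))//.
have -> : (\sum_i \sum_j a i ^+ 2 * b j ^+ 2) * 2 =
    \sum_i \sum_j (a i ^+ 2 * b j ^+ 2 + a j ^+ 2 * b i ^+ 2).
  rewrite mulr_natr mulr2n {2}exchange_big/= -big_split/=.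
  by apply: eq_bigr => i _; rewrite -big_split.
rewrite mulr_suml; apply: ler_sum => i _; rewrite mulr_suml; apply: ler_sum => j _.
rewrite -subr_ge0 (_ : _ - _ = (a i * b j - a j * b i) ^+ 2); last by ring.
exact: sqr_ge0.
Qed.

Section Bil.
Context (Q : E -> E -> R).
Hypothesis sQ : symbil Q.

Lemma sbC x y : Q x y = Q y x. Proof using sQ. exact: (proj1 sQ). Qed.
Lemma sb0l z : Q 0 z = 0.
Proof using sQ.
have := proj2 sQ 1 0 0 z; rewrite scale1r addr0 mul1r => /eqP.
by rewrite -subr_eq0 opprD addNKr oppr_eq0 => /eqP.
Qed.
Lemma sbZl a x z : Q (a *: x) z = a * Q x z.
Proof using sQ. by have := proj2 sQ a x 0 z; rewrite addr0 sb0l addr0. Qed.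
Lemma sbDl x y z : Q (x + y) z = Q x z + Q y z.
Proof using sQ. by have := proj2 sQ 1 x y z; rewrite scale1r mul1r. Qed.
Lemma sbNl x z : Q (- x) z = - Q x z.
Proof using sQ. by rewrite -scaleN1r sbZl mulN1r. Qed.
Lemma sbBl x y z : Q (x - y) z = Q x z - Q y z.
Proof using sQ. by rewrite sbDl sbNl. Qed.
Lemma sbZr a x z : Q z (a *: x) = a * Q z x.
Proof using sQ. by rewrite sbC sbZl (sbC x). Qed.
Lemma sbDr x y z : Q z (x + y) = Q z x + Q z y.
Proof using sQ. by rewrite sbC sbDl (sbC x) (sbC y). Qed.
Lemma sbNr x z : Q z (- x) = - Q z x.
Proof using sQ. by rewrite sbC sbNl (sbC x). Qed.
Lemma sbBr x y z : Q z (x - y) = Q z x - Q z y.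
Proof using sQ. by rewrite sbDr sbNr. Qed.
Lemma sb_lincomb k (a : 'rV[R]_k) u z : Q (lincomb a u) z = \sum_i a 0 i * Q (u i) z.
Proof using sQ.
rewrite /lincomb; elim/big_ind2 : _ => [|x1 x2 y1 y2 <- <-|i _]; first by rewrite sb0l.
  by rewrite sbDl.
by rewrite sbZl.
Qed.

Lemma sb_sqD x y : Q (x + y) (x + y) = Q x x + 2 * Q x y + Q y y.
Proof using sQ. by rewrite sbDl !sbDr (sbC y x); ring. Qed.
Lemma sb_sqB x y : Q (x - y) (x - y) = Q x x - 2 * Q x y + Q y y.
Proof using sQ. by rewrite sbBl !sbBr (sbC y x); ring. Qed.

Hypothesis pQ : forall x, 0 <= Q x x.

Lemma psd_CS x y : (Q x y) ^+ 2 <= Q x x * Q y y.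
Proof using sQ pQ.
have h t : 0 <= Q x x - 2 * t * Q x y + t ^+ 2 * Q y y.
  by have := pQ (x - t *: y); rewrite sb_sqB sbZl !sbZr; lra.
have := pQ y; rewrite le_eqVlt => /orP[/eqP y0|y0].
  rewrite -y0 mulr0; apply: contrapT => /negP; rewrite -ltNge => xy.
  have xy0 : Q x y != 0 by apply: contraTneq xy => ->; rewrite expr0n ltxx.
  have := h ((Q x x + 1) / (2 * Q x y)); rewrite -y0 mulr0 addr0.
  by rewrite (_ : 2 * _ * Q x y = Q x x + 1); [lra|field].
have := h (Q x y / Q y y).
rewrite (_ : _ - _ + _ = Q x x - Q x y ^+ 2 / Q y y); last by field; rewrite gt_eqF.
by rewrite subr_ge0 ler_pdivrMr.
Qed.

Lemma psd_parallelogram x y : Q (x + y) (x + y) <= 2 * Q x x + 2 * Q y y.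
Proof using sQ pQ. by have := pQ (x - y); rewrite sb_sqB sb_sqD; lra. Qed.

Lemma psd_parallelogramB x y : Q (x - y) (x - y) <= 2 * Q x x + 2 * Q y y.
Proof using sQ pQ. by have := pQ (x + y); rewrite sb_sqB sb_sqD; lra. Qed.

End Bil.

Lemma lincomb_recl k (a : 'rV[R]_k.+1) (u : 'I_k.+1 -> E) :
  lincomb a u = a 0 ord0 *: u ord0 + lincomb (\row_j a 0 (lift ord0 j)) (u \o lift ord0).
Proof.
rewrite /lincomb big_ord_recl; congr (_ + _).
by apply: eq_bigr => i _; rewrite mxE.
Qed.

Definition consr k (c : R) (a : 'rV[R]_k) : 'rV[R]_k.+1 :=
  \row_i (if unlift ord0 i is Some j then a 0 j else c).

Lemma consr0 k c (a : 'rV[R]_k) : consr c a 0 ord0 = c.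
Proof. by rewrite mxE unlift_none. Qed.

Lemma consrS k c (a : 'rV[R]_k) : \row_j consr c a 0 (lift ord0 j) = a.
Proof. by apply/rowP => j; rewrite !mxE liftK. Qed.

Definition consf k (x : E) (u : 'I_k -> E) (i : 'I_k.+1) :=
  if unlift ord0 i is Some j then u j else x.

Lemma lincomb_consf k (a : 'rV[R]_k.+1) x (u : 'I_k -> E) :
  lincomb a (consf x u) = a 0 ord0 *: x + lincomb (\row_j a 0 (lift ord0 j)) u.
Proof.
rewrite lincomb_recl {1}/consf unlift_none; congr (_ + lincomb _ _).
by apply/funext => j; rewrite /consf /= liftK.
Qed.

(** Gram-Schmidt for [- Q]. [A] is closed under linear combinations and holds the family; in the
    induction it also carries orthogonality to the vectors already found. *)
Lemma negdef_orthonormal Q k (u : 'I_k -> E) (A : set E) : symbil Q -> negdef Q u ->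
  (forall a x y, A x -> A y -> A (a *: x + y)) -> (forall i, A (u i)) ->
  exists e : 'I_k -> E, (forall i, A (e i)) /\
    (forall i j, Q (e i) (e j) = - (i == j)%:R).
Proof.
move=> sQ; elim: k u A => [|k ih] u A nu cA Au; first by exists u; split=> // -[].
have Q0 : Q (u ord0) (u ord0) < 0.
  have := nu (consr 1 0); rewrite lincomb_recl consr0 consrS scale1r.
  rewrite (_ : lincomb 0 _ = 0) ?addr0; last first.
    by rewrite /lincomb big1// => i _; rewrite mxE scale0r.
  apply; apply/eqP => /rowP/(_ ord0); rewrite consr0 mxE => /eqP.
  by rewrite oner_eq0.
set r := Num.sqrt (- Q (u ord0) (u ord0)).
have r0 : 0 < r by rewrite sqrtr_gt0 oppr_gt0.
have r2 : Q (u ord0) (u ord0) = - r ^+ 2 by rewrite sqr_sqrtr ?opprK// oppr_ge0 ltW.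
pose e0 := r^-1 *: u ord0.
have Qe0 : Q e0 e0 = -1.
  by rewrite /e0 (sbZl sQ) (sbZr sQ) r2; field; rewrite gt_eqF.
(* As [Q e0 e0 = -1], the projection to [e0] is removed by adding this multiple. *)
pose u' j := Q (u (lift ord0 j)) e0 *: e0 + u (lift ord0 j).
have [||i|e' [Ae' oe']] := ih u' (A `&` [set x | Q x e0 = 0]).
- move=> a a0.
  have -> : lincomb a u' = lincomb (consr (r^-1 * \sum_j a 0 j * Q (u (lift ord0 j)) e0) a) u.
    rewrite lincomb_recl consr0 consrS /lincomb /u' /e0 /=.
    rewrite mulrC -scalerA scaler_suml -big_split/=.
    by apply: eq_bigr => i _; rewrite scalerDr [a 0 i *: (_ *: _)]scalerA.
  apply: nu; apply: contraNneq a0 => /(congr1 (fun v : 'rV_k.+1 => \row_j v 0 (lift ord0 j) : 'rV_k)).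
  by rewrite consrS => ->; apply/eqP/rowP => j; rewrite !mxE.
- move=> a x y [Ax Qx] [Ay Qy]; split; first exact: cA.
  by rewrite /= (sbDl sQ) (sbZl sQ) Qx Qy mulr0 addr0.
- have Ae0 : A e0.
    rewrite /e0 -[_ *: _]addr0 -(subrr (u ord0)) addrA -scaleN1r addrC.
    apply: (cA) => //; rewrite -[u ord0 in X in _ + X]scale1r -scalerDl.
    have -> : (r^-1 + 1) *: u ord0 = r^-1 *: u ord0 + u ord0 by rewrite scalerDl scale1r.
    exact: cA.
  split; first exact: cA.
  by rewrite /u' /= (sbDl sQ) (sbZl sQ) Qe0; ring.
have Ae0 : A e0.
  rewrite /e0 -[_ *: _]addr0 -(subrr (u ord0)) addrA -scaleN1r addrC.
  apply: (cA) => //; exact: cA.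
exists (consf e0 e'); split=> [i|i j].
  by rewrite /consf; case: unliftP => // j _; case: (Ae' j).
rewrite /consf; case: (unliftP ord0 i) => [i' ->|->]; case: (unliftP ord0 j) => [j' ->|->].
- by rewrite oe' (inj_eq lift_inj).
- by have [_ /= ->] := Ae' i'; rewrite oppr0.
- by have [_ /= h] := Ae' j'; rewrite (sbC sQ) h oppr0.
- by rewrite Qe0 eqxx.
Qed.

Lemma homo_ltn_ge (t : nat -> nat) : {homo t : m n / (m < n)%N} ->
  forall n, (n <= t n)%N.
Proof. by move=> ti; elim=> // n ih; apply: leq_ltn_trans ih _; exact: ti. Qed.

Lemma cvgn_subseq (u : nat -> R) (l : R) (t : nat -> nat) : {homo t : m n / (m < n)%N} ->
  u @ \oo --> l -> (fun n => u (t n)) @ \oo --> l.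
Proof.
move=> ti ul A /ul [N _ hN]; exists N => // n /= Nn; apply: hN => /=.
exact: leq_trans Nn (homo_ltn_ge ti n).
Qed.

(** Bolzano-Weierstrass, one coordinate after another. *)
Lemma bounded_subseq k (l : nat -> 'I_k -> R) M : (forall n i, `|l n i| <= M) ->
  exists s : nat -> nat, {homo s : m n / (m < n)%N} /\
    forall i, cvgn (fun n => l (s n) i).
Proof.
elim: k l => [|k ih] l lM; first by exists id; split=> // -[].
have [|s [si sc]] := ih (fun n j => l n (lift ord0 j)); first by move=> n i; exact: lM.
have [|t ti tc] := @bolzano_weierstrass R (fun n => l (s n) ord0).
  exists M; split=> [|x Mx n _]; first exact: num_real.
  by apply: le_trans (lM _ _) _; exact: ltW.
have {}ti : {homo t : m n / (m < n)%N} by move=> m n; rewrite !ltnNge -(ti n m).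
exists (s \o t); split=> [m n mn|i]; first by apply: si; exact: ti.
case: (unliftP ord0 i) => [j ->|->] //.
have /cvg_ex[/= v hv] := sc j; apply/cvg_ex; exists v.
exact: (@cvgn_subseq (fun n => l (s n) (lift ord0 j)) v t).
Qed.

(* The minimizing sequence converges in a direct way: on the Q-complement of the
   maximal negative definite space spanned by [e] the form [Q - lam B] dominates
   [- lam B], and the component along [e] stays in a finite-dimensional space. *)
Lemma minimizing_sequence Q (B : E -> E -> R) C k (e : 'I_k -> E) :
  symbil Q -> symbil B -> (forall x, 0 <= B x x) ->
  0 <= C -> (forall x, - C * B x x <= Q x x) ->
  (forall i j, Q (e i) (e j) = - (i == j)%:R) ->
  (forall x, (forall i, Q x (e i) = 0) -> 0 <= Q x x) ->
  (exists x, Q x x < 0) ->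
  exists (phi : nat -> E) (lam : R), [/\ lam < 0, - C <= lam,
    forall n, B (phi n) (phi n) = 1,
    forall x, lam * B x x <= Q x x &
    Q (phi n) (phi n) - lam @[n --> \oo] --> 0 /\
    forall eps, 0 < eps -> exists N, forall m n, (N <= m)%N -> (N <= n)%N ->
      B (phi m - phi n) (phi m - phi n) < eps /\
      Q (phi m - phi n) (phi m - phi n) < eps].
Proof.
move=> sQ sB pB C0 QC oe mx [x0 Qx0].
pose A := [set Q x x | x in [set x | B x x = 1]].
have normalize x : B x x != 0 -> A (Q x x / B x x).
  move=> Bx; have b0 : 0 < B x x by rewrite lt_def Bx pB.
  exists ((Num.sqrt (B x x))^-1 *: x) => /=; rewrite (sbZl sB, sbZl sQ) (sbZr sB, sbZr sQ) mulrA -invfM -expr2 sqr_sqrtr ?pB// mulrC //.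
  by rewrite divff.
have neg0 x : Q x x < 0 -> B x x != 0.
  by apply: contraTneq => b0; rewrite -leNgt; have := QC x; rewrite b0 mulr0.
have A0 : A !=set0 by eexists; exact: normalize (neg0 _ Qx0).
have lbA : lbound A (- C) by move=> _ [x /= Bx <-]; have := QC x; rewrite Bx mulr1.
have iA : has_inf A by split=> //; exists (- C).
set lam := inf A.
have lamle x : lam * B x x <= Q x x.
  have [b0|b0] := eqVneq (B x x) 0; first by have := QC x; rewrite b0 !mulr0.
  rewrite -ler_pdivlMr; last by rewrite lt_def b0 pB.
  by apply: ge_inf; [exists (- C)|exact: normalize].
have lam0 : lam < 0.
  have Bx0 := neg0 _ Qx0.
  apply: (@le_lt_trans _ _ (Q x0 x0 / B x0 x0)); first by apply: ge_inf; [exists (- C)|exact: normalize].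
  by rewrite pmulr_llt0// invr_gt0 lt_def Bx0 pB.
have lamC : - C <= lam by apply: lb_le_inf.
have ex n : exists x, B x x = 1 /\ Q x x < lam + n.+1%:R^-1.
  have n0 : 0 < n.+1%:R^-1 :> R by rewrite invr_gt0.
  by have [_ [x Bx <-] Qx] := inf_adherent n0 iA; exists x.
pose psi n := projT1 (cid (ex n)).
have Bpsi n : B (psi n) (psi n) = 1 by rewrite /psi; case: cid => x [].
have Qpsi n : Q (psi n) (psi n) < lam + n.+1%:R^-1 by rewrite /psi; case: cid => x [].
(* Shifting by the infimum makes the form semidefinite: Cauchy-Schwarz holds for it, and along [psi]
   it tends to zero. *)
pose P x y := Q x y - lam * B x y.
have sP : symbil P.
  split=> [x y|a x y z]; first by rewrite /P (sbC sQ) (sbC sB).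
  by rewrite /P (sbDl sQ) (sbDl sB) (sbZl sQ) (sbZl sB); ring.
have pP x : 0 <= P x x by rewrite subr_ge0.
have Ppsi n : P (psi n) (psi n) <= n.+1%:R^-1.
  by rewrite /P Bpsi mulr1 lerBlDl; exact: ltW.
have [SP SPE] : exists SP, SP = \sum_i P (e i) (e i) by eexists.
have [SB SBE] : exists SB, SB = \sum_i B (e i) (e i) by eexists.
have [K KE] : exists K, K = SP + (- lam) * SB + 1 - lam by eexists.
have Ple i : P (e i) (e i) <= SP.
  by rewrite SPE (bigD1 i)//= lerDl sumr_ge0.
have Ble i : B (e i) (e i) <= SB.
  by rewrite SBE (bigD1 i)//= lerDl sumr_ge0.
have sq1 a b : a ^+ 2 <= b -> `|a| <= b + 1 :> R.
  move=> ab; have := sqr_ge0 (`|a| - 1); rewrite sqrrB real_normK ?num_real//.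
  by have := normr_ge0 a; lra.
have bnd n i : `|Q (psi n) (e i)| <= K.
  have E1 : Q (psi n) (e i) = P (psi n) (e i) + lam * B (psi n) (e i) by rewrite /P; ring.
  have h1 : `|P (psi n) (e i)| <= P (e i) (e i) + 1.
    apply: sq1; apply: le_trans (psd_CS sP pP _ _) _.
    by rewrite ler_piMl// (le_trans (Ppsi n))// invf_le1// ler1n.
  have h2 : `|B (psi n) (e i)| <= B (e i) (e i) + 1.
    by apply: sq1; apply: le_trans (psd_CS sB pB _ _) _; rewrite Bpsi mul1r.
  rewrite E1; apply: le_trans (ler_normD _ _) _; rewrite normrM (ltr0_norm lam0).
  have h3 : - lam * `|B (psi n) (e i)| <= - lam * (SB + 1).
    apply: ler_wpM2l; first by rewrite oppr_ge0 ltW.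
    exact: le_trans h2 (lerD (Ble i) (lexx _)).
  apply: le_trans (lerD h1 h3) _; rewrite KE mulrDr mulr1 addrA lerD2r addrAC lerD2r lerD2r.
  exact: Ple.
have [s [si sc]] := bounded_subseq bnd.
pose phi n := psi (s n); have sn := homo_ltn_ge si.
exists phi, lam; split=> //; first by move=> n; exact: Bpsi.
have Pphi n : P (phi n) (phi n) <= n.+1%:R^-1.
  apply: le_trans (Ppsi _) _; rewrite lef_pV2 ?posrE// ler_nat ltnS; exact: sn.
have PphiE n : P (phi n) (phi n) = Q (phi n) (phi n) - lam by rewrite /P Bpsi mulr1.
split.
  apply: (@squeeze_cvgr _ _ _ _ (fun=> 0) (fun n => n.+1%:R^-1)).
  - by near=> n; rewrite -PphiE pP Pphi.
  - exact: cvg_cst.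
  - exact: cvg_harmonic.
(* The [Q]-projection to the span of [e]; the sign comes from [Q (e i) (e i) = -1]. *)
pose vpart x := \sum_i (- Q x (e i)) *: e i.
have Qv x j : Q (x - vpart x) (e j) = 0.
  rewrite (sbBl sQ) /vpart.
  have -> : Q (\sum_i - Q x (e i) *: e i) (e j) = Q x (e j).
    have := sb_lincomb sQ (\row_i - Q x (e i)) e (e j).
    rewrite /lincomb; under eq_bigr do rewrite mxE; move=> ->.
    rewrite (bigD1 j)//= big1 => [|i ij]; first by rewrite mxE oe eqxx mulrNN mulr1 addr0.
    by rewrite oe (negbTE ij) oppr0 mulr0.
  by rewrite subrr.
have p0 : 0 <= SP by rewrite SPE sumr_ge0.
have b0 : 0 <= SB by rewrite SBE sumr_ge0.
(* Cauchy-Schwarz for sums and for [D] bounds any semidefinite [D] on the span by the squares of the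
   coordinates. It is applied to both [P] and [B]. *)
have vP (D : E -> E -> R) : symbil D -> (forall x, 0 <= D x x) -> forall x,
    D (vpart x) (vpart x) <= (\sum_i Q x (e i) ^+ 2) * (k%:R * \sum_i D (e i) (e i)).
  move=> sD pD x.
  have E0 : vpart x = lincomb (\row_i - Q x (e i)) e.
    by rewrite /lincomb; apply: eq_bigr => i _; rewrite mxE.
  have E1 : D (vpart x) (vpart x) = \sum_i (- Q x (e i)) * D (e i) (vpart x).
    by rewrite {1}E0 (sb_lincomb sD); apply: eq_bigr => i _; rewrite mxE.
  have := sum_CS (fun i => - Q x (e i)) (fun i => D (e i) (vpart x)); rewrite -E1.
  under [X in X * _]eq_bigr do rewrite sqrrN.
  set S := \sum_i Q x (e i) ^+ 2; set d := D (vpart x) (vpart x) => h.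
  have h2 : \sum_i D (e i) (vpart x) ^+ 2 <= d * \sum_i D (e i) (e i).
    by rewrite mulr_sumr ler_sum// => i _; rewrite mulrC psd_CS.
  have S0 : 0 <= S by rewrite sumr_ge0// => i _; exact: sqr_ge0.
  have T0 : 0 <= \sum_i D (e i) (e i) by exact: sumr_ge0.
  have [d0|d0] := leP d 0.
    by rewrite (le_trans d0)// mulr_ge0// mulr_ge0.
  have {}h : d ^+ 2 <= S * (d * \sum_i D (e i) (e i)) by rewrite (le_trans h)// ler_wpM2l.
  have {}h : d <= S * \sum_i D (e i) (e i) by rewrite -(ler_pM2l d0) -expr2 mulrCA.
  apply: le_trans h _; rewrite ler_wpM2l//.
  have [k0|] := posnP k; last by move=> k0; rewrite ler_peMl// ler1n.
  by rewrite big1 ?mulr0// => -[i ik]; exfalso; rewrite k0 in ik.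
move=> eps eps0.
have P0 : 0 <= k%:R * SP by rewrite mulr_ge0.
have B0 : 0 <= k%:R * SB by rewrite mulr_ge0.
have [M ME] : exists M, M = k%:R * SP + k%:R * SB + 1 by eexists.
have M0 : 0 < M by rewrite ME; lra.
have MP : k%:R * SP <= M by rewrite ME; lra.
have MB : k%:R * SB <= M by rewrite ME; lra.
rewrite SPE in MP; rewrite SBE in MB.
(* Chosen so that the final estimates [- lam * B x x <= 8 * dl + 2 * dl * - lam] and [P x x <= dl]
   both fall below their targets. *)
pose dl := eps * (- lam) / (16 * (1 - lam)).
have l1 : 0 < 1 - lam by lra.
have dl0 : 0 < dl by rewrite divr_gt0// mulr_gt0// oppr_gt0.
have dlE : dl * (16 * (1 - lam)) = eps * - lam by rewrite /dl divfK// gt_eqF// mulr_gt0.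
have dle : dl * 16 <= eps.
  rewrite -(ler_pM2r l1) -mulrA dlE mulrBr mulr1 mulrN lerDr; exact: ltW.
have [v vc] : exists v : 'I_k -> R, forall i, Q (phi n) (e i) @[n --> \oo] --> v i.
  by exists (fun i => limn (fun n => Q (phi n) (e i))) => i; exact: sc.
pose g n := \sum_i (Q (phi n) (e i) - v i) ^+ 2.
have gc : g n @[n --> \oo] --> (0 : R).
  rewrite (_ : 0 = \sum_(i < k) (v i - v i) ^+ 2); last first.
    by rewrite big1// => i _; rewrite subrr expr0n.
  apply: (@cvg_big _ _ _ 0 xpredT); first exact: add_continuous.
  by move=> i _; apply: cvgM; (apply: cvgB; [exact: vc|exact: cvg_cst]).
have [N1 _ hN1] : \forall n \near \oo, g n < dl / (4 * M).
  by apply: (@cvgr_lt _ _ _ _ g 0 gc); rewrite divr_gt0// mulr_gt0.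
have [N2 _ hN2] : \forall n \near \oo, n.+1%:R^-1 < dl / 4.
  apply: (@cvgr_lt _ _ _ _ (fun n => n.+1%:R^-1) (0 : R)); first exact: cvg_harmonic.
  by rewrite divr_gt0.
exists (maxn N1 N2) => m n; rewrite !geq_max => /andP[m1 m2] /andP[n1 n2].
set x := phi m - phi n; set S := \sum_i Q x (e i) ^+ 2.
have gM (y : nat) : (N1 <= y)%N -> g y * M < dl / 4.
  move=> /hN1; rewrite ltr_pdivlMr ?mulr_gt0// => h; lra.
have SM : S * M <= dl.
  have : S <= 2 * g m + 2 * g n.
    rewrite /S /g !mulr_sumr -big_split/=; apply: ler_sum => i _; rewrite (sbBl sQ).
    set a := Q (phi m) _; set b := Q (phi n) _; set c := v i.
    have := sqr_ge0 ((a - c) + (b - c)); nra.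
  rewrite -(ler_pM2r M0) => h; apply: le_trans h _.
  by have := gM _ m1; have := gM _ n1; lra.
have Px : P x x <= dl.
  apply: le_trans (psd_parallelogramB sP pP _ _) _.
  have := le_lt_trans (Pphi m) (hN2 _ m2); have := le_lt_trans (Pphi n) (hN2 _ n2).
  by move: (P (phi m) _) (P (phi n) _) => a b; lra.
pose w := x - vpart x.
have S0 : 0 <= S by rewrite sumr_ge0// => i _; exact: sqr_ge0.
have Pv : P (vpart x) (vpart x) <= dl.
  by apply: le_trans (vP P sP pP x) _; apply: le_trans SM; rewrite ler_wpM2l.
have Bv : B (vpart x) (vpart x) <= dl.
  by apply: le_trans (vP B sB pB x) _; apply: le_trans SM; rewrite ler_wpM2l.
(* The remainder [w] is [Q]-orthogonal to the negative space, so [- lam * B w w] is at most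
   [P w w]. *)
have Qw : 0 <= Q w w by apply: mx => i; exact: Qv.
have Pw : P w w <= 4 * dl by have := psd_parallelogramB sP pP x (vpart x); rewrite -/w; lra.
have Bx : B x x <= 2 * B w w + 2 * B (vpart x) (vpart x).
  by have := psd_parallelogram sB pB w (vpart x); rewrite /w addrNK.
have Bw : - lam * B w w <= 4 * dl by move: Pw; rewrite /P; lra.
have Bxe : B x x < eps.
  have nl : 0 < - lam by rewrite oppr_gt0.
  rewrite -(ltr_pM2l nl).
  have h1 := ler_wpM2l (ltW nl) Bx; have h2 := ler_wpM2l (ltW nl) Bv.
  have h3 : 0 < eps * - lam by rewrite mulr_gt0.
  have h6 : 0 < dl * - lam by rewrite mulr_gt0.
  move: h1 h2 h3 h6 Bw dlE; rewrite mulrDr.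
  move: (B x x) (B w w) (B (vpart x) (vpart x)) (lam) (dl) (eps) => a b c l d f.
  by move=> h1 h2 h3 h4 h5 h6; lra.
split=> //; have PE : P x x = Q x x - lam * B x x by [].
have l0 : lam * B x x <= 0 by rewrite nmulr_rle0.
have dl_eps : dl < eps by move: dl0 dle; move: (dl) (eps) => d f; lra.
by apply: le_lt_trans dl_eps; move: Px l0; rewrite PE; move: (Q x x) (lam * _) (dl) => a b d; lra.
Unshelve. all: by end_near. Qed.

(* The residual [Q (phi n) - lam B (phi n)] tends to zero in the dual of the energy
   norm [Q + K B]. *)
Definition eigseq Q (B : E -> E -> R) (phi : nat -> E) (lam : R) := [/\ lam < 0,
  B (phi n) (phi n) @[n --> \oo] --> (1 : R),
  forall eps, 0 < eps -> exists N, forall m n, (N <= m)%N -> (N <= n)%N ->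
    B (phi m - phi n) (phi m - phi n) < eps /\
    Q (phi m - phi n) (phi m - phi n) < eps &
  exists K (d : nat -> R), [/\ forall x, B x x <= Q x x + K * B x x,
    d @ \oo --> (0 : R), forall n, 0 <= d n &
    forall n x, (Q (phi n) x - lam * B (phi n) x) ^+ 2 <= d n * (Q x x + K * B x x)]].

(** A vector with negative [Q] that is [Q]-orthogonal to a maximal family would enlarge it, so the
    minimizing argument applies. The residual bound is Cauchy-Schwarz for the semidefinite
    [Q - lam B], whose value on [phi n] tends to zero. *)
Lemma eigseq_exists Q (B : E -> E -> R) C k (u : 'I_k.+1 -> E) :
  symbil Q -> symbil B -> (forall x, 0 <= B x x) ->
  0 <= C -> (forall x, - C * B x x <= Q x x) ->
  negdef Q u -> (forall u' : 'I_k.+2 -> E, ~ negdef Q u') ->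
  exists phi lam, eigseq Q B phi lam.
Proof.
move=> sQ sB pB C0 QC nu mx.
have [e [_ oe]] := @negdef_orthonormal Q _ u setT sQ nu (fun _ _ _ _ _ => I) (fun=> I).
have Qlc a : Q (lincomb a e) (lincomb a e) = - \sum_i a 0 i ^+ 2.
  rewrite (sb_lincomb sQ) -sumrN; apply: eq_bigr => i _.
  rewrite (sbC sQ) (sb_lincomb sQ) (bigD1 i)//= big1 => [|j ji].
    by rewrite oe eqxx addr0 mulrN1 mulrN -expr2.
  by rewrite oe (negbTE ji) oppr0 mulr0.
have sum0 k' (a : 'rV[R]_k') : a != 0 -> 0 < \sum_i a 0 i ^+ 2.
  move=> a0; rewrite lt_def sumr_ge0 ?andbT => [|i _]; last exact: sqr_ge0.
  apply: contraNneq a0 => /eqP; rewrite psumr_eq0 => [/allP h|i _]; last exact: sqr_ge0.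
  apply/eqP/rowP => i; rewrite mxE; apply/eqP; rewrite -sqrf_eq0.
  exact: (h i (mem_index_enum _)).
have [] := @minimizing_sequence Q B C _ e sQ sB pB C0 QC oe.
- move=> x xe; rewrite leNgt; apply/negP => Qx.
  apply: (mx (consf x e)) => a a0.
  rewrite lincomb_consf; set b := \row_j _; rewrite (sb_sqD sQ).
  have -> : Q (a 0 ord0 *: x) (lincomb b e) = 0.
    by rewrite (sbC sQ) (sb_lincomb sQ) big1// => i _; rewrite (sbZr sQ) (sbC sQ) xe !mulr0.
  rewrite (sbZl sQ) (sbZr sQ) mulr0 addr0 Qlc mulrA -expr2.
  have [b0|b0] := eqVneq b 0.
    have a00 : a 0 ord0 != 0.
      apply: contraNneq a0 => a00; apply/eqP/rowP => i; rewrite mxE.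
      case: (unliftP ord0 i) => [j ->|->//].
      by have /rowP/(_ j) := b0; rewrite !mxE.
    rewrite b0 big1 => [|i _]; last by rewrite mxE expr0n.
    by rewrite subr0 pmulr_rlt0// exprn_even_gt0.
  have := sum0 _ _ b0; have : a 0 ord0 ^+ 2 * Q x x <= 0.
    by rewrite mulr_ge0_le0 ?sqr_ge0// ltW.
  by move: (\sum_i _) (_ * _) => ? ?; lra.
- exists (u ord0).
  have := nu (consr 1 0); rewrite lincomb_recl consr0 consrS scale1r.
  rewrite (_ : lincomb 0 _ = 0) ?addr0; last first.
    by rewrite /lincomb big1// => i _; rewrite mxE scale0r.
  apply; apply/eqP => /rowP/(_ ord0); rewrite consr0 mxE => /eqP.
  by rewrite oner_eq0.
move=> phi [lam [lam0 lamC B1 lamQ [Ql Cau]]]; exists phi, lam; split=> //.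
  by under eq_fun do rewrite B1; exact: cvg_cst.
pose P x y := Q x y - lam * B x y.
have sP : symbil P.
  split=> [x y|a x y z]; first by rewrite /P (sbC sQ) (sbC sB).
  by rewrite /P (sbDl sQ) (sbDl sB) (sbZl sQ) (sbZl sB); ring.
have pP x : 0 <= P x x by rewrite subr_ge0.
exists (C + 1), (fun n => Q (phi n) (phi n) - lam); split=> //.
- by move=> x; have := QC x; move: (Q x x) (B x x) => ? ?; lra.
- by move=> n; have := lamQ (phi n); rewrite B1 mulr1 subr_ge0.
move=> n x; have := psd_CS sP pP (phi n) x; rewrite {2}/P B1 mulr1 => h.
apply: le_trans h _; apply: ler_wpM2l.
  by have := lamQ (phi n); rewrite B1 mulr1 subr_ge0.
rewrite /P; have : (C + 1 + lam) * B x x >= 0 by rewrite mulr_ge0//; lra.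
by move: (Q x x) (B x x) => ? ?; lra.
Qed.

End Forms.

Lemma sqr_le_cvg0 (R : realType) (u d : nat -> R) M :
  (\forall n \near \oo, u n ^+ 2 <= d n * M) -> d @ \oo --> (0 : R) -> u @ \oo --> (0 : R).
Proof.
move=> ud dc.
have h : u n ^+ 2 @[n --> \oo] --> (0 : R).
  apply: (@squeeze_cvgr _ _ _ _ (fun=> 0) (fun n => d n * M)).
  - by near=> n; rewrite sqr_ge0/=; near: n.
  - exact: cvg_cst.
  - by rewrite -[X in _ --> X](mul0r M); apply: cvgM => //; exact: cvg_cst.
apply/cvgr0Pnorm_lt => e e0.
move/cvgr0Pnorm_lt: h => /(_ (e ^+ 2)); rewrite exprn_gt0// => /(_ isT).
apply: filterS => n; rewrite ger0_norm ?sqr_ge0// => hn.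
by rewrite -(@ltr_pXn2r _ 2)// ?nnegrE ?ltW// real_normK ?num_real.
Unshelve. all: by end_near. Qed.

(** The residual is tested on [phi n] itself, whose energy is bounded because the sequence is
    Cauchy. *)
Lemma eigseq_Qself_gen (R : realType) (E : lmodType R) (Q B : E -> E -> R) phi lam :
  symbil Q -> symbil B -> (forall x, 0 <= B x x) -> eigseq Q B phi lam ->
  Q (phi n) (phi n) @[n --> \oo] --> lam.
Proof.
move=> sQ sB pB eig.
have [_ B1 cau [K [d [KB dc d0 dP]]]] := eig.
have [N hN] := cau 1 ltr01.
have bnd : exists M, forall n, (N <= n)%N -> Q (phi n) (phi n) + K * B (phi n) (phi n) <= M.
  pose P x y := Q x y + K * B x y.
  have sP : symbil P.
    split=> [x y|a x y z]; first by rewrite /P (sbC sQ) (sbC sB).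
    by rewrite /P (sbDl sQ) (sbDl sB) (sbZl sQ) (sbZl sB); ring.
  have pP x : 0 <= P x x by apply: le_trans (pB x) (KB x).
  exists (2 * (1 + `|K|) + 2 * P (phi N) (phi N)) => n Nn.
  have := psd_parallelogram sP pP (phi n - phi N) (phi N); rewrite addrNK => h.
  apply: le_trans h _; rewrite lerD2r ler_pM2l//.
  have [h1 h2] := hN n N Nn (leqnn _); rewrite /P lerD ?(ltW h2)//.
  apply: le_trans (_ : `|K| * 1 <= _); last by rewrite mulr1.
  apply: le_trans (ler_norm _) _; rewrite normrM ler_wpM2l// ger0_norm// ltW//.
have [M hM] := bnd.
have h2 : Q (phi n) (phi n) - lam * B (phi n) (phi n) @[n --> \oo] --> (0 : R).
  apply: (@sqr_le_cvg0 _ _ d M) => //; near=> n.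
  apply: le_trans (dP _ _) _; rewrite ler_wpM2l// hM//.
  by near: n; exact: nbhs_infty_ge.
rewrite -[X in _ --> X]add0r -[X in _ --> 0 + X]mulr1.
have -> : (fun n => Q (phi n) (phi n)) =
    (fun n => (Q (phi n) (phi n) - lam * B (phi n) (phi n)) + lam * B (phi n) (phi n)).
  by apply/funext => n; rewrite addrNK.
by apply: cvgD => //; apply: cvgM; [exact: cvg_cst|].
Unshelve. all: by end_near. Qed.

(** * Deflation by an eigenvector *)

Section Deflation.
Context (R : realType) (E : lmodType R).
Implicit Types (x y z : E).
Context (Q B : E -> E -> R) (C : R).
Hypotheses (sQ : symbil Q) (sB : symbil B) (pB : forall x, 0 <= B x x).
Hypotheses (C0 : 0 <= C) (QC : forall x, - C * B x x <= Q x x).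
Context (phi : nat -> E) (lam : R).
Hypothesis eig : eigseq Q B phi lam.

Lemma eigseq_cvg x : cvgn (fun n => B (phi n) x).
Proof using eig sB pB.
case: eig => _ _ cau _; apply: cauchy_cvg; apply/cauchy_exP => e e0.
have d0 : 0 < e ^+ 2 / (B x x + 1).
  by rewrite divr_gt0 ?exprn_gt0// ltr_wpDl.
have [N hN] := cau _ d0.
exists (B (phi N) x); exists N => // n /= Nn; rewrite /ball/= -(sbBl sB).
have [h _] := hN N n (leqnn _) Nn.
rewrite -(@ltr_pXn2r _ 2)// ?nnegrE ?ltW// real_normK ?num_real//.
apply: le_lt_trans (psd_CS sB pB _ _) _.
have [b0|b0] := eqVneq (B x x) 0; first by rewrite b0 mulr0 exprn_gt0.
have {}b0 : 0 < B x x by rewrite lt_def b0 pB.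
apply: (@lt_le_trans _ _ (e ^+ 2 / (B x x + 1) * B x x)); first by rewrite ltr_pM2r.
rewrite mulrAC ler_pdivrMr; last by rewrite ltr_wpDl.
by rewrite ler_wpM2l ?sqr_ge0// lerDl.
Qed.

(** The pairing with the limit of [phi], available although that limit need not lie in [E]. *)
Definition eigfun x := limn (fun n => B (phi n) x).

Lemma eigfunE x : B (phi n) x @[n --> \oo] --> eigfun x.
Proof using eig sB pB. exact: eigseq_cvg. Qed.

Lemma eigfun_lin a x y : eigfun (a *: x + y) = a * eigfun x + eigfun y.
Proof using eig sB pB.
apply: (@cvg_lim _ (@norm_hausdorff _ R^o)) => //.
have -> : (fun n => B (phi n) (a *: x + y)) = (fun n => a * B (phi n) x + B (phi n) y).
  by apply/funext => n; rewrite (sbDr sB) (sbZr sB).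
apply: cvgD; last exact: eigfunE.
by apply: cvgM; [exact: cvg_cst|exact: eigfunE].
Qed.

Lemma eigfun_sq x : eigfun x ^+ 2 <= B x x.
Proof using eig sB pB.
have h : B (phi n) x ^+ 2 @[n --> \oo] --> eigfun x ^+ 2.
  by apply: cvgM; exact: eigfunE.
have h2 : B (phi n) (phi n) * B x x @[n --> \oo] --> 1 * B x x.
  by apply: cvgM; [case: eig|exact: cvg_cst].
rewrite -[leRHS]mul1r; apply: ler_cvg_to h h2 _.
by near=> n; exact: psd_CS.
Unshelve. all: by end_near. Qed.

(** The limit of [phi], of [B]-norm [1], receives the eigenvalue [0]; on vectors that are
    [B]-orthogonal to it the form is unchanged. *)
Definition deflate x y := Q x y - lam * (eigfun x * eigfun y).

Lemma deflate_symbil : symbil deflate.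
Proof using eig sB pB sQ.
split=> [x y|a x y z]; first by rewrite /deflate (sbC sQ) (mulrC (eigfun x)).
by rewrite /deflate eigfun_lin (sbDl sQ) (sbZl sQ); ring.
Qed.

Lemma deflate_ge x : Q x x <= deflate x x.
Proof using eig.
case: eig => lam0 _ _ _; rewrite /deflate lerDl oppr_ge0.
by apply: mulr_le0_ge0; [exact: ltW|rewrite -expr2 sqr_ge0].
Qed.

Lemma deflate_le x : deflate x x <= Q x x - lam * B x x.
Proof using eig sB pB.
case: (eig) => lam0 _ _ _; rewrite /deflate lerD2l -!mulNr ler_wpM2l ?oppr_ge0 ?(ltW lam0)//.
exact: eigfun_sq.
Qed.

(** Against a fixed vector the residual tends to zero, which is the weak eigenvalue equation of the
    limit. *)
Lemma eigseq_Qlim x : Q (phi n) x @[n --> \oo] --> lam * eigfun x.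
Proof using eig sB pB.
have [_ _ _ [K [d [_ dc d0 dP]]]] := eig.
have h2 : Q (phi n) x - lam * B (phi n) x @[n --> \oo] --> (0 : R).
  by apply: (@sqr_le_cvg0 _ _ d (Q x x + K * B x x)) => //; near=> n.
rewrite -[X in _ --> X]add0r.
have -> : (fun n => Q (phi n) x) =
    (fun n => (Q (phi n) x - lam * B (phi n) x) + lam * B (phi n) x).
  by apply/funext => n; rewrite addrNK.
by apply: cvgD => //; apply: cvgM; [exact: cvg_cst|exact: eigfunE].
Unshelve. all: by end_near. Qed.

Let eigseq_Qself := eigseq_Qself_gen sQ sB pB eig.

(* If the deflated form were negative definite on a k-dimensional space, adding
   [phi n] for large [n] would give a (k+1)-dimensional one for [Q]. *)
Lemma deflate_index k : (forall u : 'I_k.+1 -> E, ~ negdef Q u) ->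
  forall u : 'I_k -> E, ~ negdef deflate u.
Proof using eig sB pB sQ C0 QC.
move=> mx u nu; have sD := deflate_symbil.
have [e [_ oe]] := @negdef_orthonormal _ _ deflate _ u setT sD nu (fun _ _ _ _ _ => I) (fun=> I).
have [lam0 _ _ _] := eig.
have Qlc (a : 'rV_k) : Q (lincomb a e) (lincomb a e) = - \sum_i a 0 i ^+ 2 + lam * eigfun (lincomb a e) ^+ 2.
  have -> : Q (lincomb a e) (lincomb a e) = deflate (lincomb a e) (lincomb a e) + lam * eigfun (lincomb a e) ^+ 2.
    by rewrite /deflate expr2 addrNK.
  congr (_ + _).
  rewrite (sb_lincomb sD) -sumrN; apply: eq_bigr => i _.
  rewrite (sbC sD) (sb_lincomb sD) (bigD1 i)//= big1 => [|j ji].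
    by rewrite oe eqxx addr0 mulrN1 mulrN -expr2.
  by rewrite oe (negbTE ji) oppr0 mulr0.
have blc (a : 'rV_k) : eigfun (lincomb a e) = \sum_i a 0 i * eigfun (e i).
  rewrite /lincomb; elim/big_ind2 : _ => [|x1 x2 y1 y2 <- <-|i _].
  - by have := eigfun_lin (-1) 0 0; rewrite scaler0 addr0 mulN1r addNr.
  - by have := eigfun_lin 1 x2 y2; rewrite scale1r mul1r.
  - have := eigfun_lin (a 0 i) (e i) 0; rewrite addr0 => ->.
    by have := eigfun_lin (-1) 0 0; rewrite scaler0 addr0 mulN1r addNr => ->; rewrite addr0.
have [beta bE] : exists b, b = \sum_i eigfun (e i) ^+ 2 by eexists.
have b0 : 0 <= beta by rewrite bE sumr_ge0// => i _; exact: sqr_ge0.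
(* The first bound lets [dl * (c + b) ^+ 2] be absorbed by a part of [lam * (c + b) ^+ 2] in the
   estimate [main] below, the second lets [dl * b ^+ 2] be absorbed by [A]. *)
pose dl := Num.min (- lam / 8) (16 * (beta + 1))^-1.
have dl0 : 0 < dl by rewrite lt_min divr_gt0 ?oppr_gt0//= invr_gt0 mulr_gt0// ltr_wpDl.
have dl1 : dl <= - lam / 8 by rewrite /dl ge_min lexx.
have dl2 : dl * beta <= 1 / 16.
  have : dl <= (16 * (beta + 1))^-1 by rewrite /dl ge_min lexx orbT.
  rewrite -[X in _ <= X]mul1r ler_pdivlMr ?mulr_gt0 ?ltr_wpDl// => h.
  rewrite ler_pdivlMr//; apply: le_trans h; rewrite -mulrA ler_wpM2l ?(ltW dl0)//.
  by rewrite mulrC ler_wpM2l// lerDl.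
have [N1 _ hN1] : \forall n \near \oo, `|lam - Q (phi n) (phi n)| < dl.
  by apply: (@cvgr_dist_lt _ _ _ _ _ (fun n => Q (phi n) (phi n)) lam eigseq_Qself).
have rc : \sum_i (Q (phi n) (e i) - lam * eigfun (e i)) ^+ 2 @[n --> \oo] --> (0 : R).
  rewrite [X in _ --> X](_ : _ = \sum_(i < k) (lam * eigfun (e i) - lam * eigfun (e i)) ^+ 2); last first.
    by rewrite big1// => i _; rewrite subrr expr0n.
  apply: (@cvg_big _ _ _ 0 xpredT); first exact: add_continuous.
  by move=> i _; apply: cvgM; (apply: cvgB; [exact: eigseq_Qlim|exact: cvg_cst]).
have [N2 _ hN2] : \forall n \near \oo, \sum_i (Q (phi n) (e i) - lam * eigfun (e i)) ^+ 2 < dl / 4.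
  by apply: cvgr_lt rc _ _; rewrite divr_gt0.
pose n := maxn N1 N2.
have {hN1} r0 := hN1 n (leq_maxl _ _).
have {hN2} r1 := hN2 n (leq_maxr _ _).
rewrite /= in r0 r1.
apply: (mx (consf (phi n) e)) => a a0; rewrite lincomb_consf.
set c := a 0 ord0; set a' := \row_j _; set y := lincomb a' e.
have cE : c = a 0 ord0 by [].
rewrite (sb_sqD sQ) (sbZl sQ) (sbZr sQ) (sbZl sQ) Qlc -/y.
have QE : Q (phi n) y = lam * eigfun y + \sum_i a' 0 i * (Q (phi n) (e i) - lam * eigfun (e i)).
  rewrite (sbC sQ) (sb_lincomb sQ) blc mulr_sumr -big_split/=; apply: eq_bigr => i _.
  by rewrite (sbC sQ (e i)); ring.
have CS1 := sum_CS (fun i => a' 0 i) (fun i => eigfun (e i)).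
have CS2 := sum_CS (fun i => a' 0 i) (fun i => Q (phi n) (e i) - lam * eigfun (e i)).
rewrite -blc -/y -bE in CS1.
rewrite QE.
have A0 : 0 <= \sum_i a' 0 i ^+ 2 by rewrite sumr_ge0// => i _; exact: sqr_ge0.
have rp : 0 <= \sum_i (Q (phi n) (e i) - lam * eigfun (e i)) ^+ 2 by rewrite sumr_ge0// => i _; exact: sqr_ge0.
(* [c] is the coefficient of [phi n], [b] the pairing of [y] with the limit, [A] the squared length
   of the other coefficients, [r] the pairing with the residual. Up to errors [Q] is
   [lam * (c + b) ^+ 2 - A], and the errors take at most half of each term. *)
have main A b r rho q : 0 <= A -> b ^+ 2 <= A * beta -> r ^+ 2 <= A * rho -> 0 <= rho ->
    rho < dl / 4 -> `|lam - q| < dl ->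
    c * (c * q) + 2 * (c * (lam * b + r)) + (- A + lam * b ^+ 2) <= lam / 2 * (c + b) ^+ 2 - A / 2.
  move=> hA hb hr hrho hrd; rewrite ltr_norml => /andP[q1 q2].
  have c2 : c ^+ 2 <= 2 * (c + b) ^+ 2 + 2 * b ^+ 2.
    by rewrite -subr_ge0 (_ : _ - _ = (c + 2 * b) ^+ 2) ?sqr_ge0//; ring.
  have e1 : 2 * (c * r) <= dl * c ^+ 2 + A / 4.
    have h1 : 2 * (c * r) <= dl * c ^+ 2 + r ^+ 2 / dl.
      rewrite -subr_ge0 (_ : _ - _ = (dl * c - r) ^+ 2 / dl); last by field; rewrite gt_eqF.
      by rewrite divr_ge0 ?sqr_ge0 ?ltW.
    apply: le_trans h1 _; rewrite lerD2l ler_pdivrMr// (le_trans hr)// mulrAC -mulrA ler_wpM2l//.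
    exact: ltW.
  have e2 : c ^+ 2 * (q - lam) <= c ^+ 2 * dl.
    by rewrite ler_wpM2l ?sqr_ge0//; move: q1 q2; move: (dl) => ?; lra.
  have e3 : dl * c ^+ 2 <= 2 * dl * (c + b) ^+ 2 + A / 8.
    have h1 : dl * c ^+ 2 <= dl * (2 * (c + b) ^+ 2 + 2 * b ^+ 2) by rewrite ler_wpM2l// ltW.
    have h2 : dl * b ^+ 2 <= A * (1 / 16).
      apply: le_trans (_ : _ <= dl * (A * beta)) _; first by rewrite ler_wpM2l// ltW.
      by rewrite mulrCA ler_wpM2l.
    by move: h1 h2; move: (dl) (b ^+ 2) ((c + b) ^+ 2) (c ^+ 2) => ? ? ? ?; lra.
  have e4 : dl * (c + b) ^+ 2 <= - lam / 8 * (c + b) ^+ 2 by rewrite ler_wpM2r ?sqr_ge0.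
  rewrite (_ : _ + _ + _ = lam * (c + b) ^+ 2 + c ^+ 2 * (q - lam) + 2 * (c * r) - A); last by ring.
  move: e1 e2 e3 e4; rewrite (mulrC (c ^+ 2) dl) -(mulrA 2 dl).
  move: (dl * c ^+ 2) (dl * (c + b) ^+ 2) (2 * (c * r)) (c ^+ 2 * _) => x1 x2 x3 x4.
  have : lam / 2 * (c + b) ^+ 2 = lam * (c + b) ^+ 2 / 2 by ring.
  have : - lam / 8 * (c + b) ^+ 2 = - (lam * (c + b) ^+ 2) / 8 by ring.
  move: (lam / 2 * _) (- lam / 8 * _) (lam * _) => x5 x6 x7 -> ->; lra.
apply: le_lt_trans (main _ _ _ _ _ A0 CS1 CS2 rp r1 r0) _.
(* Strictness: if the coefficients [a'] vanish, then so does the pairing of [y], while [c] does not;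
   otherwise the sum of squares is positive. *)
have [a'0|a'0] := eqVneq a' 0.
  have c0 : c != 0.
    apply: contraNneq a0; rewrite cE => a00; apply/eqP/rowP => i; rewrite mxE.
    case: (unliftP ord0 i) => [j ->|->//].
    by have /rowP/(_ j) := a'0; rewrite !mxE.
  have -> : eigfun y = 0 by rewrite /y blc a'0 big1// => i _; rewrite mxE mul0r.
  rewrite addr0 big1 => [|i _]; last by rewrite a'0 mxE expr0n.
  by rewrite mul0r subr0 nmulr_rlt0 ?exprn_even_gt0// pmulr_llt0.
have Ap : 0 < \sum_i a' 0 i ^+ 2.
  rewrite lt_def A0 andbT; apply: contraNneq a'0 => /eqP; rewrite psumr_eq0 => [/allP h|i _]; last exact: sqr_ge0.
  apply/eqP/rowP => i; rewrite [RHS]mxE; apply/eqP; rewrite -sqrf_eq0.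
  exact: (h i (mem_index_enum _)).
have : lam / 2 * (c + eigfun y) ^+ 2 <= 0 by rewrite mulr_le0_ge0 ?sqr_ge0// pmulr_lle0// ltW.
by move: Ap; move: (\sum_i _) (lam / 2 * _) => ? ?; lra.
Qed.

(** Cauchy-Schwarz makes the convergence uniform on [B]-bounded sets, so that it applies to pairings
    with moving vectors. *)
Lemma eigfun_unif e : 0 < e -> exists N, forall n x, (N <= n)%N ->
  (B (phi n) x - eigfun x) ^+ 2 <= e * B x x.
Proof using eig sB pB.
move=> e0; have [_ _ cau _] := eig; have [N hN] := cau e e0.
exists N => n x Nn.
have h : (B (phi n) x - B (phi m) x) ^+ 2 @[m --> \oo] --> (B (phi n) x - eigfun x) ^+ 2.
  by apply: cvgM; (apply: cvgB; [exact: cvg_cst|exact: eigfunE]).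
apply: (ler_cvg_to h (@cvg_cst _ (e * B x x) _ \oo _)).
near=> m; rewrite -(sbBl sB); apply: le_trans (psd_CS sB pB _ _) _.
rewrite ler_wpM2r// ltW//; have [] // := hN n m Nn.
by near: m; exact: nbhs_infty_ge.
Unshelve. all: by end_near. Qed.

Section Orthogonality.
Context (p : nat -> E) (l : R).
Hypothesis eigp : eigseq deflate B p l.

(** Approximate eigenvectors of the deflated form for different eigenvalues, [0] for [phi] and [l]
    for [p]: its value on the pair is near [0] by the equation of [phi] and near [l] times the
    [B]-product by the equation of [p], and [l < 0]. *)
Lemma deflate_orth : B (phi n) (p n) @[n --> \oo] --> (0 : R) /\
  eigfun (p n) @[n --> \oo] --> (0 : R).
Proof using eigp eig sQ sB pB C0 QC.
have [l0 Bp1 _ [K' [d' [K'B d'c d'0 d'P]]]] := eigp.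
have [lam0 B1 _ [K [d [KB dc d0 dP]]]] := eig.
have sD := deflate_symbil.
have DC x : - C * B x x <= deflate x x by apply: le_trans (QC x) (deflate_ge x).
have Qp := eigseq_Qself_gen sD sB pB eigp.
have Qf := eigseq_Qself.
have ev (u : nat -> R) c : u @ \oo --> c -> \forall n \near \oo, u n <= `|c| + 1.
  move=> uc; near=> n; apply: ltW; near: n; apply: cvgr_lt uc _ _.
  by rewrite (le_lt_trans (ler_norm _))// ltrDl.
have t1 : deflate (p n) (phi n) - l * B (p n) (phi n) @[n --> \oo] --> (0 : R).
  have hc : Q (phi n) (phi n) - lam * B (phi n) (phi n) + K' * B (phi n) (phi n)
      @[n --> \oo] --> lam - lam * 1 + K' * 1.
    by apply: cvgD; [apply: cvgB => //|]; apply: cvgM => //; exact: cvg_cst.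
  apply: (sqr_le_cvg0 _ d'c); near=> n.
  apply: le_trans (d'P _ _) _; rewrite ler_wpM2l//.
  apply: le_trans (_ : _ <= Q (phi n) (phi n) - lam * B (phi n) (phi n) + K' * B (phi n) (phi n)) _.
    by rewrite lerD2r; exact: deflate_le.
  by near: n; exact: ev hc.
have t2 : Q (phi n) (p n) - lam * B (phi n) (p n) @[n --> \oo] --> (0 : R).
  have hc : deflate (p n) (p n) + K * B (p n) (p n) @[n --> \oo] --> l + K * 1.
    by apply: cvgD => //; apply: cvgM => //; exact: cvg_cst.
  apply: (sqr_le_cvg0 _ dc); near=> n.
  apply: le_trans (dP _ _) _; rewrite ler_wpM2l//.
  apply: le_trans (_ : _ <= deflate (p n) (p n) + K * B (p n) (p n)) _.
    by rewrite lerD2r; exact: deflate_ge.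
  by near: n; exact: ev hc.
have unif (q : nat -> E) : B (q n) (q n) @[n --> \oo] --> (1 : R) ->
    B (phi n) (q n) - eigfun (q n) @[n --> \oo] --> (0 : R).
  move=> qc; apply/cvgr0Pnorm_lt => e e0.
  have e20 : 0 < e ^+ 2 / 4 by rewrite divr_gt0// exprn_gt0.
  have [N hN] := eigfun_unif e20.
  near=> n; rewrite -(@ltr_pXn2r _ 2)// ?nnegrE ?ltW// real_normK ?num_real//.
  have Nn : (N <= n)%N by near: n; exact: nbhs_infty_ge.
  apply: le_lt_trans (hN n (q n) Nn) _.
  have : B (q n) (q n) <= `|1| + 1 by near: n; exact: ev qc.
  rewrite normr1; have := exprn_gt0 2 e0.
  by move: (B _ _) (e ^+ 2) => ? ?; nra.
have t3 := unif p Bp1.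
have t4 := unif phi B1.
have t5 : eigfun (phi n) - 1 @[n --> \oo] --> (0 : R).
  rewrite -[X in _ --> X](subrr (0 : R)).
  have -> : (fun n => eigfun (phi n) - 1) =
     (fun n => (B (phi n) (phi n) - 1) - (B (phi n) (phi n) - eigfun (phi n))).
    by apply/funext => n; ring.
  apply: cvgB => //; rewrite -[X in _ --> X](subrr (1 : R)).
  by apply: cvgB => //; exact: cvg_cst.
have t6 : eigfun (p n) * (eigfun (phi n) - 1) @[n --> \oo] --> (0 : R).
  have t7 : (eigfun (phi n) - 1) ^+ 2 @[n --> \oo] --> (0 : R).
    by rewrite -[X in _ --> X](mul0r (0 : R)); apply: cvgM.
  apply: (@sqr_le_cvg0 _ _ _ (`|1| + 1) _ t7); near=> n.
  rewrite exprMn mulrC ler_wpM2l ?sqr_ge0// (le_trans (eigfun_sq _))//.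
  by near: n; exact: ev Bp1.
have Bc : B (phi n) (p n) @[n --> \oo] --> (0 : R).
  have h : - l * B (phi n) (p n) @[n --> \oo] --> 0 - 0 - lam * 0 + lam * 0.
    have -> : (fun n => - l * B (phi n) (p n)) = (fun n =>
       (deflate (p n) (phi n) - l * B (p n) (phi n)) - (Q (phi n) (p n) - lam * B (phi n) (p n))
       - lam * (B (phi n) (p n) - eigfun (p n)) + lam * (eigfun (p n) * (eigfun (phi n) - 1))).
      by apply/funext => n; rewrite /deflate (sbC sB (p n)) (sbC sQ (p n)); ring.
    by apply: cvgD; [apply: cvgB; [exact: cvgB|]|]; apply: cvgM => //; exact: cvg_cst.
  have -> : (fun n => B (phi n) (p n)) = (fun n => (- l)^-1 * (- l * B (phi n) (p n))).
    by apply/funext => n; rewrite mulKf// oppr_eq0 lt_eqF.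
  rewrite (_ : (0 : R) = (- l)^-1 * (0 - 0 - lam * 0 + lam * 0)); last by ring.
  by apply: cvgM => //; exact: cvg_cst.
split=> //; rewrite -[X in _ --> X](subrr (0 : R)).
have -> : (fun n => eigfun (p n)) = (fun n => B (phi n) (p n) - (B (phi n) (p n) - eigfun (p n))).
  by apply/funext => n; ring.
exact: cvgB.
Unshelve. all: by end_near. Qed.

(** The rank-one term enters the residual as [lam * eigfun (p n) * eigfun x], and [eigfun (p n)]
    tends to zero by orthogonality. *)
Lemma eigseq_undeflate : eigseq Q B p l.
Proof using eigp eig sQ sB pB C0 QC.
have [_ bc] := deflate_orth.
have [l0 Bp1 cau [K [d [KB dc d0 dP]]]] := eigp.
split=> //.
  move=> e /cau[N hN]; exists N => m n Nm Nn; have [h1 h2] := hN m n Nm Nn; split=> //.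
  by apply: le_lt_trans (deflate_ge _) h2.
have KW x : B x x <= Q x x + (K - lam) * B x x.
  have := deflate_le x; have := KB x; rewrite mulrBl.
  by move: (deflate x x) (Q x x) (B x x) (K * _) (lam * _) => ? ? ? ? ?; lra.
(* [(a + b)^2 <= 2 a^2 + 2 b^2] gives the new residual bound; the shift by [- lam] in the energy
   constant comes from bounding the deflated form by [Q - lam B]. *)
exists (K - lam + 1), (fun n => 2 * d n + 2 * lam ^+ 2 * eigfun (p n) ^+ 2); split.
- move=> x; apply: le_trans (KW x) _; rewrite lerD2l ler_wpM2r// lerDl//.
- rewrite [X in _ --> X](_ : _ = 2 * 0 + 2 * lam ^+ 2 * (0 * 0)); last by ring.
  apply: cvgD; apply: cvgM => //; try exact: cvg_cst.
  exact: cvgM.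
- move=> n; apply: addr_ge0; first by apply: mulr_ge0.
  by apply: mulr_ge0; [apply: mulr_ge0 => //; exact: sqr_ge0|exact: sqr_ge0].
move=> n x.
have W0 : B x x <= Q x x + (K - lam + 1) * B x x.
  by apply: le_trans (KW x) _; rewrite lerD2l ler_wpM2r// lerDl.
have W1 : deflate x x + K * B x x <= Q x x + (K - lam + 1) * B x x.
  have := deflate_le x; have := pB x; rewrite !mulrDl mulNr mul1r.
  by move: (deflate x x) (Q x x) (B x x) (K * _) (lam * _) => ? ? ? ? ?; lra.
have E1 : Q (p n) x - l * B (p n) x =
    (deflate (p n) x - l * B (p n) x) + lam * eigfun (p n) * eigfun x.
  by rewrite /deflate; ring.
rewrite E1.
apply: le_trans (_ : _ <= 2 * (deflate (p n) x - l * B (p n) x) ^+ 2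
   + 2 * (lam * eigfun (p n) * eigfun x) ^+ 2) _.
  by rewrite -subr_ge0 (_ : _ - _ = ((deflate (p n) x - l * B (p n) x) - lam * eigfun (p n) * eigfun x) ^+ 2) ?sqr_ge0//; ring.
rewrite [X in _ <= X]mulrDl; apply: lerD.
  rewrite -mulrA ler_pM2l//; apply: le_trans (dP n x) _; exact: ler_wpM2l.
rewrite (_ : 2 * _ = 2 * lam ^+ 2 * eigfun (p n) ^+ 2 * eigfun x ^+ 2); last by ring.
apply: ler_wpM2l; first by apply: mulr_ge0; [apply: mulr_ge0 => //; exact: sqr_ge0|exact: sqr_ge0].
exact: le_trans (eigfun_sq x) W0.
Qed.

End Orthogonality.

End Deflation.

(** Induction on the bound of the index. If no negative definite family of size [I.+1] exists, the
    bound improves; otherwise one eigenvector is split off, and on vectors orthogonal to its limit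
    the deflated form agrees with [Q]. *)
Theorem eigensystem (R : realType) (E : lmodType R) (B : E -> E -> R) (C : R) :
  symbil B -> (forall x, 0 <= B x x) -> 0 <= C ->
  forall I (Q : E -> E -> R), symbil Q -> (forall x, - C * B x x <= Q x x) ->
  (forall u : 'I_I.+1 -> E, ~ negdef Q u) ->
  exists k (phi : 'I_k -> nat -> E) (lam : 'I_k -> R), [/\ (k <= I)%N,
    forall i, eigseq Q B (phi i) (lam i),
    forall i j, B (phi i n) (phi j n) @[n --> \oo] --> ((i == j)%:R : R) &
    forall x, (forall i, B (phi i n) x @[n --> \oo] --> (0 : R)) -> 0 <= Q x x].
Proof.
move=> sB pB C0; elim=> [|I ih] Q sQ QC mx.
  exists 0%N, (fun _ _ => 0), (fun=> 0); split=> //; try by case.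
  move=> x _; rewrite leNgt; apply/negP => Qx; apply: (mx (fun=> x)) => a a0.
  rewrite /lincomb big_ord_recl big_ord0 addr0 (sbZl sQ) (sbZr sQ) mulrA -expr2.
  rewrite pmulr_rlt0// exprn_even_gt0//=; apply: contraNneq a0 => a00.
  by apply/eqP/rowP => i; rewrite !ord1 mxE.
have [[u nu]|nn] := pselect (exists u : 'I_I.+1 -> E, negdef Q u); last first.
  have [//|k [phi [lam [kI h1 h2 h3]]]] := ih Q sQ QC.
    by move=> u nu; apply: nn; exists u.
  by exists k, phi, lam; split=> //; exact: leqW.
have [phi [lam eig]] := eigseq_exists sQ sB pB C0 QC nu mx.
pose Q1 := deflate Q B phi lam.
have sQ1 : symbil Q1 := deflate_symbil sQ sB pB eig.
have Q1C x : - C * B x x <= Q1 x x by apply: le_trans (QC x) (deflate_ge eig x).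
have [k [ps [ls [kI eigs orth ge]]]] := ih Q1 sQ1 Q1C (deflate_index sQ sB pB C0 QC eig mx).
pose f (i : 'I_k.+1) := if unlift ord0 i is Some j then ps j else phi.
pose lf (i : 'I_k.+1) := if unlift ord0 i is Some j then ls j else lam.
have f0 : f ord0 = phi by rewrite /f unlift_none.
have fS j : f (lift ord0 j) = ps j by rewrite /f liftK.
have lf0 : lf ord0 = lam by rewrite /lf unlift_none.
have lfS j : lf (lift ord0 j) = ls j by rewrite /lf liftK.
exists k.+1, f, lf; split=> //.
- move=> i; case: (unliftP ord0 i) => [j ->|->]; last by rewrite f0 lf0.
  by rewrite fS lfS; apply: (eigseq_undeflate sQ sB pB C0 QC eig); exact: eigs.
- move=> i j; case: (unliftP ord0 i) => [i' ->|->]; case: (unliftP ord0 j) => [j' ->|->].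
  + by rewrite !fS (inj_eq lift_inj); exact: orth.
  + rewrite fS f0; under eq_fun do rewrite (sbC sB).
    by case: (deflate_orth sQ sB pB C0 QC eig (eigs i')).
  + by rewrite fS f0; case: (deflate_orth sQ sB pB C0 QC eig (eigs j')).
  + by rewrite f0 eqxx; case: eig.
move=> x hx.
have : 0 <= Q1 x x by apply: ge => i; have := hx (lift ord0 i); rewrite fS.
rewrite /Q1 /deflate; have -> : eigfun B phi x = 0.
  by apply: cvg_lim => //; have := hx ord0; rewrite f0.
by rewrite mul0r mulr0 subr0.
Qed.

(** * The quadratic form on test functions *)

Section TestFunctions.
Context (R : realType) (n : nat) (X : manifold R n).

Definition Cc_pred : {pred (X -> R^o)} := fun u => `[< Cc (u : X -> R) setT >].

Lemma Cc_submod : submod_closed Cc_pred.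
Proof.
split=> [|a u v /asboolP cu /asboolP cv]; first by apply/asboolP; exact: Cc0.
apply/asboolP; exact: (CcD (CcZ a cu) cv).
Qed.
HB.instance Definition _ := GRing.isSubmodClosed.Build R (X -> R^o) Cc_pred Cc_submod.

(** The abstract spectral theory asks for a module; this is [C_0^oo] as a subspace of all
    functions. *)
Record testfun := TestFun { tf_val : X -> R^o; _ : tf_val \in Cc_pred }.
HB.instance Definition _ := [isSub for tf_val].
HB.instance Definition _ := [Choice of testfun by <:].
HB.instance Definition _ := [SubChoice_isSubLmodule of testfun by <:].

Lemma tfP (u : testfun) : Cc (tf_val u : X -> R) setT.
Proof. by case: u => u /= /asboolP. Qed.

Lemma tf_lin (a : R) (u v : testfun) p : tf_val (a *: u + v) p = a * tf_val u p + tf_val v p.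
Proof. by []. Qed.

Lemma testfun_of (u : X -> R) : Cc u setT -> exists f : testfun, tf_val f = u.
Proof. move=> cu; have h : (u : X -> R^o) \in Cc_pred by apply/asboolP.
by exists (TestFun h). Qed.

Lemma tf_smooth (u : testfun) : smooth_fun (tf_val u : X -> R).
Proof. by have [] := tfP u. Qed.

Lemma tf_lincomb k (a : 'rV[R]_k) (u : 'I_k -> testfun) p :
  tf_val (lincomb a u) p = \sum_i a 0 i * tf_val (u i) p.
Proof.
rewrite /lincomb; elim/big_rec2: _ => [//|i y x _ <-].
by rewrite tf_lin.
Qed.

End TestFunctions.

Lemma lbm_mulr (R : realType) (X : ptopologicalType) (D : set (borel X)) (f w : borel X -> R) :
  hausdorff_space X -> measurable D -> lbm D f -> continuous (w : X -> R) -> lbm D (fun p => f p * w p).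
Proof.
move=> hX mD lf cw; apply: lbmM => //; apply: (lbmS mD measurableT) => //; exact: lbm_continuous.
Qed.

Section Forms.
Context (R : realType) (S : riemannian R 1).
Context (mu sigma : {measure set (borel S) -> \bar R}).
Hypotheses (mu_area : is_area mu) (sigma_length : is_bdry_length sigma).
Context (P q : S -> R).
Hypotheses (cP : continuous P) (lq : lbm (@bdry R 1 S) (q : borel S -> R)).
Implicit Types (u v : S -> R) (p : S) (K : set S).
Local Notation bd := (@bdry R 1 S).
Local Notation test := (testfun S).
Let hS : hausdorff_space S := @mf_hausdorff _ _ S.
Let mb : measurable (bd : set (borel S)) := @bdry_measurable _ S.

Lemma mu_integrable (w : S -> R) K : continuous w -> compact K -> (forall p, ~ K p -> w p = 0) ->
  mu.-integrable setT (EFin \o (w : borel S -> R)).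
Proof.
move=> cw cK w0; apply: (lbm_integrable hS (area_compact_finite mu_area) measurableT _ cK).
  exact: lbm_continuous.
by move=> p _; exact: w0.
Qed.

Lemma sigma_integrable (w : S -> R) K : lbm bd (w : borel S -> R) -> compact K -> (forall p, ~ K p -> w p = 0) ->
  sigma.-integrable bd (EFin \o (w : borel S -> R)).
Proof.
move=> lw cK w0; apply: (lbm_integrable hS (length_compact_finite sigma_length) mb lw cK).
by move=> p _; exact: w0.
Qed.

Definition dens u v p := coip p (diff_fun u p) (diff_fun v p) - P p * u p * v p.

(** [Qgen] with the two potentials replaced by arbitrary [P] and [q]. From here on the immersion
    enters only through continuity of [P] and local boundedness of [q] on the boundary. *)
Definition qform (f : S -> R) (xi : S -> 'rV[R]_2) (tau phi : S -> R) : R :=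
  \int[mu]_p (coip p (xi p) (diff_fun phi p) - P p * f p * phi p)
  - \int[sigma]_(p in bd) (q p * tau p * phi p).

Definition Qf u v := qform u (diff_fun u) u v.

Definition Bf u v := \int[mu]_p (u p * v p).

Lemma dens_integrable u v : smooth_fun u -> Cc v setT -> mu.-integrable setT (EFin \o (dens u v : borel S -> R)).
Proof.
move=> su [sv [K [cK _ v0]]]; apply: (mu_integrable _ cK) => [|p Kp].
  move=> p; apply: cvgB; first exact: (smooth_fun_continuous (coip_smooth su sv)).
  apply: cvgM; last exact: smooth_fun_continuous.
  by apply: cvgM; [exact: cP|exact: smooth_fun_continuous].
rewrite /dens (diff_fun_near (u := v) (v := fun=> 0)) ?diff_fun_cst ?v0//.
  by rewrite coip_sym coip0l mulr0 subr0.
have cL : closed K by exact: compact_closed.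
by apply: filterS (open_nbhs_nbhs (conj (closed_openC cL) Kp)) => z; exact: v0.
Qed.

Lemma bdry_integrable u v : smooth_fun u -> Cc v setT ->
  sigma.-integrable bd (EFin \o (fun p : borel S => q p * u p * v p)).
Proof.
move=> su [sv [K [cK _ v0]]]; apply: (sigma_integrable _ cK) => [|p Kp]; last by rewrite v0// mulr0.
apply: lbm_mulr => //; last exact: smooth_fun_continuous.
by apply: lbm_mulr => //; exact: smooth_fun_continuous.
Qed.

Lemma prod_integrable u v : smooth_fun u -> Cc v setT ->
  mu.-integrable setT (EFin \o (fun p : borel S => u p * v p)).
Proof. by move=> su cv; apply: (Cc_integrable mu_area); exact: CcM. Qed.

Lemma Qf_sym u v : Qf u v = Qf v u.
Proof.
rewrite /Qf /qform; congr (_ - _); apply: eq_Rintegral => p _; last by ring.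
by rewrite coip_sym; congr (_ - _); ring.
Qed.

Lemma Qf_lin a u v w : Cc u setT -> Cc v setT -> Cc w setT ->
  Qf (fun p => a * u p + v p) w = a * Qf u w + Qf v w.
Proof.
move=> cu cv cw; have [su _] := cu; have [sv _] := cv; have [sw _] := cw.
rewrite /Qf /qform.
have -> : \int[mu]_p (coip p (diff_fun (fun p => a * u p + v p) p) (diff_fun w p) - P p * (a * u p + v p) * w p) =
    a * \int[mu]_p dens u w p + \int[mu]_p dens v w p.
  have h1 := dens_integrable su cw; have h2 := dens_integrable sv cw.
  rewrite -RintegralZl// -RintegralD//; last exact: (integrableZl measurableT a h1).
  apply: eq_Rintegral => p _; rewrite diff_funD//; last exact: smooth_funZ.
  by rewrite diff_funZ// coipDl coipZl /dens; ring.
have -> : \int[sigma]_(p in bd) (q p * (a * u p + v p) * w p) =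
    a * \int[sigma]_(p in bd) (q p * u p * w p) + \int[sigma]_(p in bd) (q p * v p * w p).
  have h1 := bdry_integrable su cw; have h2 := bdry_integrable sv cw.
  rewrite -RintegralZl// -RintegralD//; last exact: (integrableZl mb a h1).
  by apply: eq_Rintegral => p _; ring.
rewrite /dens; ring.
Qed.

Definition Qt (u v : test) : R := Qf (tf_val u) (tf_val v).
Definition Bt (u v : test) : R := Bf (tf_val u) (tf_val v).

Lemma Qt_symbil : symbil Qt.
Proof.
split=> [u v|a u v w]; first exact: Qf_sym.
by rewrite /Qt -(Qf_lin _ (tfP u) (tfP v) (tfP w)).
Qed.

Lemma Bt_symbil : symbil Bt.
Proof.
split=> [u v|a u v w]; first by apply: eq_Rintegral => p _; rewrite mulrC.
have h1 := prod_integrable (tf_smooth u) (tfP w); have h2 := prod_integrable (tf_smooth v) (tfP w).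
rewrite /Bt /Bf -RintegralZl// -RintegralD//; last exact: (integrableZl measurableT a h1).
by apply: eq_Rintegral => p _; rewrite tf_lin; ring.
Qed.

Lemma Bt_ge0 (u : test) : 0 <= Bt u u.
Proof. by apply: Rintegral_ge0 => p _; rewrite -expr2 sqr_ge0. Qed.

End Forms.

(** Otherwise [w] could be added to the maximal family. *)
Lemma negdef_perp (R : realType) (E : lmodType R) (Q : E -> E -> R) k (v : 'I_k -> E) w :
  symbil Q -> negdef Q v -> (forall u : 'I_k.+1 -> E, ~ negdef Q u) ->
  (forall i, Q w (v i) = 0) -> 0 <= Q w w.
Proof.
move=> sQ nv mx wv; rewrite leNgt; apply/negP => Qw; apply: (mx (consf w v)) => a a0.
rewrite lincomb_consf; set b := \row_j _; set c := a 0 ord0.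
rewrite (sb_sqD sQ) !(sbZl sQ) !(sbZr sQ) (sbC sQ w (lincomb b v)) (sb_lincomb sQ) big1 ?mulr0 ?addr0 => [|i _]; last first.
  by rewrite (sbC sQ) wv mulr0.
have [b0|b0] := eqVneq b 0; last first.
  rewrite -[ltRHS]addr0; apply: ler_ltD; last exact: nv.
  by rewrite mulrA -expr2 mulr_ge0_le0 ?sqr_ge0// ltW.
have c0 : c != 0.
  apply: contraNneq a0 => c0; apply/eqP/rowP => i; rewrite mxE.
  have [j ->|->] := unliftP ord0 i; last exact: c0.
  by have /rowP/(_ j) := b0; rewrite !mxE.
rewrite b0; have -> : lincomb 0 v = 0 by rewrite /lincomb big1// => i _; rewrite mxE scale0r.
by rewrite (sb0l sQ) addr0 mulrA -expr2 nmulr_llt0// exprn_even_gt0.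
Qed.

Lemma Rintegral0 d (T : measurableType d) (R : realType) (m : {measure set T -> \bar R}) (D : set T) (f : T -> R) :
  (forall x, D x -> f x = 0) -> \int[m]_(x in D) f x = 0.
Proof. by move=> f0; rewrite /Rintegral integral0_eq// => x /f0 ->. Qed.

(** In the application [w] and [y] are the inner and outer parts of [u], [D] and [T] the Dirichlet
    integral and the squared boundary norm of [w], [e] the localization error, [cT] a bound for the
    boundary term of [Q]. Half of [D] absorbs [cT]; the remaining errors are linear in [Bu]. *)
Lemma garding_arith (R : realType) (e Qu Qw Qy Bu Bw D T cT CE Cp cqT CT : R) :
  0 <= CE -> 0 <= Cp -> 0 <= cqT -> 0 <= CT -> 0 <= Qy -> 0 <= Bw -> Bw <= Bu ->
  0 <= D -> 0 <= T -> Qu = Qw + Qy - e -> e <= CE * Bu -> D - Cp * Bw - cT <= Qw ->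
  cT <= D / 2 + cqT * Bw -> T <= D + CT * Bw ->
  let C := 2 + (CE + Cp + cqT) + CT in
  D <= C * (Qu + C * Bu) /\ T <= C * (Qu + C * Bu).
Proof.
move=> CE0 Cp0 cq0 CT0 Qy0 Bw0 BB D0 T0 QE he hQ hc hT C.
pose C1 := CE + Cp + cqT.
have p1 : Cp * Bw <= Cp * Bu by rewrite ler_wpM2l.
have p2 : cqT * Bw <= cqT * Bu by rewrite ler_wpM2l.
have p3 : CT * Bw <= CT * Bu by rewrite ler_wpM2l.
have Bu0 : 0 <= Bu by exact: le_trans BB.
have C10 : 0 <= C1 by rewrite /C1 !addr_ge0.
have hZ : D / 2 <= Qu + C1 * Bu.
  rewrite QE /C1 !mulrDl; move: he hQ hc p1 p2; move: (CE * Bu) (Cp * Bw) (Cp * Bu) (cqT * Bw) (cqT * Bu) => a b c d f; lra.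
set Z := Qu + C1 * Bu in hZ.
have Z0 : 0 <= Z by apply: le_trans hZ; rewrite divr_ge0.
have C2 : 2 <= C by rewrite /C -/C1; lra.
have E : C * (Qu + C * Bu) = C * Z + C * (2 + CT) * Bu by rewrite /C -/C1 /Z; ring.
have h1 : 2 * Z <= C * Z by rewrite ler_wpM2r.
have h2 : CT * Bu <= C * (2 + CT) * Bu.
  rewrite ler_wpM2r//; apply: le_trans (_ : 2 * (2 + CT) <= _); first by lra.
  by rewrite ler_wpM2r//; lra.
have h3 : 0 <= CT * Bu by rewrite mulr_ge0.
rewrite E; move: h1 h2 h3 hT p3 hZ D0; move: (C * Z) (CT * Bu) (C * _ * Bu) (CT * Bw) => a b c d; split; lra.
Qed.

(** * Localization and the Garding inequality *)

Section Garding.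
Context (R : realType) (S : riemannian R 1).
Context (mu sigma : {measure set (borel S) -> \bar R}).
Hypotheses (mu_area : is_area mu) (sigma_length : is_bdry_length sigma).
Context (P q : S -> R).
Hypotheses (cP : continuous P) (lq : lbm (@bdry R 1 S) (q : borel S -> R)).
Implicit Types (u : S -> R) (p : S) (K : set S).
Local Notation bd := (@bdry R 1 S).
Local Notation test := (testfun S).
Local Notation Q := (Qf mu sigma P q).
Local Notation B := (Bf mu).
Local Notation sqd u p := (coip p (diff_fun u p) (diff_fun u p)).
Let hS : hausdorff_space S := @mf_hausdorff _ _ S.
Let mb : measurable (bd : set (borel S)) := @bdry_measurable _ S.

Lemma compact_family (I : finType) (u : I -> S -> R) : (forall i, Cc (u i) setT) ->
  exists2 K, compact K & forall i p, ~ K p -> u i p = 0.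
Proof.
move=> cu; pose K i := projT1 (cid (proj2 (cu i))).
have hK i : [/\ compact (K i), K i `<=` setT & forall p, ~ K i p -> u i p = 0] by rewrite /K; case: cid.
suff [L cL LK] : exists2 L, compact L & forall i, i \in index_enum I -> K i `<=` L.
  exists L => // i p Lp; have [_ _ h] := hK i; apply: h => Kp; apply: Lp.
  exact: (LK i (mem_index_enum i)).
elim: (index_enum I) => [|i s [L cL LK]]; first by exists set0 => //; exact: compact0.
exists (K i `|` L) => [|j]; first by apply: compactU => //; case: (hK i).
rewrite inE => /orP[/eqP->|js]; first by left.
by apply: subset_trans (LK j js) _; right.
Qed.

Lemma closed_out K p : compact K -> ~ K p -> \forall z \near p, ~ K z.
Proof.
move=> cK Kp; have cL : closed K by exact: compact_closed.
by apply: open_nbhs_nbhs; split=> //; exact: closed_openC.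
Qed.

Lemma diff_fun_out u K p : compact K -> (forall p, ~ K p -> u p = 0) -> ~ K p -> diff_fun u p = 0.
Proof.
move=> cK u0 Kp; rewrite (diff_fun_near (v := fun=> 0)) ?diff_fun_cst//.
by apply: filterS (closed_out cK Kp) => z; exact: u0.
Qed.

(** The pair [a], [1 - a] is divided by its Euclidean norm, which preserves the values [(1, 0)] near
    [K] and [(0, 1)] far away. *)
Lemma quadratic_partition K : compact K -> exists (al be : S -> R) (U L : set S),
  [/\ smooth_fun al /\ smooth_fun be, forall p, al p ^+ 2 + be p ^+ 2 = 1,
      open U /\ K `<=` U, forall p, U p -> al p = 1 /\ be p = 0 &
      compact L /\ forall p, ~ L p -> al p = 0 /\ be p = 1].
Proof.
move=> cK; have [s [rho [U [cr r0 r1 [oU KU] rU]]]] := partition_of_unity cK.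
pose a p := \sum_(i <- s) rho i p.
have [sa [L [cL _ aL]]] : Cc a setT by apply: Cc_sum => i; apply: CcS (cr i).
pose w p := a p ^+ 2 + (1 - a p) ^+ 2.
have w0 p : 0 < w p.
  (* Completing the square keeps the norm away from zero. *)
  have h : w p = ((2 * a p - 1) ^+ 2 + 1) / 2 by rewrite /w; field.
  by rewrite h divr_gt0// ltr_wpDl// sqr_ge0.
have s1a : smooth_fun (fun p => 1 - a p) by apply: smooth_funB => //; exact: smooth_fun_cst.
have sw : smooth_fun w by apply: smooth_funD; exact: smooth_fun_sqr.
have sr : smooth_fun (fun p => (Num.sqrt (w p))^-1).
  by apply: smooth_funV; [move=> p; rewrite sqrtr_eq0 -ltNge|exact: smooth_fun_sqrt].
exists (fun p => a p * (Num.sqrt (w p))^-1), (fun p => (1 - a p) * (Num.sqrt (w p))^-1), U, L; split=> //.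
- by split; apply: smooth_funM.
- move=> p; rewrite !exprMn -mulrDl exprVn sqr_sqrtr ?ltW// -/(w p) divff// gt_eqF//.
- move=> p Up; have -> : w p = 1 by rewrite /w /a rU// subrr expr0n addr0 expr1n.
  by rewrite sqrtr1 invr1 /a rU// subrr mulr1 mul0r.
- split=> // p Lp; have -> : w p = 1 by rewrite /w aL// subr0 expr0n add0r expr1n.
  by rewrite sqrtr1 invr1 aL// subr0 mul0r mulr1.
Qed.

Lemma lbm_bound K (h : S -> R) : lbm bd (h : borel S -> R) -> compact K ->
  exists2 M, 0 < M & forall p, bd p -> K p -> `|h p| <= M.
Proof.
move=> [_ lh] cK; have [M hM] := lh _ cK; exists (`|M| + 1) => [|p bp Kp]; first by rewrite ltr_wpDl.
by apply: le_trans (hM p bp Kp) _; rewrite (le_trans (ler_norm _))// lerDl.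
Qed.

Lemma continuous_bound K (h : S -> R) : continuous h -> compact K ->
  exists2 M, 0 < M & forall p, K p -> `|h p| <= M.
Proof.
move=> ch cK; have [_ lh] := lbm_continuous ch; have [M hM] := lh _ cK.
exists (`|M| + 1) => [|p Kp]; first by rewrite ltr_wpDl.
by apply: le_trans (hM p I Kp) _; rewrite (le_trans (ler_norm _))// lerDl.
Qed.

Context (I : nat) (v : 'I_I -> test).
Hypotheses (nv : negdef (Qt mu sigma P q) v) (mxv : forall u : 'I_I.+1 -> test, ~ negdef (Qt mu sigma P q) u).
Let sQ : symbil (Qt mu sigma P q) := Qt_symbil mu_area sigma_length cP lq.

(** [u] vanishes near the supports of the maximal family, so it is [Q]-orthogonal to that family. *)
Lemma Qf_disjoint_ge0 K U u : compact K -> (forall i p, ~ K p -> tf_val (v i) p = 0) ->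
  open U -> K `<=` U -> Cc u setT -> (forall p, U p -> u p = 0) -> 0 <= Q u u.
Proof.
move=> cK vK oU KU cu uU; have [f fu] := testfun_of cu; rewrite -fu.
apply: (negdef_perp (w := f) sQ nv mxv) => i; rewrite /Qt /Qf /qform fu.
rewrite !Rintegral0 ?subr0// => p _.
  have [Kp|Kp] := pselect (K p); first by rewrite uU ?mulr0 ?mul0r//; exact: KU.
  by rewrite vK// mulr0.
have [Kp|Kp] := pselect (K p).
  rewrite uU ?mulr0 ?mul0r ?subr0//; last exact: KU.
  rewrite (diff_fun_near (v := fun=> 0)) ?diff_fun_cst ?coip0l//.
  by apply: filterS (open_nbhs_nbhs (conj oU (KU _ Kp))) => z; exact: uU.
rewrite vK// mulr0 subr0 coip_sym (diff_fun_out cK (vK i) Kp) coip0l//.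
Qed.

(* With [al ^+ 2 + be ^+ 2 = 1] and [be = 0] on the supports of a maximal negative
   definite family, [Q (be u) (be u) >= 0], while [Q u u] differs from
   [Q (al u) (al u) + Q (be u) (be u)] by the integral of [(|d al|^2 + |d be|^2) u^2]
   only. Hence [Q u u] controls [Q (al u) (al u)] up to the L^2 norm of [u]. *)
Lemma garding_local K : compact K -> exists (al : S -> R) (U : set S) (C : R),
  [/\ smooth_fun al, open U /\ K `<=` U, forall p, U p -> al p = 1, 0 < C &
   forall u, Cc u setT -> let w p := al p * u p in
     [/\ Cc w setT, \int[mu]_p sqd w p <= C * (Q u u + C * B u u) &
      \int[sigma]_(p in bd) (w p ^+ 2) <= C * (Q u u + C * B u u)]].
Proof.
move=> cK.
have [Kv cKv vKv] := compact_family (fun i => tfP (v i)).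
have [al [be [U [L [[sal sbe] ab [oU KU] aU [cL aL]]]]]] := quadratic_partition (compactU cK cKv).
pose E p := sqd al p + sqd be p.
have cE : continuous E by apply: smooth_fun_continuous; apply: smooth_funD; exact: coip_smooth.
have [CE CE0 hE] := continuous_bound cE cL.
have E0 p : ~ L p -> E p = 0.
  move=> Lp; have nL := closed_out cL Lp; rewrite /E.
  rewrite (diff_fun_near (u := al) (v := fun=> 0)); last by apply: filterS nL => z /aL[].
  rewrite (diff_fun_near (u := be) (v := fun=> 1)); last by apply: filterS nL => z /aL[].
  by rewrite !diff_fun_cst !coip0l addr0.
have Eb p : E p <= CE.
  have [Lp|Lp] := pselect (L p); last by rewrite E0// ltW.
  by apply: le_trans (hE _ Lp); exact: ler_norm.
(* The derivative of [al ^+ 2 + be ^+ 2 = 1]; it removes the cross terms of the localization. *)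
have dz p : al p *: diff_fun al p + be p *: diff_fun be p = 0.
  have h : diff_fun (fun z => al z * al z + be z * be z) p = 0.
    rewrite (_ : (fun z => _) = fun=> 1) ?diff_fun_cst//.
    by apply/funext => z; rewrite -!expr2 ab.
  move: h; rewrite diff_funD ?diff_funM//; try exact: smooth_funM.
  move: (al p *: _) (be p *: _) => x y; rewrite addrACA -mulr2n => /eqP.
  by rewrite -scaler_nat scaler_eq0 pnatr_eq0 /= => /eqP.
have [Cp Cp0 hP] := continuous_bound cP cL.
have [Cq Cq0 hq] := lbm_bound lq cL.
pose cq := Cq + 1; have cq1 : 1 < cq by rewrite /cq ltrDr.
(* With this parameter in the trace inequality the boundary term of [Q] costs half of the Dirichlet
   integral. *)
have eps0 : 0 < (2 * cq)^-1 by rewrite invr_gt0 mulr_gt0// (lt_trans _ cq1).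
have [CT CT0 hT] := trace_inequality mu_area sigma_length cL eps0.
pose C1 := CE + Cp + cq * CT.
have cq0 : 0 < cq by apply: lt_trans cq1.
have C10 : 0 <= C1 by rewrite /C1 !addr_ge0 ?mulr_ge0 ?(ltW CE0) ?(ltW Cp0) ?(ltW cq0).
exists al, U, (2 + C1 + CT); split=> //.
- by split=> // p Kp; apply: KU; left.
- by move=> p /aU[].
- by apply: ltr_wpDr => //; apply: ltr_wpDr.
move=> u cu w; have [su _] := cu; pose y p := be p * u p.
have cw : Cc w setT by exact: CcM.
have cy : Cc y setT by exact: CcM.
have [sw _] := cw; have [sy _] := cy.
have w0 p : ~ L p -> w p = 0 by move=> /aL[a0 _]; rewrite /w a0 mul0r.
have cEu : Cc (fun p => E p * (u p * u p)) setT.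
  have sE : smooth_fun E by apply: smooth_funD; exact: coip_smooth.
  by apply: CcM => //; exact: CcM.
(* The IMS localization formula, pointwise: the only error is the term of order zero with [E]. *)
have dE p : dens P u u p = dens P w w p + dens P y y p - E p * (u p * u p).
  have e2 : al p * coip p (diff_fun al p) (diff_fun u p) + be p * coip p (diff_fun be p) (diff_fun u p) = 0.
    by have := congr1 (fun z => coip p z (diff_fun u p)) (dz p); rewrite coipDl !coipZl coip0l.
  transitivity ((al p ^+ 2 + be p ^+ 2) * dens P u u p + 2 * u p *
    (al p * coip p (diff_fun al p) (diff_fun u p) + be p * coip p (diff_fun be p) (diff_fun u p))).
    by rewrite ab e2 mulr0 addr0 mul1r.
  rewrite /dens /w /y !diff_funM// !coipDl !coipDr !coipZl !coipZr /E.
  rewrite !(coip_sym p (diff_fun u p) (diff_fun al p)) !(coip_sym p (diff_fun u p) (diff_fun be p)); ring.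
have iw := dens_integrable mu_area cP sw cw; have iy := dens_integrable mu_area cP sy cy.
have iE := Cc_integrable mu_area cEu.
have bw := bdry_integrable sigma_length lq sw cw; have by' := bdry_integrable sigma_length lq sy cy.
have QE : Q u u = Q w w + Q y y - \int[mu]_p (E p * (u p * u p)).
  have i1 : \int[mu]_p dens P u u p = \int[mu]_p dens P w w p + \int[mu]_p dens P y y p - \int[mu]_p (E p * (u p * u p)).
    rewrite -RintegralD// -RintegralB//; last exact: (integrableD measurableT iw iy).
    by apply: eq_Rintegral => p _; exact: dE.
  have i2 : \int[sigma]_(p in bd) (q p * u p * u p) = \int[sigma]_(p in bd) (q p * w p * w p) + \int[sigma]_(p in bd) (q p * y p * y p).
    rewrite -RintegralD//; apply: eq_Rintegral => p _; rewrite /w /y.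
    by transitivity ((al p ^+ 2 + be p ^+ 2) * (q p * u p * u p)); [rewrite ab mul1r|ring].
  rewrite /Qf /qform -/(dens P u u) -/(dens P w w) -/(dens P y y); move: i1 i2; rewrite /dens => -> ->; ring.
have Qy : 0 <= Q y y.
  apply: (Qf_disjoint_ge0 cKv _ oU _ cy) => [i p|p Kp|p /aU[_ b0]]; first exact: vKv.
    by apply: KU; right.
  by rewrite /y b0 mul0r.
have iuu := prod_integrable mu_area su cu; have iww := prod_integrable mu_area sw cw.
have eE : \int[mu]_p (E p * (u p * u p)) <= CE * B u u.
  rewrite /Bf -RintegralZl//; apply: le_Rintegral => //; first exact: (integrableZl measurableT CE iuu).
  by move=> p _; apply: ler_wpM2r => //; rewrite -expr2 sqr_ge0.
have Bw : B w w <= B u u.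
  apply: le_Rintegral => // p _; rewrite /w -!expr2 exprMn ler_piMl ?sqr_ge0//.
  by rewrite -(ab p) lerDl sqr_ge0.
have Bw0 : 0 <= B w w by apply: Rintegral_ge0 => p _; rewrite -expr2 sqr_ge0.
have cs : Cc (fun p => sqd w p) setT.
  split; first exact: coip_smooth.
  by exists L; split=> // p Lp; rewrite (diff_fun_out cL w0)// coip0l.
have isq := Cc_integrable mu_area cs.
pose T := \int[sigma]_(p in bd) (w p ^+ 2); pose D := \int[mu]_p sqd w p.
have T0 : 0 <= T by apply: Rintegral_ge0 => p _; rewrite sqr_ge0.
have D0 : 0 <= D by apply: Rintegral_ge0 => p _; exact: coip_ge0.
have Bw2 : \int[mu]_p (w p ^+ 2) = B w w by apply: eq_Rintegral => p _; rewrite expr2.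
have hTw : T <= (2 * cq)^-1 * D + CT * B w w by rewrite -Bw2; exact: hT.
have ibs : sigma.-integrable bd (EFin \o (fun p : borel S => w p ^+ 2)).
  apply: (sigma_integrable sigma_length _ cL) => [|p Lp]; last by rewrite w0// expr0n.
  apply: (lbmS mb measurableT) => //; apply: lbm_continuous; apply: smooth_fun_continuous; exact: smooth_fun_sqr.
have Qw : D - Cp * B w w - cq * T <= Q w w.
  have h1 : D - Cp * B w w <= \int[mu]_p dens P w w p.
    rewrite /D /Bf -RintegralZl// -RintegralB//; last exact: (integrableZl measurableT Cp iww).
    apply: le_Rintegral => //.
      exact: (integrableB measurableT isq (integrableZl measurableT Cp iww)).
    move=> p _; rewrite /dens lerD2l lerN2; have [Lp|Lp] := pselect (L p); last by rewrite w0// !mulr0.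
    rewrite -mulrA; apply: ler_wpM2r; first by rewrite -expr2 sqr_ge0.
    by apply: le_trans (hP _ Lp); exact: ler_norm.
  have h2 : \int[sigma]_(p in bd) (q p * w p * w p) <= cq * T.
    rewrite /T -RintegralZl//; apply: le_Rintegral => //; first exact: (integrableZl mb cq ibs).
    move=> p bp; have [Lp|Lp] := pselect (L p); last by rewrite w0// expr0n !mulr0.
    rewrite -mulrA -expr2; apply: ler_wpM2r; first by rewrite sqr_ge0.
    apply: le_trans (ler_norm _) _; apply: le_trans (hq _ bp Lp) _; by rewrite /cq lerDl.
  by rewrite /Qf /qform -/(dens P w w); apply: lerB.
have cT : cq * T <= D / 2 + cq * CT * B w w.
  have -> : D / 2 + cq * CT * B w w = cq * ((2 * cq)^-1 * D + CT * B w w) by field; rewrite gt_eqF.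
  by rewrite ler_pM2l.
have T1 : T <= D + CT * B w w.
  apply: le_trans hTw _; rewrite lerD2r ler_piMl// invf_le1 ?mulr_gt0//.
  by rewrite -[leLHS]mulr1; apply: ler_pM => //; [rewrite ler1n|exact: ltW].
have [h1 h2] : D <= (2 + C1 + CT) * (Q u u + (2 + C1 + CT) * B u u) /\ T <= (2 + C1 + CT) * (Q u u + (2 + C1 + CT) * B u u).
  apply: (garding_arith (ltW CE0) (ltW Cp0) (mulr_ge0 (ltW cq0) CT0) CT0 Qy Bw0 Bw D0 T0 QE eE Qw cT T1).
by split.
Qed.

End Garding.

(** * Passing to the limit *)

(** After multiplication by the weight [4 ^ j] the integrals are still bounded by [2 ^- j.+1], a
    summable sequence. *)
Definition speed {R : realType} (j : nat) : R := (4 ^ j * 2 ^ j.+1)%:R^-1.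

Lemma speed_gt0 {R : realType} j : 0 < speed j :> R.
Proof. by rewrite invr_gt0 ltr0n muln_gt0 !expn_gt0. Qed.

(* Where [tot w] is finite, [w j] is bounded by a multiple of [4 ^- j]. *)
Definition tot {T : Type} {R : realType} (w : nat -> T -> R) x : \bar R :=
  (\sum_(j <oo) ((4 ^ j)%:R * w j x)%:E)%E.

Section Approximation.
Local Open Scope ereal_scope.
Context d (T : measurableType d) (R : realType) (m : {measure set T -> \bar R}).
Context (D : set T) (mD : measurable D).
Implicit Types (f g h b w : T -> R).

Lemma ge0_integral_fun_le f g : measurable_fun D f -> measurable_fun D g ->
  (forall x, D x -> (0 <= f x <= g x)%R) ->
  \int[m]_(x in D) (f x)%:E <= \int[m]_(x in D) (g x)%:E.
Proof.
move=> mf mg fg; apply: ge0_le_integral => //.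
- by move=> x /fg /andP[f0 _]; rewrite lee_fin.
- exact/measurable_EFinP.
- exact/measurable_EFinP.
- by move=> x /fg /andP[_ h]; rewrite lee_fin.
Qed.

(* Young's inequality [|f| <= g / e + e b] under [f ^ 2 <= g b]. *)
Lemma integral_abs_le f g b (e : R) : (0 < e)%R -> measurable_fun D f -> measurable_fun D g ->
  measurable_fun D b -> (forall x, D x -> (0 <= g x)%R /\ (0 <= b x)%R) ->
  (forall x, D x -> (f x ^+ 2 <= g x * b x)%R) ->
  \int[m]_(x in D) (`|f x|)%:E <= e^-1%:E * (\int[m]_(x in D) (g x)%:E) + e%:E * \int[m]_(x in D) (b x)%:E.
Proof.
move=> e0 mf mg mb gb0 fgb; have e0' := ltW e0.
have ei0 : (0 <= e^-1)%R by rewrite invr_ge0.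
have hg x : D x -> (0 <= g x)%R by move=> /gb0[].
have hb x : D x -> (0 <= b x)%R by move=> /gb0[].
rewrite -!ge0_integralZl//; first last.
- exact/measurable_EFinP.
- exact/measurable_EFinP.
rewrite -ge0_integralD//; first last.
- by apply: measurable_funeM; exact/measurable_EFinP.
- by move=> x /hb h; rewrite -EFinM lee_fin mulr_ge0.
- by apply: measurable_funeM; exact/measurable_EFinP.
- by move=> x /hg h; rewrite -EFinM lee_fin mulr_ge0.
apply: (@ge0_integral_fun_le (fun x => `|f x|)%R (fun x => e^-1 * g x + e * b x)%R).
- exact: measurableT_comp.
- by apply: measurable_funD; apply: measurable_funM => //; exact: measurable_cst.
move=> x Dx; rewrite normr_ge0/=; have := fgb x Dx; have := hg x Dx; have := hb x Dx.
move: (f x) (g x) (b x) => u v z z0 v0 h.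
rewrite -(@ler_pXn2r _ 2)// ?nnegrE ?addr_ge0 ?mulr_ge0// real_normK ?num_real//.
apply: (le_trans h); rewrite -subr_ge0.
have -> : ((e^-1 * v + e * z) ^+ 2 - v * z = (e^-1 * v) ^+ 2 + (e * z) ^+ 2 + v * z)%R.
  by field; rewrite gt_eqF.
by rewrite !addr_ge0 ?sqr_ge0 ?mulr_ge0.
Qed.

(** Cauchy-Schwarz in pointwise form: the hypothesis on squares covers products of functions and
    pairings of covectors alike, and yields convergence in L^1. *)
Lemma Rintegral_cvg_of_sq (h_ : nat -> T -> R) h (g b : nat -> T -> R) (M : R) :
  (forall n, m.-integrable D (EFin \o h_ n)) -> measurable_fun D h ->
  (forall n, measurable_fun D (g n)) -> (forall n, measurable_fun D (b n)) ->
  (forall n x, D x -> (0 <= g n x)%R /\ (0 <= b n x)%R) ->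
  (forall n x, D x -> ((h_ n x - h x) ^+ 2 <= g n x * b n x)%R) ->
  (\forall n \near \oo, \int[m]_(x in D) (b n x)%:E <= M%:E) ->
  \int[m]_(x in D) (g n x)%:E @[n --> \oo] --> 0 ->
  m.-integrable D (EFin \o h) /\
  (\int[m]_(x in D) h_ n x)%R @[n --> \oo] --> (\int[m]_(x in D) h x)%R.
Proof.
move=> ih mh mg mb gb0 hgb bM g0.
have mh_ n : measurable_fun D (h_ n) by have /integrableP[/measurable_EFinP] := ih n.
have M0 : (0 <= `|M| + 1)%R by rewrite addr_ge0.
have dl (e : R) : (0 < e)%R -> \forall n \near \oo, \int[m]_(x in D) (`|h_ n x - h x|)%:E <= e%:E.
  (* With this weight in Young's inequality the part with [b] is at most [e / 2]; so is the part
     with [g] once the integral of [g n] is below [k * (e / 2)]. *)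
  move=> e0; pose k : R := (e / (2 * (`|M| + 1)))%R.
  have k0 : (0 < k)%R by rewrite divr_gt0// mulr_gt0// ltr_wpDl.
  have : \forall n \near \oo, \int[m]_(x in D) (g n x)%:E < (k * (e / 2))%:E.
    move/fine_cvgP: g0 => [gf gc].
    have ke : (0 < k * (e / 2))%R by rewrite mulr_gt0// divr_gt0.
    have gk : \forall n \near \oo, (fine (\int[m]_(x in D) (g n x)%:E) < k * (e / 2))%R by exact: (cvgr_lt _ gc _ ke).
    apply: filterS2 gf gk => n gf h'.
    by rewrite -(fineK gf) lte_fin.
  apply: filterS2 bM => n bn gn.
  apply: le_trans (integral_abs_le k0 _ (mg n) (mb n) (gb0 n) (hgb n)) _.
    exact: measurable_funB.
  apply: (@le_trans _ _ (k^-1%:E * (k * (e / 2))%:E + k%:E * M%:E)).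
    by apply: leeD; apply: lee_wpmul2l => //; rewrite ?lee_fin ?invr_ge0 ltW.
  rewrite -!EFinM -EFinD lee_fin mulKf ?gt_eqF// {2}(splitr e) lerD2l.
  apply: (@le_trans _ _ (k * (`|M| + 1))%R).
    by rewrite ler_wpM2l ?(ltW k0)// (le_trans (ler_norm _))// lerDl.
  by rewrite /k le_eqVlt; apply/orP; left; apply/eqP; field; rewrite gt_eqF// ltr_wpDl.
have ihn : \forall n \near \oo, m.-integrable D (EFin \o (fun x => h_ n x - h x)%R).
  apply: filterS (dl _ ltr01) => n hn; apply/integrableP; split.
    by apply/measurable_EFinP; exact: measurable_funB.
  by under eq_integral do rewrite abse_EFin; apply: le_lt_trans hn _; rewrite ltry.
have inth : m.-integrable D (EFin \o h).
  have [n _ hn] := ihn; have {}hn := hn n (leqnn n).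
  have := integrableB mD (ih n) hn; congr (m.-integrable D _).
  by apply/funext => x /=; rewrite -EFinB; congr EFin; ring.
split=> //; apply/cvgrPdist_le => e e0; apply: filterS2 ihn (dl e e0) => n ihn hn.
rewrite distrC -RintegralB//.
apply: le_trans (le_normr_Rintegral mD ihn) _.
rewrite -lee_fin; apply: le_trans _ hn; rewrite /Rintegral fineK//.
rewrite ge0_fin_numE ?integral_ge0//.
by have /integrableP[] := ihn.
Qed.

Lemma fatou_le (f_ : nat -> T -> R) f (e : R) : (forall n, measurable_fun D (f_ n)) ->
  (forall n x, D x -> (0 <= f_ n x)%R) -> (forall x, D x -> f_ n x @[n --> \oo] --> f x) ->
  (\forall n \near \oo, \int[m]_(x in D) (f_ n x)%:E <= e%:E) ->
  \int[m]_(x in D) (f x)%:E <= e%:E.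
Proof.
move=> mf f0 ff [N _ hN].
have := @fatou _ _ _ m D mD (fun n x => (f_ (n + N)%N x)%:E) _ _.
move=> /(_ (fun n => (measurable_EFinP D _).2 (mf _))) /(_ _)/wrap[n x Dx|]; first by rewrite lee_fin f0.
move=> h; apply: (@le_trans _ _ (\int[m]_(x in D) limn_einf (fun n => (f_ (n + N)%N x)%:E))).
  rewrite (eq_integral (fun x => limn_einf (fun n => (f_ (n + N)%N x)%:E)))// => x /[!inE] Dx.
  have hc : (f_ (n + N)%N x)%:E @[n --> \oo] --> (f x)%:E.
    by apply/cvg_EFin; [exact: nearW|exact: (cvg_comp (fun n => (n + N)%N) (f_ ^~ x) (cvg_addnr N) (ff x Dx))].
  by rewrite (cvg_limn_einf_sup hc).1.
apply: (le_trans h); rewrite limn_einf_lim; apply: lime_le; first exact: is_cvg_einfs.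
apply: nearW => n; apply: (@le_trans _ _ (\int[m]_(x in D) (f_ (n + N)%N x)%:E)).
  by apply: ereal_inf_lbound; exists n => /=.
by apply: hN => /=; rewrite leq_addl.
Qed.

(** By monotone convergence [tot w] has a finite integral. *)
Lemma tot_ae (w : nat -> T -> R) : (forall j, measurable_fun D (w j)) ->
  (forall j x, D x -> (0 <= w j x)%R) ->
  (forall j, \int[m]_(x in D) (w j x)%:E <= (speed j : R)%:E) ->
  {ae m, forall x, D x -> tot w x < +oo}.
Proof.
move=> mw w0 hw.
have mw' j : measurable_fun D (fun x => ((4 ^ j)%:R * w j x)%:E).
  by apply/measurable_EFinP; apply: measurable_funM => //; exact: measurable_cst.
have w0' j x : D x -> 0 <= ((4 ^ j)%:R * w j x)%:E.
  by move=> Dx; rewrite lee_fin mulr_ge0// w0.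
have mtot : measurable_fun D (tot w).
  have := @ge0_emeasurable_sum _ T R D (fun j x => ((4 ^ j)%:R * w j x)%:E) xpredT.
  by move=> /(_ (fun k x Dx _ => w0' k x Dx) (fun k _ => mw' k)).
have tot0 x : D x -> 0 <= tot w x by move=> Dx; apply: nneseries_ge0 => j _ _; exact: w0'.
have it : m.-integrable D (tot w).
  apply/integrableP; split=> //.
  rewrite (eq_integral (tot w)) => [|x /[!inE] Dx]; last by rewrite gee0_abs// tot0.
  rewrite /tot integral_nneseries//.
  apply: (@le_lt_trans _ _ (\sum_(j <oo) (1 / (2 ^ j.+1)%:R)%:E)); last first.
    by apply: le_lt_trans (@epsilon_trick0 R 1%R xpredT ler01) _; rewrite ltry.
  apply: lee_nneseries => [j _ _|j _]; first by apply: integral_ge0 => x; exact: w0'.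
  under eq_integral do rewrite EFinM.
  rewrite ge0_integralZl//; first last.
  - by move=> x Dx; rewrite lee_fin w0.
  - exact/measurable_EFinP.
  apply: (@le_trans _ _ ((4 ^ j)%:R%:E * (speed j : R)%:E)); first by rewrite lee_wpmul2l.
  rewrite -EFinM lee_fin /speed natrM invfM mulrA mulfV ?pnatr_eq0 ?expn_eq0//.
have := integrable_ae mD it; apply: filterS => x h Dx; have := h Dx.
by rewrite ge0_fin_numE// tot0.
Qed.

End Approximation.
Lemma cvge_0 (R : realType) (a : nat -> \bar R) : (forall n, (0 <= a n)%E) ->
  (forall e, 0 < e -> exists N, forall n, (N <= n)%N -> (a n <= e%:E)%E) -> a @ \oo --> 0%E.
Proof.
move=> a0 h; apply/fine_cvgP; split.
  have [N hN] := h 1 ltr01; exists N => // n /= Nn.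
  by rewrite ge0_fin_numE//; apply: le_lt_trans (hN n Nn) _; rewrite ltry.
apply/cvgrPdist_le => e e0; have [N hN] := h e e0; exists N => // n /= Nn.
have an : a n \is a fin_num by rewrite ge0_fin_numE//; apply: le_lt_trans (hN n Nn) _; rewrite ltry.
by rewrite sub0r normrN ger0_norm ?fine_ge0// -lee_fin fineK//; exact: hN.
Qed.

Lemma finite_of_cvg d (T : measurableType d) (R : realType) (m : {measure set T -> \bar R}) (D : set T)
  (g : T -> R) (g_ h_ : nat -> T -> R) : measurable D -> measurable_fun D g ->
  (forall n, measurable_fun D (g_ n)) -> (forall n, measurable_fun D (h_ n)) ->
  (forall p, 0 <= g p) -> (forall n p, 0 <= g_ n p) -> (forall n p, 0 <= h_ n p) ->
  (forall n p, g p <= 2 * g_ n p + 2 * h_ n p) ->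
  (\int[m]_(p in D) (g_ n p)%:E)%E @[n --> \oo] --> 0%E ->
  (forall n, (\int[m]_(p in D) (h_ n p)%:E < +oo)%E) -> (\int[m]_(p in D) (g p)%:E < +oo)%E.
Proof.
move=> mD mg mg_ mh_ g0 g_0 h_0 le c0 fin.
have /fine_cvgP[[N _ hN] _] := c0; have {}hN := hN N (leqnn N).
apply: (@le_lt_trans _ _ (\int[m]_(p in D) (2 * g_ N p + 2 * h_ N p)%:E)%E).
  apply: ge0_integral_fun_le => // [|p _]; last by rewrite g0/=.
  by apply: measurable_funD; apply: measurable_funM => //; exact: measurable_cst.
under eq_integral do rewrite EFinD !EFinM.
have m2 (k : T -> R) : measurable_fun D k -> measurable_fun D (fun p => (2%:E * (k p)%:E)%E).
  by move=> mk; apply: measurable_funeM; exact/measurable_EFinP.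
rewrite ge0_integralD//; first last.
- exact: m2.
- by move=> p _; rewrite -EFinM lee_fin mulr_ge0.
- exact: m2.
- by move=> p _; rewrite -EFinM lee_fin mulr_ge0.
rewrite !ge0_integralZl//; try exact/measurable_EFinP.
all: try by move=> p _; rewrite lee_fin.
apply: lte_add_pinfty; apply: lte_mul_pinfty => //.
by rewrite -ge0_fin_numE ?integral_ge0// => p _; rewrite lee_fin.
Qed.

Lemma ae_imply d (T : measurableType d) (R : realType) (m : {measure set T -> \bar R}) (P P' : T -> Prop) :
  {ae m, forall x, P x} -> (forall x, P x -> P' x) -> {ae m, forall x, P' x}.
Proof. by move=> h i; apply: filterS h. Qed.

Lemma tot_bound (T : Type) (R : realType) (w : nat -> T -> R) x : (forall j, 0 <= w j x) ->
  (tot w x < +oo)%E -> exists2 C, 0 <= C & forall j, w j x <= C / 4 ^+ j.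
Proof.
move=> w0 tf; have w0' j : (0 <= ((4 ^ j)%:R * w j x)%:E)%E by rewrite lee_fin mulr_ge0.
have t0 : (0 <= tot w x)%E by apply: nneseries_ge0 => j _ _.
exists (fine (tot w x)); first exact: fine_ge0.
move=> j; rewrite ler_pdivlMr ?exprn_gt0// mulrC -natrX -lee_fin fineK ?ge0_fin_numE//.
apply: le_trans (@nneseries_lim_ge R _ xpredT 0 j.+1 (fun n _ _ => w0' n)).
by rewrite big_nat_recr//= leeDr// sume_ge0.
Qed.

(** After taking roots the increments are bounded by the terms [c / 2 ^+ j] of a geometric
    series. *)
Lemma geometric_cvg (R : realType) (x : nat -> R) (C : R) N :
  (forall j, (N <= j)%N -> (x j.+1 - x j) ^+ 2 <= C / 4 ^+ j) -> cvgn x.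
Proof.
move=> hx; pose c := Num.sqrt C.
have C0 : 0 <= C.
  by have := le_trans (sqr_ge0 _) (hx N (leqnn N)); rewrite pmulr_lge0// invr_gt0 exprn_gt0.
have step j : (N <= j)%N -> `|x j.+1 - x j| <= c / 2 ^+ j.
  move=> /hx h; rewrite -(@ler_pXn2r _ 2)// ?nnegrE ?divr_ge0 ?sqrtr_ge0 ?exprn_ge0//.
  rewrite real_normK ?num_real// exprMn sqr_sqrtr// exprVn -exprM mulnC exprM.
  by rewrite (_ : 2 ^+ 2 = 4 :> R)//; ring.
have tail k i : (N <= k)%N -> `|x (k + i)%N - x k| <= 2 * c / 2 ^+ k - 2 * c / 2 ^+ (k + i).
  move=> Nk; elim: i => [|i ih]; first by rewrite addn0 !subrr normr0.
  rewrite addnS (_ : x _ - x k = (x (k + i).+1 - x (k + i)%N) + (x (k + i)%N - x k)); last by ring.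
  apply: le_trans (ler_normD _ _) _; apply: le_trans (lerD (step _ _) ih) _.
    by rewrite (leq_trans Nk)// leq_addr.
  rewrite le_eqVlt; apply/orP; left; apply/eqP.
  by rewrite exprS; field; rewrite !expf_neq0//= ?pnatr_eq0.
apply: cauchy_cvg; apply/cauchy_exP => e e0.
have [k Nk hk] : exists2 k, (N <= k)%N & 2 * c / 2 ^+ k < e.
  have h : 2 * c * (2^-1) ^+ k @[k --> \oo] --> (0 : R).
    rewrite -[X in _ --> X](mulr0 (2 * c)); apply: cvgM; first exact: cvg_cst.
    by apply: cvg_expr; rewrite ger0_norm ?invr_ge0// invf_lt1// ltr1n.
  have [M _ hM] := cvgr_lt _ h _ e0.
  exists (maxn N M); first by rewrite leq_maxl.
  by rewrite -exprVn; apply: hM => /=; exact: leq_maxr.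
exists (x k); exists k => // n /= kn; rewrite /ball /= distrC -(subnKC kn).
apply: le_lt_trans (tail _ _ Nk) _; apply: le_lt_trans _ hk.
by rewrite gerBl divr_ge0 ?mulr_ge0 ?sqrtr_ge0 ?exprn_ge0.
Qed.

Lemma fast_subsequence (P : nat -> nat -> nat -> Prop) :
  (forall j, exists N, forall n k, (N <= n)%N -> (N <= k)%N -> P j n k) ->
  exists phi : nat -> nat, (forall j, (j <= phi j)%N) /\ forall j, P j (phi j.+1) (phi j).
Proof.
move=> hP; pose N j := projT1 (cid (hP j)).
have hN j n k : (N j <= n)%N -> (N j <= k)%N -> P j n k by rewrite /N; case: cid => M h; exact: h.
(* Adding up the thresholds makes [phi] monotone, so both [phi j] and [phi j.+1] are at least [N j];
   the summand [j] makes it unbounded. *)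
pose phi j := (j + \sum_(i < j.+1) N i)%N.
have Nphi j : (N j <= phi j)%N by rewrite /phi big_ord_recr/= addnA leq_addl.
exists phi; split=> j; first by rewrite leq_addr.
apply: hN => //; apply: leq_trans (Nphi j) _.
by rewrite /phi [X in (_ <= _ + X)%N]big_ord_recr/= addnA -!addnA leq_add// ?leqnSn// leq_addr.
Qed.

(** The support of a bump function shows that each point has a neighbourhood inside a compact set,
    hence one from the countable base. Finite unions of compact sets, one for each such base
    element, exhaust [X]. *)
Lemma sigma_compact (R : realType) n (X : manifold R n) : exists K : nat -> set X,
  (forall j, compact (K j)) /\ forall p, exists N, forall j, (N <= j)%N -> K j p.
Proof.
have [B /countable_injP[f fI] [Bo Bb]] := @mf_second_countable _ _ X.
(* One compact set per index of a base element; it is empty when no base element of that index lies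
   in a compact set. *)
have LP j : exists L : set X, compact L /\ forall b, B b -> f b = j ->
    (exists2 L', compact L' & b `<=` L') -> b `<=` L.
  have [[b [Bb' fb [L cL bL]]]|h] := pselect (exists b, [/\ B b, f b = j & exists2 L', compact L' & b `<=` L']).
    exists L; split=> // b' Bb'' fb' _.
    by rewrite (fI b' b) ?inE// fb fb'.
  by exists set0; split=> [|b b1 b2 b3]; [exact: compact0|exfalso; apply: h; exists b].
pose L j := projT1 (cid (LP j)).
have cL j : compact (L j) by rewrite /L; case: cid => ? [].
have hL b : B b -> (exists2 L', compact L' & b `<=` L') -> b `<=` L (f b).
  by move=> b1 b2; have [_ h] := projT2 (cid (LP (f b))); exact: h.
exists (fun j => \big[setU/set0]_(i < j) L i); split=> [j|p]; first exact: bigsetU_compact.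
have [chi [[sc [K [cK _ chi0]]] _ chip]] := bump_exists p.
have : nbhs p [set z | 0 < chi z].
  have cc : continuous chi := smooth_fun_continuous sc.
  exact: (cvgr_gt _ (cc p) _ chip).
move=> /Bb[b [Bb' bp] bV].
have bL : b `<=` L (f b).
  by apply: hL => //; exists K => // z /bV /=; apply: contraPP => /chi0 ->; rewrite ltxx.
exists (f b).+1 => j fj; rewrite -bigcup_mkord; exists (f b) => //; exact: bL.
Qed.

Section CometricLimits.
Context (R : realType) (S : riemannian R 1).
Implicit Types (p : S) (z : 'rV[R]_2).

Lemma coip_cvg p (x y : nat -> 'rV[R]_2) (x0 y0 : 'rV[R]_2) :
  (forall i, x j 0 i @[j --> \oo] --> x0 0 i) -> (forall i, y j 0 i @[j --> \oo] --> y0 0 i) ->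
  coip p (x j) (y j) @[j --> \oo] --> coip p x0 y0.
Proof.
move=> hx hy; rewrite /coip ip2; under eq_fun do rewrite ip2.
by repeat apply: cvgD; (apply: cvgM => //; apply: cvgM => //; exact: cvg_cst).
Qed.

Lemma coip_component p i : exists2 M, 0 <= M & forall z, z 0 i ^+ 2 <= M * coip p z z.
Proof.
pose e : 'rV[R]_2 := delta_mx 0 i *m metric p.
exists (coip p e e) => [|z]; first exact: coip_ge0.
rewrite mulrC; suff -> : z 0 i = coip p z e by exact: coip_CS.
have um : metric p \in unitmx by apply: spd_unit => v; exact: metric_pos.
rewrite /coip /ip /e trmx_mul Defs.metric_sym mulmxA -(mulmxA z) mulVmx// mulmx1.
rewrite mxE (bigD1 i)//= big1 => [|j ji]; first by rewrite !mxE !eqxx mulr1 addr0.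
by rewrite !mxE (negbTE ji) andbF mulr0.
Qed.

End CometricLimits.

(** * Limits of sequences that are Cauchy in H^1_loc together with their boundary values *)

Section WeakLimit.
Context (R : realType) (S : riemannian R 1).
Context (mu sigma : {measure set (borel S) -> \bar R}).
Hypotheses (mu_area : is_area mu) (sigma_length : is_bdry_length sigma).
Implicit Types (p : S) (K : set S) (v : S -> R) (c : chart R S 1).
Local Notation bd := (@bdry R 1 S).
Let hS : hausdorff_space S := @mf_hausdorff _ _ S.
Let mb : measurable (bd : set (borel S)) := @bdry_measurable _ S.
Local Notation sq p z := (coip p z z).
Context (u : nat -> S -> R).
Hypothesis su : forall n, smooth_fun (u n).
Local Notation df n p := (diff_fun (u n) p).

Definition cauchy_form := forall K, compact K -> forall e, 0 < e -> exists N, forall n k, (N <= n)%N -> (N <= k)%N ->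
  [/\ (\int[mu]_(p in K) ((u n p - u k p) ^+ 2)%:E <= e%:E)%E,
      (\int[mu]_(p in K) (sq p (df n p - df k p))%:E <= e%:E)%E &
      (\int[sigma]_(p in K `&` bd) ((u n p - u k p) ^+ 2)%:E <= e%:E)%E].
Hypothesis cau : cauchy_form.

Lemma measurable_smooth v (D : set (borel S)) : measurable D -> smooth_fun v -> measurable_fun D (v : borel S -> R).
Proof.
move=> mD sv; apply: (measurable_funS (E := setT)) => //.
by have [] := lbm_continuous (smooth_fun_continuous sv).
Qed.

Let sdiff n k : smooth_fun (fun p => (u n p - u k p) ^+ 2).
Proof. by apply: smooth_fun_sqr; exact: smooth_funB. Qed.

Let sgrad n k : smooth_fun (fun p => sq p (df n p - df k p)).
Proof.
have := coip_smooth (smooth_funB (su n) (su k)) (smooth_funB (su n) (su k)).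
by congr smooth_fun; apply/funext => p; rewrite diff_funB.
Qed.

Lemma integral_indicM (m : {measure set (borel S) -> \bar R}) (D K : set (borel S)) (f : borel S -> R) :
  (\int[m]_(p in D) (\1_K p * f p)%:E = \int[m]_(p in D `&` K) (f p)%:E)%E.
Proof.
rewrite integral_mkcondr; apply: eq_integral => p _; rewrite patchE indicE.
by case: ifP => _; rewrite ?mul1r ?mul0r.
Qed.

(* Multiplying by indicators makes the subsequence converge everywhere, so the limits are
   measurable. For [xi] this matters in charts only: its components in the preferred
   charts need not be measurable. *)
Lemma limit_exists : exists (phi : nat -> nat) (G G' : set (borel S)) (f : S -> R) (xi : S -> 'rV[R]_2),
  [/\ measurable G /\ measurable G',
      forall p, \1_G p * u (phi j) p @[j --> \oo] --> f p,
      forall p i, \1_G' p * df (phi j) p 0 i @[j --> \oo] --> xi p 0 i,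
      forall j, (j <= phi j)%N &
      [/\ {ae mu, forall p, G p}, {ae mu, forall p, G' p} &
        {ae sigma, forall p, bd p -> G p}]].
Proof.
have [K [cK Kp]] := sigma_compact S.
have mK j : measurable (K j : set (borel S)) by exact: compact_measurable_borel.
have [phi [phij hphi]] := fast_subsequence (fun j => cau (cK j) (speed_gt0 j)).
(* The Cauchy estimates hold on compact sets only. The indicator of [K j] localizes them, and a
   given point lies in all [K j] from some index on. *)
pose w j (p : borel S) : R := \1_(K j) p * (u (phi j.+1) p - u (phi j) p) ^+ 2.
pose w' j (p : borel S) : R := \1_(K j) p * sq p (df (phi j.+1) p - df (phi j) p).
have w0 j p : 0 <= w j p by rewrite mulr_ge0 ?sqr_ge0// indicE.
have w'0 j p : 0 <= w' j p by rewrite mulr_ge0 ?coip_ge0// indicE.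
have mw j : measurable_fun setT (w j).
  by apply: measurable_funM; [exact: measurable_indic|apply: measurable_smooth => //; exact: sdiff].
have mw' j : measurable_fun setT (w' j).
  by apply: measurable_funM; [exact: measurable_indic|apply: measurable_smooth => //; exact: sgrad].
have mtot (h : nat -> borel S -> R) : (forall j p, 0 <= h j p) -> (forall j, measurable_fun setT (h j)) ->
    measurable [set p | (tot h p < +oo)%E].
  move=> h0 mh; rewrite -[X in measurable X]setTI; apply: emeasurable_fun_infty_o => //.
  apply: (@ge0_emeasurable_sum _ _ R setT (fun j x => ((4 ^ j)%:R * h j x)%:E) xpredT) => [k x _ _|k _].
    by rewrite lee_fin mulr_ge0.
  by apply/measurable_EFinP; apply: measurable_funM => //; exact: measurable_cst.
pose G : set (borel S) := [set p | (tot w p < +oo)%E].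
pose G' : set (borel S) := [set p | (tot w' p < +oo)%E].
have fin p : G p -> cvgn (fun j => u (phi j) p).
  move=> /(tot_bound (w0 ^~ p))[C C0 hC]; have [N hN] := Kp p.
  apply: (@geometric_cvg _ _ C N) => j /hN Kj; apply: le_trans (hC j).
  by rewrite /w indicE mem_set ?mul1r.
have fin' p i : G' p -> cvgn (fun j => df (phi j) p 0 i).
  move=> /(tot_bound (w'0 ^~ p))[C C0 hC]; have [N hN] := Kp p; have [M M0 hM] := coip_component p i.
  apply: (@geometric_cvg _ _ (M * C) N) => j /hN Kj.
  rewrite -mulrA; apply: (@le_trans _ _ (M * w' j p)); last exact: ler_wpM2l.
  rewrite /w' indicE mem_set ?mul1r//; apply: le_trans (hM _).
  by rewrite le_eqVlt; apply/orP; left; apply/eqP; rewrite !mxE.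
exists phi, G, G', (fun p => limn (fun j => \1_G p * u (phi j) p)),
  (fun p => \row_i limn (fun j => \1_G' p * df (phi j) p 0 i)); split=> //.
- by split; apply: mtot.
- move=> p; suff h : cvgn (fun j => \1_G p * u (phi j) p) by exact: h.
  rewrite indicE; case: (boolP (p \in G)); last by under eq_fun do rewrite mul0r; move=> _; exact: is_cvg_cst.
  by rewrite inE (_ : true%:R = 1 :> R)// => /fin h; under eq_fun do rewrite mul1r.
- move=> p i; rewrite mxE; suff h : cvgn (fun j => \1_G' p * df (phi j) p 0 i) by exact: h.
  rewrite indicE; case: (boolP (p \in G')); last by under eq_fun do rewrite mul0r; move=> _; exact: is_cvg_cst.
  by rewrite inE (_ : true%:R = 1 :> R)// => /(fin' p i) h; under eq_fun do rewrite mul1r.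
have hw j : (\int[mu]_p (w j p)%:E <= (speed j)%:E)%E.
  by rewrite integral_indicM setTI; case: (hphi j).
have hw' j : (\int[mu]_p (w' j p)%:E <= (speed j)%:E)%E.
  by rewrite integral_indicM setTI; case: (hphi j).
have hws j : (\int[sigma]_(p in bd) (w j p)%:E <= (speed j)%:E)%E.
  by rewrite integral_indicM setIC; case: (hphi j).
split.
- by apply: filterS (tot_ae measurableT mw (fun j p _ => w0 j p) hw) => p; exact.
- by apply: filterS (tot_ae measurableT mw' (fun j p _ => w'0 j p) hw') => p; exact.
apply: (tot_ae mb _ (fun j p _ => w0 j p) hws) => j.
by apply: measurable_funS (mw j).
Qed.

Lemma compact_integral_finite (m : {measure set (borel S) -> \bar R}) (D : set (borel S)) v K :
  (forall L : set S, compact L -> (m L < +oo)%E) -> measurable D -> smooth_fun v -> (forall p, 0 <= v p) ->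
  compact K -> (\int[m]_(p in K `&` D) (v p)%:E < +oo)%E.
Proof.
move=> mfin mD sv v0 cK; have mK := compact_measurable_borel hS cK.
have mKD : measurable (K `&` D : set (borel S)) by exact: measurableI.
have lv : lbm (K `&` D) (v : borel S -> R).
  by apply: (lbmS mKD measurableT) => //; apply: lbm_continuous; exact: smooth_fun_continuous.
have /integrableP[_] := lbm_integrable hS mfin mKD lv cK (fun p KDp Kp => False_ind _ (Kp KDp.1)).
by under eq_integral do rewrite /= ger0_norm//.
Qed.

Section LimitData.
Context (phi : nat -> nat) (G G' : set (borel S)) (f : S -> R) (xi : S -> 'rV[R]_2).
Hypotheses (mG : measurable G) (mG' : measurable G').
Hypothesis hf : forall p, \1_G p * u (phi j) p @[j --> \oo] --> f p.
Hypothesis hxi : forall p i, \1_G' p * df (phi j) p 0 i @[j --> \oo] --> xi p 0 i.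
Hypothesis phij : forall j, (j <= phi j)%N.
Hypotheses (aeG : {ae mu, forall p, G p}) (aeG' : {ae mu, forall p, G' p}).
Hypothesis aeGs : {ae sigma, forall p, bd p -> G p}.

Lemma limit_measurable (D : set (borel S)) : measurable D -> measurable_fun D (f : borel S -> R).
Proof.
move=> mD; apply: (measurable_fun_cvg (h := fun j (p : borel S) => \1_G p * u (phi j) p)) => [j|p _]; last exact: hf.
by apply: measurable_funM; [exact: measurable_indic|exact: measurable_smooth].
Qed.

Let hxi' p i : (\1_G' p *: df (phi j) p) 0 i @[j --> \oo] --> xi p 0 i.
Proof. by under eq_fun do rewrite mxE; exact: hxi. Qed.

Lemma limit_coip_measurable v : smooth_fun v ->
  measurable_fun setT (fun p : borel S => coip p (xi p) (diff_fun v p)).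
Proof.
move=> sv; apply: (measurable_fun_cvg (h := fun j (p : borel S) => \1_G' p * coip p (df (phi j) p) (diff_fun v p))) => [j|p _].
  by apply: measurable_funM; [exact: measurable_indic|apply: measurable_smooth => //; exact: coip_smooth].
by under eq_fun do rewrite -coipZl; apply: coip_cvg => // i; exact: cvg_cst.
Qed.

Lemma limit_sq_measurable : measurable_fun setT (fun p : borel S => sq p (xi p)).
Proof.
apply: (measurable_fun_cvg (h := fun j (p : borel S) => \1_G' p * (\1_G' p * sq p (df (phi j) p)))) => [j|p _].
  apply: measurable_funM; first exact: measurable_indic.
  by apply: measurable_funM; [exact: measurable_indic|apply: measurable_smooth => //; exact: coip_smooth].
by under eq_fun do rewrite -coipZr -coipZl; exact: coip_cvg.
Qed.

Let sqB p (x y : 'rV[R]_2) : sq p (x - y) = sq p x - 2 * coip p y x + sq p y.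
Proof.
rewrite -(scaleN1r y) !(coipDl, coipDr, coipZl, coipZr) (coip_sym p x y); ring.
Qed.

Lemma limit_form_dist_measurable v : smooth_fun v ->
  measurable_fun setT (fun p : borel S => sq p (diff_fun v p - xi p)).
Proof.
move=> sv; under eq_fun do rewrite sqB.
apply: measurable_funD; last exact: limit_sq_measurable.
apply: measurable_funB; first by apply: measurable_smooth => //; exact: coip_smooth.
by apply: measurable_funM; [exact: measurable_cst|exact: limit_coip_measurable].
Qed.

(** Fatou's lemma in the second index passes the Cauchy bound to the limit. The truncation by [G]
    changes the integrand on a null set only. *)
Lemma limit_fun_le (m : {measure set (borel S) -> \bar R}) (D : set (borel S)) n N e :
  measurable D -> {ae m, forall p, D p -> G p} ->
  (forall k, (N <= k)%N -> (\int[m]_(p in D) ((u n p - u k p) ^+ 2)%:E <= e%:E)%E) ->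
  (\int[m]_(p in D) ((u n p - f p) ^+ 2)%:E <= e%:E)%E.
Proof.
move=> mD aeD h.
have mj j : measurable_fun D (fun p : borel S => (u n p - \1_G p * u (phi j) p) ^+ 2).
  apply: measurable_funX; apply: measurable_funB; first exact: measurable_smooth.
  by apply: measurable_funM; [exact: measurable_indic|exact: measurable_smooth].
apply: (fatou_le mD mj) => [j p _|p _|]; first exact: sqr_ge0.
  by apply: cvgM; (apply: cvgB; [exact: cvg_cst|exact: hf]).
near=> j; rewrite (@ge0_ae_eq_integral _ _ _ _ _ _ (fun p : borel S => ((u n p - u (phi j) p) ^+ 2)%:E))//.
- by apply: h; apply: leq_trans (phij j); near: j; exact: nbhs_infty_ge.
- exact/measurable_EFinP.
- by apply/measurable_EFinP; apply: measurable_smooth.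
- by move=> p _; rewrite lee_fin sqr_ge0.
- by move=> p _; rewrite lee_fin sqr_ge0.
- by apply: (ae_imply aeD) => p Gp Dp; rewrite indicE mem_set ?mul1r//; exact: Gp.
Unshelve. all: by end_near. Qed.

Lemma limit_form_le (D : set (borel S)) n N e : measurable D ->
  (forall k, (N <= k)%N -> (\int[mu]_(p in D) (sq p (df n p - df k p))%:E <= e%:E)%E) ->
  (\int[mu]_(p in D) (sq p (df n p - xi p))%:E <= e%:E)%E.
Proof.
move=> mD h.
have mj j : measurable_fun D (fun p : borel S => sq p (df n p - \1_G' p *: df (phi j) p)).
  under eq_fun do rewrite sqB !coipZl coipZr.
  apply: measurable_funD; [apply: measurable_funB|]; try apply: measurable_funM => //.
  all: try exact: measurable_indic; try exact: measurable_cst.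
  - by apply: measurable_smooth => //; exact: coip_smooth.
  - by apply: measurable_funM; [exact: measurable_indic|apply: measurable_smooth => //; exact: coip_smooth].
  - by apply: measurable_funM; [exact: measurable_indic|apply: measurable_smooth => //; exact: coip_smooth].
apply: (fatou_le mD mj) => [j p _|p _|]; first exact: coip_ge0.
  have hc i : (df n p - \1_G' p *: df (phi j) p) 0 i @[j --> \oo] --> (df n p - xi p) 0 i.
    under eq_fun do rewrite mxE [X in _ + X]mxE.
    by rewrite mxE [X in _ + X]mxE; apply: cvgB; [exact: cvg_cst|exact: hxi'].
  exact: coip_cvg.
near=> j; rewrite (@ge0_ae_eq_integral _ _ _ _ _ _ (fun p : borel S => (sq p (df n p - df (phi j) p))%:E))//.
- by apply: h; apply: leq_trans (phij j); near: j; exact: nbhs_infty_ge.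
- exact/measurable_EFinP.
- by apply/measurable_EFinP; apply: measurable_smooth.
- by move=> p _; rewrite lee_fin coip_ge0.
- by move=> p _; rewrite lee_fin coip_ge0.
- by apply: filterS aeG' => p Gp Dp; rewrite indicE mem_set ?scale1r.
Unshelve. all: by end_near. Qed.

Lemma limit_cvg K : compact K ->
  [/\ (\int[mu]_(p in K) ((u n p - f p) ^+ 2)%:E)%E @[n --> \oo] --> 0%E,
      (\int[mu]_(p in K) (sq p (df n p - xi p))%:E)%E @[n --> \oo] --> 0%E &
      (\int[sigma]_(p in K `&` bd) ((u n p - f p) ^+ 2)%:E)%E @[n --> \oo] --> 0%E].
Proof.
move=> cK; have mK : measurable (K : set (borel S)) by exact: compact_measurable_borel.
have mKb : measurable (K `&` bd : set (borel S)) by exact: measurableI.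
split; apply: cvge_0 => [n|e e0]; try by apply: integral_ge0 => p _; rewrite lee_fin ?sqr_ge0 ?coip_ge0.
all: have [N hN] := cau cK e0; exists N => n Nn.
- apply: (limit_fun_le (N := N)) => //; first by apply: filterS aeG.
  by move=> k Nk; case: (hN n k).
- by apply: (limit_form_le (N := N)) => // k Nk; case: (hN n k).
- apply: (limit_fun_le (N := N)) => //; first by apply: (ae_imply aeGs) => p Gp [_ /Gp].
  by move=> k Nk; case: (hN n k).
Qed.

(** [f] serves as its own trace: the subsequence also converges [sigma]-almost everywhere, so the
    values of [f] on the boundary are the limits of the boundary values. *)
Lemma limit_trace : is_trace mu sigma f xi f.
Proof.
split; first exact: limit_measurable.
by exists u; split=> // K /limit_cvg[].
Qed.

Let sqr_le2 (x y : R) : y ^+ 2 <= 2 * (x - y) ^+ 2 + 2 * x ^+ 2.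
Proof. by rewrite -subr_ge0 (_ : _ - _ = (2 * x - y) ^+ 2) ?sqr_ge0//; ring. Qed.

Lemma limit_L2loc : L2loc mu f.
Proof.
split=> [|K cK]; first exact: limit_measurable.
have [h1 _ _] := limit_cvg cK; have mK : measurable (K : set (borel S)) by exact: compact_measurable_borel.
apply: (finite_of_cvg (g := fun p : borel S => f p ^+ 2) (g_ := fun n (p : borel S) => (u n p - f p) ^+ 2)
  (h_ := fun n (p : borel S) => u n p ^+ 2)) => //.
- by apply: measurable_funX; exact: limit_measurable.
- by move=> n; apply: measurable_funX; apply: measurable_funB; [exact: measurable_smooth|exact: limit_measurable].
- by move=> n; apply: measurable_funX; exact: measurable_smooth.
- by move=> p; exact: sqr_ge0.
- by move=> n p; exact: sqr_ge0.
- by move=> n p; exact: sqr_ge0.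
move=> n; rewrite -[K]setIT; apply: compact_integral_finite => //.
- exact: (area_compact_finite mu_area).
- exact: smooth_fun_sqr.
- by move=> p; exact: sqr_ge0.
Qed.

Lemma limit_chart_measurable c i : atlas S c ->
  measurable_fun (cdom c : set (borel S)) (fun p : borel S => (xi p *m (to_pref c p)^T) 0 i).
Proof.
move=> ac.
apply: (measurable_fun_cvg (h := fun j (p : borel S) => \1_G' p * (df (phi j) p *m (to_pref c p)^T) 0 i)) => [j|p cp].
  apply: measurable_funM; first exact: measurable_indic.
  apply: (@eq_measurable_fun _ _ _ _ _ (fun p : borel S => pderiv i (u (phi j) \o cinv c) (cmap c p))).
    by move=> p /[!inE] cp; rewrite -(grad_chart (su _) ac cp) mxE.
  have oc := cdom_open ac; apply: within_continuous_measurable; first exact: borel_open.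
  apply: continuous_in_subspaceT => p /[!inE] cp.
  have h : pderiv i (u (phi j) \o cinv c) @ hnbhs (cmap c p) --> pderiv i (u (phi j) \o cinv c) (cmap c p).
    by apply: (smooth_hcont (cimg_ropen ac)); [exact: cmap_img|apply: (smooth_pderiv (cimg_ropen ac)); exact: su].
  exact: (cvg_comp (cmap c) (pderiv i (u (phi j) \o cinv c)) (cmap_hcvg ac cp) h).
under eq_fun do rewrite !mxE mulr_sumr.
rewrite mxE; apply: (@cvg_big _ _ _ 0 xpredT) => [|k _]; first exact: add_continuous.
under eq_fun do rewrite mulrA.
by apply: cvgM; [exact: hxi|exact: cvg_cst].
Qed.

Lemma limit_L2loc_form : L2loc_form mu xi.
Proof.
split=> [c ac i|K cK]; first exact: limit_chart_measurable.
have [_ h1 _] := limit_cvg cK; have mK : measurable (K : set (borel S)) by exact: compact_measurable_borel.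
apply: (finite_of_cvg (g := fun p : borel S => sq p (xi p)) (g_ := fun n (p : borel S) => sq p (df n p - xi p))
  (h_ := fun n (p : borel S) => sq p (df n p))) => //.
- by apply: measurable_funS limit_sq_measurable.
- by move=> n; apply: measurable_funS (limit_form_dist_measurable (su n)).
- by move=> n; apply: measurable_smooth => //; exact: coip_smooth.
- by move=> p; exact: coip_ge0.
- by move=> n p; exact: coip_ge0.
- by move=> n p; exact: coip_ge0.
- move=> n p; rewrite -subr_ge0; have := coip_ge0 p (2 *: df n p - xi p).
  rewrite !sqB !(coipZl, coipZr) => h; apply: le_trans h _; rewrite le_eqVlt; apply/orP; left; apply/eqP; ring.
move=> n; rewrite -[K]setIT; apply: compact_integral_finite => //.
- exact: (area_compact_finite mu_area).
- exact: coip_smooth.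
- by move=> p; exact: coip_ge0.
Qed.

Lemma limit_pairing_fun (m : {measure set (borel S) -> \bar R}) (D : set (borel S)) K (w : borel S -> R) :
  (forall L : set S, compact L -> (m L < +oo)%E) -> measurable D -> lbm D w -> compact K ->
  (forall p, ~ K p -> w p = 0) ->
  (\int[m]_(p in K `&` D) ((u n p - f p) ^+ 2)%:E)%E @[n --> \oo] --> 0%E ->
  m.-integrable D (EFin \o (fun p : borel S => f p * w p)) /\
  \int[m]_(p in D) (u n p * w p) @[n --> \oo] --> \int[m]_(p in D) (f p * w p).
Proof.
move=> mfin mD lw cK w0 c0; have mK := compact_measurable_borel hS cK.
have mw : measurable_fun D w by case: lw.
have mf := limit_measurable mD.
have iw : m.-integrable D (EFin \o (fun p => w p ^+ 2)).
  apply: (lbm_integrable hS mfin mD _ cK) => [|p _ Kp]; last by rewrite w0// expr0n.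
  by have := lbmM lw lw; congr lbm; apply/funext => p; rewrite expr2.
have fw : (\int[m]_(p in D) (w p ^+ 2)%:E)%E \is a fin_num by exact: integrable_fin_num.
apply: (@Rintegral_cvg_of_sq _ _ _ m D mD (fun n p => u n p * w p) (fun p => f p * w p)
  (fun n p => \1_K p * (u n p - f p) ^+ 2) (fun _ p => w p ^+ 2) (fine (\int[m]_(p in D) (w p ^+ 2)%:E))).
- move=> n; apply: (lbm_integrable hS mfin mD _ cK) => [|p _ Kp]; last by rewrite w0// mulr0.
  apply: lbmM => //; apply: (lbmS mD measurableT) => //; apply: lbm_continuous; exact: smooth_fun_continuous.
- exact: measurable_funM.
- move=> n; apply: measurable_funM; first exact: measurable_indic.
  by apply: measurable_funX; apply: measurable_funB => //; exact: measurable_smooth.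
- by move=> n; exact: measurable_funX.
- by move=> n p _; rewrite mulr_ge0 ?sqr_ge0// indicE.
- move=> n p _; rewrite -mulrBl exprMn indicE; have [Kp|Kp] := pselect (K p).
    by rewrite mem_set// mul1r.
  by rewrite w0// expr0n !mulr0.
- by apply: nearW => n; rewrite fineK.
- by under eq_fun do rewrite integral_indicM setIC.
Qed.

(** [L p] is an additive functional on covectors whose squared norm is at most [W p]. It stands for
    the pairing with a vector field and for the product with the differential of a test function. *)
Lemma limit_pairing_form K (W : S -> R) (L : S -> 'rV[R]_2 -> R) : compact K ->
  (forall p, 0 <= W p) -> smooth_fun W -> (forall p, ~ K p -> W p = 0) ->
  (forall p x y, L p (x - y) = L p x - L p y) -> (forall p x, L p x ^+ 2 <= sq p x * W p) ->
  (forall n, smooth_fun (fun p => L p (df n p))) ->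
  measurable_fun setT (fun p : borel S => L p (xi p)) ->
  mu.-integrable setT (EFin \o (fun p : borel S => L p (xi p))) /\
  \int[mu]_p L p (df n p) @[n --> \oo] --> \int[mu]_p L p (xi p).
Proof.
move=> cK W0 sW Wout LB hL sL mL; have mK := compact_measurable_borel hS cK.
have Lout p x : ~ K p -> L p x = 0.
  move=> Kp; have := hL p x; rewrite Wout// mulr0 => h; apply/eqP; rewrite -sqrf_eq0; apply/eqP/le_anti.
  by rewrite h sqr_ge0.
have iW := mu_integrable mu_area (smooth_fun_continuous sW) cK Wout.
have fW : (\int[mu]_p (W p)%:E)%E \is a fin_num by exact: integrable_fin_num.
have [_ c0 _] := limit_cvg cK.
apply: (@Rintegral_cvg_of_sq _ _ _ mu setT measurableT (fun n p => L p (df n p)) (fun p => L p (xi p))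
  (fun n p => \1_K p * sq p (df n p - xi p)) (fun _ p => W p) (fine (\int[mu]_p (W p)%:E))) => //.
- move=> n; apply: (mu_integrable mu_area _ cK); first exact: smooth_fun_continuous.
  by move=> p; exact: Lout.
- move=> n; apply: measurable_funM; first exact: measurable_indic.
  exact: limit_form_dist_measurable.
- by move=> n; exact: measurable_smooth.
- by move=> n p _; rewrite mulr_ge0 ?coip_ge0// indicE.
- move=> n p _; rewrite -LB indicE; have [Kp|Kp] := pselect (K p).
    by rewrite mem_set// mul1r.
  by rewrite Lout// expr0n Wout// mulr0.
- by apply: nearW => n; rewrite fineK.
- by under eq_fun do rewrite integral_indicM setTI.
Qed.

(** Both sides of the integration by parts for [u n] converge; the pairing with [V] is controlled by
    the squared length of [V]. *)
Lemma limit_weak_diff : weak_diff mu f xi.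
Proof.
move=> V sV [K [cK Kb V0]].
have sdiv := divergence_smooth sV.
have [_ h1] : mu.-integrable setT (EFin \o (fun p : borel S => (xi p *m (V p)^T) 0 0)) /\
    \int[mu]_p (df n p *m (V p)^T) 0 0 @[n --> \oo] --> \int[mu]_p (xi p *m (V p)^T) 0 0.
  apply: (@limit_pairing_form K (fun p => ip (metric p) (V p) (V p)) (fun p x => (x *m (V p)^T) 0 0) cK).
  - move=> p; have [->|/metric_pos/ltW//] := eqVneq (V p) 0.
    by rewrite /ip !mul0mx mxE.
  - move=> c ac; have rc := cimg_ropen ac.
    apply: (smooth_eq rc (f := fun x => (fld V c x *m metric_in c x *m (fld V c x)^T) 0 0)) => [_ [p cp <-]|].
      rewrite /= cinvK// fld_cmap// metric_inE//.
      have -> : V p *m from_pref c p *m (to_pref c p *m metric p *m (to_pref c p)^T) *m (V p *m from_pref c p)^T =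
        V p *m (from_pref c p *m to_pref c p) *m metric p *m (V p *m (from_pref c p *m to_pref c p))^T.
        by rewrite !trmx_mul !mulmxA.
      by rewrite from_to// !mulmx1.
    have sf := fld_smooth sV ac.
    exact: (msmooth_mul rc (msmooth_mul rc sf (metric_in_smooth ac)) (msmooth_tr rc sf)).
  - by move=> p Kp; rewrite V0// /ip !mul0mx mxE.
  - by move=> p x y; rewrite mulmxBl [LHS]mxE [X in _ + X]mxE.
  - move=> p x; have um : metric p \in unitmx by apply: spd_unit => v; exact: metric_pos.
    have -> : (x *m (V p)^T) 0 0 = coip p x (V p *m metric p).
      by rewrite /coip /ip trmx_mul Defs.metric_sym mulmxA -(mulmxA x) mulVmx// mulmx1.
    have -> : ip (metric p) (V p) (V p) = sq p (V p *m metric p).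
      by rewrite /coip /ip trmx_mul Defs.metric_sym mulmxA mulmxK.
    exact: coip_CS.
  - by move=> n; exact: pairing_smooth.
  apply: (measurable_fun_cvg (h := fun j (p : borel S) => \1_G' p * (df (phi j) p *m (V p)^T) 0 0)) => [j|p _].
    apply: measurable_funM; first exact: measurable_indic.
    by apply: measurable_smooth => //; exact: pairing_smooth.
  rewrite mxE sum2; under eq_fun do rewrite mxE sum2 mulrDr !mulrA.
  by apply: cvgD; (apply: cvgM; [exact: hxi|exact: cvg_cst]).
have [_ h2] : mu.-integrable setT (EFin \o (fun p : borel S => f p * divergence V p)) /\
    \int[mu]_p (u n p * divergence V p) @[n --> \oo] --> \int[mu]_p (f p * divergence V p).
  apply: (@limit_pairing_fun mu setT K) => //.
  - exact: (area_compact_finite mu_area).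
  - by apply: lbm_continuous; exact: smooth_fun_continuous.
  - by move=> p; exact: divergence_out cK V0.
  - by under eq_fun do rewrite setIT; have [] := limit_cvg cK.
have h3 : \int[mu]_p (df n p *m (V p)^T) 0 0 @[n --> \oo] --> - \int[mu]_p (f p * divergence V p).
  have -> : (fun n => \int[mu]_p (df n p *m (V p)^T) 0 0) = (fun n => - \int[mu]_p (u n p * divergence V p)).
    by apply/funext => n; apply: weak_diff_smooth => //; exists K.
  exact: cvgN.
exact: (cvg_unique (@norm_hausdorff _ R^o) h1 h3).
Qed.

Lemma limit_pairing_Cc psi : Cc psi setT ->
  \int[mu]_p (u n p * psi p) @[n --> \oo] --> \int[mu]_p (f p * psi p).
Proof.
move=> [spsi [K [cK _ p0]]]; apply: (@limit_pairing_fun mu setT K _ _ _ _ cK p0 _).2 => //.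
- exact: (area_compact_finite mu_area).
- by apply: lbm_continuous; exact: smooth_fun_continuous.
- by under eq_fun do rewrite setIT; have [] := limit_cvg cK.
Qed.

Lemma limit_qform (P q : S -> R) psi : continuous P -> lbm bd (q : borel S -> R) -> Cc psi setT ->
  Qf mu sigma P q (u n) psi @[n --> \oo] --> qform mu sigma P q f xi f psi.
Proof.
move=> cP lq cpsi; have [spsi [K [cK _ p0]]] := cpsi; have [c1 c2 c3] := limit_cvg cK.
have ar := area_compact_finite mu_area.
have lpsi : lbm setT (psi : borel S -> R) by apply: lbm_continuous; exact: smooth_fun_continuous.
have [i1 h1] : mu.-integrable setT (EFin \o (fun p : borel S => coip p (xi p) (diff_fun psi p))) /\
    \int[mu]_p coip p (df n p) (diff_fun psi p) @[n --> \oo] --> \int[mu]_p coip p (xi p) (diff_fun psi p).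
  apply: (@limit_pairing_form K (fun p => sq p (diff_fun psi p)) (fun p x => coip p x (diff_fun psi p)) cK).
  - by move=> p; exact: coip_ge0.
  - exact: coip_smooth.
  - by move=> p Kp; rewrite (diff_fun_out cK p0 Kp) coip0l.
  - by move=> p x y; rewrite coipDl -scaleN1r coipZl mulN1r.
  - by move=> p x; exact: coip_CS.
  - by move=> n; exact: coip_smooth.
  exact: limit_coip_measurable.
have lP : lbm setT (fun p : borel S => P p * psi p) by apply: lbmM => //; exact: lbm_continuous.
have [i2 h2] : mu.-integrable setT (EFin \o (fun p : borel S => f p * (P p * psi p))) /\
    \int[mu]_p (u n p * (P p * psi p)) @[n --> \oo] --> \int[mu]_p (f p * (P p * psi p)).
  apply: (@limit_pairing_fun mu setT K) => //; first by move=> p Kp; rewrite p0// mulr0.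
  by under eq_fun do rewrite setIT.
have lq' : lbm bd (fun p : borel S => q p * psi p) by apply: lbmM => //; exact: (lbmS mb measurableT).
have [i3 h3] : sigma.-integrable bd (EFin \o (fun p : borel S => f p * (q p * psi p))) /\
    \int[sigma]_(p in bd) (u n p * (q p * psi p)) @[n --> \oo] --> \int[sigma]_(p in bd) (f p * (q p * psi p)).
  apply: (@limit_pairing_fun sigma bd K) => //; first exact: (length_compact_finite sigma_length).
  by move=> p Kp; rewrite p0// mulr0.
have E (g : S -> R) (ze : S -> 'rV[R]_2) :
    mu.-integrable setT (EFin \o (fun p : borel S => coip p (ze p) (diff_fun psi p))) ->
    mu.-integrable setT (EFin \o (fun p : borel S => g p * (P p * psi p))) ->
    qform mu sigma P q g ze g psi = \int[mu]_p coip p (ze p) (diff_fun psi p) - \int[mu]_p (g p * (P p * psi p))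
      - \int[sigma]_(p in bd) (g p * (q p * psi p)).
  move=> j1 j2; rewrite /qform -RintegralB//; congr (_ - _); apply: eq_Rintegral => p _; last by ring.
  by congr (_ - _); ring.
rewrite E//.
have -> : (fun n => Qf mu sigma P q (u n) psi) = (fun n => \int[mu]_p coip p (df n p) (diff_fun psi p)
    - \int[mu]_p (u n p * (P p * psi p)) - \int[sigma]_(p in bd) (u n p * (q p * psi p))).
  apply/funext => n; apply: E.
    apply: (mu_integrable mu_area _ cK); first by apply: smooth_fun_continuous; exact: coip_smooth.
    by move=> p Kp; rewrite (diff_fun_out cK p0 Kp) coip_sym coip0l.
  apply: (mu_integrable mu_area _ cK) => [p|p Kp]; last by rewrite p0// !mulr0.
  apply: cvgM; first exact: smooth_fun_continuous.
  by apply: cvgM; [exact: cP|exact: smooth_fun_continuous].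
by apply: cvgB => //; exact: cvgB.
Qed.

End LimitData.

End WeakLimit.

(** * Eigenfunctions *)

(** With [k < I] the matrix of pairings of the [v j] with the eigenvectors has more rows than
    columns, so a nonzero combination of the [v j] is orthogonal to all eigenvectors. There [Q]
    would be nonnegative, against negative definiteness. *)
Lemma eigensystem_full (R : realType) (E : lmodType R) (B : E -> E -> R) (C : R) :
  symbil B -> (forall x, 0 <= B x x) -> 0 <= C ->
  forall I (Q : E -> E -> R) (v : 'I_I -> E), symbil Q -> (forall x, - C * B x x <= Q x x) ->
  negdef Q v -> (forall u : 'I_I.+1 -> E, ~ negdef Q u) ->
  exists (phi : 'I_I -> nat -> E) (lam : 'I_I -> R), [/\
    forall i, eigseq Q B (phi i) (lam i),
    forall i j, B (phi i n) (phi j n) @[n --> \oo] --> ((i == j)%:R : R) &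
    forall x, (forall i, B (phi i n) x @[n --> \oo] --> (0 : R)) -> 0 <= Q x x].
Proof.
move=> sB pB C0 I Q v sQ QC nv mx.
have [k [phi [lam [kI eigs orth ge]]]] := eigensystem sB pB C0 sQ QC mx.
suff kE : k = I by subst k; exists phi, lam.
apply/eqP; rewrite eqn_leq kI/= leqNgt; apply/negP => ltk.
pose A : 'M[R]_(I, k) := \matrix_(j, i) eigfun B (phi i) (v j).
have kA : kermx A != 0.
  rewrite -mxrank_eq0 mxrank_ker -lt0n subn_gt0.
  exact: leq_ltn_trans (rank_leq_col A) ltk.
have /rowV0Pn[r /sub_kermxP rA r0] := kA.
have := nv r r0; rewrite ltNge => /negP; apply; apply: ge => i.
have h : \sum_j r 0 j * B (v j) (phi i n) @[n --> \oo] --> \sum_j r 0 j * eigfun B (phi i) (v j).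
  apply: (@cvg_big _ _ _ 0 xpredT) => [|j _]; first exact: add_continuous.
  under eq_fun do rewrite (sbC sB).
  by apply: cvgM; [exact: cvg_cst|exact: (eigfunE sB pB (eigs i))].
have e0 : \sum_j r 0 j * eigfun B (phi i) (v j) = 0.
  have /rowP/(_ i) := rA; rewrite [LHS]mxE [RHS]mxE => h0; rewrite -[RHS]h0.
  by apply: eq_bigr => j _; rewrite mxE.
rewrite -e0 (_ : (fun n => B (phi i n) _) = fun n => \sum_j r 0 j * B (v j) (phi i n))//.
by apply/funext => n; rewrite (sbC sB) (sb_lincomb sB).
Qed.

Section Garding.
Context (R : realType) (S : riemannian R 1).
Context (mu sigma : {measure set (borel S) -> \bar R}).
Hypotheses (mu_area : is_area mu) (sigma_length : is_bdry_length sigma).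
Context (P q : S -> R).
Hypotheses (cP : continuous P) (lq : lbm (@bdry R 1 S) (q : borel S -> R)).
Implicit Types (u : S -> R) (p : S) (K : set S).
Local Notation bd := (@bdry R 1 S).
Local Notation test := (testfun S).
Local Notation Qt := (Qt mu sigma P q).
Local Notation Bt := (Bt mu).
Let hS : hausdorff_space S := @mf_hausdorff _ _ S.
Let mb : measurable (bd : set (borel S)) := @bdry_measurable _ S.
Context (I : nat) (v : 'I_I -> test).
Hypotheses (nv : negdef Qt v) (mxv : forall u : 'I_I.+1 -> test, ~ negdef Qt u).

(** The local estimate for the empty compact set already suffices: its left-hand side is
    nonnegative, hence so is [Q + C B]. *)
Lemma Qt_lower : exists2 C, 0 <= C & forall x : test, - C * Bt x x <= Qt x x.
Proof.
have [al [U [C [_ _ _ C0 h]]]] := garding_local mu_area sigma_length cP lq nv mxv (@compact0 S).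
exists C; first exact: ltW.
move=> x; have [_ h1 _] := h _ (tfP x).
have : 0 <= C * (Qf mu sigma P q (tf_val x) (tf_val x) + C * Bf mu (tf_val x) (tf_val x)).
  by apply: le_trans h1; apply: Rintegral_ge0 => p _; exact: coip_ge0.
by rewrite pmulr_rge0// -lerBlDr sub0r mulNr.
Qed.

(** The cutoff [al] is [1] near [K], where the test function and its localized part agree. *)
Lemma garding K : compact K -> exists2 C, 0 < C & forall x : test,
  (\int[mu]_(p in K) (coip p (diff_fun (tf_val x) p) (diff_fun (tf_val x) p))%:E <= (C * (Qt x x + C * Bt x x))%:E)%E /\
  (\int[sigma]_(p in K `&` bd) (tf_val x p ^+ 2)%:E <= (C * (Qt x x + C * Bt x x))%:E)%E.
Proof.
move=> cK; have [al [U [C [sal [oU KU] aU C0 h]]]] := garding_local mu_area sigma_length cP lq nv mxv cK.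
have mK : measurable (K : set (borel S)) by exact: compact_measurable_borel.
have mKb : measurable (K `&` bd : set (borel S)) by exact: measurableI.
exists C => // x; have [cw h1 h2] := h _ (tfP x); have [sw [L [cL _ w0]]] := cw.
pose w p := al p * tf_val x p.
split.
- apply: (@le_trans _ _ (\int[mu]_p (coip p (diff_fun w p) (diff_fun w p))%:E)%E).
    rewrite (eq_integral (fun p : borel S => (coip p (diff_fun w p) (diff_fun w p))%:E)) => [|p].
      apply: ge0_subset_integral => //.
        by apply/measurable_EFinP; apply: measurable_smooth => //; exact: coip_smooth.
      by move=> p _; rewrite lee_fin coip_ge0.
    rewrite inE => Kp; have -> // : diff_fun (tf_val x) p = diff_fun w p.
    apply: diff_fun_near; apply: filterS (open_nbhs_nbhs (conj oU (KU _ Kp))) => z Uz.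
    by rewrite /w aU// mul1r.
  have iw : mu.-integrable setT (EFin \o (fun p : borel S => coip p (diff_fun w p) (diff_fun w p))).
    apply: (mu_integrable mu_area _ cL); first by apply: smooth_fun_continuous; exact: coip_smooth.
    by move=> p Lp; rewrite (diff_fun_out cL w0 Lp) coip0l.
  by rewrite -(fineK (integrable_fin_num measurableT iw)) lee_fin.
apply: (@le_trans _ _ (\int[sigma]_(p in bd) (w p ^+ 2)%:E)%E).
  rewrite (eq_integral (fun p : borel S => (w p ^+ 2)%:E)) => [|p].
    apply: ge0_subset_integral => //.
      by apply/measurable_EFinP; apply: measurable_smooth => //; exact: smooth_fun_sqr.
    by move=> p _; rewrite lee_fin sqr_ge0.
  by rewrite inE => -[Kp _]; rewrite /w aU ?mul1r//; exact: KU.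
have iw : sigma.-integrable bd (EFin \o (fun p : borel S => w p ^+ 2)).
  apply: (sigma_integrable sigma_length _ cL) => [|p Lp]; last by rewrite /w w0// expr0n.
  by apply: (lbmS mb measurableT) => //; apply: lbm_continuous; apply: smooth_fun_continuous; exact: smooth_fun_sqr.
by rewrite -(fineK (integrable_fin_num mb iw)) lee_fin.
Qed.

Context (phi : nat -> test) (lam : R).
Hypothesis eig : eigseq Qt Bt phi lam.
Let sQ := Qt_symbil mu_area sigma_length cP lq.
Let sB := Bt_symbil mu_area.
Let pB := @Bt_ge0 _ _ mu.
Local Notation u n := (tf_val (phi n)).

Lemma Bt_integral (x : test) (K : set (borel S)) : measurable K ->
  (\int[mu]_(p in K) (tf_val x p ^+ 2)%:E <= (Bt x x)%:E)%E.
Proof.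
move=> mK; apply: (@le_trans _ _ (\int[mu]_p (tf_val x p ^+ 2)%:E)%E).
  apply: ge0_subset_integral => //; last by move=> p _; rewrite lee_fin sqr_ge0.
  by apply/measurable_EFinP; apply: measurable_smooth => //; apply: smooth_fun_sqr; exact: tf_smooth.
have ix := prod_integrable mu_area (tf_smooth x) (tfP x).
rewrite /Bt /Bf /Rintegral fineK; last exact: integrable_fin_num.
by rewrite le_eqVlt; apply/orP; left; apply/eqP; apply: eq_integral => p _; rewrite expr2.
Qed.

Lemma eigseq_cauchy_L2 e : 0 < e -> exists N, forall n k, (N <= n)%N -> (N <= k)%N ->
  forall K : set (borel S), measurable K -> (\int[mu]_(p in K) ((u n p - u k p) ^+ 2)%:E <= e%:E)%E.
Proof.
move=> e0; have [_ _ /(_ e e0)[N hN] _] := eig; exists N => n k Nn Nk K mK.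
by apply: le_trans (Bt_integral (phi n - phi k) mK) _; rewrite lee_fin ltW//; case: (hN n k Nn Nk).
Qed.

(** Differences of the sequence are small in [B] and in [Q]; the Garding inequality turns this into
    local smallness of gradients and boundary values. *)
Lemma eigseq_cauchy_form : cauchy_form mu sigma (fun n => u n).
Proof.
move=> K cK e e0; have mK : measurable (K : set (borel S)) by exact: compact_measurable_borel.
have [N1 hN1] := eigseq_cauchy_L2 e0; have [C C0 hC] := garding cK.
have d0 : 0 < e / (C * (1 + C)) by rewrite divr_gt0// mulr_gt0// addr_gt0.
have [_ _ /(_ _ d0)[N2 hN2] _] := eig.
exists (maxn N1 N2) => n k; rewrite !geq_max => /andP[n1 n2] /andP[k1 k2].
have [hB hQ] := hN2 n k n2 k2; have [h1 h2] := hC (phi n - phi k).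
have le : C * (Qt (phi n - phi k) (phi n - phi k) + C * Bt (phi n - phi k) (phi n - phi k)) <= e.
  move: hB hQ; move: (Qt _ _) (Bt _ _) => a b hb ha.
  have -> : e = C * (e / (C * (1 + C)) + C * (e / (C * (1 + C)))).
    by field; rewrite !gt_eqF// addr_gt0.
  rewrite ler_pM2l//; apply: lerD; first exact: ltW.
  by rewrite ler_pM2l// ltW.
split; first exact: hN1.
- apply: le_trans (le_trans h1 _); last by rewrite lee_fin.
  rewrite le_eqVlt; apply/orP; left; apply/eqP; apply: eq_integral => p _.
  by rewrite -diff_funB//; exact: tf_smooth.
by apply: le_trans h2 _; rewrite lee_fin.
Qed.

(** The L^2 Cauchy estimate is uniform in the domain, so the last convergence is global although the
    others are local. The weak equation is the limit of [eigseq_Qlim]. *)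
Lemma eigseq_limit : exists (f : S -> R) (xi : S -> 'rV[R]_2), [/\
  H1loc mu f xi, is_trace mu sigma f xi f,
  forall psi, Cc psi setT -> qform mu sigma P q f xi f psi = lam * \int[mu]_p (f p * psi p),
  forall psi : test, Bt (phi n) psi @[n --> \oo] --> \int[mu]_p (f p * tf_val psi p) &
  (\int[mu]_p ((u n p - f p) ^+ 2)%:E)%E @[n --> \oo] --> 0%E].
Proof.
have su n : smooth_fun (u n) := tf_smooth (phi n).
have cau := eigseq_cauchy_form.
have [th [G [G' [f [xi [[mG mG'] hf hxi thj [a1 a2 a3]]]]]]] := limit_exists su cau.
have hB (psi : test) : Bt (phi n) psi @[n --> \oo] --> \int[mu]_p (f p * tf_val psi p).
  exact: (limit_pairing_Cc mu_area su cau mG mG' hf hxi thj a1 a2 a3 (tfP psi)).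
exists f, xi; split=> //.
- split.
  + exact: (limit_L2loc mu_area su cau mG mG' hf hxi thj a1 a2 a3).
  + exact: (limit_L2loc_form mu_area su cau mG mG' hf hxi thj a1 a2 a3).
  + exact: (limit_weak_diff mu_area su cau mG mG' hf hxi thj a1 a2 a3).
- exact: (limit_trace su cau mG mG' hf hxi thj a1 a2 a3).
- move=> psi cpsi; have [x xE] := testfun_of cpsi.
  have h1 := limit_qform mu_area sigma_length su cau mG mG' hf hxi thj a1 a2 a3 cP lq cpsi.
  have h2 : Qf mu sigma P q (u n) psi @[n --> \oo] --> lam * eigfun Bt phi x.
    by rewrite -xE; exact: (eigseq_Qlim sB pB eig).
  rewrite (cvg_unique (@norm_hausdorff _ R^o) h1 h2); congr (_ * _).
  have h3 : Bt (phi n) x @[n --> \oo] --> eigfun Bt phi x by exact: (eigfunE sB pB eig).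
  by rewrite (cvg_unique (@norm_hausdorff _ R^o) h3 (hB x)) xE.
apply: cvge_0 => [n|e e0]; first by apply: integral_ge0 => p _; rewrite lee_fin sqr_ge0.
have [N hN] := eigseq_cauchy_L2 e0; exists N => n Nn.
apply: (limit_fun_le su mG hf thj (N := N)) => //; first by apply: (ae_imply a1).
by move=> k Nk; exact: hN.
Qed.

End Garding.

Section L2limits.
Context (R : realType) (S : riemannian R 1) (mu : {measure set (borel S) -> \bar R}).
Hypothesis mu_area : is_area mu.
Implicit Types (x y : nat -> testfun S) (f g : borel S -> R).
Local Notation L2cvg x f := ((\int[mu]_p ((tf_val (x n) p - f p) ^+ 2)%:E)%E @[n --> \oo] --> 0%E).

Let mt (a : testfun S) : measurable_fun setT (tf_val a : borel S -> R).
Proof. by apply: measurable_smooth => //; exact: tf_smooth. Qed.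

Let sqr_le2 (a b : R) : b ^+ 2 <= 2 * (a - b) ^+ 2 + 2 * a ^+ 2.
Proof. by rewrite -subr_ge0 (_ : _ - _ = (2 * a - b) ^+ 2) ?sqr_ge0//; ring. Qed.

Lemma Bt_fin (a : testfun S) : (\int[mu]_p (tf_val a p ^+ 2)%:E)%E = (Bt mu a a)%:E.
Proof.
have ix := prod_integrable mu_area (tf_smooth a) (tfP a).
rewrite /Bt /Bf /Rintegral fineK; last exact: integrable_fin_num.
by apply: eq_integral => p _; rewrite expr2.
Qed.

Lemma L2cvg_fin x f : measurable_fun setT f -> L2cvg x f -> (\int[mu]_p (f p ^+ 2)%:E < +oo)%E.
Proof.
move=> mf c0; apply: (finite_of_cvg (g := fun p => f p ^+ 2) (g_ := fun n (p : borel S) => (tf_val (x n) p - f p) ^+ 2)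
  (h_ := fun n (p : borel S) => tf_val (x n) p ^+ 2)) => //.
- exact: measurable_funX.
- by move=> n; apply: measurable_funX; exact: measurable_funB.
- by move=> n; exact: measurable_funX.
- by move=> p; exact: sqr_ge0.
- by move=> n p; exact: sqr_ge0.
- by move=> n p; exact: sqr_ge0.
by move=> n; rewrite Bt_fin ltry.
Qed.

Lemma L2cvg_ip x y f g b : measurable_fun setT f -> measurable_fun setT g -> L2cvg x f -> L2cvg y g ->
  Bt mu (y n) (y n) @[n --> \oo] --> (b : R) ->
  Bt mu (x n) (y n) @[n --> \oo] --> \int[mu]_p (f p * g p).
Proof.
move=> mf mg cx cy cb.
have ff := L2cvg_fin mf cx; pose M := fine (\int[mu]_p (f p ^+ 2)%:E)%E.
have fE : (\int[mu]_p (f p ^+ 2)%:E)%E = M%:E.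
  by rewrite fineK// ge0_fin_numE// integral_ge0// => p _; rewrite lee_fin sqr_ge0.
apply: (@Rintegral_cvg_of_sq _ _ _ mu setT measurableT (fun n p => tf_val (x n) p * tf_val (y n) p) (fun p => f p * g p)
  (fun n p => (tf_val (x n) p - f p) ^+ 2 + (tf_val (y n) p - g p) ^+ 2)
  (fun n p => 2 * (tf_val (y n) p ^+ 2 + f p ^+ 2)) (2 * (b + 1 + M)) _ _ _ _ _ _ _ _).2.
- by move=> n; apply: (prod_integrable mu_area); [exact: tf_smooth|exact: tfP].
- exact: measurable_funM.
- by move=> n; apply: measurable_funD; apply: measurable_funX; exact: measurable_funB.
- move=> n; apply: measurable_funM; first exact: measurable_cst.
  by apply: measurable_funD; exact: measurable_funX.
- by move=> n p _; split; [rewrite addr_ge0 ?sqr_ge0|rewrite mulr_ge0// addr_ge0 ?sqr_ge0].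
- move=> n p _; move: (tf_val (x n) p) (tf_val (y n) p) (f p) (g p) => a c d e.
  (* A sum of squares that certifies [(a c - d e)^2 <= ((a - d)^2 + (c - e)^2) 2 (c^2 + d^2)]. *)
  rewrite -subr_ge0 (_ : _ - _ = ((a - d) * c - d * (c - e)) ^+ 2 + 2 * ((a - d) ^+ 2 * d ^+ 2 + (c - e) ^+ 2 * c ^+ 2)).
    by rewrite addr_ge0 ?sqr_ge0// mulr_ge0// addr_ge0// mulr_ge0 ?sqr_ge0.
  ring.
- have hb : \forall n \near \oo, Bt mu (y n) (y n) < b + 1 by apply: (cvgr_lt _ cb); rewrite ltrDl.
  apply: filterS hb => n hn; under eq_integral do rewrite EFinM.
  rewrite ge0_integralZl//; first last.
  + by move=> p _; rewrite lee_fin addr_ge0 ?sqr_ge0.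
  + by apply/measurable_EFinP; apply: measurable_funD; exact: measurable_funX.
  under eq_integral do rewrite EFinD.
  rewrite ge0_integralD//; first last.
  + by apply/measurable_EFinP; exact: measurable_funX.
  + by move=> p _; rewrite lee_fin sqr_ge0.
  + by apply/measurable_EFinP; exact: measurable_funX.
  + by move=> p _; rewrite lee_fin sqr_ge0.
  by rewrite Bt_fin fE -EFinD -EFinM lee_fin ler_pM2l// lerD2r ltW.
under eq_fun do under eq_integral do rewrite EFinD.
have -> : (fun n => \int[mu]_p (((tf_val (x n) p - f p) ^+ 2)%:E + ((tf_val (y n) p - g p) ^+ 2)%:E))%E =
    (fun n => \int[mu]_p (((tf_val (x n) p - f p) ^+ 2)%:E) + \int[mu]_p (((tf_val (y n) p - g p) ^+ 2)%:E))%E.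
  apply/funext => n; rewrite ge0_integralD//.
  - by move=> p _; rewrite lee_fin sqr_ge0.
  - by apply/measurable_EFinP; apply: measurable_funX; exact: measurable_funB.
  - by move=> p _; rewrite lee_fin sqr_ge0.
  - by apply/measurable_EFinP; apply: measurable_funX; exact: measurable_funB.
have h := cvgeD (isT : ((0 : \bar R) +? 0)%E) cx cy; rewrite adde0 in h; exact: h.
Qed.

Lemma Lfun2P f : measurable_fun setT f -> (\int[mu]_p (f p ^+ 2)%:E < +oo)%E -> f \in Lfun mu 2%:E.
Proof.
move=> mf fin; rewrite inE; apply/andP; split; rewrite inE//=.
rewrite /finite_norm unlock; apply: poweR_lty; apply: le_lt_trans fin.
rewrite le_eqVlt; apply/orP; left; apply/eqP; apply: eq_integral => p _ /=.
by rewrite powR_mulrn// real_normK// num_real.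
Qed.

End L2limits.

(** * From the strong index to maximal negative definite families *)

Section Index.
Context (R : realType) (M : riemannian R 2) (S : riemannian R 1) (F : S -> M) (nu : S -> 'rV[R]_3) (theta : R).
Context (mu sigma : {measure set (borel S) -> \bar R}) (I : nat).
Hypothesis indexI : strong_index F nu theta mu sigma (I%:R)%:E.
Local Notation stab := (Qt mu sigma (potential F nu) (bdry_potential F nu theta)).
Local Notation index := (index_on F nu theta mu sigma).

Lemma increasing_cover (Om : nat -> set S) K : (forall k, open (Om k)) -> (forall k, Om k `<=` Om k.+1) ->
  \bigcup_k Om k = setT -> compact K -> exists k, forall j, (k <= j)%N -> K `<=` Om j.
Proof.
move=> oO mO cO; rewrite compact_cover => /(_ _ setT Om (fun k _ => oO k)) [|D _ KD].
  by move=> p _; have : (\bigcup_k Om k) p by rewrite cO.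
have mono i j : (i <= j)%N -> Om i `<=` Om j.
  by move=> /subnK <-; elim: (j - i)%N => [//|k ih]; exact: subset_trans (mO _).
exists (\max_(i <- finmap.enum_fset D) i)%N => j hj p /KD[i iD Oi].
apply: (mono i) Oi; apply: leq_trans hj; rewrite (big_rem i)//=; exact: leq_maxl.
Qed.

(** The index of [Om k] is a supremum of integers. Once it exceeds [I - 1/2], some family has at
    least [I] members, and the first [I] are kept. *)
Lemma index_negdef : exists v : 'I_I -> testfun S, negdef stab v.
Proof.
have [Om [oO _ mO cO] lim] := indexI.
have : \forall k \near \oo, (index (Om k) > (I%:R - 1 / 2)%:E)%E.
  have lt : ((I%:R - 1 / 2)%:E < I%:R%:E :> \bar R)%E by rewrite lte_fin ltrBlDr ltrDl.
  by have := lim [set y | ((I%:R - 1 / 2)%:E < y)%E]; apply; apply: open_nbhs_nbhs; split=> //; exact: open_ereal_gt_ereal.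
move=> [k _ hk]; have /ereal_sup_gt[_ [n [u [cu nu_]] <-]] := hk k (leqnn k).
rewrite lte_fin => ltn.
have leI : (I <= n)%N.
  rewrite leqNgt; apply/negP => nI; move: ltn; rewrite ltNge => /negP; apply.
  have : n.+1%:R <= I%:R :> R by rewrite ler_nat.
  by rewrite -natr1; lra.
have cu' i : Cc (u i) setT by have [s [K [cK _ h]]] := cu i; split=> //; exists K.
pose v (i : 'I_I) := projT1 (cid (testfun_of (cu' (widen_ord leI i)))).
have vE i : tf_val (v i) = u (widen_ord leI i) by rewrite /v; case: cid.
exists v => a a0.
pose b : 'rV[R]_n := \row_i (if insub (i : nat) is Some j then a 0 j else 0).
have bw (j : 'I_I) : b 0 (widen_ord leI j) = a 0 j.
  by rewrite mxE /= insubT// => lt; congr (a 0 _); apply/val_inj.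
have b0 : b != 0.
  by apply: contraNneq a0 => b0; apply/eqP/rowP => j; rewrite -bw b0 !mxE.
have := nu_ b b0; rewrite /Qt; congr (_ < 0).
have -> // : tf_val (lincomb a v) = (fun p => \sum_i b 0 i * u i p).
apply/funext => p; rewrite tf_lincomb.
rewrite [RHS](bigID (fun i : 'I_n => (i < I)%N))/= [X in _ + X]big1 ?addr0 => [|i]; last first.
  by move=> /negbTE iI; rewrite mxE insubF// mul0r.
by rewrite (big_ord_narrow leI); apply: eq_bigr => i _; rewrite bw vE.
Qed.

(** The supports of finitely many test functions lie in one compact set, hence in all late [Om k]; a
    family of size [I.+1] would keep the index at [I.+1] or more there. *)
Lemma index_max (u : 'I_I.+1 -> testfun S) : ~ negdef stab u.
Proof.
move=> nu_; have [Om [oO _ mO cO] lim] := indexI.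
have [K cK Ku] := compact_family (fun i => tfP (u i)).
have [k hk] := increasing_cover oO mO cO cK.
have [N _ hN] : \forall k \near \oo, (index (Om k) < (I%:R + 1 / 2)%:E)%E.
  have lt : (I%:R%:E < (I%:R + 1 / 2)%:E :> \bar R)%E by rewrite lte_fin ltrDl.
  by have := lim [set y | (y < (I%:R + 1 / 2)%:E)%E]; apply; apply: open_nbhs_nbhs; split=> //; exact: open_ereal_lt_ereal.
have := hN (maxn k N) (leq_maxr _ _); rewrite ltNge => /negP; apply.
apply: (@le_trans _ _ (I.+1%:R)%:E); first by rewrite lee_fin -[I.+1%:R]natr1; lra.
apply: ereal_sup_ubound; exists I.+1 => //; exists (fun i => tf_val (u i)); split.
  move=> i; split; first exact: tf_smooth.
  by exists K; split=> //; [apply: hk; exact: leq_maxl|exact: Ku].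
move=> a a0; have := nu_ a a0; rewrite /Qt.
have -> // : tf_val (lincomb a u) = (fun p => \sum_i a 0 i * tf_val (u i) p).
by apply/funext => p; rewrite tf_lincomb.
Qed.

End Index.

Theorem proposition4p9 (R : realType) (M : riemannian R 2) (S : riemannian R 1)
    (F : S -> M) (nu : S -> 'rV[R]_3) (theta : R)
    (theta_gt0 : 0 < theta) (theta_ltpi : theta < pi)
    (capF : capillary F nu theta)
    (noncompact : ~ compact [set: S])
    (mu sigma : {measure set (borel S) -> \bar R})
    (mu_area : is_area mu) (sigma_length : is_bdry_length sigma)
    (I : nat) (indexI : strong_index F nu theta mu sigma (I%:R)%:E) :
  exists (W : set (borel S -> R)) (f : 'I_I -> borel S -> R)
         (lambda : 'I_I -> R),
    [/\ orthonormal_basis mu W f,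
        forall i, weak_eigenfunction F nu theta mu sigma (f i) (lambda i),
        forall i, lambda i < 0 &
        forall phi : S -> R, Cc phi setT -> orthogonal_to mu W phi ->
          0 <= Q F nu theta mu sigma phi phi].
Proof.
have sin0 : 0 < sin theta by apply: sin_gt0_pi; rewrite theta_gt0 theta_ltpi.
have cP := potential_continuous capF.
have lq := bdry_potential_lbm capF sin0.
have [v nv] := index_negdef indexI; have mxv := @index_max _ _ _ _ _ _ _ _ _ indexI.
have [C C0 QC] := Qt_lower mu_area sigma_length cP lq nv mxv.
have sQ := Qt_symbil mu_area sigma_length cP lq.
have sB := Bt_symbil mu_area.
have pB := @Bt_ge0 _ _ mu.
have [phi [lam [eigs orth ge]]] := eigensystem_full sB pB C0 sQ QC nv mxv.
have lims i := eigseq_limit mu_area sigma_length cP lq nv mxv (eigs i).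
pose f i : borel S -> R := projT1 (cid (lims i)).
have hf i : exists xi : S -> 'rV[R]_2, [/\
  H1loc mu (f i) xi, is_trace mu sigma (f i) xi (f i),
  forall psi, Cc psi setT -> qform mu sigma (potential F nu) (bdry_potential F nu theta) (f i) xi (f i) psi
    = lam i * \int[mu]_p (f i p * psi p),
  forall psi : testfun S, Bt mu (phi i n) psi @[n --> \oo] --> \int[mu]_p (f i p * tf_val psi p) &
  (\int[mu]_p ((tf_val (phi i n) p - f i p) ^+ 2)%:E)%E @[n --> \oo] --> 0%E].
  by rewrite /f; case: cid.
have mf i : measurable_fun setT (f i) by have [xi [[[]]]] := hf i.
have cf i : (\int[mu]_p ((tf_val (phi i n) p - f i p) ^+ 2)%:E)%E @[n --> \oo] --> 0%E by have [xi []] := hf i.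
have lf i : f i \in Lfun mu 2%:E by apply: Lfun2P (mf i) _; exact: L2cvg_fin (cf i).
have on i j : L2ip mu (f i) (f j) = (i == j)%:R.
  have h1 := L2cvg_ip mu_area (mf i) (mf j) (cf i) (cf j) (orth j j).
  exact: (cvg_unique (@norm_hausdorff _ R^o) h1 (orth i j)).
exists [set g | g \in Lfun mu 2%:E /\ exists a : 'rV[R]_I,
  {ae mu, forall p, g p = \sum_i a 0 i * f i p}], f, lam; split.
- by split.
- move=> i; split.
    (* [f i] has norm [1], so it cannot vanish almost everywhere. *)
    move=> ae0; have := on i i; rewrite eqxx /L2ip => /eqP; apply/negP; rewrite eq_sym.
    rewrite (_ : \int[mu]_p (f i p * f i p) = 0) ?oner_eq0//.
    have -> : \int[mu]_p (f i p * f i p) = fine (\int[mu]_p (cst 0 p)%:E)%E; last by rewrite /= integral0.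
    congr fine; apply: ae_eq_integral => //.
    - by apply/measurable_EFinP; exact: measurable_funM.
    - by apply/measurable_EFinP; exact: measurable_cst.
    by apply: (ae_imply ae0) => p -> _; rewrite mul0r.
  by have [xi [h1 h2 h3 _ _]] := hf i; exists xi, (f i).
- by move=> i; case: (eigs i).
move=> psi cpsi oW; have [x xE] := testfun_of cpsi; rewrite -xE.
(* Orthogonality to [W] makes the limits of the pairings with the approximating sequences vanish,
   which is the condition in [ge]. *)
apply: (ge x) => i; have [xi [_ _ _ h _]] := hf i; have := h x.
suff -> : \int[mu]_p (f i p * tf_val x p) = 0 by [].
rewrite xE -(oW (f i)); last first.
  split=> //; exists (delta_mx 0 i); apply: aeW => p.
  by rewrite (bigD1 i)//= big1 => [|j ji]; rewrite !mxE ?eqxx ?(negbTE ji) ?mul1r ?addr0// mul0r.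
by apply: eq_Rintegral => p _; rewrite mulrC.
Qed.
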